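(* Every element $T$ of $\mathcal A$ can be written uniquely as $$T = M_\phi + g(H) + K,$$ where $\phi\in C([0,1])$, $g\in A(\overline{\mathbb D(1,1)})$, $\phi(0)=g(0)$, and $K\in\mathcal K_{\mathcal A}$.
   Context: $L^2$ means $L^2[0,1]$. $H$ is the (bounded) Hardy operator on $L^2$, $Hf(x)=\frac1x\int_0^x f(t)\,dt$; $M_\phi$ is multiplication by $\phi$ on $L^2$, and $M_x$ is multiplication by $x$. $\mathcal A$ is the closure in the operator norm of $B(L^2)$ of the unital algebra generated by $H$ and $M_x$. $\mathcal K_{\mathcal A}$ is the set of compact operators on $L^2$ that belong to $\mathcal A$. $\mathbb D(1,1)$ is the open disk in $\mathbb C$ with center $1$ and radius $1$; $A(\overline{\mathbb D(1,1)})$ is the algebra of functions continuous on $\overline{\mathbb D(1,1)}$ and analytic on $\mathbb D(1,1)$. For $g\in A(\overline{\mathbb D(1,1)})$, $g(H)$ is the norm limit of $p_n(H)$ for polynomials $p_n\to g$ uniformly on $\overline{\mathbb D(1,1)}$ (well defined since $\overline{\mathbb D(1,1)}$ is a spectral set for $H$). *)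

(* Defs.v *)
From HB Require Import structures.
From mathcomp Require Import all_boot all_order all_algebra.
From mathcomp Require Import complex.
From mathcomp Require Import all_classical all_reals all_analysis.
From mathcomp Require Import measurable_realfun.
From mathcomp Require Import ring lra.
Set Implicit Arguments.
Unset Strict Implicit.
Unset Printing Implicit Defensive.
Import Order.TTheory GRing.Theory Num.Theory.
Import numFieldNormedType.Exports.
Local Open Scope classical_set_scope.
Local Open Scope ring_scope.
Local Open Scope quotient_scope.

Section SquareIntegrable.
Context {R : realType}.
Local Notation C := R[i].
Local Notation mu := (@lebesgue_measure R).

Definition I01 : set R := `[0, 1].

Definition sqmod (z : C) : R := complex.Re z ^+ 2 + complex.Im z ^+ 2.

(* Only the restriction of f to [0, 1] matters. *)
Definition sqint (f : R -> C) : Prop :=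
  [/\ measurable_fun I01 (fun x => complex.Re (f x)),
      measurable_fun I01 (fun x => complex.Im (f x)) &
      (\int[mu]_(x in I01) (sqmod (f x))%:E < +oo)%E].

Definition sqnorm (f : R -> C) : R :=
  Num.sqrt (fine (\int[mu]_(x in I01) (sqmod (f x))%:E)).

Let mI : measurable I01. Proof. exact: measurable_itv. Qed.
#[local] Hint Resolve mI : core.

Lemma sqmod_ge0 z : 0 <= sqmod z.
Proof. by rewrite addr_ge0 ?sqr_ge0. Qed.
#[local] Hint Resolve sqmod_ge0 : core.

Lemma sqmodM z w : sqmod (z * w) = sqmod z * sqmod w.
Proof. by case: z => a b; case: w => c d; rewrite /sqmod /=; ring. Qed.

Lemma sqmod_eq0 z : sqmod z = 0 -> z = 0.
Proof.
case: z => a b /eqP; rewrite /sqmod /= paddr_eq0 ?sqr_ge0// !sqrf_eq0.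
by move=> /andP[/eqP-> /eqP->].
Qed.

Lemma normc_sqmod z : `|z| = (Num.sqrt (sqmod z))%:C%C.
Proof. exact: normc_def. Qed.

Lemma sqmodD_le (t : R) z w : 0 < t ->
  sqmod (z + w) <= (1 + t) * sqmod z + (1 + t^-1) * sqmod w.
Proof.
move=> t0; case: z => a b; case: w => c d; rewrite /sqmod /=.
have key (u v : R) : (u + v) ^+ 2 <= (1 + t) * u ^+ 2 + (1 + t^-1) * v ^+ 2.
  rewrite -subr_ge0.
  rewrite [leRHS](_ : _ = t * (u - t^-1 * v) ^+ 2).
    by rewrite mulr_ge0 ?sqr_ge0// ltW.
  by field; rewrite gt_eqF.
have := key a c; have := key b d; lra.
Qed.

Lemma measurable_sqmod f : sqint f ->
  measurable_fun I01 (fun x => (sqmod (f x))%:E).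
Proof.
case=> mr mi _; apply/measurable_EFinP/measurable_funD.
- exact: measurable_funX.
- exact: measurable_funX.
Qed.

Lemma sqnormE f : sqint f ->
  (\int[mu]_(x in I01) (sqmod (f x))%:E)%E = (sqnorm f ^+ 2)%:E.
Proof.
move=> [_ _ fy].
have f0 : (0 <= \int[mu]_(x in I01) (sqmod (f x))%:E)%E.
  by apply: integral_ge0 => x _; rewrite lee_fin.
rewrite /sqnorm sqr_sqrtr ?fine_ge0// fineK// ge0_fin_numE//.
Qed.

Lemma sqint_le (f g h : R -> C) (a b : R) : sqint f -> sqint g ->
  measurable_fun I01 (fun x => complex.Re (h x)) ->
  measurable_fun I01 (fun x => complex.Im (h x)) ->
  0 <= a -> 0 <= b ->
  (forall x, sqmod (h x) <= a * sqmod (f x) + b * sqmod (g x)) ->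
  sqint h /\ sqnorm h ^+ 2 <= a * sqnorm f ^+ 2 + b * sqnorm g ^+ 2.
Proof.
move=> sf sg mr mi a0 b0 hle.
have mh : measurable_fun I01 (fun x => (sqmod (h x))%:E).
  by apply/measurable_EFinP/measurable_funD; exact: measurable_funX.
have le : (\int[mu]_(x in I01) (sqmod (h x))%:E <=
    (a * sqnorm f ^+ 2 + b * sqnorm g ^+ 2)%:E)%E.
  rewrite EFinD (EFinM a) (EFinM b) -!sqnormE//.
  rewrite -!ge0_integralZl_EFin//; [|by move=> *; rewrite lee_fin|exact: measurable_sqmod
   |by move=> *; rewrite lee_fin|exact: measurable_sqmod].
  have mcf (c : R) k : sqint k ->
      measurable_fun I01 (fun x => (c%:E * (sqmod (k x))%:E)%E).
    move=> sk; apply: (@measurable_funeM _ _ _ _ (fun x => (sqmod (k x))%:E)).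
    exact: measurable_sqmod.
  have cf0 (c : R) (k : R -> C) x : 0 <= c -> (0 <= c%:E * (sqmod (k x))%:E)%E.
    by move=> c0; rewrite -EFinM lee_fin mulr_ge0.
  rewrite -ge0_integralD//; [|by move=> *; exact: cf0|exact: mcf|by move=> *; exact: cf0|exact: mcf].
  apply: ge0_le_integral => //.
  - by move=> *; rewrite lee_fin.
  - by apply: emeasurable_funD; exact: mcf.
  - by move=> x _; rewrite -!EFinM -EFinD lee_fin.
have sh : sqint h by split => //; exact: le_lt_trans le (ltry _).
by split=> //; rewrite -lee_fin -sqnormE.
Qed.

Lemma sqint0 : sqint (fun=> 0).
Proof.
split; [exact: measurable_cst|exact: measurable_cst|].
by rewrite /sqmod /= expr0n /= addr0 integral0 ltry.
Qed.

Lemma sqintD_norm (t : R) f g : 0 < t -> sqint f -> sqint g ->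
  sqint (fun x => f x + g x) /\
  sqnorm (fun x => f x + g x) ^+ 2 <=
    (1 + t) * sqnorm f ^+ 2 + (1 + t^-1) * sqnorm g ^+ 2.
Proof.
move=> t0 sf sg; have [[fr fi _] [gr gi _]] := (sf, sg).
have ti : 0 < t^-1 by rewrite invr_gt0.
have mr : measurable_fun I01 (fun x => complex.Re (f x + g x)).
  under [X in measurable_fun _ X]eq_fun do rewrite raddfD /=.
  exact: measurable_funD.
have mi : measurable_fun I01 (fun x => complex.Im (f x + g x)).
  under [X in measurable_fun _ X]eq_fun do rewrite raddfD /=.
  exact: measurable_funD.
by apply: sqint_le => // [||x]; [lra|lra|exact: sqmodD_le].
Qed.

Lemma sqintD f g : sqint f -> sqint g -> sqint (fun x => f x + g x).
Proof. by move=> sf sg; have [] := sqintD_norm ltr01 sf sg. Qed.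

Lemma sqintZ (c : C) f : sqint f -> sqint (fun x => c * f x).
Proof.
move=> sf; have [fr fi _] := sf.
suff [] : sqint (fun x => c * f x) /\ sqnorm (fun x => c * f x) ^+ 2 <=
   sqmod c * sqnorm f ^+ 2 + 0 * sqnorm f ^+ 2 by [].
case: c => a b.
have mr : measurable_fun I01 (fun x => complex.Re ((a +i* b)%C * f x)).
  rewrite (_ : (fun _ => _) =
      (fun x => a * complex.Re (f x) - b * complex.Im (f x))).
    by apply: measurable_funB; apply: measurable_funM.
  by apply/funext => x; case: (f x).
have mi : measurable_fun I01 (fun x => complex.Im ((a +i* b)%C * f x)).
  rewrite (_ : (fun _ => _) =
      (fun x => a * complex.Im (f x) + b * complex.Re (f x))).
    by apply: measurable_funD; apply: measurable_funM.
  by apply/funext => x; case: (f x).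
by apply: sqint_le => // x; rewrite sqmodM mul0r addr0.
Qed.

Lemma sqnormZ (c : C) f : sqint f ->
  sqnorm (fun x => c * f x) = Num.sqrt (sqmod c) * sqnorm f.
Proof.
move=> sf; rewrite /sqnorm.
under eq_integral do rewrite sqmodM EFinM.
rewrite ge0_integralZl_EFin//; [|by move=> *; rewrite lee_fin|exact: measurable_sqmod].
by rewrite sqnormE// -EFinM /= sqrtrM.
Qed.

Definition sqint_eq (f g : R -> C) : Prop := ae_eq mu I01 f g.

Lemma sqint_eq_refl f : sqint_eq f f.
Proof. exact: ae_eq_refl. Qed.

Lemma sqint_eq_sym f g : sqint_eq f g -> sqint_eq g f.
Proof. by apply: filterS => x fg /fg. Qed.

Lemma sqint_eq_trans f g h : sqint_eq f g -> sqint_eq g h -> sqint_eq f h.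
Proof. by apply: filterS2 => x fg gh xI; rewrite fg// gh. Qed.

Lemma sqnorm_eq f g : sqint f -> sqint g -> sqint_eq f g ->
  sqnorm f = sqnorm g.
Proof.
move=> sf sg fg; congr (Num.sqrt (fine _)).
apply: ae_eq_integral => //; try exact: measurable_sqmod.
by apply: filterS fg => x fg xI; rewrite fg.
Qed.

Lemma sqnorm_ge0 f : 0 <= sqnorm f. Proof. exact: sqrtr_ge0. Qed.

Lemma sqnorm_eq0 f : sqint f -> sqnorm f = 0 -> sqint_eq f (fun=> 0).
Proof.
move=> sf f0; have := sqnormE sf; rewrite f0 expr0n /= => i0.
have : (\int[mu]_(x in I01) `|(sqmod (f x))%:E| = 0)%E.
  by rewrite -[RHS]i0; apply: eq_integral => x _; rewrite gee0_abs// lee_fin.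
move/ae_eq_integral_abs => /(_ mI (measurable_sqmod sf)).
by apply: filterS => x h xI; apply: sqmod_eq0; have [] := h xI.
Qed.

Lemma sqnormD f g : sqint f -> sqint g ->
  sqnorm (fun x => f x + g x) <= sqnorm f + sqnorm g.
Proof.
move=> sf sg; have sfg := sqintD sf sg.
have [f0|fn0] := eqVneq (sqnorm f) 0.
  rewrite f0 add0r (sqnorm_eq sfg sg)//.
  by apply: filterS (sqnorm_eq0 sf f0) => x h xI; rewrite h// add0r.
have [g0|gn0] := eqVneq (sqnorm g) 0.
  rewrite g0 addr0 (sqnorm_eq sfg sf)//.
  by apply: filterS (sqnorm_eq0 sg g0) => x h xI; rewrite h// addr0.
have fp : 0 < sqnorm f by rewrite lt_def fn0 sqnorm_ge0.
have gp : 0 < sqnorm g by rewrite lt_def gn0 sqnorm_ge0.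
rewrite -ler_sqr ?nnegrE ?addr_ge0 ?sqnorm_ge0//.
have [_ /le_trans] := sqintD_norm (divr_gt0 gp fp) sf sg; apply.
rewrite le_eqVlt; apply/orP; left; apply/eqP; field.
by rewrite fn0 gn0.
Qed.

End SquareIntegrable.

Section L2space.
Variable R : realType.
Local Notation C := R[i].
Local Notation mu := (@lebesgue_measure R).

Definition sqfun : Type := {f : R -> C | `[< sqint f >]}.
HB.instance Definition _ := Choice.on sqfun.

Definition sqfun_eq (f g : sqfun) : bool := `[< sqint_eq (val f) (val g) >].

Let sqfun_eq_refl : reflexive sqfun_eq.
Proof. by move=> f; apply/asboolP; exact: sqint_eq_refl. Qed.
Let sqfun_eq_sym : symmetric sqfun_eq.
Proof. by move=> f g; apply/asboolP/asboolP; exact: sqint_eq_sym. Qed.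
Let sqfun_eq_trans : transitive sqfun_eq.
Proof.
by move=> g f h /asboolP fg /asboolP gh; apply/asboolP; exact: sqint_eq_trans gh.
Qed.

Canonical sqfun_equiv :=
  EquivRel sqfun_eq sqfun_eq_refl sqfun_eq_sym sqfun_eq_trans.

(* Complex L^2[0, 1]: square-integrable functions modulo a.e. equality *)
Definition L2 : Type := {eq_quot sqfun_eq}.
HB.instance Definition _ := Choice.on L2.
HB.instance Definition _ := EqQuotient.on L2.

Definition L2fun (u : L2) : R -> C := val (repr u).
Coercion L2fun : L2 >-> Funclass.

Definition sqfun0 : sqfun := exist _ (fun=> 0) (asboolT sqint0).

(* The class of f; the default value 0 is taken when f is not square
   integrable. *)
Definition toL2 (f : R -> C) : L2 := \pi_L2 (insubd sqfun0 f).

Lemma L2_sqint (u : L2) : sqint u.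
Proof. by have /asboolP := valP (repr u). Qed.

Lemma L2P (u v : L2) : sqint_eq u v -> u = v.
Proof.
by move=> uv; rewrite -[u]reprK -[v]reprK; apply/eqmodP/asboolP.
Qed.

Lemma toL2K f : sqint f -> sqint_eq (toL2 f) f.
Proof.
move=> sf; have : repr (toL2 f) = insubd sqfun0 f %[mod L2] by rewrite reprK.
move=> /eqmodP /asboolP; rewrite insubdK//; exact/asboolP.
Qed.

Lemma toL2_eq f g : sqint f -> sqint g -> sqint_eq f g -> toL2 f = toL2 g.
Proof.
move=> sf sg fg; apply: L2P; apply: sqint_eq_trans (toL2K sf) _.
by apply: sqint_eq_trans fg _; apply: sqint_eq_sym; exact: toL2K.
Qed.

Definition addL2 (u v : L2) : L2 := toL2 (fun x => u x + v x).
Definition oppL2 (u : L2) : L2 := toL2 (fun x => - u x).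
Definition scaleL2 (c : C) (u : L2) : L2 := toL2 (fun x => c * u x).

Let sqintN f : sqint f -> @sqint R (fun x => - f x).
Proof.
move=> /(sqintZ (-1)).
by under [X in sqint X -> _]eq_fun do rewrite mulN1r.
Qed.

Lemma toL2_0E : sqint_eq (toL2 (fun=> 0)) (fun=> 0).
Proof. exact: toL2K sqint0. Qed.
Lemma addL2E u v : sqint_eq (addL2 u v) (fun x => u x + v x).
Proof. by apply/toL2K/sqintD; exact: L2_sqint. Qed.
Lemma oppL2E u : sqint_eq (oppL2 u) (fun x => - u x).
Proof. by apply/toL2K/sqintN; exact: L2_sqint. Qed.
Lemma scaleL2E c u : sqint_eq (scaleL2 c u) (fun x => c * u x).
Proof. by apply/toL2K/sqintZ; exact: L2_sqint. Qed.

Let addL2A : associative addL2.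
Proof.
move=> u v w; apply: L2P.
near=> x => xI.
rewrite (near (addL2E u (addL2 v w)))// (near (addL2E v w))//.
by rewrite (near (addL2E (addL2 u v) w))// (near (addL2E u v))// addrA.
Unshelve. all: by end_near. Qed.

Let addL2C : commutative addL2.
Proof.
move=> u v; apply: L2P.
have := addL2E u v; have := addL2E v u.
by apply: filterS2 => x h1 h2 xI; rewrite h2// h1// addrC.
Qed.

Let add0L2 : left_id (toL2 (fun=> 0)) addL2.
Proof.
move=> u; apply: L2P.
have := addL2E (toL2 (fun=> 0)) u; have := toL2_0E.
by apply: filterS2 => x h1 h2 xI; rewrite h2// h1// add0r.
Qed.

Let addNL2 : left_inverse (toL2 (fun=> 0)) oppL2 addL2.
Proof.
move=> u; apply: L2P.
have := addL2E (oppL2 u) u; have := toL2_0E; have := oppL2E u.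
by apply: filterS3 => x h1 h2 h3 xI; rewrite h3// h2// h1// addNr.
Qed.

HB.instance Definition _ :=
  GRing.isZmodule.Build L2 addL2A addL2C add0L2 addNL2.

Let scaleL2A a b u : scaleL2 a (scaleL2 b u) = scaleL2 (a * b) u.
Proof.
apply: L2P; have := scaleL2E a (scaleL2 b u); have := scaleL2E b u.
have := scaleL2E (a * b) u.
by apply: filterS3 => x h1 h2 h3 xI; rewrite h3// h2// h1// mulrA.
Qed.

Let scale1L2 : left_id 1 scaleL2.
Proof.
move=> u; apply: L2P; have := scaleL2E 1 u.
by apply: filterS => x h1 xI; rewrite h1// mul1r.
Qed.

Let scaleL2Dr : right_distributive scaleL2 +%R.
Proof.
move=> a u v; apply: L2P.
near=> x => xI.
rewrite (near (scaleL2E a (addL2 u v)))// (near (addL2E u v))//.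
rewrite (near (addL2E (scaleL2 a u) (scaleL2 a v)))//.
by rewrite (near (scaleL2E a u))// (near (scaleL2E a v))// mulrDr.
Unshelve. all: by end_near. Qed.

Let scaleL2Dl u : {morph scaleL2^~ u : a b / a + b}.
Proof.
move=> a b; apply: L2P.
near=> x => xI.
rewrite (near (scaleL2E (a + b) u))//.
rewrite (near (addL2E (scaleL2 a u) (scaleL2 b u)))//.
by rewrite (near (scaleL2E a u))// (near (scaleL2E b u))// mulrDl.
Unshelve. all: by end_near. Qed.

HB.instance Definition _ := GRing.Zmodule_isLmodule.Build C L2
  scaleL2A scale1L2 scaleL2Dr scaleL2Dl.

(* The norm of the normedModType structure is R[i]-valued; L2norm is the same
   norm with values in R. *)
Definition L2norm (u : L2) : R := sqnorm u.

Let normL2 (u : L2) : C := (L2norm u)%:C%C.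

Let normL2D u v : normL2 (u + v) <= normL2 u + normL2 v.
Proof.
rewrite /normL2 -rmorphD lecR /L2norm.
have su := L2_sqint u; have sv := L2_sqint v.
rewrite (sqnorm_eq (L2_sqint (u + v)) (sqintD su sv) (addL2E u v)).
exact: sqnormD.
Qed.

Let normL2Z a u : normL2 (a *: u) = `|a| * normL2 u.
Proof.
rewrite /normL2 normc_sqmod -rmorphM /L2norm.
have su := L2_sqint u.
by rewrite (sqnorm_eq (L2_sqint (a *: u)) (sqintZ a su) (scaleL2E a u)) sqnormZ.
Qed.

Let normL2_eq0 u : normL2 u = 0 -> u = 0.
Proof.
move=> /eqP; rewrite /normL2 eq_complex /= eqxx andbT => /eqP u0.
apply: L2P; apply: sqint_eq_trans (sqnorm_eq0 (L2_sqint u) u0) _.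
exact/sqint_eq_sym/toL2_0E.
Qed.

HB.instance Definition _ :=
  Lmodule_isNormed.Build C L2 normL2D normL2Z normL2_eq0.

Lemma normL2E (u : L2) : `|u| = (L2norm u)%:C%C.
Proof. by []. Qed.

End L2space.

Section Operators.
Variable R : realType.
Local Notation C := R[i].
Local Notation L2 := (L2 R).
Local Notation mu := (@lebesgue_measure R).

(* Equal to +oo when T is unbounded on the unit ball. *)
Definition opnorm (T : L2 -> L2) : \bar R :=
  ereal_sup [set (L2norm (T u))%:E | u in [set u : L2 | L2norm u <= 1]].

(* B(L^2) *)
Definition bounded_op : set (L2 -> L2) :=
  [set T | linear T /\ (opnorm T < +oo)%E].

Definition opnorm_closure (A : set (L2 -> L2)) : set (L2 -> L2) :=
  [set T | bounded_op T /\
    forall e : R, 0 < e -> exists2 S, A S & (opnorm (T \- S)%R < e%:E)%E].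

Definition compact_op : set (L2 -> L2) :=
  [set T | bounded_op T /\ compact (closure (T @` [set u : L2 | L2norm u <= 1]))].

Definition unital_algebra (A : set (L2 -> L2)) : Prop :=
  [/\ A idfun,
      forall S T, A S -> A T -> A (S \+ T),
      forall (c : C) T, A T -> A (c \*: T) &
      forall S T, A S -> A T -> A (S \o T)].

Definition cintegral (D : set R) (f : R -> C) : C :=
  ((\int[mu]_(t in D) complex.Re (f t))%R +i*
   (\int[mu]_(t in D) complex.Im (f t))%R)%C.

(* By Hardy's inequality the argument of toL2 is always square integrable. *)
Definition hardy (u : L2) : L2 :=
  toL2 (fun x => (x^-1)%:C%C * cintegral `[0, x] u).

(* For phi continuous on [0, 1] the argument of toL2 is always square
   integrable. *)
Definition mulop (phi : R -> C) (u : L2) : L2 := toL2 (fun x => phi x * u x).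

Definition hardy_algebra : set (L2 -> L2) :=
  opnorm_closure
    (smallest unital_algebra [set hardy; mulop (fun x => x%:C%C)]).

Definition hardy_compacts : set (L2 -> L2) := hardy_algebra `&` compact_op.

Definition disk11 : set C^o := [set z | `|z - 1| < 1].
Definition cdisk11 : set C^o := [set z | `|z - 1| <= 1].

(* Derivability is over the field R[i], i.e., complex differentiability. *)
Definition disk_algebra : set (C^o -> C^o) :=
  [set g | {within cdisk11, continuous g} /\
           forall z, disk11 z -> derivable g z 1].

Definition poly_op (p : {poly C}) (T : L2 -> L2) (u : L2) : L2 :=
  \sum_(i < size p) p`_i *: iter i T u.

(* g(H), the norm limit of p_n(H) for polynomials p_n -> g uniformly *)
Definition hardy_calc (g : C^o -> C^o) : L2 -> L2 :=
  get [set G | bounded_op G /\ exists p : nat -> {poly C},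
    {uniform cdisk11, (fun n (z : C^o) => (p n).[z] : C^o) @ \oo --> g} /\
    opnorm (poly_op (p n) hardy \- G) @[n --> \oo] --> 0%E].

(* phi and g are total functions, but only their restrictions to [0, 1] and to
   the closed disk matter. *)
Definition hardy_decomp (T : L2 -> L2)
    (phi : R -> C^o) (g : C^o -> C^o) (K : L2 -> L2) : Prop :=
  [/\ {within I01, continuous phi}, disk_algebra g, phi 0 = g 0,
      hardy_compacts K & T = mulop phi \+ hardy_calc g \+ K].

End Operators.

(* Main.v *)
Require Import Defs.
From HB Require Import structures.
From mathcomp Require Import all_boot all_order all_algebra.
From mathcomp Require Import complex.
From mathcomp Require Import all_classical all_reals all_analysis.
From mathcomp Require Import measurable_realfun.
From mathcomp Require Import ring lra zify.
Set Implicit Arguments.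
Unset Strict Implicit.
Unset Printing Implicit Defensive.
Import Order.TTheory GRing.Theory Num.Theory.
Import numFieldNormedType.Exports.
Local Open Scope classical_set_scope.
Local Open Scope ring_scope.

(** Every element of the polynomial algebra generated by [H] and [M_x] has the form
[M_p + q(H) + K] with [p], [q] polynomials and [K] compact: the mixed products reduce to
[M_x H], which is the (compact) Volterra operator [V], and to [H M_x = (1 - H) V]. The symbols
are controlled by the lower bounds [|p(x) + q(0)| <= |T|] for [x] in ]0, 1] and
[|p(0) + q(z)| <= |T|] for [z] in the disk, hence, after normalizing [p(0) = q(0)], both [p] and [q]
converge uniformly along a sequence converging in norm, and so does [K]. The same bounds give
uniqueness.

[q(H)] is controlled from above by von Neumann's inequality for the contraction [C = 1 - H]:
on polynomials [C] has the isometric dilation given by [|C f|^2 = |f|^2 - |mean f|^2], so the Gram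
matrix of the iterates of [f] becomes Toeplitz after adding the dilation coordinates, and a positive
Toeplitz form is averaged over roots of unity. The lower bounds compress [T] to shrinking intervals,
which kills [K]: near [x > 0] the function [1] is used, and near [0] dilations of approximate
eigenvectors [\sum_k w^k e_k] of [H], where [C] acts as a backward shift on the [e_k]. Finally,
functions of the disk algebra are uniform limits of polynomials by Goursat's theorem in polar
coordinates and Fejer's theorem. *)

(** * Complex moduli, roots of unity and positive Toeplitz forms *)

(** [H] multiplies [x^i] by [1 / (i + 1)], so on polynomials the identities relating [H], [1 - H],
    [M_x] and dilations are identities between coefficients; L^2 enters only through norms and the
    density of polynomials, with no inner product or adjoint on it. The eigenfunctions of [H] are
    [x^(1/z - 1)], square integrable exactly when [|z - 1| < 1]; they are not polynomials, whence
    the approximate ones. [H] commutes with dilations and [H f] on [[0, a]] depends only on [f] on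
    [[0, a]], so an eigenvector can be squeezed next to 0: this attaches the whole disk to the point
    0 of the interval. Scalars belong to both symbols, and the condition [phi 0 = g 0] removes this
    ambiguity: at [z = 0] the second lower bound becomes [2 |p(0)|], which controls the two symbols
    separately. The lower bounds hold for polynomials in [H]; they reach [g(H)], known only as some
    norm limit, through approximation of [g]. *)

Section Modulus.
Context {R : realType}.
Local Notation C := R[i].
Implicit Types z w : C.

(** The norm of [R[i]] takes its values in [R[i]]; a modulus in [R] lets [lra] and [nra] close
    estimates. *)
Definition cmod (z : C) : R := Num.sqrt (sqmod z).

Lemma normE z : `|z| = (cmod z)%:C%C.
Proof. exact: normc_sqmod. Qed.

Lemma cmod_ge0 z : 0 <= cmod z. Proof. exact: sqrtr_ge0. Qed.

Lemma cmod_sqr z : cmod z ^+ 2 = sqmod z.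
Proof. by rewrite sqr_sqrtr// sqmod_ge0. Qed.

Lemma cmodM z w : cmod (z * w) = cmod z * cmod w.
Proof. by rewrite /cmod sqmodM sqrtrM// sqmod_ge0. Qed.

Lemma cmodD z w : cmod (z + w) <= cmod z + cmod w.
Proof. by rewrite -lecR rmorphD /= -!normE ler_normD. Qed.

Lemma cmodN z : cmod (- z) = cmod z.
Proof. by apply: (@complexI R); rewrite /= -!normE normrN. Qed.

Lemma cmodB z w : cmod (z - w) <= cmod z + cmod w.
Proof. by rewrite -(cmodN w) cmodD. Qed.

Lemma cmodC z w : cmod (z - w) = cmod (w - z).
Proof. by rewrite -cmodN opprB. Qed.

Lemma cmod_dist z u w : cmod (z - w) <= cmod (z - u) + cmod (u - w).
Proof. by rewrite -[z - w](subrKA u) cmodD. Qed.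

Lemma cmod_lower z w : cmod z - cmod w <= cmod (z - w).
Proof. by rewrite lerBlDr -{1}(subrK w z) cmodD. Qed.

Lemma cmod0 : cmod 0 = 0.
Proof. by apply: (@complexI R); rewrite /= -!normE normr0. Qed.

Lemma cmod1 : cmod 1 = 1.
Proof. by apply: (@complexI R); rewrite /= -!normE normr1. Qed.

Lemma cmod_eq0 z : cmod z = 0 -> z = 0.
Proof. by move=> h; apply: sqmod_eq0; rewrite -cmod_sqr h expr0n. Qed.

Lemma cmod_gt0 z : z != 0 -> 0 < cmod z.
Proof.
move=> z0; rewrite lt_neqAle cmod_ge0 andbT eq_sym.
by apply: contra z0 => /eqP/cmod_eq0/eqP.
Qed.

Lemma cmodX z n : cmod (z ^+ n) = cmod z ^+ n.
Proof. by elim: n => [|n IH]; rewrite ?expr0 ?cmod1// !exprS cmodM IH. Qed.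

Lemma cmodV z : cmod (z^-1) = (cmod z)^-1.
Proof.
have [->|z0] := eqVneq z 0; first by rewrite !invr0 cmod0 invr0.
apply: (mulfI (lt0r_neq0 (cmod_gt0 z0))).
by rewrite -cmodM !divff ?cmod1// lt0r_neq0// cmod_gt0.
Qed.

Lemma cmod_real (x : R) : cmod x%:C%C = `|x|.
Proof. by rewrite /cmod /sqmod /= expr0n addr0 sqrtr_sqr. Qed.

Lemma cmod_nat n : cmod n%:R = n%:R.
Proof. by rewrite -(rmorph_nat (real_complex R)) cmod_real normr_nat. Qed.

Lemma cmodJ z : cmod z^*%C = cmod z.
Proof. by apply: (@complexI R); rewrite /= -!normE normcJ. Qed.

Lemma mulcJE z : z * z^*%C = (cmod z ^+ 2)%:C%C.
Proof. by rewrite -sqr_normc normE rmorphXn. Qed.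

Lemma cmod_Re z : `|complex.Re z| <= cmod z.
Proof. by rewrite -lecR -normE normc_ge_Re. Qed.

Lemma cmod_Im z : `|complex.Im z| <= cmod z.
Proof.
case: z => a b /=; rewrite -sqrtr_sqr /cmod ler_wsqrtr// /sqmod /=.
by rewrite lerDr sqr_ge0.
Qed.

Lemma cmod_ReIm z : cmod z <= `|complex.Re z| + `|complex.Im z|.
Proof.
case: z => a b /=; rewrite (_ : (a +i* b)%C = a%:C%C + b%:C%C * 'i%C); last first.
  by rewrite /real_complex_def; simpc.
rewrite (le_trans (cmodD _ _))// cmodM !cmod_real lerD2l.
by rewrite ler_piMr// /cmod /sqmod /= expr0n expr1n add0r sqrtr1.
Qed.

Lemma cmod_sum (I : Type) (s : seq I) (P : pred I) (F : I -> C) :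
  cmod (\sum_(i <- s | P i) F i) <= \sum_(i <- s | P i) cmod (F i).
Proof.
elim/big_rec2: _ => [|i y x _ H]; first by rewrite cmod0.
by rewrite (le_trans (cmodD _ _))// lerD2l.
Qed.

Lemma Re_sum (I : Type) (s : seq I) (P : pred I) (F : I -> C) :
  complex.Re (\sum_(i <- s | P i) F i) = \sum_(i <- s | P i) complex.Re (F i).
Proof. by elim/big_rec2: _ => // i y x _ <-; case: x; case: (F i). Qed.

Lemma Re_realM (x : R) z : complex.Re (x%:C%C * z) = x * complex.Re z.
Proof. by case: z => a b /=; rewrite mul0r subr0. Qed.

Lemma ReD z w : complex.Re (z + w) = complex.Re z + complex.Re w.
Proof. by case: z; case: w. Qed.

Lemma ReB z w : complex.Re (z - w) = complex.Re z - complex.Re w.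
Proof. by case: z; case: w. Qed.

End Modulus.

Section RootsOfUnity.
Context {R : realType}.
Local Notation C := R[i].

(** ['X^n - 1] splits in [R[i]] and is separable, so it has [n] distinct roots; [n] distinct [n]-th
    roots of unity in a field include a primitive one. *)
Lemma prim_root_exists n : (0 < n)%N -> exists w : C, n.-primitive_root w.
Proof.
move=> n0; pose p : {poly C} := 'X^n - 1.
have [s ps] := closed_field_poly_normal p.
have lp : lead_coef p = 1 by rewrite lead_coefDl ?lead_coefXn// size_polyXn size_polyN size_poly1 ltnS.
rewrite lp scale1r in ps.
have p0 : p != 0 by rewrite -lead_coef_eq0 lp oner_neq0.
have sz : size s = n.
  apply: succn_inj; rewrite -(size_prod_XsubC s id) -ps size_polyDl ?size_polyXn//.
  by rewrite size_polyN size_poly1 ltnS.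
have us : uniq s.
  rewrite -separable.separable_prod_XsubC -ps cyclotomic.separable_Xn_sub_1//.
  by rewrite pnatr_eq0 -lt0n.
have := @cyclic.has_prim_root _ n s n0 _ us.
rewrite sz leqnn => /(_ _ isT) h.
have /hasP[w _ ww] : has n.-primitive_root s.
  apply: h; apply/allP => x xs; rewrite unity_rootE -subr_eq0.
  have : root p x by rewrite ps root_prod_XsubC.
  by rewrite /root !hornerE.
by exists w.
Qed.

Lemma cmod_unity n (w : C) : (0 < n)%N -> w ^+ n = 1 -> cmod w = 1.
Proof.
move=> n0 w1; apply/eqP; rewrite -(@pexpr_eq1 _ _ n) ?cmod_ge0//.
by rewrite -cmodX w1 cmod1.
Qed.

Lemma cmod1_conj (w : C) : cmod w = 1 -> w * w^*%C = 1.
Proof. by move=> w1; rewrite mulcJE w1 expr1n. Qed.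

(** Discrete orthogonality of characters: for [j != k] the sum is geometric with ratio
    [v = w^j conj(w^k)], where [v^n = 1] and [v != 1]. *)
Lemma sum_unity n (w : C) j k : n.-primitive_root w -> (j < n)%N -> (k < n)%N ->
  \sum_(t < n) (w ^+ t) ^+ j * ((w ^+ t) ^+ k)^*%C = if j == k then n%:R else 0.
Proof.
move=> pw jn kn; have n0 := prim_order_gt0 pw.
have w1 := cmod1_conj (cmod_unity n0 (prim_expr_order pw)).
have v1 : w ^+ n = 1 := prim_expr_order pw.
have [->|jk] := eqVneq j k.
  rewrite -[in RHS](card_ord n) -sum1_card natr_sum.
  by apply: eq_bigr => t _; rewrite -exprM rmorphXn /= -exprMn w1 expr1n.
pose v := w ^+ j * (w ^+ k)^*%C.
have vn : v ^+ n = 1.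
  by rewrite exprMn -rmorphXn /= -!exprM ![(_ * n)%N]mulnC !exprM v1 !expr1n conjc1 mulr1.
have v1' : v - 1 != 0.
  apply/eqP => /eqP; rewrite subr_eq0 => /eqP h.
  have : w ^+ j = w ^+ k.
    rewrite -[RHS]mul1r -h /v -mulrA [_^*%C * _]mulrC -{2}[w ^+ k]/(w ^+ k).
    by rewrite rmorphXn /= -exprMn w1 expr1n mulr1.
  move/eqP; rewrite (eq_prim_root_expr pw) !modn_small//.
  by rewrite (negbTE jk).
apply: (mulfI v1'); rewrite mulr0 (eq_bigr (fun t : 'I_n => v ^+ t)).
  by rewrite -subrX1 vn subrr.
by move=> t _; rewrite /v exprMn -rmorphXn /= -!exprM ![(t * _)%N]mulnC.
Qed.

End RootsOfUnity.

Section Toeplitz.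
Context {R : realType}.
Local Notation C := R[i].

Lemma card_diagonal_eq N j k m :
  (\sum_(n < N) (j + n == k + m)%N = (j <= k + m < j + N))%N.
Proof.
case: (boolP (j <= k + m < j + N)%N) => [/andP[h1 h2]|h].
  have hn : (k + m - j < N)%N by rewrite ltn_subLR.
  rewrite (bigD1 (Ordinal hn))//= subnKC// eqxx big1// => i /eqP hi.
  apply/eqP; rewrite eqb0; apply/eqP => e; apply: hi; apply: val_inj => /=.
  by rewrite -e addKn.
apply: big1 => i _; apply/eqP; rewrite eqb0; apply: contra h => /eqP <-.
by rewrite leq_addr ltn_add2l ltn_ord.
Qed.

Lemma sum_diagonal_le N j k :
  (\sum_(m < N) \sum_(n < N) (j + n == k + m) <= N)%N.
Proof.
rewrite -[leqRHS]card_ord -sum1_card; apply: leq_sum => m _.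
by rewrite card_diagonal_eq; case: (_ && _).
Qed.

(** The diagonal [j + n = k + m] misses a row [m] only if [m < j] or [N <= k + m], that is at most
    [j + k] rows. *)
Lemma sum_diagonal_ge N j k :
  (N <= \sum_(m < N) \sum_(n < N) (j + n == k + m) + (j + k))%N.
Proof.
have h1 N' : (\sum_(m < N') (m < j) <= minn N' j)%N.
  elim: N' => [|N' IH]; first by rewrite big_ord0.
  rewrite big_ord_recr /=; move: IH; set s := bigop _ _ _.
  by case: (ltnP N' j) => /=; lia.
have h2 N' : (\sum_(m < N') (N <= k + m) <= N' - (N - k))%N.
  elim: N' => [|N' IH]; first by rewrite big_ord0.
  rewrite big_ord_recr /=; move: IH; set s := bigop _ _ _.
  by case: (leqP N (k + N')) => /=; lia.
have : (\sum_(m < N) 1 <= \sum_(m < N) (\sum_(n < N) (j + n == k + m) +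
    ((m < j) + (N <= k + m))))%N.
  apply: leq_sum => m _; rewrite card_diagonal_eq.
  by case: (leqP j (k + m)); case: (ltnP (k + m) (j + N)); case: (ltnP m j); case: (leqP N (k + m)) => //=; lia.
rewrite sum1_card card_ord 2!big_split /=.
move=> /leq_trans; apply; rewrite leq_add2l leq_add ?(leq_trans (h1 N)) ?geq_minr//.
by rewrite (leq_trans (h2 N))//; lia.
Qed.

Variable c : nat -> nat -> C.
Hypothesis cS : forall j k, c j.+1 k.+1 = c j k.
Hypothesis c_ge0 : forall N (b : nat -> C),
  0 <= complex.Re (\sum_(j < N) \sum_(k < N) b j * (b k)^*%C * c j k).

Let cD l j k : c (l + j) (l + k) = c j k.
Proof. by elim: l => // l IH; rewrite !addSn cS IH. Qed.

Let c_diag j k m n : (j + n = k + m)%N -> c m n = c j k.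
Proof.
move=> e; case: (leqP j m) => jm.
  have [hm hn] : (m = m - j + j)%N /\ (n = m - j + k)%N by lia.
  by rewrite hm [in LHS]hn cD.
have [hm hn] : (j = j - m + m)%N /\ (k = j - m + n)%N by lia.
by rewrite hm [in RHS]hn cD.
Qed.

(** Positivity is tested on the vectors [conj(w^(t a))], [a < N], with [w] a root of unity; this
    gives [Q t >= 0]. Averaging [|p(w^t)|^2 Q t] over [t] recovers [N] times the form of [p] up to
    an error independent of [N], while [Q t] averages to [N c 0 0]; then [N] tends to infinity. *)
Lemma toeplitz_bound (p : {poly C}) (m : R) :
  (forall z, cmod z = 1 -> cmod p.[z] <= m) ->
  complex.Re (\sum_(j < size p) \sum_(k < size p) p`_j * (p`_k)^*%C * c j k)
    <= m ^+ 2 * complex.Re (c 0 0).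
Proof.
move=> pm; set d := size p; set S := bigop _ _ _.
pose E := (2 * d)%:R * \sum_(j < d) \sum_(k < d) cmod (p`_j * (p`_k)^*%C * c j k).
(* [E] does not depend on [N], so a positive factor of [N] on the left would contradict the
   archimedean property. *)
suff key N : (0 < N)%N -> N%:R * (complex.Re S - m ^+ 2 * complex.Re (c 0 0)) <= E.
  rewrite -subr_le0 leNgt; apply/negP => h.
  have := key _ (ltn0Sn (Num.truncn (E / (complex.Re S - m ^+ 2 * complex.Re (c 0 0))))).
  by rewrite -ler_pdivlMr// leNgt truncnS_gt.
(* The order [N + d] exceeds all exponents [j + b] and [k + a], so orthogonality selects equality of
   exponents and not mere congruence. *)
move=> N0; pose M := (N + d)%N.
have M0 : (0 < M)%N by rewrite addn_gt0 N0.
have [w pw] := @prim_root_exists R _ M0.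
have wt1 t : cmod (w ^+ t) = 1.
  by rewrite cmodX (cmod_unity M0 (prim_expr_order pw)) expr1n.
pose Q t := \sum_(a < N) \sum_(b < N) ((w ^+ t) ^+ a)^*%C * (w ^+ t) ^+ b * c a b.
have Q0 t : 0 <= complex.Re (Q t).
  have := c_ge0 N (fun a => ((w ^+ t) ^+ a)^*%C).
  by under eq_bigr do under eq_bigr do rewrite conjcK.
pose K j k := (\sum_(a < N) \sum_(b < N) (j + b == k + a)%N)%N.
have QE : \sum_(t < M) Q t = M%:R * (N%:R * c 0 0).
  have -> : N%:R * c 0 0 = \sum_(a < N) c 0 0 by rewrite sumr_const card_ord mulr_natl.
  rewrite exchange_big /= [RHS]mulr_sumr.
  apply: eq_bigr => a _; rewrite exchange_big /= (bigD1 a)//= [X in _ + X]big1 ?addr0.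
    rewrite -mulr_suml (c_diag (j := 0) (k := 0))//; congr (_ * _).
    under eq_bigr do rewrite mulrC; rewrite (sum_unity pw) ?eqxx//;
      by rewrite (leq_trans (ltn_ord a))// leq_addr.
  move=> b ba; rewrite -mulr_suml; under eq_bigr do rewrite mulrC.
  rewrite (sum_unity pw) ?(leq_trans (ltn_ord _)) ?leq_addr//.
  by rewrite val_eqE (negbTE ba) mul0r.
have PQ : \sum_(t < M) (cmod p.[w ^+ t] ^+ 2)%:C%C * Q t =
    M%:R * \sum_(j < d) \sum_(k < d) p`_j * (p`_k)^*%C * c j k * (K j k)%:R.
  transitivity (\sum_(t < M) \sum_(j < d) \sum_(k < d) \sum_(a < N) \sum_(b < N)
      p`_j * (p`_k)^*%C * c a b * ((w ^+ t) ^+ (j + b) * ((w ^+ t) ^+ (k + a))^*%C)).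
    apply: eq_bigr => t _; rewrite -mulcJE horner_coef rmorph_sum /= !mulr_suml.
    apply: eq_bigr => j _; rewrite [_ * \sum_(_ < size p) _]mulr_sumr mulr_suml; apply: eq_bigr => k _.
    rewrite mulr_sumr; apply: eq_bigr => a _; rewrite mulr_sumr; apply: eq_bigr => b _.
    rewrite !exprD !rmorphM /=; ring.
  rewrite exchange_big /= mulr_sumr; apply: eq_bigr => j _.
  rewrite exchange_big /= mulr_sumr; apply: eq_bigr => k _.
  rewrite exchange_big /= natr_sum !mulr_sumr; apply: eq_bigr => a _.
  rewrite exchange_big /= natr_sum !mulr_sumr; apply: eq_bigr => b _.
  rewrite -mulr_sumr (sum_unity pw); last 2 first.
  - by rewrite /M addnC -addSn leq_add// ltnW.
  - by rewrite /M addnC -addSn leq_add// ltnW.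
  have [e|_] := eqVneq (j + b)%N (k + a)%N; last by rewrite !mulr0.
  by rewrite (c_diag e) mulr1 mulrC.
have le : complex.Re (\sum_(t < M) (cmod p.[w ^+ t] ^+ 2)%:C%C * Q t) <=
    m ^+ 2 * complex.Re (\sum_(t < M) Q t).
  rewrite !Re_sum mulr_sumr; apply: ler_sum => t _.
  rewrite Re_realM ler_wpM2r// lerXn2r ?nnegrE ?cmod_ge0//; last exact: pm.
  exact: le_trans (cmod_ge0 _) (pm _ (wt1 t)).
have M0' : 0 < M%:R :> R by rewrite ltr0n.
have ReM n (z : C) : complex.Re (n%:R * z) = n%:R * complex.Re z.
  by rewrite -(rmorph_nat (real_complex R)) Re_realM.
move: le; rewrite PQ QE !ReM mulrCA ler_pM2l//.
rewrite mulrBr mulrCA => le.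
apply: le_trans (lerB (lexx (N%:R * complex.Re S)) le) _.
rewrite -ReM -ReB mulr_sumr -sumrB /E.
rewrite (le_trans (ler_norm _))// (le_trans (cmod_Re _))//.
rewrite (le_trans (cmod_sum _ _ _))// mulr_sumr; apply: ler_sum => j _.
rewrite mulr_sumr -sumrB (le_trans (cmod_sum _ _ _))// mulr_sumr.
apply: ler_sum => k _; rewrite [N%:R * _]mulrC -mulrBr cmodM mulrC ler_wpM2r ?cmod_ge0//.
(* The weight [N - K j k] lies between 0 and [j + k], hence below the constant [2 d] of [E]. *)
have KN : (K j k <= N)%N by exact: sum_diagonal_le.
rewrite -natrB// cmod_nat ler_nat leq_subLR (leq_trans (sum_diagonal_ge N j k))// leq_add2l.
by rewrite mul2n -addnn leq_add// ltnW.
Qed.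

End Toeplitz.

(** * Uniform limits of polynomials on the disk *)

Section ComplexTopology.
Context {R : realType}.
Local Notation C := R[i].

(** A positive element of [R[i]] is real, so the complex radii of the topology may be replaced by
    real ones. *)
Lemma cvgCP (T : Type) (F : set_system T) (FF : Filter F) (f : T -> C^o) (l : C^o) :
  f @ F --> l <-> forall e : R, 0 < e -> \forall x \near F, cmod (l - f x) < e.
Proof.
split=> [/cvgrPdist_lt h e e0|h].
  have := h e%:C%C; rewrite ltcR => /(_ e0); apply: filterS => x.
  by rewrite normE ltcR.
apply/cvgrPdist_lt => -[a b]; rewrite ltcE /= => /andP[/eqP-> a0].
by apply: filterS (h _ a0) => x; rewrite normE ltcR.
Qed.

Lemma nbhsCP (A : set C^o) (z : C^o) :
  nbhs z A <-> exists2 d : R, 0 < d & forall w : C, cmod (w - z) < d -> A w.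
Proof.
split=> [/nbhs_ballP[[a b] /= ]|[d d0 h]].
  rewrite ltcE /= => /andP[/eqP-> a0] h; exists a => // w wz; apply: h => /=.
  by rewrite /ball /= normE cmodC ltcR.
apply/nbhs_ballP; exists d%:C%C; rewrite /= ?ltcR// => w.
by rewrite /ball /= normE cmodC ltcR => /h.
Qed.

Lemma cauchy_real (u : nat -> R) :
  (forall e, 0 < e -> exists N, forall m n, (N <= m)%N -> (N <= n)%N -> `|u m - u n| <= e) ->
  exists l, forall e, 0 < e -> exists N, forall n, (N <= n)%N -> `|u n - l| <= e.
Proof.
move=> h; have /cauchy_cvgP/cvg_ex[l /cvgrPdist_le ul] : cauchy (u @ \oo).
  apply: cauchy_exP => e e0; have [N hN] := h _ (divr_gt0 e0 (ltr0n _ 2)).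
  exists (u N); exists N => // n /= Nn; rewrite /ball /=.
  by apply: le_lt_trans (hN _ _ (leqnn N) Nn) _; rewrite ltr_pdivrMr// ltr_pMr// ltr1n.
exists l => e /ul [N _ hN]; exists N => n Nn; rewrite distrC; exact: hN.
Qed.

Lemma cauchy_complex (u : nat -> C) :
  (forall e : R, 0 < e -> exists N, forall m n, (N <= m)%N -> (N <= n)%N -> cmod (u m - u n) <= e) ->
  exists l, forall e, 0 < e -> exists N, forall n, (N <= n)%N -> cmod (u n - l) <= e.
Proof.
move=> h.
have [|a ha] := @cauchy_real (fun n => complex.Re (u n)).
  move=> e /h[N hN]; exists N => m n mN nN; rewrite -ReB.
  exact: le_trans (cmod_Re _) (hN _ _ mN nN).
have [|b hb] := @cauchy_real (fun n => complex.Im (u n)).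
  move=> e /h[N hN]; exists N => m n mN nN.
  apply: le_trans (hN _ _ mN nN); apply: le_trans (cmod_Im _).
  by case: (u m) => ? ?; case: (u n).
exists (a +i* b)%C => e e0; have e2 : 0 < e / 2 by lra.
have [N1 h1] := ha _ e2; have [N2 h2] := hb _ e2.
exists (maxn N1 N2) => n; rewrite geq_max => /andP[n1 n2].
apply: le_trans (cmod_ReIm _) _; rewrite [e]splitr lerD//.
  by move: (h1 _ n1); case: (u n).
by move: (h2 _ n2); case: (u n).
Qed.

End ComplexTopology.

Section CauchyEstimates.
Context {R : realType}.
Local Notation C := R[i].

(** Cauchy's estimate without integrals: the degree of [q] is below the order of the root of unity,
    so the discrete average over the circle extracts the coefficient exactly. *)
Lemma poly_coef_bound (q : {poly C}) (r B : R) k : 0 <= r ->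
  (forall z, cmod z = r -> cmod q.[z] <= B) -> cmod q`_k * r ^+ k <= B.
Proof.
move=> r0 qB; have [kq|kq] := leqP (size q) k.
  rewrite nth_default// cmod0 mul0r (le_trans _ (qB r%:C%C _)) ?cmod_ge0//.
  by rewrite cmod_real ger0_norm.
have M0 : (0 < size q)%N by exact: leq_ltn_trans kq.
have [w pw] := @prim_root_exists R _ M0.
have w1 t : cmod (w ^+ t) = 1.
  by rewrite cmodX (cmod_unity M0 (prim_expr_order pw)) expr1n.
have E : \sum_(t < size q) q.[r%:C%C * w ^+ t] * ((w ^+ t) ^+ k)^*%C =
   (size q)%:R * (q`_k * r%:C%C ^+ k).
  transitivity (\sum_(t < size q) \sum_(j < size q)
      q`_j * r%:C%C ^+ j * ((w ^+ t) ^+ j * ((w ^+ t) ^+ k)^*%C)).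
    apply: eq_bigr => t _; rewrite horner_coef mulr_suml; apply: eq_bigr => j _.
    by rewrite exprMn !mulrA.
  rewrite exchange_big /= (bigD1 (Ordinal kq))//= -mulr_sumr (sum_unity pw)// eqxx.
  rewrite mulrC big1 ?addr0// => j jk; rewrite -mulr_sumr (sum_unity pw)//.
  by case: ifP => [/eqP e|]; rewrite ?mulr0//; case/eqP: jk; apply: val_inj.
have s0 : 0 < (size q)%:R :> R by rewrite ltr0n.
rewrite -(ler_pM2l s0) -[X in X * (_ * _)](cmod_nat) -[X in _ * X](_ : cmod (q`_k * r%:C%C ^+ k) = _); last first.
  by rewrite cmodM cmodX cmod_real ger0_norm.
rewrite -cmodM -E (le_trans (cmod_sum _ _ _))// mulr_natl -[in leRHS](card_ord (size q)) -sumr_const.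
apply: ler_sum => t _; rewrite cmodM cmodJ cmodX w1 expr1n mulr1; apply: qB.
by rewrite cmodM w1 mulr1 cmod_real ger0_norm.
Qed.

Lemma poly_deriv_bound (p : {poly C}) z0 (r B : R) : 0 <= r ->
  (forall z, cmod (z - z0) = r -> cmod p.[z] <= B) -> cmod (p^`()).[z0] * r <= B.
Proof.
move=> r0 pB; pose q := p \Po ('X + z0%:P).
have -> : (p^`()).[z0] = q`_1.
  have : (q^`()).[0] = q`_1 by rewrite horner_coef0 coef_deriv.
  by rewrite deriv_comp derivD derivX derivC addr0 mulr1 horner_comp !hornerE.
rewrite -[r]expr1; apply: poly_coef_bound => // z zr; rewrite horner_comp !hornerE.
by apply: pB; rewrite addrK.
Qed.

Lemma geometric_half (x : R) n : 0 <= x -> x <= 1 / 2 -> \sum_(k < n) x ^+ k <= 2.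
Proof.
move=> x0 x1; have /= e := subrX1 x n.
have h : 0 <= x ^+ n by rewrite exprn_ge0.
have x1' : 0 < 1 - x by lra.
rewrite -(ler_pM2l x1'); move: e; set s := bigop _ _ _; nra.
Qed.

(** The coefficient of index [k + 2] at [z0] is at most [B / r^(k+2)], and [|h| <= r / 2] bounds the
    tail by a geometric series of ratio at most [1 / 2]. *)
Lemma poly_taylor_bound (p : {poly C}) z0 h (r B : R) : 0 < r ->
  (forall z, cmod (z - z0) = r -> cmod p.[z] <= B) -> cmod h <= r / 2 ->
  cmod (p.[z0 + h] - p.[z0] - (p^`()).[z0] * h) <= 2 * B / r ^+ 2 * cmod h ^+ 2.
Proof.
move=> r0 pB hr; pose q := p \Po ('X + z0%:P).
have q1 : (p^`()).[z0] = q`_1.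
  have : (q^`()).[0] = q`_1 by rewrite horner_coef0 coef_deriv.
  by rewrite deriv_comp derivD derivX derivC addr0 mulr1 horner_comp !hornerE.
have q0 : p.[z0] = q`_0 by rewrite -horner_coef0 horner_comp !hornerE.
have qb k : cmod q`_k * r ^+ k <= B.
  apply: poly_coef_bound => [|z zr]; first exact: ltW.
  by rewrite horner_comp !hornerE; apply: pB; rewrite addrK.
have qh : p.[z0 + h] = q.[h] by rewrite horner_comp !hornerE addrC.
rewrite qh q1 q0 -{1}[q](poly_take_drop 2) hornerD hornerM hornerXn.
have -> : (take_poly 2 q).[h] = q`_0 + q`_1 * h.
  rewrite (@horner_coef_wide _ 2) ?size_take_poly// !big_ord_recl big_ord0 /=.
  by rewrite !coef_take_poly /= expr0 mulr1 expr1 addr0.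
rewrite (_ : _ - _ = (drop_poly 2 q).[h] * h ^+ 2); last by ring.
rewrite cmodM cmodX ler_wpM2r ?sqr_ge0// horner_coef (le_trans (cmod_sum _ _ _))//.
pose x := cmod h / r.
have B0 : 0 <= B by apply: le_trans (qb 0%N); rewrite mulr_ge0 ?cmod_ge0// exprn_ge0// ltW.
have le : \sum_(k < size (drop_poly 2 q)) x ^+ k <= 2.
  apply: geometric_half; first by rewrite divr_ge0 ?cmod_ge0// ltW.
  by rewrite ler_pdivrMr//; lra.
rewrite (_ : 2 * B / r ^+ 2 = B / r ^+ 2 * 2); last by ring.
apply: le_trans (ler_wpM2l _ le); last by rewrite divr_ge0// sqr_ge0.
rewrite mulr_sumr; apply: ler_sum => k _; rewrite cmodM cmodX coef_drop_poly.
rewrite /x exprMn mulrCA mulrC ler_wpM2l ?exprn_ge0 ?cmod_ge0//.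
rewrite exprVn -mulrA -invfM -exprD ler_pdivlMr ?exprn_gt0// addnC.
exact: qb.
Qed.

Lemma poly_continuous (p : {poly C}) : continuous (fun z : C^o => p.[z] : C^o).
Proof.
elim/poly_ind: p => [|p c IH] w.
  by apply/(@cvgCP R C^o (nbhs (w : C^o)) (nbhs_filter w)) => e e0; apply: filterE => x; rewrite !horner0 subrr cmod0.
rewrite (_ : (fun _ => _) = (fun x : C^o => (p.[x] : C^o) * x + (c : C^o))); last first.
  by apply/funext => x; rewrite hornerMXaddC.
apply: (@cvgD C C^o C^o (nbhs (w : C^o)) _ (fun x => p.[x] * x) (fun=> c)); last exact: cvg_cst.
by apply: (@cvgM C C^o (nbhs (w : C^o)) _ (fun x => p.[x]) id); [exact: IH|exact: cvg_id].
Qed.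

Lemma cdisk11P (z : C) : cdisk11 (R:=R) z <-> cmod (z - 1) <= 1.
Proof. by rewrite /cdisk11 /= normE lecR. Qed.
Lemma disk11P (z : C) : disk11 (R:=R) z <-> cmod (z - 1) < 1.
Proof. by rewrite /disk11 /= normE ltcR. Qed.

(** Weierstrass's theorem. The derivatives at [z] form a Cauchy sequence by [poly_deriv_bound], and
    the quadratic remainder of [poly_taylor_bound], uniform in [n], passes to the limit. *)
Lemma uniform_limit_disk_algebra (p : nat -> {poly C}) (g : C^o -> C^o) :
  (forall e : R, 0 < e -> exists N, forall n, (N <= n)%N ->
     forall z, cdisk11 z -> cmod ((p n).[z] - g z) <= e) ->
  disk_algebra g.
Proof.
move=> pg; split.
  apply/subspace_continuousP => z zD; apply/cvgCP => e e0.
  have e3 : 0 < e / 4 by lra.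
  have [N hN] := pg _ e3.
  have : ((p N).[w] : C^o) @[w --> (z : C^o)] --> ((p N).[z] : C^o).
    exact: poly_continuous.
  move/cvgCP => /(_ _ e3); rewrite near_withinE; apply: filterS => w hw wD.
  apply: le_lt_trans (cmod_dist _ (p N).[z] _) _.
  apply: le_lt_trans (lerD (lexx _) (cmod_dist _ (p N).[w] _)) _.
  have := hN _ (leqnn N) _ zD; have := hN _ (leqnn N) _ wD; rewrite [in X in _ -> X -> _]cmodC.
  lra.
move=> z zD; have [N hN] := pg _ ltr01.
(* Half the distance from [z] to the boundary circle, so that the closed disk of radius [r] about
   [z] stays inside. *)
pose r : R := (1 - cmod (z - 1)) / 2.
have r0 : 0 < r by move/disk11P: zD; rewrite /r; lra.
have cD w : cmod (w - z) <= r -> cdisk11 w.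
  move=> wz; apply/cdisk11P; apply: le_trans (cmod_dist _ z _) _.
  by move: wz r0; rewrite /r; lra.
have [|L hL] := @cauchy_complex R (fun n => (p n)^`().[z]).
  move=> e e0; have e2 : 0 < e * r / 2 by apply: divr_gt0 => //; apply: mulr_gt0.
  have [N' hN'] := pg _ e2; exists N' => m n mN nN.
  rewrite -(ler_pM2r r0) -hornerN -hornerD -derivN -derivD.
  apply: poly_deriv_bound => [|w wr]; first exact: ltW.
  have wD : cdisk11 w by apply: cD; rewrite wr.
  rewrite hornerD hornerN (le_trans (cmod_dist _ (g w) _))//.
  have := hN' _ mN _ wD; have := hN' _ nN _ wD; rewrite [in X in X -> _ -> _]cmodC; lra.
(* The bound is uniform in [n] because on the disk [p n] stays within 2 of [p N]. *)
have [B hB] : exists B : R, forall n, (N <= n)%N -> forall w, cmod (w - z) = r -> cmod (p n).[w] <= B.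
  have [B hB] : exists B : R, forall w, cmod (w - z) = r -> cmod (p N).[w] <= B.
    exists (\sum_(k < size (p N)) cmod (p N)`_k * 2 ^+ k) => w wr.
    have w2 : cmod w <= 2.
      rewrite -[w](subrK 1) (le_trans (cmodD _ _))// cmod1.
      have /cdisk11P : cdisk11 w by apply: cD; rewrite wr.
      lra.
    rewrite horner_coef (le_trans (cmod_sum _ _ _))//; apply: ler_sum => k _.
    by rewrite cmodM cmodX ler_wpM2l ?cmod_ge0// lerXn2r ?nnegrE ?cmod_ge0.
  exists (B + 2) => n nN w wr; have wD : cdisk11 w by apply: cD; rewrite wr.
  have := cmod_lower (p n).[w] (p N).[w]; have := hB _ wr.
  have := cmod_dist (p n).[w] (g w) (p N).[w]; have := hN _ nN _ wD; have := hN _ (leqnn N) _ wD.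
  by rewrite [cmod (g w - _)]cmodC; lra.
have B0 : 0 <= B.
  apply: le_trans (hB N (leqnn N) (z + r%:C%C) _); rewrite ?cmod_ge0//.
  by rewrite addrAC subrr add0r cmod_real gtr0_norm.
have key h : cmod h <= r / 2 -> cmod (g (z + h) - g z - L * h) <= 2 * B / r ^+ 2 * cmod h ^+ 2.
  move=> hr; apply/ler_addgt0Pr => e e0.
  have e3 : 0 < e / 3 by lra.
  (* The derivative is approximated up to [e / 3] divided by [r / 2] because it gets multiplied by
     [h], with [|h| <= r / 2]. *)
  have [N1 h1] := pg _ e3; have [N2 h2] := hL (e / 3 / (r / 2)) (divr_gt0 e3 (divr_gt0 r0 (ltr0n _ 2))).
  pose n := maxn N (maxn N1 N2).
  have n0 : (N <= n)%N by rewrite leq_maxl.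
  have n1 : (N1 <= n)%N by rewrite /n maxnCA leq_maxl.
  have n2 : (N2 <= n)%N by rewrite /n maxnA leq_maxr.
  have zh : cdisk11 (z + h) by apply: cD; rewrite addrAC subrr add0r; lra.
  have zz : cdisk11 z by apply: cD; rewrite subrr cmod0 ltW.
  have := poly_taylor_bound r0 (hB _ n0) hr; set X := (_ - _ - _) => hX.
  rewrite (_ : _ - _ = X - ((p n).[z + h] - g (z + h)) + ((p n).[z] - g z) + ((p n)^`().[z] - L) * h); last first.
    by rewrite /X; ring.
  have H1 := h1 _ n1 _ zh; have H2 := h1 _ n1 _ zz.
  have H3 : cmod (((p n)^`().[z] - L) * h) <= e / 3.
    rewrite cmodM (le_trans (ler_pM _ _ (h2 _ n2) hr)) ?cmod_ge0//.
    by rewrite divfK// lt0r_neq0// divr_gt0.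
  apply: le_trans (cmodD _ _) _; apply: le_trans (lerD (cmodD _ _) H3) _.
  have := cmodB X ((p n).[z + h] - g (z + h)); lra.
apply/cvg_ex; exists L; apply/cvgCP => e e0.
pose K := 2 * B / r ^+ 2 + 1.
have K0 : 0 < K by apply: ltr_wpDl => //; apply: divr_ge0; [exact: mulr_ge0|exact: sqr_ge0].
rewrite near_withinE; apply/nbhsCP; exists (Num.min (r / 2) (e / K)).
  by rewrite lt_min (divr_gt0 r0)// (divr_gt0 e0).
move=> h; rewrite subr0 lt_min => /andP[hr he] h0 /=.
have hp : 0 < cmod h := cmod_gt0 h0.
have -> : L - h^-1 *: (g (h *: (1 : C^o) + z) - g z) = - (h^-1 * (g (z + h) - g z - L * h)).
  rewrite (_ : h *: (1 : C^o) = h); last exact: mulr1.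
  have E (l k a b : C) : k != 0 -> l - k^-1 * (a - b) = - (k^-1 * (a - b - l * k)) by move=> ?; field.
  by rewrite [h + z]addrC; exact: E.
rewrite cmodN cmodM cmodV mulrC ltr_pdivrMr//.
apply: le_lt_trans (key _ (ltW hr)) _; rewrite expr2 mulrA ltr_pM2r//.
apply: le_lt_trans (_ : _ <= K * cmod h) _; first by rewrite ler_wpM2r ?cmod_ge0// /K lerDl.
by rewrite mulrC -ltr_pdivlMr.
Qed.

End CauchyEstimates.

(** * Functions of the disk algebra are uniform limits of polynomials *)

Section RealIntegral.
Context {R : realType}.
Local Notation mu := (@lebesgue_measure R).

Definition contitv (a b : R) (f : R -> R) := {within `[a, b], continuous f}.
Definition Rint (a b : R) (f : R -> R) : R := (\int[mu]_(x in `[a, b]) f x)%R.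

Lemma contitvP a b f : contitv a b f <-> forall x, x \in `[a, b] ->
  forall e : R, 0 < e -> exists2 d : R, 0 < d &
    forall y, y \in `[a, b] -> `|y - x| < d -> `|f y - f x| < e.
Proof.
split=> [/subspace_continuousP h x xab e e0|h].
  have /cvgrPdist_lt /(_ e e0) := h x xab.
  rewrite near_withinE => /nbhs_ballP[d /= d0 hd]; exists d => // y yab yx.
  by rewrite distrC; apply: hd => //; rewrite /ball /= distrC.
apply/subspace_continuousP => x xab; apply/cvgrPdist_lt => e e0.
have [d d0 hd] := h x xab e e0; rewrite near_withinE.
apply/nbhs_ballP; exists d => // y xy yab; rewrite distrC; apply: hd => //.
by rewrite distrC.
Qed.

Lemma contitv_integrable a b f : contitv a b f -> mu.-integrable `[a, b] (EFin \o f).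
Proof. by move=> h; apply: continuous_compact_integrable => //; exact: segment_compact. Qed.

Lemma contitv_sub a b c d f : `[c, d] `<=` `[a, b] -> contitv a b f -> contitv c d f.
Proof. exact: continuous_subspaceW. Qed.

Lemma RintB a b f g : contitv a b f -> contitv a b g ->
  Rint a b (fun x => f x - g x) = Rint a b f - Rint a b g.
Proof. by move=> cf cg; rewrite /Rint RintegralB//; exact: contitv_integrable. Qed.

Lemma Rint_split a m b f : a <= m -> m <= b -> contitv a b f ->
  Rint a b f = Rint a m f + Rint m b f.
Proof.
move=> am mb cf; have hi := contitv_integrable cf.
have sub1 : `[a, m] `<=` `[a, b].
  by apply: subset_itv; rewrite bnd_simp.
have sub2 : `]m, b] `<=` `[a, b].
  by apply: subset_itv; rewrite bnd_simp.
rewrite /Rint -[X in _ + X]Rintegral_itv_obnd_cbnd; last first.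
  by apply: integrableS hi => //; apply: subset_itv; rewrite bnd_simp.
rewrite -Rintegral_setU//.
- by congr Rintegral; rewrite -itv_bndbnd_setU// bnd_simp.
- by rewrite -itv_bndbnd_setU// bnd_simp.
apply/disj_setPS => x [] /=; rewrite !in_itv /= => /andP[_ h1] /andP[h2 _].
by have := lt_le_trans h2 h1; rewrite ltxx.
Qed.

Lemma Rint_cst a b (k : R) : a <= b -> Rint a b (fun=> k) = (b - a) * k.
Proof.
move=> ab; rewrite /Rint Rintegral_cst//.
rewrite [X in fine X](_ : _ = (b - a)%:E); first by rewrite mulrC.
transitivity (lebesgue_measure (`[a, b]%classic : set R)); first by [].
rewrite lebesgue_measure_itv /= lte_fin; case: ltgtP ab => //= -> _.
by rewrite subrr.
Qed.

Lemma contitv_cst a b (k : R) : contitv a b (fun=> k).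
Proof. by apply/contitvP => x xab e e0; exists 1 => // y _ _; rewrite subrr normr0. Qed.

Lemma Rint_le a b f g : contitv a b f -> contitv a b g ->
  (forall x, x \in `[a, b] -> f x <= g x) -> Rint a b f <= Rint a b g.
Proof. by move=> cf cg h; apply: le_Rintegral => //; exact: contitv_integrable. Qed.

Lemma Rint_near a b f k M : a <= b -> contitv a b f ->
  (forall x, x \in `[a, b] -> `|f x - k| <= M) -> `|Rint a b f - (b - a) * k| <= (b - a) * M.
Proof.
move=> ab cf h.
have h1 : Rint a b f <= (b - a) * (k + M).
  rewrite -Rint_cst//; apply: Rint_le => //; first exact: contitv_cst.
  by move=> x /h; rewrite ler_norml; lra.
have h2 : (b - a) * (k - M) <= Rint a b f.
  rewrite -Rint_cst//; apply: Rint_le => //; first exact: contitv_cst.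
  by move=> x /h; rewrite ler_norml; lra.
by rewrite ler_norml; apply/andP; split; lra.
Qed.

End RealIntegral.

Lemma itv_dist_le (R : realFieldType) (a b s p : R) : a <= s <= b -> a <= p <= b -> `|p - s| <= b - a.
Proof.
by move=> /andP[? ?] /andP[? ?]; rewrite ler_norml; apply/andP; split; lra.
Qed.

Lemma mem_sub_itv (R : realFieldType) (a0 b0 a b p : R) : a0 <= a -> b <= b0 -> a <= p <= b ->
  p \in `[a0, b0].
Proof.
by move=> h1 h2 /andP[h3 h4]; rewrite in_itv /= (le_trans h1)//= (le_trans h4).
Qed.

Lemma itv_left (R : realFieldType) (a b : R) : a <= b -> a <= a <= b.
Proof. by rewrite lexx. Qed.

Lemma itv_right (R : realFieldType) (a b : R) : a <= b -> a <= b <= b.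
Proof. by rewrite lexx andbT. Qed.

(** Two first-order expansions sharing the base value [w] and the increment [k] of one variable:
    their difference keeps only the slope [be] in the other variable. *)
Lemma increment_dist (R : realFieldType) (u w v be c d t k M : R) :
  `|u - w - k - be * (c - t)| <= M -> `|v - w - k - be * (d - t)| <= M ->
  `|u - v - be * (c - d)| <= 2 * M.
Proof.
rewrite !ler_norml => /andP[? ?] /andP[? ?].
by apply/andP; split; lra.
Qed.

(** * Goursat's bisection argument on rectangles *)

Section Green.
Context {R : realType}.
Variables (U V : R -> R -> R) (a0 b0 c0 d0 : R).
Hypotheses (ab0 : a0 < b0) (cd0 : c0 < d0).
(* The common [be] says that the form [U ds + V dt] is closed at [(s, t)]. *)
Hypothesis dUV : forall s t, s \in `[a0, b0] -> t \in `[c0, d0] ->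
  exists al be ga : R, forall e : R, 0 < e -> exists2 d : R, 0 < d &
    forall s' t', s' \in `[a0, b0] -> t' \in `[c0, d0] ->
      `|s' - s| < d -> `|t' - t| < d ->
      `|U s' t' - U s t - al * (s' - s) - be * (t' - t)| <= e * (`|s' - s| + `|t' - t|) /\
      `|V s' t' - V s t - be * (s' - s) - ga * (t' - t)| <= e * (`|s' - s| + `|t' - t|).

(** Counterclockwise integral of [U ds + V dt] along the boundary of [[a, b] x [c, d]]. *)
Let B a b c d : R :=
  Rint a b (fun s => U s c) - Rint a b (fun s => U s d) +
  Rint c d (fun t => V b t) - Rint c d (fun t => V a t).

Let contU c : c \in `[c0, d0] -> contitv a0 b0 (fun s => U s c).
Proof.
move=> hc; apply/contitvP => s hs e e0; have [al [be [ga /(_ 1 ltr01)[d d_gt0 h]]]] := dUV hs hc.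
exists (Num.min d (e / (`|al| + 2))).
  by rewrite lt_min d_gt0 divr_gt0// ltr_wpDl.
move=> y hy; rewrite lt_min => /andP[yd ye].
have [|h1 _] := h y c hy hc yd; first by rewrite subrr normr0.
rewrite subrr normr0 mulr0 subr0 addr0 mul1r in h1.
rewrite ltr_pdivlMr ?ltr_wpDl// in ye.
rewrite -[U y c - U s c](subrK (al * (y - s))).
apply: le_lt_trans (ler_normD _ _) _; rewrite normrM.
have := normr_ge0 (y - s); move: h1 ye; set n1 := `|U y c - _ - _|; set n2 := `|y - _|; rewrite mulrDr [n2 * _]mulrC; lra.
Qed.

Let contV s : s \in `[a0, b0] -> contitv c0 d0 (fun t => V s t).
Proof.
move=> hs; apply/contitvP => t ht e e0; have [al [be [ga /(_ 1 ltr01)[d d_gt0 h]]]] := dUV hs ht.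
exists (Num.min d (e / (`|ga| + 2))).
  by rewrite lt_min d_gt0 divr_gt0// ltr_wpDl.
move=> y hy; rewrite lt_min => /andP[yd ye].
have [||_ h1] := h s y hs hy; rewrite ?subrr ?normr0//.
rewrite subrr normr0 mulr0 subr0 add0r mul1r in h1.
rewrite ltr_pdivlMr ?ltr_wpDl// in ye.
rewrite -[V s y - V s t](subrK (ga * (y - t))).
apply: le_lt_trans (ler_normD _ _) _; rewrite normrM.
have := normr_ge0 (y - t); move: h1 ye; set n1 := `|V s y - _ - _|; set n2 := `|y - _|; rewrite mulrDr [n2 * _]mulrC; lra.
Qed.

Let sub (a b c d : R) : a <= c -> d <= b -> `[c, d] `<=` `[a, b].
Proof. by move=> ac db; apply: subset_itv; rewrite bnd_simp. Qed.

Let B_splitx a m b c d : a0 <= a -> a <= m -> m <= b -> b <= b0 ->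
  c0 <= c -> c <= d -> d <= d0 -> B a b c d = B a m c d + B m b c d.
Proof.
move=> h1 h2 h3 h4 h5 h6 h7.
have hc : c \in `[c0, d0] by rewrite in_itv /=; apply/andP; split; lra.
have hd : d \in `[c0, d0] by rewrite in_itv /=; apply/andP; split; lra.
rewrite /B (@Rint_split _ a m b (fun s => U s c))//; last first.
  by apply: contitv_sub (contU hc); exact: sub.
rewrite (@Rint_split _ a m b (fun s => U s d))//; last first.
  by apply: contitv_sub (contU hd); exact: sub.
ring.
Qed.

Let B_splity a b c m d : a0 <= a -> a <= b -> b <= b0 ->
  c0 <= c -> c <= m -> m <= d -> d <= d0 -> B a b c d = B a b c m + B a b m d.
Proof.
move=> h1 h2 h3 h4 h5 h6 h7.
have ha : a \in `[a0, b0] by rewrite in_itv /=; apply/andP; split; lra.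
have hb : b \in `[a0, b0] by rewrite in_itv /=; apply/andP; split; lra.
rewrite /B (@Rint_split _ c m d (fun s => V a s))//; last first.
  by apply: contitv_sub (contV ha); exact: sub.
rewrite (@Rint_split _ c m d (fun s => V b s))//; last first.
  by apply: contitv_sub (contV hb); exact: sub.
ring.
Qed.

(** The linear terms contribute [be (c - d) (b - a)] on the horizontal sides and
    [be (b - a) (d - c)] on the vertical ones, and cancel. What is left is the error of the
    expansions integrated over the sides, quadratic in the size. *)
Let B_small s t e : s \in `[a0, b0] -> t \in `[c0, d0] -> 0 < e ->
  exists2 r : R, 0 < r & forall a b c d, a0 <= a -> b <= b0 -> c0 <= c -> d <= d0 ->
    a <= s <= b -> c <= t <= d -> b - a < r -> d - c < r ->
    `|B a b c d| <= e * (b - a + (d - c)) ^+ 2.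
Proof.
move=> hs ht e0; have [al [be [ga h]]] := dUV hs ht.
(* Half of [e], since [increment_dist] doubles the error of each expansion. *)
have e4 : 0 < e / 2 by lra.
have [r r0 {}h] := h _ e4; exists r => // a b c d h1 h2 h3 h4 sI tI h9 h10.
have /andP[h5 h6] := sI; have /andP[h7 h8] := tI.
have ab := le_trans h5 h6; have cd := le_trans h7 h8.
have ha := mem_sub_itv h1 h2 (itv_left ab); have hb := mem_sub_itv h1 h2 (itv_right ab).
have hc := mem_sub_itv h3 h4 (itv_left cd); have hd := mem_sub_itv h3 h4 (itv_right cd).
have near p q : a <= p <= b -> c <= q <= d ->
    `|U p q - U s t - al * (p - s) - be * (q - t)| <= e / 2 * (b - a + (d - c)) /\
    `|V p q - V s t - be * (p - s) - ga * (q - t)| <= e / 2 * (b - a + (d - c)).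
  move=> pI qI.
  have ps := itv_dist_le sI pI; have qt := itv_dist_le tI qI.
  have [k1 k2] := h p q (mem_sub_itv h1 h2 pI) (mem_sub_itv h3 h4 qI) (le_lt_trans ps h9) (le_lt_trans qt h10).
  have le : e / 2 * (`|p - s| + `|q - t|) <= e / 2 * (b - a + (d - c)).
    by rewrite ler_pM2l//; exact: lerD.
  by split; [exact: le_trans k1 le|exact: le_trans k2 le].
set M := e / 2 * (b - a + (d - c)) in near.
rewrite /B -addrA -RintB; last 2 first.
- by apply: contitv_sub (contU hc); exact: sub.
- by apply: contitv_sub (contU hd); exact: sub.
rewrite -RintB; last 2 first.
- by apply: contitv_sub (contV hb); exact: sub.
- by apply: contitv_sub (contV ha); exact: sub.
have cU : contitv a b (fun x => U x c - U x d).
  have cc := contitv_sub (sub h1 h2) (contU hc); have cd' := contitv_sub (sub h1 h2) (contU hd).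
  by move=> x; apply: cvgB; [exact: cc|exact: cd'].
have cV : contitv c d (fun x => V b x - V a x).
  have cc := contitv_sub (sub h3 h4) (contV hb); have cd' := contitv_sub (sub h3 h4) (contV ha).
  by move=> x; apply: cvgB; [exact: cc|exact: cd'].
have kU := @Rint_near _ a b (fun x => U x c - U x d) (be * (c - d)) (2 * M) ab cU.
have kV := @Rint_near _ c d (fun x => V b x - V a x) (be * (b - a)) (2 * M) cd cV.
have {}kU : `|Rint a b (fun x => U x c - U x d) - (b - a) * (be * (c - d))| <= (b - a) * (2 * M).
  apply: kU => x; rewrite in_itv /= => hx.
  have [n1 _] := near x c hx (itv_left cd); have [n2 _] := near x d hx (itv_right cd).
  exact: increment_dist n1 n2.
have {}kV : `|Rint c d (fun x => V b x - V a x) - (d - c) * (be * (b - a))| <= (d - c) * (2 * M).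
  apply: kV => x; rewrite in_itv /= => hx.
  have [_ n1] := near b x (itv_right ab) hx; have [_ n2] := near a x (itv_left ab) hx.
  by apply: (@increment_dist R _ (V s t) _ be _ _ s (ga * (x - t))); rewrite addrAC.
move: kU kV; set X := Rint a b _; set Y := Rint c d _ => kU kV.
have -> : X + Y = X - (b - a) * (be * (c - d)) + (Y - (d - c) * (be * (b - a))) by ring.
apply: le_trans (ler_normD _ _) _; apply: le_trans (lerD kU kV) _.
rewrite /M le_eqVlt; apply/orP; left; apply/eqP; by field.
Qed.

Let nested_intervals (x w : nat -> R) : (forall n, 0 <= w n) ->
  (forall n, x n <= x n.+1) -> (forall n, x n.+1 + w n.+1 <= x n + w n) ->
  exists s, forall n, x n <= s <= x n + w n.
Proof.
move=> w0 x1 x2.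
have up n k : x n <= x (n + k)%N.
  by elim: k => [|k IH]; rewrite ?addn0// addnS (le_trans IH).
have dn n k : x (n + k)%N + w (n + k)%N <= x n + w n.
  by elim: k => [|k IH]; rewrite ?addn0// addnS (le_trans _ IH).
have cross m n : x m <= x n + w n.
  have := le_trans (up m (maxn m n - m)%N) (le_trans _ (dn n (maxn m n - n)%N)).
  by rewrite !subnKC ?leq_maxl ?leq_maxr// => ->//; rewrite lerDl.
exists (sup (range x)) => n; apply/andP; split.
  by apply: ub_le_sup; [exists (x 0 + w 0) => _ [m _ <-]|exists n].
by apply: ge_sup; [exists (x 0%N); exists 0%N|move=> _ [m _ <-]].
Qed.

(** If all four quarters were at most [e], additivity of [B] would bound the whole by [4 * e]. *)
Let B_quarter x y w h e : 0 < w -> 0 < h ->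
  a0 <= x -> x + (w + w) <= b0 -> c0 <= y -> y + (h + h) <= d0 ->
  4 * e < `|B x (x + (w + w)) y (y + (h + h))| ->
  exists q : R * R, [/\ x <= q.1, q.1 <= x + w, y <= q.2, q.2 <= y + h &
    e < `|B q.1 (q.1 + w) q.2 (q.2 + h)|].
Proof.
move=> w0 h0 h1 h2 h3 h4; rewrite !addrA in h2 h4 *.
have E : B x (x + w + w) y (y + h + h) =
   B x (x + w) y (y + h) + B x (x + w) (y + h) (y + h + h) +
   (B (x + w) (x + w + w) y (y + h) +
    B (x + w) (x + w + w) (y + h) (y + h + h)).
  by rewrite -!B_splity -?B_splitx//; lra.
rewrite E => b5.
have xw : x <= x + w by rewrite lerDl ltW.
have yh : y <= y + h by rewrite lerDl ltW.
have [l1|l1] := ltP e `|B x (x + w) y (y + h)|.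
  by exists (x, y).
have [l2|l2] := ltP e `|B x (x + w) (y + h) (y + h + h)|.
  by exists (x, y + h).
have [l3|l3] := ltP e `|B (x + w) (x + w + w) y (y + h)|.
  by exists (x + w, y).
have [l4|l4] := ltP e `|B (x + w) (x + w + w) (y + h) (y + h + h)|.
  by exists (x + w, y + h).
exfalso; move: b5; rewrite ltNge => /negP; apply.
apply: le_trans (ler_normD _ _) _.
apply: le_trans (lerD (ler_normD _ _) (ler_normD _ _)) _.
by rewrite (_ : 4 * e = e + e + (e + e)); [rewrite !lerD|ring].
Qed.

(** Goursat: a nonzero boundary integral survives, divided by at most 4, in some quarter of each
    rectangle; at the common point of the nested rectangles this contradicts the quadratic bound
    [B_small]. *)
Lemma green_boundary0 :
  Rint a0 b0 (fun s => U s c0) - Rint a0 b0 (fun s => U s d0) +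
  Rint c0 d0 (fun t => V b0 t) - Rint c0 d0 (fun t => V a0 t) = 0.
Proof.
rewrite -/(B a0 b0 c0 d0); apply/eqP/negPn/negP => Bn0.
pose W := b0 - a0; pose H := d0 - c0.
have W0 : 0 < W by rewrite subr_gt0.
have H0 : 0 < H by rewrite subr_gt0.
pose w n := W / 2 ^+ n; pose h n := H / 2 ^+ n.
(* Half of the boundary integral, so that the strict inequality in [big] holds at the start. *)
pose e := `|B a0 b0 c0 d0| / 2.
have e0 : 0 < e by rewrite divr_gt0// normr_gt0.
pose big n (q : R * R) := [/\ a0 <= q.1, q.1 + w n <= b0, c0 <= q.2, q.2 + h n <= d0 &
   e / 4 ^+ n < `|B q.1 (q.1 + w n) q.2 (q.2 + h n)|].
have wS n : w n = w n.+1 + w n.+1 by rewrite /w exprS; field; rewrite expf_neq0.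
have hS n : h n = h n.+1 + h n.+1 by rewrite /h exprS; field; rewrite expf_neq0.
have wp n : 0 < w n by rewrite divr_gt0// exprn_gt0.
have hp n : 0 < h n by rewrite divr_gt0// exprn_gt0.
(* Stated as an implication, with [q] itself as default when [q] is not [big], so that [step] is
   total and can be iterated by a fixpoint. *)
have step n q : {q' | big n q ->
   [/\ big n.+1 q', q.1 <= q'.1 <= q.1 + w n.+1 & q.2 <= q'.2 <= q.2 + h n.+1]}.
  apply: cid; case: (pselect (big n q)) => [[b1 b2 b3 b4 b5]|nb]; last by exists q.
  have big4 : e / 4 ^+ n = 4 * (e / 4 ^+ n.+1).
    by rewrite exprS; field; rewrite expf_neq0.
  rewrite wS hS big4 in b2 b4 b5.
  have [q' [q1 q2 q3 q4 q5]] := B_quarter (wp n.+1) (hp n.+1) b1 b2 b3 b4 b5.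
  exists q' => _; rewrite q1 q2 q3 q4; split => //; split => //.
  - exact: le_trans q1.
  - by apply: le_trans b2; rewrite addrA lerD2r.
  - exact: le_trans q3.
  - by apply: le_trans b4; rewrite addrA lerD2r.
pose q := fix q n := if n is n'.+1 then sval (step n' (q n')) else (a0, c0).
have qb n : big n (q n).
  elim: n => [|n IH]; last by have /= [] := svalP (step n (q n)) IH.
  rewrite /big /= /w /h !expr0 !divr1 /W /H ![_ + (_ - _)]addrC !subrK; split => //.
  by rewrite /e gtr_pMr ?normr_gt0// invf_lt1// ltr1n.
have qS n : (q n).1 <= (q n.+1).1 <= (q n).1 + w n.+1 /\ (q n).2 <= (q n.+1).2 <= (q n).2 + h n.+1.
  by have [_ ? ?] := svalP (step n (q n)) (qb n).
have [s s_in] : exists s, forall n, (q n).1 <= s <= (q n).1 + w n.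
  apply: nested_intervals => n; first exact: ltW.
    by have [/andP[]] := qS n.
  by have [/andP[_ k] _] := qS n; rewrite (wS n) addrA lerD2r.
have [t t_in] : exists t, forall n, (q n).2 <= t <= (q n).2 + h n.
  apply: nested_intervals => n; first exact: ltW.
    by have [_ /andP[]] := qS n.
  by have [_ /andP[_ k]] := qS n; rewrite (hS n) addrA lerD2r.
have [k1 k2 k3 k4 _] := qb 0%N.
have hs : s \in `[a0, b0].
  by rewrite in_itv /=; have /andP[l1 l2] := s_in 0%N; rewrite (le_trans k1) ?(le_trans l2).
have ht : t \in `[c0, d0].
  by rewrite in_itv /=; have /andP[l1 l2] := t_in 0%N; rewrite (le_trans k3) ?(le_trans l2).
have WH0 : 0 < (W + H) ^+ 2 by rewrite exprn_gt0// addr_gt0.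
(* With this tolerance the quadratic bound at the [n]-th rectangle is exactly [e / 4 ^+ n]. *)
have [r r0 hr] := B_small hs ht (divr_gt0 e0 WH0).
have [n hn] : exists n, (W + H) / 2 ^+ n < r.
  have [n hn] : exists n : nat, (W + H) / r < n%:R.
    by exists (Num.truncn ((W + H) / r)).+1; exact: truncnS_gt.
  exists n; rewrite ltr_pdivrMr ?exprn_gt0// mulrC -ltr_pdivrMr//.
  by apply: lt_le_trans hn _; rewrite -natrX ler_nat ltnW// ltn_expl.
have [b1 b2 b3 b4 b5] := qb n.
have hn' : w n + h n < r by rewrite /w /h -mulrDl.
have wr : w n < r by apply: le_lt_trans hn'; rewrite lerDl ltW.
have hrr : h n < r by apply: le_lt_trans hn'; rewrite lerDr ltW.
have := hr _ _ _ _ b1 b2 b3 b4 (s_in n) (t_in n).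
rewrite ![_ + _ - _]addrAC !subrr !add0r => /(_ wr hrr).
move=> le; have := lt_le_trans b5 le.
rewrite /w /h -mulrDl exprMn mulrA divfK ?lt0r_neq0// exprVn -exprM mulnC exprM.
by rewrite (_ : 2 ^+ 2 = 4 :> R) ?ltxx//; ring.
Qed.

End Green.

(** * Compactness of the closed disk and uniform continuity *)

Section UniformContinuity.
Context {R : realType}.
Local Notation C := R[i].

Lemma compact_square : compact [set z : C^o | (0 <= complex.Re z <= 2) /\ (-1 <= complex.Im z <= 1)].
Proof.
pose h (x : R * R) : C^o := (x.1 +i* x.2)%C.
have -> : [set z : C^o | (0 <= complex.Re z <= 2) /\ (-1 <= complex.Im z <= 1)] =
    h @` (`[0, 2] `*` `[-1, 1]).
  apply/seteqP; split => [[a b] /= [ha hb]|_ [[a b] [/= + +] <-]].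
    by exists (a, b) => //=; rewrite !in_itv.
  by rewrite !in_itv.
apply: continuous_compact; last by apply: compact_setX; exact: segment_compact.
apply: continuous_subspaceT => x; apply/cvgCP => e e0.
have e2 : 0 < e / 2 by lra.
near=> y; apply: le_lt_trans (cmod_ReIm _) _; rewrite [e]splitr ltrD//=.
- near: y; apply: (@cvgr_dist_lt _ _ _ (nbhs x) _ fst x.1) => //; exact: cvg_fst.
- near: y; apply: (@cvgr_dist_lt _ _ _ (nbhs x) _ snd x.2) => //; exact: cvg_snd.
Unshelve. all: by end_near. Qed.

Lemma compact_cdisk11 : compact (cdisk11 (R:=R)).
Proof.
apply: (subclosed_compact _ compact_square).
  move=> z hz; apply/cdisk11P; apply/ler_addgt0Pr => e e0.
  have [w [/cdisk11P wD wz]] : @cdisk11 R `&` [set w : C | cmod (w - z) < e] !=set0.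
    by apply: hz; apply/nbhsCP; exists e.
  by have := cmod_dist z w 1; move: wz wD; rewrite /= [cmod (w - z)]cmodC; lra.
move=> z /cdisk11P zD /=.
have := le_trans (cmod_Re _) zD; have := le_trans (cmod_Im _) zD.
case: z {zD} => a b /=; rewrite oppr0 addr0 !ler_norml => /andP[? ?] /andP[? ?].
by split; apply/andP; split; lra.
Qed.

Lemma uniform_continuity (K : set C^o) (g : C^o -> C^o) : compact K ->
  {within K, continuous g} -> forall e : R, 0 < e -> exists2 d : R, 0 < d &
  forall z w : C, K z -> K w -> cmod (z - w) < d -> cmod (g z - g w) < e.
Proof.
move=> cK /subspace_continuousP gc e e0; have e2 : 0 < e / 2 by lra.
have cov : near_covering K by apply/compact_near_coveringP.
have : \forall d \near (0 : R)^'+, K `<=` (fun x => K x -> forall w, K w -> cmod (x - w) < d -> cmod (g x - g w) < e).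
  apply: cov.
  move=> x Kx; have /cvgCP/(_ _ e2) := gc x Kx; rewrite near_withinE => /nbhsCP[d d0 hd].
  have d2 : 0 < d / 2 by lra.
  exists ([set y : C^o | cmod (y - x) < d / 2], [set r | 0 < r < d / 2]) => /=.
    split; first by apply/nbhsCP; exists (d / 2).
    by near=> r; apply/andP; split; near: r; [exact: nbhs_right_gt|exact: nbhs_right_lt].
  move=> [y r] /= [yx /andP[r0 rd]] Ky w Kw yw.
  have wx : cmod (w - x) < d.
    have := cmod_dist w y x; rewrite [cmod (w - y)]cmodC; lra.
  have yx' : cmod (y - x) < d by lra.
  have := cmod_dist (g y) (g x) (g w); have := hd _ yx' Ky; have := hd _ wx Kw.
  by rewrite /from_subspace [cmod (g y - g x)]cmodC; lra.
move=> [d /= d0 hd]; exists (d / 2); first by lra.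
move=> z w Kz Kw zw; apply: (hd (d / 2)) => //=; last 2 first.
- by rewrite sub0r normrN gtr0_norm; lra.
- by lra.
Unshelve. all: by end_near. Qed.

(** The radius from 1 to [z] is cut into [n] pieces shorter than [d], and [g] varies by less than 1
    along each. *)
Lemma cdisk11_bounded (g : C^o -> C^o) : {within cdisk11 (R:=R), continuous g} ->
  exists2 M : R, 0 < M & forall z, cdisk11 z -> cmod (g z) <= M.
Proof.
move=> gc; have [d d0 hd] := uniform_continuity compact_cdisk11 gc ltr01.
pose n := (Num.truncn d^-1).+1.
have nd : n%:R^-1 < d by rewrite invf_plt ?posrE ?ltr0n// truncnS_gt.
exists (cmod (g 1) + n%:R); first by rewrite ltr_wpDl ?cmod_ge0// ltr0n.
move=> z /cdisk11P zD; pose u k : C := 1 + (k%:R / n%:R) * (z - 1).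
have uD k : (k <= n)%N -> cdisk11 (u k).
  move=> kn; apply/cdisk11P; rewrite addrAC subrr add0r cmodM.
  rewrite cmodM cmodV !cmod_nat mulr_ile1 ?cmod_ge0// ?divr_ge0//.
  by rewrite ler_pdivrMr ?ltr0n// mul1r ler_nat.
have step k : (k <= n)%N -> cmod (g (u k)) <= cmod (g 1) + k%:R.
  elim: k => [_|k IH kn]; first by rewrite /u mul0r mul0r !addr0.
  have h : cmod (g (u k.+1) - g (u k)) < 1.
    apply: hd; [exact: uD|exact/uD/ltnW|].
    rewrite (_ : _ - _ = n%:R^-1 * (z - 1)); last by rewrite /u -natr1; ring.
    rewrite cmodM cmodV cmod_nat; apply: le_lt_trans nd.
    by rewrite ler_piMr// invr_ge0.
  have := IH (ltnW kn); have := cmod_lower (g (u k.+1)) (g (u k)).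
  by rewrite -natr1; lra.
have := step n (leqnn n); rewrite /u divff ?pnatr_eq0// mul1r addrCA subrr addr0.
by [].
Qed.

End UniformContinuity.

(** * Holomorphic functions in logarithmic polar coordinates *)

Section PolarCoordinates.
Context {R : realType}.
Local Notation C := R[i].
Implicit Types (s t x y : R) (F : C -> C).

(** Complex derivative in increment form: no division, and [h = 0] is not excluded. *)
Definition cderiv F (z L : C) := forall e : R, 0 < e -> exists2 d : R, 0 < d &
  forall h : C, cmod h < d -> cmod (F (z + h) - F z - L * h) <= e * cmod h.

Lemma derivable_cderiv (F : C^o -> C^o) (z : C^o) : derivable F z 1 -> exists L, cderiv F z L.
Proof.
move=> /cvg_ex[L /cvgCP hL]; exists L => e /hL; rewrite near_withinE => /nbhsCP[d d0 hd].
exists d => // h hh; have [->|h0] := eqVneq h 0.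
  by rewrite addr0 subrr mulr0 subrr cmod0 mulr0.
have := hd h; rewrite subr0 => /(_ hh h0)/ltW.
have -> : h *: (1 : C^o) = h by exact: mulr1.
have E (l k a b : C) : k != 0 -> a - b - l * k = - (l - k^-1 * (a - b)) * k by move=> ?; field.
rewrite /= => le; rewrite [z + h]addrC E// cmodM cmodN ler_wpM2r ?cmod_ge0//.
Qed.

Lemma is_derive_taylor (f : R -> R) (x l : R) : is_derive x 1 f l ->
  forall e : R, 0 < e -> exists2 d : R, 0 < d &
  forall y, `|y| < d -> `|f (x + y) - f x - l * y| <= e * `|y|.
Proof.
move=> [/cvg_ex[L hL]]; rewrite /derive; move/cvg_lim: (hL) => -> // Ll.
move=> e e0; move/cvgrPdist_lt: hL => /(_ e e0); rewrite near_withinE => /nbhs_ballP[d /= d0 hd].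
exists d => // y yd; have [->|y0] := eqVneq y 0.
  by rewrite addr0 subrr mulr0 subrr normr0 mulr0.
have := hd y; rewrite /ball /= sub0r normrN => /(_ yd y0)/ltW.
have -> : y *: (1 : R^o) = y by exact: mulr1.
have E (a b : R) : a - b - l * y = - (l - y^-1 * (a - b)) * y by field.
by move=> le; rewrite [x + y]addrC E normrM normrN ler_wpM2r// -Ll.
Qed.

(** This is [exp(s + i t)]: circles about 0 become vertical segments, and the Cauchy-Riemann
    equations keep their cartesian form. *)
Definition cexp s t : C := ((expR s * cos t) +i* (expR s * sin t))%C.
Definition cis t : C := (cos t +i* sin t)%C.

Lemma cexpE s t : cexp s t = (expR s)%:C%C * cis t.
Proof. by rewrite /cexp /cis /real_complex_def /=; simpc. Qed.

Lemma cisD s t : cis (s + t) = cis s * cis t.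
Proof. by rewrite /cis cosD sinD; apply/eqP; rewrite eq_complex /=; apply/andP; split; apply/eqP; ring. Qed.

Lemma cexpD s t x y : cexp (s + x) (t + y) = cexp s t * cexp x y.
Proof. by rewrite !cexpE expRD rmorphM /= cisD; ring. Qed.

Lemma cmod_cis t : cmod (cis t) = 1.
Proof. by rewrite /cmod /sqmod /= cos2Dsin2 sqrtr1. Qed.

Lemma cmod_cexp s t : cmod (cexp s t) = expR s.
Proof. by rewrite cexpE cmodM cmod_cis mulr1 cmod_real gtr0_norm ?expR_gt0. Qed.

Lemma cis0 : cis 0 = 1. Proof. by rewrite /cis cos0 sin0. Qed.

Lemma cisNK t : cis t * (cis t)^*%C = 1.
Proof. exact/cmod1_conj/cmod_cis. Qed.

Lemma cis_2pi : cis (2 * pi) = 1.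
Proof. by rewrite /cis -[2 * pi]add0r mulr_natl cosD2pi sinD2pi cos0 sin0. Qed.

Lemma cexp_taylor (e : R) : 0 < e -> exists2 d : R, 0 < d &
  forall x y, `|x| < d -> `|y| < d -> cmod (cexp x y - 1 - (x +i* y)%C) <= e * (`|x| + `|y|).
Proof.
move=> e0; pose e' := e / 8; have e'0 : 0 < e' by rewrite /e'; lra.
have [d1 d10 h1] := is_derive_taylor (is_derive_expR 0) e'0.
have [d2 d20 h2] := is_derive_taylor (is_derive_cos 0) e'0.
have [d3 d30 h3] := is_derive_taylor (is_derive_sin 0) e'0.
have [d4 d40 h4] : exists2 d : R, 0 < d & forall x, `|x| < d -> expR x <= 2 /\ `|expR x - 1| <= e'.
  have m0 : 0 < Num.min 1 e' by rewrite lt_min ltr01.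
  have /cvgrPdist_lt/(_ _ m0) := @continuous_expR R 0.
  move=> /nbhs_ballP[d /= d0 hd]; exists d => // x xd.
  have := hd x; rewrite /ball /= sub0r normrN => /(_ xd).
  rewrite expR0 lt_min distrC => /andP[]; rewrite ltr_norml => /andP[_ ? /ltW ?].
  by split => //; lra.
exists (Num.min (Num.min d1 d2) (Num.min d3 d4)); first by rewrite !lt_min d10 d20 d30.
move=> x y; rewrite !lt_min => /andP[/andP[x1 _] /andP[_ x4]] /andP[/andP[_ y2] /andP[y3 _]].
have [E2 E1] := h4 _ x4.
have := h1 _ x1; rewrite add0r expR0 mul1r => A1.
have := h2 _ y2; rewrite add0r cos0 sin0 oppr0 mul0r subr0 => A2.
have := h3 _ y3; rewrite add0r cos0 sin0 mul1r subr0 => A3.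
apply: le_trans (cmod_ReIm _) _ => /=; rewrite subr0.
have -> : expR x * cos y - 1 - x = (expR x - 1 - x) + expR x * (cos y - 1) by ring.
have -> : expR x * sin y - y = expR x * (sin y - y) + (expR x - 1) * y by ring.
have B2 : `|expR x * (cos y - 1)| <= 2 * (e' * `|y|).
  by rewrite normrM ler_pM// gtr0_norm ?expR_gt0.
have B3 : `|expR x * (sin y - y)| <= 2 * (e' * `|y|).
  by rewrite normrM ler_pM// gtr0_norm ?expR_gt0.
have B4 : `|(expR x - 1) * y| <= e' * `|y| by rewrite normrM ler_wpM2r.
apply: le_trans (lerD (ler_normD _ _) (ler_normD _ _)) _.
apply: le_trans (lerD (lerD A1 B2) (lerD B3 B4)) _.
have : 0 <= e' * `|x| by rewrite mulr_ge0// ltW.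
have : 0 <= e' * `|y| by rewrite mulr_ge0// ltW.
have -> : e = 8 * e' by rewrite /e'; field.
lra.
Qed.

Lemma polar_expansion F s t L : cderiv F (cexp s t) L ->
  forall e : R, 0 < e -> exists2 d : R, 0 < d & forall s' t', `|s' - s| < d -> `|t' - t| < d ->
    cmod (F (cexp s' t') - F (cexp s t) - L * cexp s t * ((s' - s) +i* (t' - t))%C)
      <= e * (`|s' - s| + `|t' - t|).
Proof.
move=> FL e e0; set A := expR s; have A0 : 0 < A := expR_gt0 s.
(* The increment [k] of the exponential is at most [2 * A * n] thanks to [e1 <= 1]; so [e2] leaves
   [e / 2] for the remainder of [F], and the second entry of [e1] leaves [e / 2] for that of the
   exponential. *)
pose e2 := e / (4 * A); have e20 : 0 < e2 by rewrite divr_gt0// mulr_gt0.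
pose e1 := Num.min 1 (e / (2 * (cmod L * A + 1))).
have LA : 0 < cmod L * A + 1 by rewrite ltr_wpDl// mulr_ge0 ?cmod_ge0// ltW.
have e10 : 0 < e1 by rewrite lt_min ltr01 divr_gt0// mulr_gt0.
have [d2 d20 h2] := FL _ e20; have [d1 d10 h1] := cexp_taylor e10.
exists (Num.min d1 (d2 / (4 * A))); first by rewrite lt_min d10 divr_gt0// mulr_gt0.
move=> s' t'; rewrite !lt_min => /andP[s1 s2] /andP[t1 t2].
set x := s' - s in s1 s2 *; set y := t' - t in t1 t2 *.
have -> : s' = s + x by rewrite /x addrC subrK.
have -> : t' = t + y by rewrite /y addrC subrK.
have H1 := h1 _ _ s1 t1; set n := `|x| + `|y| in H1 *.
have n0 : 0 <= n by rewrite addr_ge0.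
pose k := cexp s t * (cexp x y - 1).
have kE : cexp (s + x) (t + y) = cexp s t + k by rewrite cexpD /k; ring.
have e11 : e1 <= 1 by rewrite ge_min lexx.
have xy : cmod (x +i* y)%C <= n by exact: cmod_ReIm.
have k1 : cmod k <= 2 * A * n.
  rewrite cmodM cmod_cexp -/A (_ : 2 * A * n = A * (2 * n)); last by ring.
  rewrite ler_wpM2l ?(ltW A0)//.
  rewrite -[cexp x y - 1](subrK (x +i* y)%C) (le_trans (cmodD _ _))//.
  have : e1 * n <= 1 * n by rewrite ler_wpM2r.
  lra.
have k2 : cmod k < d2.
  apply: le_lt_trans k1 _.
  rewrite -ltr_pdivlMl ?mulr_gt0//.
  have -> : (2 * A)^-1 * d2 = d2 / (4 * A) + d2 / (4 * A) by field; exact: lt0r_neq0.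
  by rewrite ltrD.
have H2 := h2 _ k2.
rewrite kE (_ : _ - _ - _ = (F (cexp s t + k) - F (cexp s t) - L * k) +
   L * (cexp s t * (cexp x y - 1 - (x +i* y)%C))); last by rewrite /k; ring.
apply: le_trans (cmodD _ _) _; rewrite cmodM cmodM cmod_cexp -/A.
apply: le_trans (lerD H2 (ler_wpM2l (cmod_ge0 L) (ler_wpM2l (ltW A0) H1))) _.
have T1 : e2 * cmod k <= e / 2 * n.
  apply: le_trans (ler_wpM2l (ltW e20) k1) _; rewrite /e2.
  have -> : e / (4 * A) * (2 * A * n) = e / 2 * n by field; exact: lt0r_neq0.
  exact: lexx.
have T2 : cmod L * (A * (e1 * n)) <= e / 2 * n.
  rewrite !mulrA ler_wpM2r//.
  have l0 : 0 <= cmod L * A by rewrite mulr_ge0 ?cmod_ge0// ltW.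
  apply: le_trans (_ : (cmod L * A + 1) * (e / (2 * (cmod L * A + 1))) <= _).
    apply: ler_pM => //; [exact: ltW|by rewrite lerDl|by rewrite ge_min lexx orbT].
  by rewrite le_eqVlt; apply/orP; left; apply/eqP; field; exact: lt0r_neq0.
lra.
Qed.

(** [Im F ds + Re F dt] is the imaginary part of [F(exp zeta) d zeta], hence closed. On the
    rectangle the sides [t = 0] and [t = 2 pi] cancel by periodicity; the other two are the circle
    integrals. *)
Lemma circle_mean_const_re F : (forall z, 0 < cmod z < 1 -> exists L, cderiv F z L) ->
  forall s1 s2, s1 < s2 -> s2 < 0 ->
  Rint 0 (2 * pi) (fun t => complex.Re (F (cexp s1 t))) =
  Rint 0 (2 * pi) (fun t => complex.Re (F (cexp s2 t))).
Proof.
move=> dF s1 s2 s12 s20.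
have pi2 : 0 < 2 * pi :> R by rewrite mulr_gt0// pi_gt0.
have := @green_boundary0 R (fun s t => complex.Im (F (cexp s t)))
  (fun s t => complex.Re (F (cexp s t))) s1 s2 0 (2 * pi) s12 pi2 _.
have -> : (fun s => complex.Im (F (cexp s (2 * pi)))) = (fun s => complex.Im (F (cexp s 0))).
  by apply/funext => s; rewrite !cexpE cis_2pi cis0.
rewrite subrr add0r => H; apply/esym/eqP; rewrite -subr_eq0; apply/eqP; apply: H.
move=> s t; rewrite in_itv /= => /andP[_ ss2] _.
have [|L hL] := dF (cexp s t).
  by rewrite cmod_cexp expR_gt0 expR_lt1; lra.
have hM := polar_expansion hL; move: (L * cexp s t) hM => M hM.
(* The composite has slope [M] along [s] and [i M] along [t], so the common coefficient [be] is
   [Re M]. *)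
exists (complex.Im M), (complex.Re M), (- complex.Im M) => e /hM[d d0 hd].
exists d => // s' t' _ _ hs ht; have := hd s' t' hs ht.
set z := F (cexp s' t'); set w := F (cexp s t) => le.
split.
  apply: le_trans le; apply: le_trans (cmod_Im _); rewrite le_eqVlt; apply/orP; left.
  by apply/eqP; congr (`|_|); case: z; case: w; case: M {hM hd} => a b c d' f g /=; ring.
apply: le_trans le; apply: le_trans (cmod_Re _); rewrite le_eqVlt; apply/orP; left.
by apply/eqP; congr (`|_|); case: z; case: w; case: M {hM hd} => a b c d' f g /=; ring.
Qed.

End PolarCoordinates.

Section Conjugation.
Context {R : realType}.
Implicit Types z w : R[i].
Lemma conjM z w : (z * w)^*%C = z^*%C * w^*%C. Proof. exact: rmorphM. Qed.
Lemma conjX z n : (z ^+ n)^*%C = z^*%C ^+ n. Proof. exact: rmorphXn. Qed.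
Lemma conj_sum (I : Type) (s : seq I) (P : pred I) (F : I -> R[i]) :
  (\sum_(i <- s | P i) F i)^*%C = \sum_(i <- s | P i) (F i)^*%C.
Proof. exact: rmorph_sum. Qed.
End Conjugation.

(** * Complex integrals over the circle *)

Section CircleIntegral.
Context {R : realType}.
Local Notation C := R[i].
Implicit Types (h k : R -> C) (t : R).

Lemma contitvD a b (f g : R -> R) : contitv a b f -> contitv a b g ->
  contitv a b (fun x => f x + g x).
Proof. by move=> cf cg x; apply: cvgD; [exact: cf|exact: cg]. Qed.

Lemma contitvZ a b c (f : R -> R) : contitv a b f -> contitv a b (fun x => c * f x).
Proof. by move=> cf x; apply: cvgM; [exact: cvg_cst|exact: cf]. Qed.

Lemma RintD a b (f g : R -> R) : contitv a b f -> contitv a b g ->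
  Rint a b (fun x => f x + g x) = Rint a b f + Rint a b g.
Proof. by move=> cf cg; rewrite /Rint RintegralD//; exact: contitv_integrable. Qed.

Lemma RintZ a b c (f : R -> R) : contitv a b f ->
  Rint a b (fun x => c * f x) = c * Rint a b f.
Proof. by move=> cf; rewrite /Rint RintegralZl//; exact: contitv_integrable. Qed.

Lemma Rint_norm_le a b (f w : R -> R) : contitv a b f -> contitv a b w ->
  (forall x, `|f x| <= w x) -> `|Rint a b f| <= Rint a b w.
Proof.
move=> cf cw fw; rewrite ler_norml; apply/andP; split.
  rewrite -mulN1r -RintZ//; apply: Rint_le => //; first exact: contitvZ.
  by move=> x _; have := fw x; rewrite mulN1r ler_norml => /andP[].
by apply: Rint_le => // x _; have := fw x; rewrite ler_norml => /andP[].
Qed.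

Definition ccont h := forall t (e : R), 0 < e -> exists2 d : R, 0 < d &
  forall t', `|t' - t| < d -> cmod (h t' - h t) < e.

Lemma ccont_cst (c : C) : ccont (fun=> c).
Proof. by move=> t e e0; exists 1 => // t' _; rewrite subrr cmod0. Qed.

Lemma ccontD h k : ccont h -> ccont k -> ccont (fun t => h t + k t).
Proof.
move=> ch ck t e e0; have e2 : 0 < e / 2 by lra.
have [d1 d10 h1] := ch t _ e2; have [d2 d20 h2] := ck t _ e2.
exists (Num.min d1 d2); first by rewrite lt_min d10.
move=> t'; rewrite lt_min => /andP[/h1 l1 /h2 l2].
by rewrite opprD addrACA (le_lt_trans (cmodD _ _))// [e]splitr ltrD.
Qed.

Lemma ccontM h k : ccont h -> ccont k -> ccont (fun t => h t * k t).
Proof.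
move=> ch ck t e e0.
pose A := cmod (h t) + 1; pose B := cmod (k t) + 1.
have A0 : 0 < A by rewrite ltr_wpDl ?cmod_ge0.
have B0 : 0 < B by rewrite ltr_wpDl ?cmod_ge0.
have eB : 0 < Num.min 1 (e / 2 / B) by rewrite lt_min ltr01 divr_gt0// divr_gt0.
have eA : 0 < e / 2 / A by rewrite divr_gt0// divr_gt0.
have [d1 d10 h1] := ch t _ eB; have [d2 d20 h2] := ck t _ eA.
exists (Num.min d1 d2); first by rewrite lt_min d10.
move=> t'; rewrite lt_min => /andP[/h1 + /h2 l2]; rewrite lt_min => /andP[l0 l1].
have -> : h t' * k t' - h t * k t = h t' * (k t' - k t) + (h t' - h t) * k t by ring.
have ht' : cmod (h t') <= A.
  by have := cmod_lower (h t') (h t); rewrite /A; lra.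
apply: le_lt_trans (cmodD _ _) _; rewrite !cmodM [e]splitr; apply: ltr_leD.
  apply: le_lt_trans (ler_wpM2r (cmod_ge0 _) ht') _.
  by rewrite mulrC -ltr_pdivlMr.
apply: le_trans (_ : e / 2 / B * B <= _); last by rewrite divfK// lt0r_neq0.
by apply: ler_pM; rewrite ?cmod_ge0// ?ltW// /B ltrDl.
Qed.

Lemma ccontX h n : ccont h -> ccont (fun t => h t ^+ n).
Proof.
move=> ch; elim: n => [|n IH]; first exact: ccont_cst.
under [X in ccont X]eq_fun do rewrite exprS.
exact: ccontM.
Qed.

Lemma ccontJ h : ccont h -> ccont (fun t => (h t)^*%C).
Proof.
move=> ch t e /(ch t)[d d0 hd]; exists d => // t' /hd.
by rewrite -rmorphB /= cmodJ.
Qed.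

Lemma ccont_sum (I : Type) (s : seq I) (F : I -> R -> C) :
  (forall i, ccont (F i)) -> ccont (fun t => \sum_(i <- s) F i t).
Proof.
move=> cF; elim: s => [|i s IH].
  by under [X in ccont X]eq_fun do rewrite big_nil; exact: ccont_cst.
by under [X in ccont X]eq_fun do rewrite big_cons; exact: ccontD.
Qed.

Lemma ccont_cis : ccont (@cis R).
Proof.
move=> t e e0; have e2 : 0 < e / 2 by lra.
have /cvgrPdist_lt/(_ _ e2)/nbhs_ballP[d1 /= d10 h1] := @continuous_cos R t.
have /cvgrPdist_lt/(_ _ e2)/nbhs_ballP[d2 /= d20 h2] := @continuous_sin R t.
exists (Num.min d1 d2); first by rewrite lt_min d10.
move=> t'; rewrite lt_min => /andP[l1 l2].
apply: le_lt_trans (cmod_ReIm _) _; rewrite [e]splitr /= ltrD//.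
  by rewrite distrC; apply: h1; rewrite /ball /= distrC.
by rewrite distrC; apply: h2; rewrite /ball /= distrC.
Qed.

Lemma ccont_Re h a b : ccont h -> contitv a b (fun t => complex.Re (h t)).
Proof.
move=> ch; apply/contitvP => t _ e /(ch t)[d d0 hd]; exists d => // t' _ /hd.
by rewrite -ReB; apply: le_lt_trans; exact: cmod_Re.
Qed.

Lemma ccont_Im h a b : ccont h -> contitv a b (fun t => complex.Im (h t)).
Proof.
move=> ch; apply/contitvP => t _ e /(ch t)[d d0 hd]; exists d => // t' _ /hd.
apply: le_lt_trans; apply: le_trans (cmod_Im _).
by case: (h t); case: (h t').
Qed.

Definition circ h : C :=
  (Rint 0 (2 * pi) (fun t => complex.Re (h t)) +i*
   Rint 0 (2 * pi) (fun t => complex.Im (h t)))%C.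

Let pi2 : 0 <= 2 * pi :> R. Proof. by rewrite mulr_ge0// pi_ge0. Qed.

Lemma circD h k : ccont h -> ccont k -> circ (fun t => h t + k t) = circ h + circ k.
Proof.
move=> ch ck; apply/eqP; rewrite eq_complex /=; apply/andP; split; apply/eqP.
  rewrite -RintD; try exact: ccont_Re.
  by congr Rint; apply/funext => t; case: (h t); case: (k t).
rewrite -RintD; try exact: ccont_Im.
by congr Rint; apply/funext => t; case: (h t); case: (k t).
Qed.

Lemma circZ c h : ccont h -> circ (fun t => c * h t) = c * circ h.
Proof.
move=> ch; case: c => a b; apply/eqP; rewrite eq_complex /=; apply/andP; split; apply/eqP.
  rewrite -!RintZ; try exact: ccont_Im; try exact: ccont_Re.
  rewrite -RintB; try (apply: contitvZ; by [exact: ccont_Im|exact: ccont_Re]).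
  by congr Rint; apply/funext => t; case: (h t).
rewrite -!RintZ; try exact: ccont_Im; try exact: ccont_Re.
rewrite -RintD; try (apply: contitvZ; by [exact: ccont_Im|exact: ccont_Re]).
by congr Rint; apply/funext => t; case: (h t) => x y /=; rewrite addrC.
Qed.

Lemma circ_cst c : circ (fun=> c) = (2 * pi)%:C%C * c.
Proof.
rewrite /circ !Rint_cst// subr0; case: c => a b /=.
by apply/eqP; rewrite eq_complex /= !mul0r subr0 addr0 !eqxx.
Qed.

Lemma circ_sum (I : Type) (s : seq I) (F : I -> R -> C) :
  (forall i, ccont (F i)) -> circ (fun t => \sum_(i <- s) F i t) = \sum_(i <- s) circ (F i).
Proof.
move=> cF; elim: s => [|i s IH].
  rewrite big_nil; under [X in circ X]eq_fun do rewrite big_nil.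
  by rewrite circ_cst mulr0.
rewrite big_cons -IH -circD//; last exact: ccont_sum.
by congr circ; apply/funext => t; rewrite big_cons.
Qed.

Lemma circJ h : ccont h -> circ (fun t => (h t)^*%C) = (circ h)^*%C.
Proof.
move=> ch; apply/eqP; rewrite eq_complex /=; apply/andP; split; apply/eqP.
  by congr Rint; apply/funext => t; case: (h t).
rewrite -mulN1r -RintZ; last exact: ccont_Im.
by congr Rint; apply/funext => t; case: (h t) => a b; rewrite mulN1r.
Qed.

(** The factor 2 comes from bounding real and imaginary parts separately. *)
Lemma circ_bound h (w : R -> R) : ccont h -> contitv 0 (2 * pi) w ->
  (forall t, cmod (h t) <= w t) -> cmod (circ h) <= 2 * Rint 0 (2 * pi) w.
Proof.
move=> ch cw hw; apply: le_trans (cmod_ReIm _) _; rewrite mulr_natl mulr2n /=.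
apply: lerD; apply: Rint_norm_le => //.
- exact: ccont_Re.
- by move=> t; exact: le_trans (cmod_Re _) (hw t).
- exact: ccont_Im.
- by move=> t; exact: le_trans (cmod_Im _) (hw t).
Qed.

End CircleIntegral.

(** * Taylor coefficients as circle integrals *)

Section Fourier.
Context {R : realType}.
Local Notation C := R[i].
Implicit Types (t r : R).

(** For [f] holomorphic this is [2 pi] times the [k]-th Taylor coefficient at 0; the radius [1 / 2]
    is an arbitrary choice, by [fourier_neg]. *)
Definition fourier_coef (f : C -> C) k : C :=
  2 ^+ k * circ (fun t => f ((1 / 2)%:C%C * cis t) * (cis t)^*%C ^+ k).

Let pi2 : 0 <= 2 * pi :> R. Proof. by rewrite mulr_ge0// pi_ge0. Qed.

Lemma cderivZ (c : C) F (z L : C) : cderiv F z L -> cderiv (fun z => c * F z) z (c * L).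
Proof.
move=> hF e e0; have c0 : 0 < cmod c + 1 by rewrite ltr_wpDl ?cmod_ge0.
have [d d0 hd] := hF _ (divr_gt0 e0 c0); exists d => // h /hd le.
have -> : c * F (z + h) - c * F z - c * L * h = c * (F (z + h) - F z - L * h) by ring.
rewrite cmodM; apply: le_trans (_ : (cmod c + 1) * (e / (cmod c + 1) * cmod h) <= _).
  by apply: ler_pM => //; rewrite ?cmod_ge0// lerDl.
by rewrite mulrA [_ * (e / _)]mulrC divfK// lt0r_neq0.
Qed.

Lemma cderiv_cont F (z L : C) : cderiv F z L -> forall e : R, 0 < e -> exists2 d : R, 0 < d &
  forall w, cmod (w - z) < d -> cmod (F w - F z) < e.
Proof.
move=> /(_ 1 ltr01)[d d0 hd] e e0.
have L0 : 0 < cmod L + 2 by rewrite ltr_wpDl ?cmod_ge0.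
exists (Num.min d (e / (cmod L + 2))); first by rewrite lt_min d0 divr_gt0.
move=> w; rewrite lt_min => /andP[/hd + we]; rewrite [z + _]addrC subrK mul1r => le.
rewrite -[F w - F z](subrK (L * (w - z))).
apply: le_lt_trans (cmodD _ _) _; rewrite cmodM.
rewrite ltr_pdivlMr// in we; apply: le_lt_trans _ we.
have := cmod_ge0 (w - z); set n := cmod (w - z) in le *; set m := cmod _ in le *.
by rewrite mulrDr [n * cmod L]mulrC; lra.
Qed.

Lemma cderivM F G (z L K : C) : cderiv F z L -> cderiv G z K ->
  cderiv (fun z => F z * G z) z (L * G z + F z * K).
Proof.
move=> hF hG e e0; pose A := cmod L + cmod (F z) + cmod (G z) + 1.
have A0 : 0 < A by rewrite /A ltr_wpDl// !addr_ge0 ?cmod_ge0.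
have e3 : 0 < e / 3 / A by rewrite divr_gt0// divr_gt0.
have m0 : 0 < Num.min 1 (e / 3 / A) by rewrite lt_min ltr01.
have [d1 d10 h1] := hF _ e3; have [d2 d20 h2] := hG _ e3.
have [d3 d30 h3] := cderiv_cont hG m0.
exists (Num.min d1 (Num.min d2 d3)); first by rewrite !lt_min d10 d20.
move=> h; rewrite !lt_min => /and3P[/h1 l1 /h2 l2 hd3].
have := h3 (z + h); rewrite addrAC subrr add0r => /(_ hd3); rewrite lt_min => /andP[l3 l4].
have -> : F (z + h) * G (z + h) - F z * G z - (L * G z + F z * K) * h =
  (F (z + h) - F z - L * h) * G (z + h) + L * h * (G (z + h) - G z) +
  F z * (G (z + h) - G z - K * h) by ring.
have hG1 : cmod (G (z + h)) <= A.
  have := cmod_lower (G (z + h)) (G z); have := cmod_ge0 L; have := cmod_ge0 (F z).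
  by rewrite /A; lra.
have hL : cmod L <= A.
  by have := cmod_ge0 (G z); have := cmod_ge0 (F z); rewrite /A; lra.
have hFz : cmod (F z) <= A.
  by have := cmod_ge0 (G z); have := cmod_ge0 L; rewrite /A; lra.
have c0 := cmod_ge0 h.
have t1 : cmod ((F (z + h) - F z - L * h) * G (z + h)) <= e / 3 * cmod h.
  rewrite cmodM; apply: le_trans (ler_pM (cmod_ge0 _) (cmod_ge0 _) l1 hG1) _.
  by rewrite mulrAC divfK// lt0r_neq0.
have t2 : cmod (L * h * (G (z + h) - G z)) <= e / 3 * cmod h.
  rewrite !cmodM mulrAC ler_wpM2r//.
  apply: le_trans (ler_pM (cmod_ge0 _) (cmod_ge0 _) hL (ltW l4)) _.
  by rewrite mulrC divfK// lt0r_neq0.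
have t3 : cmod (F z * (G (z + h) - G z - K * h)) <= e / 3 * cmod h.
  rewrite cmodM; apply: le_trans (ler_pM (cmod_ge0 _) (cmod_ge0 _) hFz l2) _.
  by rewrite mulrA [A * _]mulrC divfK// lt0r_neq0.
apply: le_trans (cmodD _ _) _; apply: le_trans (lerD (cmodD _ _) t3) _.
have -> : e * cmod h = e / 3 * cmod h + e / 3 * cmod h + e / 3 * cmod h by field.
by rewrite lerD2r lerD.
Qed.

Lemma cderiv_id (z : C) : cderiv id z 1.
Proof.
move=> e e0; exists 1 => // h _.
by rewrite mul1r [z + h]addrC addrK subrr cmod0 mulr_ge0 ?cmod_ge0// ltW.
Qed.

Lemma cderiv_cst (c z : C) : cderiv (fun=> c) z 0.
Proof.
move=> e e0; exists 1 => // h _.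
by rewrite mul0r subrr subr0 cmod0 mulr_ge0 ?cmod_ge0// ltW.
Qed.

Lemma cderivX F (z L : C) k : cderiv F z L -> exists K, cderiv (fun z => F z ^+ k) z K.
Proof.
move=> hF; elim: k => [|k [K hK]]; first by exists 0; exact: cderiv_cst.
exists (L * F z ^+ k + F z * K).
rewrite (_ : (fun _ => _) = (fun z => F z * F z ^+ k)); first exact: cderivM.
by apply/funext => w; rewrite exprS.
Qed.

Lemma cderivV (z : C) : z != 0 -> cderiv (fun z => z^-1) z (- z ^- 2).
Proof.
move=> z0 e e0; have zp := cmod_gt0 z0.
have z3 : 0 < cmod z ^+ 3 / 2 by rewrite divr_gt0// exprn_gt0.
exists (Num.min (cmod z / 2) (e * (cmod z ^+ 3 / 2))).
  by rewrite lt_min divr_gt0//= mulr_gt0.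
move=> h; rewrite lt_min => /andP[hz he].
have zh : cmod z / 2 <= cmod (z + h).
  by have := cmod_lower z (- h); rewrite cmodN opprK; lra.
have zh0 : z + h != 0.
  by apply: contraTneq zh => ->; rewrite cmod0 -ltNge divr_gt0.
have -> : (z + h)^-1 - z^-1 - - z ^- 2 * h = h ^+ 2 / (z ^+ 2 * (z + h)).
  by field; rewrite z0 zh0.
rewrite cmodM cmodV cmodM !cmodX expr2 -mulrA mulrC ler_wpM2r ?cmod_ge0//.
have P : 0 < cmod z ^+ 2 * cmod (z + h) by rewrite mulr_gt0 ?exprn_gt0 ?cmod_gt0.
rewrite ler_pdivrMr//; apply: le_trans (ltW he) _; rewrite ler_wpM2l ?(ltW e0)//.
by rewrite exprSr -mulrA ler_wpM2l ?sqr_ge0.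
Qed.

Lemma cmod_rcis r t : 0 <= r -> cmod (r%:C%C * cis t) = r.
Proof. by move=> r0; rewrite cmodM cmod_cis mulr1 cmod_real ger0_norm. Qed.

Lemma ccont_circle (F : C -> C) r : 0 <= r ->
  (forall z, cmod z = r -> exists L, cderiv F z L) -> ccont (fun t => F (r%:C%C * cis t)).
Proof.
move=> r0 dF t e e0; have [L /cderiv_cont /(_ e e0)[d d0 hd]] := dF _ (cmod_rcis t r0).
have r1 : 0 < r + 1 by rewrite ltr_wpDl.
have [d' d'0 hd'] := ccont_cis t (divr_gt0 d0 r1); exists d' => // t' /hd' le.
apply: hd; rewrite -mulrBr cmodM cmod_real ger0_norm//.
rewrite ltr_pdivlMr// in le; apply: le_lt_trans _ le.
by rewrite mulrC ler_wpM2l ?cmod_ge0// lerDl.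
Qed.

(** Differentiability is asked on the punctured disk only, which admits the functions
    [f z * z^-1 ^+ k] of [fourier_neg]. The imaginary part is the real part for [- i F]. *)
Lemma circle_mean_const F : (forall z, 0 < cmod z < 1 -> exists L, cderiv F z L) ->
  forall r1 r2, 0 < r1 < 1 -> 0 < r2 < 1 ->
  circ (fun t => F (r1%:C%C * cis t)) = circ (fun t => F (r2%:C%C * cis t)).
Proof.
move=> dF.
suff H r1 r2 : 0 < r1 < r2 -> r2 < 1 ->
    circ (fun t => F (r1%:C%C * cis t)) = circ (fun t => F (r2%:C%C * cis t)).
  move=> r1 r2 /andP[r10 r11] /andP[r20 r21]; have [lt|lt|->//] := ltgtP r1 r2.
    by apply: H => //; apply/andP.
  by apply/esym/H => //; apply/andP.
move=> /andP[r10 r12] r21; have r20 := lt_trans r10 r12.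
have E r : 0 < r -> (fun t => F (r%:C%C * cis t)) = (fun t => F (cexp (ln r) t)).
  by move=> r0; apply/funext => t; rewrite cexpE lnK.
rewrite (E _ r10) (E _ r20).
have l1 : ln r1 < ln r2 by rewrite ltr_ln.
have l2 : ln r2 < 0 by rewrite ln_lt0// r20.
apply/eqP; rewrite eq_complex /=; apply/andP; split; apply/eqP.
  exact: circle_mean_const_re.
have dF' z : 0 < cmod z < 1 -> exists L, cderiv (fun z => - 'i%C * F z) z L.
  by move=> /dF[L hL]; exists (- 'i%C * L); exact: cderivZ.
have := circle_mean_const_re dF' l1 l2.
have E' s : (fun t => complex.Re (- 'i%C * F (cexp s t))) = (fun t => complex.Im (F (cexp s t))).
  by apply/funext => t; case: (F _) => a b /=; ring.
by rewrite !E'.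
Qed.

Variables (f : C^o -> C^o) (M : R).
Hypothesis df : forall z : C^o, cmod z < 1 -> derivable f z 1.
Hypothesis fM : forall z : C, cmod z < 1 -> cmod (f z) <= M.

Let fcont r : 0 <= r < 1 -> ccont (fun t => f (r%:C%C * cis t)).
Proof.
move=> /andP[r0 r1]; apply: ccont_circle => // z zr.
by apply: derivable_cderiv; apply: df; rewrite zr.
Qed.

Let cont_pos r k : 0 <= r < 1 -> ccont (fun t => f (r%:C%C * cis t) * cis t ^+ k).
Proof. by move=> r1; apply: ccontM; [exact: fcont|exact/ccontX/ccont_cis]. Qed.

Let cont_neg r k : 0 <= r < 1 -> ccont (fun t => f (r%:C%C * cis t) * (cis t)^*%C ^+ k).
Proof. by move=> r1; apply: ccontM; [exact: fcont|exact/ccontX/ccontJ/ccont_cis]. Qed.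

(** The circle integral of [f z * z ^+ k] does not depend on the radius [q] and is [O(q^k)] as [q]
    tends to 0. *)
Lemma fourier_pos k r : (0 < k)%N -> 0 < r < 1 ->
  circ (fun t => f (r%:C%C * cis t) * cis t ^+ k) = 0.
Proof.
move=> k0 r01; have /andP[r0 r1] := r01.
have dF (z : C) : 0 < cmod z < 1 -> exists L, cderiv (fun z => f z * z ^+ k) z L.
  move=> /andP[_ z1]; have [L hL] := derivable_cderiv (df z1).
  have [K hK] := cderivX k (cderiv_id z).
  by exists (L * z ^+ k + f z * K); exact: (@cderivM f (fun z => z ^+ k)).
have const := circle_mean_const dF.
have E q : 0 < q < 1 -> circ (fun t => f (q%:C%C * cis t) * (q%:C%C * cis t) ^+ k) =
    (q ^+ k)%:C%C * circ (fun t => f (q%:C%C * cis t) * cis t ^+ k).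
  move=> /andP[q0 q1]; rewrite -circZ; last by apply: cont_pos; rewrite (ltW q0).
  by congr circ; apply/funext => t; rewrite exprMn rmorphXn mulrCA.
pose B := 2 * ((2 * pi) * M).
have bd q : 0 < q < 1 -> cmod (circ (fun t => f (q%:C%C * cis t) * cis t ^+ k)) <= B.
  move=> /andP[q0 q1]; rewrite /B -[2 * pi]subr0 -Rint_cst//; apply: circ_bound.
  - by apply: cont_pos; rewrite ltW.
  - exact: contitv_cst.
  - by move=> t; rewrite cmodM cmodX cmod_cis expr1n mulr1; apply: fM; rewrite cmod_rcis// ltW.
set x := circ _; suff : cmod x * r ^+ k <= 0.
  rewrite pmulr_lle0 ?exprn_gt0// => x0; apply: cmod_eq0; apply/eqP.
  by rewrite eq_le x0 cmod_ge0.
apply/ler_addgt0Pr => e e0; rewrite add0r.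
have B1 : 0 < `|B| + 1 by rewrite ltr_wpDl.
pose q := Num.min (1 / 2) (e / (`|B| + 1)).
have q0 : 0 < q by rewrite lt_min !divr_gt0.
have q1 : q < 1 by rewrite gt_min; apply/orP; left; lra.
have q01 : 0 < q < 1 by rewrite q0.
have := etrans (esym (E _ r01)) (etrans (const _ _ r01 q01) (E _ q01)) => /(congr1 cmod); rewrite !cmodM !cmod_real.
rewrite (ger0_norm (exprn_ge0 _ (ltW r0))) (ger0_norm (exprn_ge0 _ (ltW q0))) -/x mulrC => ->.
apply: le_trans (_ : q * (`|B| + 1) <= _).
  apply: ler_pM; [exact: exprn_ge0 (ltW q0)|exact: cmod_ge0| |].
    by rewrite -(prednK k0) exprS ler_piMr ?exprn_ile1 ?(ltW q0) ?(ltW q1).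
  by apply: le_trans (bd _ q01) _; apply: le_trans (ler_norm _) _; rewrite lerDl.
by rewrite -ler_pdivlMr// ge_min lexx orbT.
Qed.

Local Notation A := (fourier_coef f).

(** The circle integral of [f z * z^-1 ^+ k] does not depend on the radius; at radius [1 / 2] it is
    [fourier_coef] by definition. *)
Lemma fourier_neg k r : 0 < r < 1 ->
  circ (fun t => f (r%:C%C * cis t) * (cis t)^*%C ^+ k) = (r ^+ k)%:C%C * A k.
Proof.
move=> r01.
have dF (z : C) : 0 < cmod z < 1 -> exists L, cderiv (fun z => f z * (z^-1) ^+ k) z L.
  move=> /andP[z0 z1]; have [L hL] := derivable_cderiv (df z1).
  have zn : z != 0 by apply: contraTneq z0 => ->; rewrite cmod0 ltxx.
  have [K hK] := cderivX k (cderivV zn).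
  by exists (L * z^-1 ^+ k + f z * K); exact: (@cderivM f (fun z => z^-1 ^+ k)).
have const := circle_mean_const dF.
have E q : 0 < q < 1 -> circ (fun t => f (q%:C%C * cis t) * (q%:C%C * cis t)^-1 ^+ k) =
    (q ^- k)%:C%C * circ (fun t => f (q%:C%C * cis t) * (cis t)^*%C ^+ k).
  move=> /andP[q0 q1]; rewrite -circZ; last by apply: cont_neg; rewrite (ltW q0).
  congr circ; apply/funext => t; rewrite -exprVn rmorphXn fmorphV /= mulrCA -exprMn.
  congr (_ * _ ^+ _); rewrite invfM; congr (_ * _).
  have c0 : cis t != 0 by apply/eqP => c0; have := cmod_cis t; rewrite c0 cmod0 => /eqP; rewrite eq_sym oner_eq0.
  by apply: (mulfI c0); rewrite cisNK divff.
have h01 : 0 < (1 / 2 : R) < 1 by apply/andP; split; lra.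
have H := etrans (esym (E _ r01)) (etrans (const _ _ r01 h01) (E _ h01)).
have rk : r ^+ k != 0 by have /andP[r0 _] := r01; rewrite expf_neq0// lt0r_neq0.
have rk' : (r ^+ k)%:C%C != 0 :> C by rewrite fmorph_eq0.
apply: (mulfI (invr_neq0 rk')); rewrite mulKf// -fmorphV H /fourier_coef; congr (_ * _).
by rewrite div1r -exprVn invrK rmorphXn rmorph_nat.
Qed.

(** Cesaro mean of Taylor polynomials: the index [k] occurs for [N - k] pairs [(m, n)]. The division
    by [2 pi] offsets the normalization of [fourier_coef]. *)
Definition fejer N : {poly C} := (N%:R * (2 * pi)%:C%C)^-1 *:
  \sum_(m < N) \sum_(n < N) (if (n <= m)%N then A (m - n) *: 'X^(m - n) else 0).

End Fourier.

(** * Fejer kernel and polynomial approximation in the disk algebra *)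

Section FejerConvergence.
Context {R : realType}.
Local Notation C := R[i].
Implicit Types (t r : R).

Let pi2 : 0 < 2 * pi :> R. Proof. by rewrite mulr_gt0// pi_gt0. Qed.

(** Its squared modulus is [N] times the Fejer kernel at [th - t]; the geometric form makes its
    product with [cis th * (cis t)^*%C - 1] telescope. *)
Definition dirichlet N (th t : R) : C := \sum_(m < N) (cis th * (cis t)^*%C) ^+ m.

Lemma ccont_dirichlet N th : ccont (dirichlet N th).
Proof.
apply: ccont_sum => m; apply: ccontX; apply: ccontM; first exact: ccont_cst.
exact/ccontJ/ccont_cis.
Qed.

Lemma cis_pow_conj (a b : C) m n : a * b = 1 ->
  b ^+ m * a ^+ n = if (n <= m)%N then b ^+ (m - n) else a ^+ (n - m).
Proof.
move=> ab; case: leqP => mn.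
  by rewrite -{1}(subnK mn) exprD -mulrA -exprMn mulrC mulrC [b * a]mulrC ab expr1n mulr1.
by rewrite -{1}(subnK (ltnW mn)) exprD mulrCA -exprMn [b * a]mulrC ab expr1n mulr1.
Qed.

Lemma circ_dirichlet (F : R -> C) N th : ccont F ->
  circ (fun t => F t * (dirichlet N th t * (dirichlet N th t)^*%C)) =
  \sum_(m < N) \sum_(n < N) if (n <= m)%N
    then cis th ^+ (m - n) * circ (fun t => F t * (cis t)^*%C ^+ (m - n))
    else (cis th)^*%C ^+ (n - m) * circ (fun t => F t * cis t ^+ (n - m)).
Proof.
move=> cF.
have cp k : ccont (fun t => F t * cis t ^+ k) by apply: ccontM => //; exact/ccontX/ccont_cis.
have cn k : ccont (fun t => F t * (cis t)^*%C ^+ k) by apply: ccontM => //; exact/ccontX/ccontJ/ccont_cis.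
pose G (m n : 'I_N) := if (n <= m)%N
    then fun t => cis th ^+ (m - n) * (F t * (cis t)^*%C ^+ (m - n))
    else fun t => (cis th)^*%C ^+ (n - m) * (F t * cis t ^+ (n - m)).
have cG m n : ccont (G m n).
  by rewrite /G; case: leqP => _; apply: ccontM => //; exact: ccont_cst.
transitivity (circ (fun t => \sum_(m < N) \sum_(n < N) G m n t)).
  congr circ; apply/funext => t; rewrite /dirichlet mulr_suml mulr_sumr.
  apply: eq_bigr => m _; rewrite conj_sum !mulr_sumr; apply: eq_bigr => n _.
  rewrite conjX conjM conjcK !exprMn.
  have -> : cis th ^+ m * (cis t)^*%C ^+ m * ((cis th)^*%C ^+ n * cis t ^+ n) =
    ((cis th)^*%C ^+ n * cis th ^+ m) * ((cis t)^*%C ^+ m * cis t ^+ n) by ring.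
  rewrite (cis_pow_conj _ _ (cisNK t)) (cis_pow_conj _ _ (cisNK th)).
  rewrite /G; case: ltngtP => [mn|mn|->]; rewrite ?subnn ?expr0 ?mulr1 ?mul1r//; ring.
rewrite circ_sum; last by move=> m; exact: ccont_sum.
apply: eq_bigr => m _; rewrite circ_sum//; apply: eq_bigr => n _.
by rewrite /G; case: leqP => _; rewrite circZ.
Qed.

Lemma circ_cis k : (0 < k)%N -> circ (fun t : R => cis t ^+ k) = 0.
Proof.
move=> k0; have := @fourier_pos R (fun=> 1) 1 _ _ k (1 / 2) k0.
under [X in circ X]eq_fun do rewrite mul1r.
apply=> [z _|z _|]; [exact: derivable_cst|by rewrite cmod1|].
by apply/andP; split; lra.
Qed.

(** Only the [N] diagonal terms of the expanded square survive integration. *)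
Lemma fejer_mass N th :
  Rint 0 (2 * pi) (fun t => cmod (dirichlet N th t) ^+ 2) = N%:R * (2 * pi).
Proof.
have := circ_dirichlet N th (ccont_cst (1 : C)).
rewrite (eq_bigr (fun=> (2 * pi)%:C%C)); last first.
  move=> m _; rewrite (bigD1 m)// leqnn subnn expr0 mul1r big1 ?addr0.
    rewrite [LHS]addr0 (_ : (fun _ => _) = (fun=> 1)) ?circ_cst ?mulr1//.
    by apply/funext => t; rewrite mul1r.
  move=> n nm; have {}nm : nat_of_ord n != m by [].
  case: ltngtP nm => // mn _; under [X in circ X]eq_fun do rewrite mul1r.
    under [X in circ X]eq_fun do rewrite -conjX.
    by rewrite circJ ?circ_cis ?subn_gt0 ?conjc0 ?mulr0//; exact/ccontX/ccont_cis.
  by rewrite circ_cis ?mulr0// subn_gt0.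
rewrite sumr_const card_ord => /(congr1 (@complex.Re R)).
rewrite -[_ *+ N]mulr_natl -(rmorph_nat (real_complex R)) -rmorphM /= => <-.
by congr Rint; apply/funext => t; rewrite mul1r mulcJE.
Qed.

(** When the kernel is expanded, the terms with [m < n] vanish by [fourier_pos] and the others are
    Taylor coefficients by [fourier_neg]. *)
Lemma fejerE (f : C^o -> C^o) (M : R) N r th :
  (forall z : C^o, cmod z < 1 -> derivable f z 1) ->
  (forall z : C, cmod z < 1 -> cmod (f z) <= M) -> 0 < r < 1 ->
  circ (fun t => f (r%:C%C * cis t) * (dirichlet N th t * (dirichlet N th t)^*%C)) =
  (N%:R * (2 * pi)%:C%C) * (fejer f N).[r%:C%C * cis th].
Proof.
move=> df fM r01; have /andP[r0 r1] := r01.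
have [->|N0] := eqVneq N 0%N.
  rewrite mul0r mul0r; under [X in circ X]eq_fun do rewrite /dirichlet big_ord0 mul0r mulr0.
  by rewrite circ_cst mulr0.
rewrite circ_dirichlet; last first.
  apply: ccont_circle => [|z zr]; first exact: ltW.
  by apply: derivable_cderiv; apply: df; rewrite zr.
rewrite /fejer hornerZ mulrA divff ?mul1r; last first.
  by rewrite mulf_neq0 ?pnatr_eq0// fmorph_eq0 lt0r_neq0.
rewrite horner_sum; apply: eq_bigr => m _; rewrite horner_sum; apply: eq_bigr => n _.
case: leqP => mn; last by rewrite (fourier_pos df fM) ?mulr0 ?horner0// subn_gt0.
rewrite (fourier_neg df)// hornerZ hornerXn exprMn.
have -> : (r ^+ (m - n))%:C%C = r%:C%C ^+ (m - n) :> C by exact: rmorphXn.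
ring.
Qed.

(** The continuity hypothesis has a quadratic term because [|w - z|] times the Dirichlet sum is at
    most 2: this term contributes to the integral a quantity independent of [N], and division by the
    mass [2 pi N] leaves [O(1 / N)]. *)
Lemma fejer_bound (f : C^o -> C^o) (M e c : R) N r th :
  (forall z : C^o, cmod z < 1 -> derivable f z 1) ->
  (forall z : C, cmod z < 1 -> cmod (f z) <= M) -> 0 < r < 1 -> (0 < N)%N ->
  0 <= e -> 0 <= c ->
  (forall z w : C, cmod z < 1 -> cmod w < 1 -> cmod (f w - f z) <= e + c * cmod (w - z) ^+ 2) ->
  cmod ((fejer f N).[r%:C%C * cis th] - f (r%:C%C * cis th)) <= 2 * e + 8 * c / N%:R.
Proof.
move=> df fM r01 N0 e0 c0 uc; have /andP[r0 r1] := r01.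
set z := r%:C%C * cis th; pose D := dirichlet N th.
have cf : ccont (fun t => f (r%:C%C * cis t)).
  apply: ccont_circle => [|u ur]; first exact: ltW.
  by apply: derivable_cderiv; apply: df; rewrite ur.
have cD : ccont (fun t => D t * (D t)^*%C).
  by apply: ccontM; [|apply: ccontJ]; exact: ccont_dirichlet.
have NR : 0 < N%:R :> R by rewrite ltr0n.
have mass : circ (fun t => D t * (D t)^*%C) = N%:R * (2 * pi)%:C%C.
  rewrite -(rmorph_nat (real_complex R)) -rmorphM /= -(fejer_mass N th).
  apply/eqP; rewrite eq_complex /=; apply/andP; split; apply/eqP.
    by congr Rint; apply/funext => t; rewrite mulcJE.
  rewrite (_ : (fun _ => _) = (fun=> 0)).
    by rewrite Rint_cst ?mulr0// ltW.
  by apply/funext => t; rewrite mulcJE.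
have key : N%:R * (2 * pi)%:C%C * ((fejer f N).[z] - f z) =
   circ (fun t => (f (r%:C%C * cis t) - f z) * (D t * (D t)^*%C)).
  rewrite mulrBr -(fejerE N th df fM r01) -mass [_ * f z]mulrC -mulNr -circZ// -circD.
  - by congr circ; apply/funext => t; rewrite mulrBl mulNr.
  - exact: ccontM.
  - by apply: ccontM => //; exact: ccont_cst.
have cw : contitv 0 (2 * pi) (fun t => e * cmod (D t) ^+ 2 + c * 4).
  apply: contitvD; last exact: contitv_cst.
  apply: contitvZ; rewrite (_ : (fun _ => _) = (fun t => complex.Re (D t * (D t)^*%C))).
    exact: ccont_Re.
  by apply/funext => t; rewrite mulcJE.
have bd : cmod (circ (fun t => (f (r%:C%C * cis t) - f z) * (D t * (D t)^*%C))) <=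
   2 * Rint 0 (2 * pi) (fun t => e * cmod (D t) ^+ 2 + c * 4).
  apply: circ_bound => //.
    by apply: ccontM => //; apply: ccontD => //; exact: ccont_cst.
  move=> t; rewrite mulcJE cmodM cmod_real ger0_norm ?sqr_ge0//.
  apply: le_trans (ler_wpM2r (sqr_ge0 _) (uc z (r%:C%C * cis t) _ _)) _.
  - by rewrite cmod_rcis// ltW.
  - by rewrite cmod_rcis// ltW.
  rewrite mulrDl lerD2l -mulrA ler_wpM2l// -exprMn.
  rewrite (_ : 4 = 2 ^+ 2 :> R); last by ring.
  rewrite lerXn2r ?nnegrE ?mulr_ge0 ?cmod_ge0//.
  rewrite /z -mulrBr cmodM cmod_real gtr0_norm// -mulrA.
  pose u := cis th * (cis t)^*%C.
  have -> : cmod (cis t - cis th) = cmod (u - 1).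
    have -> : u - 1 = (cis th - cis t) * (cis t)^*%C by rewrite mulrBl cisNK.
    by rewrite cmodM cmodJ cmod_cis mulr1 cmodC.
  (* The Dirichlet sum times [u - 1] is [u ^+ N - 1], of modulus at most 2. *)
  rewrite -cmodM -subrX1; apply: le_trans (ler_piMl (cmod_ge0 _) (ltW r1)) _.
  apply: le_trans (cmodB _ _) _; rewrite cmodX cmodM cmodJ !cmod_cis mulr1 expr1n cmod1; lra.
move: bd; rewrite -key cmodM cmodM cmod_nat cmod_real gtr0_norm// RintD; last 2 first.
- apply: contitvZ; rewrite (_ : (fun _ => _) = (fun t => complex.Re (D t * (D t)^*%C))).
    exact: ccont_Re.
  by apply/funext => t; rewrite mulcJE.
- exact: contitv_cst.
rewrite RintZ; last first.
  rewrite (_ : (fun _ => _) = (fun t => complex.Re (D t * (D t)^*%C))).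
    exact: ccont_Re.
  by apply/funext => t; rewrite mulcJE.
rewrite fejer_mass Rint_cst ?(ltW pi2)// subr0 => bd.
rewrite -(ler_pM2l (mulr_gt0 NR pi2)); apply: le_trans bd _.
rewrite le_eqVlt; apply/orP; left; apply/eqP; field; exact: lt0r_neq0.
Qed.

(** The Fejer means of [f z = g (1 + z)] approximate [f] uniformly on the punctured open disk; the
    center and the boundary circle follow by continuity. *)
Theorem disk_algebra_approx (g : C^o -> C^o) : disk_algebra g ->
  forall e : R, 0 < e -> exists p : {poly C}, forall z, cdisk11 z -> cmod (p.[z] - g z) <= e.
Proof.
move=> [gc gd] e e0.
have [M M0 hM] := cdisk11_bounded gc.
have e4 : 0 < e / 8 by lra.
have [d d0 hd] := uniform_continuity compact_cdisk11 gc e4.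
pose f (z : C^o) : C^o := g (1 + z).
have sh (z : C) : cmod z <= 1 -> cdisk11 (R:=R) (1 + z).
  by move=> z1; apply/cdisk11P; rewrite addrAC subrr add0r.
have df (z : C^o) : cmod z < 1 -> derivable f z 1.
  move=> z1; have : derivable g (1 + z) 1.
    by apply: gd; apply/disk11P; rewrite addrAC subrr add0r.
  suff E : (fun h : C^o => h^-1 *: ((f \o shift z) (h *: 1) - f z)) =
      (fun h => h^-1 *: ((g \o shift (1 + z)) (h *: 1) - g (1 + z))) by rewrite /derivable E.
  by apply/funext => h; rewrite /f /= addrCA.
have fM (z : C) : cmod z < 1 -> cmod (f z) <= M by move=> z1; apply: hM; apply: sh; exact: ltW.
(* Increments of [f] never exceed [2 * M], and this is at most [c |w - z|^2] as soon as
   [|w - z| >= d]. *)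
pose c := 2 * M / d ^+ 2.
have c0 : 0 <= c by rewrite divr_ge0 ?sqr_ge0// mulr_ge0// ltW.
have uc (z w : C) : cmod z <= 1 -> cmod w <= 1 -> cmod (f w - f z) <= e / 8 + c * cmod (w - z) ^+ 2.
  move=> z1 w1; have [lt|le] := ltP (cmod (w - z)) d.
    apply: le_trans (ltW (hd _ _ (sh _ w1) (sh _ z1) _)) _; last by rewrite lerDl mulr_ge0 ?sqr_ge0.
    by rewrite opprD addrACA subrr add0r.
  apply: le_trans (_ : 2 * M <= _).
    apply: le_trans (cmodB _ _) _; rewrite mulr_natl mulr2n.
    by apply: lerD; apply: hM; exact: sh.
  apply: le_trans (_ : c * d ^+ 2 <= _).
    by rewrite /c divfK// expf_neq0// lt0r_neq0.
  by apply: ler_wpDl; [exact: ltW|apply: ler_wpM2l => //; rewrite lerXn2r ?nnegrE ?cmod_ge0// ltW].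
pose N := (Num.truncn (8 * c / (e / 8))).+1.
have NR : 0 < N%:R :> R by rewrite ltr0n.
have hN : 8 * c / N%:R <= e / 8.
  have lt : 8 * c / (e / 8) < N%:R by exact: truncnS_gt.
  by rewrite ltr_pdivrMr// in lt; rewrite ler_pdivrMr// [e / 8 * _]mulrC ltW.
pose p := fejer f N.
have inner (z : C) : 0 < cmod z < 1 -> cmod (p.[z] - f z) <= 3 / 8 * e.
  move=> /andP[z0 z1].
  have [th hth] : exists th, z = (cmod z)%:C%C * cis th.
    pose a := complex.Re z / cmod z; pose b := complex.Im z / cmod z.
    have ab : a ^+ 2 + b ^+ 2 = 1.
      rewrite !exprMn -mulrDl -/(sqmod z) -cmod_sqr -exprMn divff ?expr1n//.
      exact: lt0r_neq0.
    have a1 : -1 <= a <= 1.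
      rewrite -ler_norml -(@ler_pXn2r _ 2)// ?nnegrE// expr1n real_normK ?num_real//.
      by rewrite -ab lerDl sqr_ge0.
    have bs : `|b| = sin (acos a).
      rewrite sin_acos//; apply/eqP; rewrite -(@eqrXn2 _ 2)// ?sqrtr_ge0//.
      rewrite sqr_sqrtr; last by rewrite -ab addrAC subrr add0r sqr_ge0.
      by rewrite real_normK ?num_real// -ab addrAC subrr add0r.
    have za : z = ((cmod z)%:C%C * (a +i* b)%C).
      rewrite /a /b; case: z z0 {z1 a b ab a1 bs} => x y z0 /=.
      apply/eqP; rewrite eq_complex /= !mul0r subr0 addr0 ![_ * (_ / _)]mulrC !divfK ?eqxx// lt0r_neq0//.
    have [b0|b0] := leP 0 b.
      exists (acos a); rewrite {1}za; congr (_ * _); rewrite /cis acosK ?in_itv//.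
      by rewrite -bs ger0_norm.
    exists (- acos a); rewrite {1}za; congr (_ * _); rewrite /cis cosN sinN acosK ?in_itv//.
    by rewrite -bs ltr0_norm// opprK.
  rewrite hth; apply: le_trans (fejer_bound th df fM _ _ _ c0 _) _.
  - by rewrite z0.
  - by [].
  - exact: ltW e4.
  - by move=> u w u1 w1; apply: uc; exact: ltW.
  - by move: hN; lra.
have pc := @poly_continuous R p.
exists (p \Po ('X - 1%:P)) => z /cdisk11P zD; rewrite horner_comp hornerD hornerN hornerX hornerC.
set y := z - 1 in zD *.
have -> : g z = f y by rewrite /f /y addrC subrK.
have e8 : 0 < e / 8 by lra.
have [d1 d10 h1] : exists2 d1 : R, 0 < d1 & forall w, cmod (w - y) < d1 -> cmod (p.[y] - p.[w]) < e / 8.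
  have /cvgCP/(_ _ e8) := pc y.
  by move=> /nbhsCP[d1 d10 h1]; exists d1.
have c1 : 0 < c + 1 by rewrite ltr_wpDl.
have s0 : 0 < Num.min (Num.min (d1 / 4) (1 / 4)) (e / 16 / (c + 1)).
  by rewrite !lt_min !divr_gt0.
set s := Num.min _ _ in s0.
have sd1 : s <= d1 / 4 by rewrite /s !ge_min lexx.
have s4 : s <= 1 / 4 by rewrite /s !ge_min lexx orbT.
have sc : s <= e / 16 / (c + 1) by rewrite /s ge_min lexx orbT.
clearbody s.
(* [y] may be 0 or lie on the circle, so [inner] is applied at a nearby nonzero interior point
   [w]. *)
have [w [w01 wy]] : exists w : C, 0 < cmod w < 1 /\ cmod (y - w) <= s.
  have [y0|yn0] := eqVneq y 0.
    exists s%:C%C; rewrite y0 sub0r cmodN cmod_real gtr0_norm//; split => //.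
    by rewrite s0 /=; lra.
  have yp := cmod_gt0 yn0; have s1 : 0 < 1 - s by lra.
  exists ((1 - s)%:C%C * y); split.
    rewrite cmodM cmod_real gtr0_norm// mulr_gt0//=.
    by apply: le_lt_trans (ler_piMr (ltW s1) zD) _; lra.
  have -> : y - (1 - s)%:C%C * y = s%:C%C * y by rewrite rmorphB rmorph1; ring.
  by rewrite cmodM cmod_real gtr0_norm// ler_piMr// ltW.
have cw : c * cmod (y - w) ^+ 2 <= e / 16.
  apply: le_trans (_ : (c + 1) * s <= _); last by rewrite mulrC -ler_pdivlMr.
  apply: ler_pM => //; rewrite ?sqr_ge0// ?lerDl//.
  have n0 := cmod_ge0 (y - w); move: wy n0; set n := cmod _ => wy n0.
  by rewrite expr2; nra.
have wd : cmod (w - y) < d1 by rewrite cmodC; lra.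
have w1 : cmod w <= 1 by case/andP: w01 => _ /ltW.
have := inner _ w01; have := h1 _ wd; have := uc w y w1 zD.
have := cmod_dist p.[y] p.[w] (f y); have := cmod_dist p.[w] (f w) (f y).
rewrite [cmod (f y - f w)]cmodC; lra.
Qed.

End FejerConvergence.

(** * Completeness of L^2 and multiplication operators *)

Section L2norm_theory.
Context {R : realType}.
Local Notation C := R[i].
Local Notation mu := (@lebesgue_measure R).
Local Notation L2 := (L2 R).
Local Notation L2norm := (@L2norm R).
Implicit Types (u v : L2) (f g : R -> C).

Lemma measurable_I01 : measurable (I01 (R:=R)). Proof. exact: measurable_itv. Qed.
Hint Resolve measurable_I01 : core.

Lemma L2normE (u : L2) : `|u| = (L2norm u)%:C%C. Proof. by []. Qed.

Lemma L2norm_ge0 u : 0 <= L2norm u. Proof. exact: sqnorm_ge0. Qed.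

Lemma L2normD u v : L2norm (u + v) <= L2norm u + L2norm v.
Proof. by rewrite -lecR rmorphD /= -!L2normE ler_normD. Qed.

Lemma L2normN u : L2norm (- u) = L2norm u.
Proof. by apply: (@complexI R); rewrite /= -!L2normE normrN. Qed.

Lemma L2normB u v : L2norm (u - v) <= L2norm u + L2norm v.
Proof. by rewrite -(L2normN v) L2normD. Qed.

Lemma L2normZ (c : C) u : L2norm (c *: u) = cmod c * L2norm u.
Proof. by apply: (@complexI R); rewrite rmorphM /= -!L2normE normrZ normE. Qed.

Lemma L2norm0 : L2norm 0 = 0.
Proof. by apply: (@complexI R); rewrite /= -L2normE normr0. Qed.

Lemma L2norm_eq0 u : L2norm u = 0 -> u = 0.
Proof. by move=> u0; apply: normr0_eq0; rewrite L2normE u0. Qed.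

Lemma L2norm_distC u v : L2norm (u - v) = L2norm (v - u).
Proof. by rewrite -[in LHS](opprB v u) L2normN. Qed.

Lemma L2norm_dist w u v : L2norm (u - v) <= L2norm (u - w) + L2norm (w - v).
Proof. by rewrite -[u - v](subrKA w) L2normD. Qed.

Lemma L2norm_lower u v : L2norm u - L2norm v <= L2norm (u - v).
Proof. by rewrite lerBlDr -{1}(subrK v u) L2normD. Qed.

Lemma L2norm_sum (I : Type) (s : seq I) (P : pred I) (F : I -> L2) :
  L2norm (\sum_(i <- s | P i) F i) <= \sum_(i <- s | P i) L2norm (F i).
Proof.
elim/big_rec2: _ => [|i y x _ H]; first by rewrite L2norm0.
by rewrite (le_trans (L2normD _ _))// lerD2l.
Qed.

Lemma sqint_ae f g : measurable_fun I01 (fun x => complex.Re (f x)) ->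
  measurable_fun I01 (fun x => complex.Im (f x)) ->
  sqint g -> sqint_eq f g -> sqint f.
Proof.
move=> mr mi sg fg; split => //.
rewrite (_ : (\int[mu]_(x in I01) _ = \int[mu]_(x in I01) (sqmod (g x))%:E)%E).
  by case: sg.
apply: ae_eq_integral => //.
- by apply/measurable_EFinP/measurable_funD; exact: measurable_funX.
- exact: measurable_sqmod.
- by apply: filterS fg => x fg xI; rewrite fg.
Qed.

Lemma L2norm_toL2 f : sqint f -> L2norm (toL2 f) = sqnorm f.
Proof. by move=> sf; apply: sqnorm_eq => //; [exact: L2_sqint|exact: toL2K]. Qed.

Lemma toL2_id u : toL2 u = u.
Proof. by apply: L2P; apply: toL2K; exact: L2_sqint. Qed.

Lemma toL2D f g : sqint f -> sqint g -> toL2 (fun x => f x + g x) = toL2 f + toL2 g.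
Proof.
move=> sf sg; apply: L2P; apply: sqint_eq_trans (toL2K (sqintD sf sg)) _.
apply: sqint_eq_sym; apply: sqint_eq_trans (addL2E _ _) _.
by have := toL2K sf; have := toL2K sg; apply: filterS2 => x h1 h2 xI; rewrite h1// h2.
Qed.

Lemma toL2Z (c : C) f : sqint f -> toL2 (fun x => c * f x) = c *: toL2 f.
Proof.
move=> sf; apply: L2P; apply: sqint_eq_trans (toL2K (sqintZ c sf)) _.
apply: sqint_eq_sym; apply: sqint_eq_trans (scaleL2E _ _) _.
by have := toL2K sf; apply: filterS => x h1 xI; rewrite h1.
Qed.

Lemma sqintN f : sqint f -> @sqint R (fun x => - f x).
Proof.
move=> /(sqintZ (-1)).
by under [X in sqint X -> _]eq_fun do rewrite mulN1r.
Qed.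

Lemma sqintB f g : sqint f -> sqint g -> @sqint R (fun x => f x - g x).
Proof. by move=> sf sg; apply: sqintD => //; exact: sqintN. Qed.

Lemma toL2B f g : sqint f -> sqint g -> toL2 (fun x => f x - g x) = toL2 f - toL2 g.
Proof.
move=> sf sg; rewrite (toL2D sf (sqintN sg)).
congr (_ + _); rewrite -[RHS]scaleN1r -(toL2Z (-1) sg); congr toL2.
by apply/funext => x; rewrite mulN1r.
Qed.

Lemma L2norm_sub u v : L2norm (u - v) = sqnorm (fun x => u x - v x).
Proof.
have su := L2_sqint u; have sv := L2_sqint v.
by rewrite -(L2norm_toL2 (sqintB su sv)) (toL2B su sv) !toL2_id.
Qed.

Lemma sqnorm_le (f : R -> C) (B : R) : 0 <= B ->
  (\int[mu]_(x in I01) (sqmod (f x))%:E <= (B ^+ 2)%:E)%E -> sqnorm f <= B.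
Proof.
move=> B0 h; rewrite /sqnorm -[leRHS]ger0_norm// -sqrtr_sqr ler_wsqrtr// -lee_fin fineK//.
rewrite ge0_fin_numE; first exact: le_lt_trans h (ltry _).
by apply: integral_ge0 => x _; rewrite lee_fin sqmod_ge0.
Qed.

Lemma measurable_limit (f_ : nat -> R -> R) (f : R -> R) :
  (forall n, measurable_fun I01 (f_ n)) ->
  (forall x, I01 x -> forall e : R, 0 < e -> exists N, forall n, (N <= n)%N -> `|f_ n x - f x| <= e) ->
  measurable_fun I01 f.
Proof.
move=> mf h; apply: (measurable_fun_cvg mf) => x xI; apply/cvgrPdist_le => e e0.
by have [N hN] := h x xI e e0; exists N => // n /hN; rewrite distrC.
Qed.

(** Balls are closed under pointwise convergence: this gives completeness, and carries Hardy's
    inequality from polynomials to all of L^2. *)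
Lemma sqint_fatou (f_ : nat -> R -> C) f (B : R) : 0 <= B ->
  (forall n, sqint (f_ n)) -> (forall n, sqnorm (f_ n) <= B) ->
  (forall x, I01 x -> forall e : R, 0 < e ->
     exists N, forall n, (N <= n)%N -> cmod (f_ n x - f x) <= e) ->
  sqint f /\ sqnorm f <= B.
Proof.
move=> B0 sf fB cv.
have mr : measurable_fun I01 (fun x => complex.Re (f x)).
  apply: (@measurable_limit (fun n x => complex.Re (f_ n x))) => [n|x xI e e0].
    by have [] := sf n.
  have [N hN] := cv x xI e e0; exists N => n /hN; apply: le_trans.
  by rewrite -ReB; exact: cmod_Re.
have mi : measurable_fun I01 (fun x => complex.Im (f x)).
  apply: (@measurable_limit (fun n x => complex.Im (f_ n x))) => [n|x xI e e0].
    by have [] := sf n.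
  have [N hN] := cv x xI e e0; exists N => n /hN; apply: le_trans.
  by apply: le_trans (cmod_Im _); case: (f_ n x); case: (f x).
have le : (\int[mu]_(x in I01) (sqmod (f x))%:E <= (B ^+ 2)%:E)%E.
  have -> : (\int[mu]_(x in I01) (sqmod (f x))%:E =
      \int[mu]_(x in I01) limn_einf (fun n => (sqmod (f_ n x))%:E))%E.
    apply: eq_integral => x; rewrite inE => xI; apply/esym; apply: (cvg_limn_einf_sup _).1.
    apply: cvg_EFin; first exact: nearW.
    have : (fun n => cmod (f_ n x)) @ \oo --> cmod (f x).
      apply/cvgrPdist_le => e e0; have [N hN] := cv x xI e e0; exists N => // n /hN.
      apply: le_trans; rewrite distrC ler_norml; apply/andP; split.
        by rewrite lerNl opprB cmodC cmod_lower.
      exact: cmod_lower.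
    move=> h; have H := cvgM h h; rewrite -cmod_sqr expr2.
    rewrite (_ : fine \o _ = (fun n => cmod (f_ n x)) * (fun n => cmod (f_ n x))); first exact: H.
    by apply/funext => n /=; rewrite -cmod_sqr.
  apply: le_trans (fatou _ _ _ _) _ => //.
  - by move=> n; exact: measurable_sqmod.
  - by move=> n x _; rewrite lee_fin sqmod_ge0.
  rewrite limn_einf_lim; apply: lime_le; first exact: is_cvg_einfs.
  apply: nearW => n; apply: (@le_trans _ _ (sqnorm (f_ n) ^+ 2)%:E).
    by rewrite -sqnormE//; apply: ereal_inf_lbound; exists n => //=.
  by rewrite lee_fin lerXn2r ?nnegrE ?sqnorm_ge0.
by split; [split => //; exact: le_lt_trans le (ltry _)|exact: sqnorm_le].
Qed.

(* Bounding the modulus by the mean of [a |h|^2] and [1 / a] replaces Cauchy-Schwarz. *)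
Lemma integral_cmod_le (f : R -> C) (a : R) : 0 < a -> sqint f ->
  measurable_fun I01 (fun x => (cmod (f x))%:E) /\
  (\int[mu]_(x in I01) (cmod (f x))%:E <= ((a * sqnorm f ^+ 2 + a^-1) / 2)%:E)%E.
Proof.
move=> a0 sf.
have mc : measurable_fun I01 (fun x => (cmod (f x))%:E).
  apply/measurable_EFinP.
  apply: (@measurableT_comp _ _ _ _ _ _ (@Num.sqrt R) _ (fun x => sqmod (f x))).
    by apply: continuous_measurable_fun; exact: sqrt_continuous.
  by apply/measurable_EFinP; exact: measurable_sqmod.
split => //.
apply: le_trans (_ : (\int[mu]_(x in I01) ((a / 2)%:E * (sqmod (f x))%:E + (a^-1 / 2)%:E) <= _)%E).
  apply: ge0_le_integral => //.
  - by move=> x _; rewrite lee_fin cmod_ge0.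
  - apply: emeasurable_funD; last exact: measurable_cst.
    by apply: measurable_funeM; exact: measurable_sqmod.
  move=> x _; rewrite -EFinM -EFinD lee_fin -cmod_sqr.
  rewrite -subr_ge0 [leRHS](_ : _ = a / 2 * (cmod (f x) - a^-1) ^+ 2).
    by rewrite mulr_ge0 ?sqr_ge0// divr_ge0// ltW.
  by field; exact: lt0r_neq0.
rewrite ge0_integralD//; last 3 first.
- by move=> x _; rewrite -EFinM lee_fin mulr_ge0 ?sqmod_ge0// divr_ge0// ltW.
- by apply: measurable_funeM; exact: measurable_sqmod.
- by move=> x _; rewrite lee_fin divr_ge0// invr_ge0 ltW.
rewrite ge0_integralZl_EFin//; last 3 first.
- by move=> x _; rewrite lee_fin sqmod_ge0.
- exact: measurable_sqmod.
- by rewrite divr_ge0// ltW.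
rewrite integral_cst// sqnormE//.
rewrite [X in (_ + _ * X)%E](_ : _ = 1%E); last first.
  transitivity (lebesgue_measure (`[0, 1]%classic : set R)); first by [].
  by rewrite lebesgue_measure_itv /= lte_fin ltr01 oppr0 adde0.
by rewrite mule1 -EFinM -EFinD lee_fin; lra.
Qed.

End L2norm_theory.

(** * The Riesz-Fischer theorem *)

Section Completeness.
Context {R : realType}.
Local Notation C := R[i].
Local Notation mu := (@lebesgue_measure R).
Local Notation L2 := (L2 R).
Local Notation L2norm := (@L2norm R).

Let mI : measurable (I01 (R:=R)). Proof. exact: measurable_itv. Qed.
Hint Resolve mI : core.

Lemma bounded_series_cauchy (a : nat -> R) (B : R) : (forall n, 0 <= a n) ->
  (forall n, \sum_(k < n) a k <= B) ->
  forall e : R, 0 < e -> exists N, forall m n, (N <= m)%N -> (m <= n)%N ->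
    \sum_(m <= k < n) a k <= e.
Proof.
move=> a0 aB e e0; pose s n := \sum_(0 <= k < n) a k.
have ss m n : (m <= n)%N -> s n = s m + \sum_(m <= k < n) a k.
  by move=> mn; rewrite /s (big_cat_nat (leq0n m) mn).
have : cvgn s.
  apply: nondecreasing_is_cvgn.
    by move=> m n /ss ->; rewrite lerDl sumr_ge0.
  by exists B => _ [n _ <-]; rewrite /s big_mkord.
move=> /cvgrPdist_le /(_ (e / 2)) []; first by lra.
move=> N _ hN; exists N => m n Nm mn.
have := hN m Nm; have := hN n (leq_trans Nm mn); rewrite (ss _ _ mn) !ler_norml.
by move=> /andP[? ?] /andP[? ?]; lra.
Qed.

Lemma half_pow_small (e : R) : 0 < e -> exists n, (1 / 2) ^+ n <= e.
Proof.
move=> e0; pose n := (Num.truncn e^-1).+1; exists n.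
have lt : e^-1 < 2 ^+ n.
  by apply: lt_trans (truncnS_gt _) _; rewrite -natrX ltr_nat ltn_expl.
by rewrite div1r exprVn -[e]invrK lef_pV2 ?posrE ?invr_gt0 ?exprn_gt0// ltW.
Qed.

(** A subsequence with summable increments converges almost everywhere, and [sqint_fatou] turns this
    into convergence in norm. *)
Lemma L2_complete (u : nat -> L2) :
  (forall e : R, 0 < e -> exists N, forall m n, (N <= m)%N -> (N <= n)%N -> L2norm (u m - u n) <= e) ->
  exists l, forall e : R, 0 < e -> exists N, forall n, (N <= n)%N -> L2norm (u n - l) <= e.
Proof.
move=> cu.
have half n : 0 < (1 / 2) ^+ n :> R by rewrite exprn_gt0.
have [k0 k0P] := choice (fun n => cu _ (half n)).
pose k := fix k n := if n is n'.+1 then maxn (k n') (k0 n) else k0 0%N.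
have kk0 n : (k0 n <= k n)%N by case: n => //= n; rewrite leq_maxr.
have kmono m n : (m <= n)%N -> (k m <= k n)%N.
  by move=> /subnK <-; elim: (n - m)%N => // j IH; rewrite addSn /= (leq_trans IH)// leq_maxl.
have uk m n : (m <= n)%N -> L2norm (u (k m) - u (k n)) <= (1 / 2) ^+ m.
  by move=> mn; apply: k0P => //; exact: leq_trans (kk0 m) (kmono _ _ mn).
pose f n : R -> C := u (k n).
have sf n : sqint (f n) by exact: L2_sqint.
pose a n x : R := cmod (f n x - f n.+1 x).
have sa n : sqint (fun x => f n x - f n.+1 x) by exact: sqintB.
have ma n : measurable_fun I01 (fun x => (a n x)%:E).
  by have [] := integral_cmod_le ltr01 (sa n).
have ia n : (\int[mu]_(x in I01) (a n x)%:E <= ((1 / 2) ^+ n)%:E)%E.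
  (* With weight [2 ^+ n] and a squared norm of at most [4^-n], both terms of the mean are at most
     [2^-n]. *)
  have [_] := integral_cmod_le (exprn_gt0 n (ltr0n R 2)) (sa n).
  move=> /le_trans; apply; rewrite lee_fin.
  have le : sqnorm (fun x => f n x - f n.+1 x) <= (1 / 2) ^+ n.
    by rewrite /f -L2norm_sub uk.
  have le2 : 2 ^+ n * sqnorm (fun x => f n x - f n.+1 x) ^+ 2 <= (1 / 2) ^+ n.
    apply: le_trans (_ : 2 ^+ n * ((1 / 2) ^+ n) ^+ 2 <= _).
      by rewrite ler_wpM2l ?exprn_ge0// lerXn2r ?nnegrE ?sqnorm_ge0// ltW.
    by rewrite expr2 mulrA -exprMn div1r divff ?expr1n ?mul1r// pnatr_eq0.
  have : (2 ^+ n)^-1 = (1 / 2) ^+ n :> R by rewrite div1r exprVn.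
  by move=> ->; lra.
pose S x : \bar R := (\sum_(0 <= n <oo) (a n x)%:E)%E.
have S0 x : (0 <= S x)%E by apply: nneseries_ge0 => n _ _; rewrite lee_fin cmod_ge0.
have mS : measurable_fun I01 S.
  by apply: ge0_emeasurable_sum => // n x _ _; rewrite lee_fin cmod_ge0.
have iS : (\int[mu]_(x in I01) S x <= 2%:E)%E.
  rewrite integral_nneseries//; last by move=> n x _; rewrite lee_fin cmod_ge0.
  apply: lime_le.
    by apply: is_cvg_nneseries => n _ _; apply: integral_ge0 => x _; rewrite lee_fin cmod_ge0.
  apply: nearW => n; apply: le_trans (lee_sum _ (fun i _ => ia i)) _.
  by rewrite sumEFin lee_fin big_mkord; apply: geometric_half; lra.
have iSS : mu.-integrable I01 S.
  apply/integrableP; split => //; under eq_integral do rewrite gee0_abs//.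
  exact: le_lt_trans iS (ltry _).
pose A : set R := I01 `&` [set x | (S x < +oo)%E].
have mA : measurable A by exact: emeasurable_fun_infty_o.
(* [f n] is cut off where the increments are not summable, a null set, so that the limit exists at
   every point, as [sqint_fatou] requires. *)
pose h n x : C := (\1_A x)%:C%C * f n x.
have hE n x : A x -> h n x = f n x by move=> Ax; rewrite /h indicE mem_set// mul1r.
have hE0 n x : ~ A x -> h n x = 0 by move=> Ax; rewrite /h indicE memNset// mul0r.
have hf n : sqint_eq (h n) (f n).
  have := @integrable_ae _ _ _ (@lebesgue_measure R) (I01 (R:=R)) mI S iSS.
  apply: filterS => x fx xI; rewrite hE//; split => //.
  by rewrite /= -ge0_fin_numE// fx.
have sh n : sqint (h n).
  have [mr mi _] := sf n; apply: (@sqint_ae _ _ (f n)) => //.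
    rewrite (_ : (fun _ => _) = (fun x => \1_A x * complex.Re (f n x))).
      by apply: measurable_funM => //; exact: measurable_indic.
    by apply/funext => x; rewrite /h; case: (f n x) => p q /=; rewrite mul0r subr0.
  rewrite (_ : (fun _ => _) = (fun x => \1_A x * complex.Im (f n x))).
    by apply: measurable_funM => //; exact: measurable_indic.
  by apply/funext => x; rewrite /h; case: (f n x) => p q /=; rewrite mul0r addr0.
have lim x : exists l, forall e : R, 0 < e -> exists N, forall n, (N <= n)%N -> cmod (h n x - l) <= e.
  have [Ax|nAx] := pselect (A x); last first.
    by exists 0 => e e0; exists 0%N => n _; rewrite hE0// subrr cmod0 ltW.
  apply: cauchy_complex => e e0.
  have [] := @bounded_series_cauchy (a^~ x) (fine (S x)) _ _ _ e0.
  - by move=> n; exact: cmod_ge0.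
  - move=> n; rewrite -lee_fin fineK; last by rewrite ge0_fin_numE//; case: Ax.
    by rewrite -sumEFin -(big_mkord xpredT (fun i => (a i x)%:E)) nneseries_lim_ge// => i _ _; rewrite lee_fin cmod_ge0.
  move=> N hN; exists N.
  have tele m n : (m <= n)%N -> cmod (h m x - h n x) <= \sum_(m <= i < n) a i x.
    move=> /subnK <-; elim: (n - m)%N => [|j IH].
      by rewrite add0n subrr cmod0 big_geq.
    rewrite addSn big_nat_recr ?leq_addl//=; apply: le_trans (cmod_dist _ (h (j + m)%N x) _) _.
    by rewrite lerD// !hE.
  move=> m n Nm Nn; case: (leqP m n) => mn.
    exact: le_trans (tele _ _ mn) (hN _ _ Nm mn).
  by rewrite cmodC; exact: le_trans (tele _ _ (ltnW mn)) (hN _ _ Nn (ltnW mn)).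
have [l lP] := choice lim.
have key n : sqint (fun x => l x - h n x) /\ sqnorm (fun x => l x - h n x) <= (1 / 2) ^+ n.
  apply: (@sqint_fatou R (fun m x => h (m + n)%N x - h n x)).
  - exact: ltW.
  - by move=> m; exact: sqintB.
  - move=> m; rewrite (@sqnorm_eq _ _ (fun x => f (m + n)%N x - f n x)).
    + by rewrite /f -L2norm_sub L2norm_distC uk// leq_addl.
    + exact: sqintB.
    + exact: sqintB.
    + by apply: filterS2 (hf (m + n)%N) (hf n) => x h1 h2 xI; rewrite h1// h2.
  - move=> x xI e e0; have [N hN] := lP x e e0; exists N => m Nm.
    by rewrite opprB addrA subrK hN// (leq_trans Nm)// leq_addr.
have sl : sqint l.
  have := sqintD (key 0%N).1 (sh 0%N).
  by under [X in sqint X -> _]eq_fun do rewrite subrK.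
exists (toL2 l) => e e0; have e2 : 0 < e / 2 by lra.
have [n hn] := half_pow_small e2.
exists (k0 n) => m km.
apply: le_trans (L2norm_dist (u (k n)) _ _) _; rewrite [e]splitr lerD//.
  exact: le_trans (k0P _ _ _ km (kk0 n)) hn.
have -> : u (k n) = toL2 (h n).
  rewrite -[LHS]toL2_id; apply: toL2_eq => //; first exact: sf.
  exact: sqint_eq_sym.
by rewrite L2norm_distC -toL2B// L2norm_toL2; [exact: le_trans (key n).2 hn|exact: (key n).1].
Qed.

End Completeness.

(** * Cauchy-Schwarz bounds for integrals over parts of the unit interval *)

Section Integrals.
Context {R : realType}.
Local Notation C := R[i].
Local Notation mu := (@lebesgue_measure R).

Let mI : measurable (I01 (R:=R)). Proof. exact: measurable_itv. Qed.
Hint Resolve mI : core.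

(** The optimal weight is [a = q / p]; when [p] or [q] is 0 the infimum may only be approached,
    whence the argument with [e]. *)
Lemma amgm_opt (y p q : R) : 0 <= p -> 0 <= q ->
  (forall a, 0 < a -> y <= (a * p ^+ 2 + q ^+ 2 / a) / 2) -> y <= p * q.
Proof.
move=> p0 q0 h; have [p0'|pn] := eqVneq p 0.
  rewrite p0' mul0r; apply/ler_addgt0Pr => e e0; rewrite add0r.
  have := h ((q ^+ 2 + 1) / e) (divr_gt0 (ltr_wpDl (sqr_ge0 _) ltr01) e0).
  rewrite p0' expr0n mulr0 add0r => /le_trans; apply.
  have q1 : 0 < q ^+ 2 + 1 by rewrite ltr_wpDl ?sqr_ge0.
  rewrite invf_div mulrA ler_pdivrMr// ler_pdivrMr//.
  by have := sqr_ge0 q; nra.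
have [q0'|qn] := eqVneq q 0.
  rewrite q0' mulr0; apply/ler_addgt0Pr => e e0; rewrite add0r.
  have p1 : 0 < p ^+ 2 by rewrite exprn_gt0// lt_def pn.
  have := h (e / p ^+ 2) (divr_gt0 e0 p1).
  by rewrite q0' expr0n mul0r addr0 divfK ?lt0r_neq0//; lra.
have pp : 0 < p by rewrite lt_def pn.
have qp : 0 < q by rewrite lt_def qn.
have := h (q / p) (divr_gt0 qp pp); move/le_trans; apply.
by rewrite le_eqVlt; apply/orP; left; apply/eqP; field; rewrite pn qn.
Qed.

Lemma sqint_integrable (f : R -> C) : sqint f ->
  mu.-integrable I01 (EFin \o (fun x => complex.Re (f x))) /\
  mu.-integrable I01 (EFin \o (fun x => complex.Im (f x))).
Proof.
move=> sf; have [mc le] := integral_cmod_le ltr01 sf; have [mr mi _] := sf.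
have fin := le_lt_trans le (ltry _).
split; apply/integrableP; split; try exact/measurable_EFinP.
  apply: le_lt_trans fin; apply: ge0_le_integral => //.
  - by apply: measurableT_comp => //; exact/measurable_EFinP.
  - by move=> x _; rewrite /= lee_fin cmod_Re.
apply: le_lt_trans fin; apply: ge0_le_integral => //.
- by apply: measurableT_comp => //; exact/measurable_EFinP.
- by move=> x _; rewrite /= lee_fin cmod_Im.
Qed.

(** Cauchy-Schwarz against the constant 1 on [D], in the weighted form that [amgm_opt] optimizes. *)
Lemma integral_cmod_set (f : R -> C) (D : set R) (d : R) : sqint f -> measurable D ->
  D `<=` I01 -> mu D = d%:E -> 0 <= d ->
  (\int[mu]_(x in D) (cmod (f x))%:E <= (sqnorm f * Num.sqrt d)%:E)%E.
Proof.
move=> sf mD DI dD d0; have [mc le] := integral_cmod_le ltr01 sf.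
have mcD : measurable_fun D (fun x => (cmod (f x))%:E) by exact: measurable_funS mc.
have ms : measurable_fun D (fun x => (sqmod (f x))%:E).
  exact: measurable_funS (measurable_sqmod sf).
have fin : (\int[mu]_(x in D) (cmod (f x))%:E)%E \is a fin_num.
  rewrite ge0_fin_numE; last by apply: integral_ge0 => x _; rewrite lee_fin cmod_ge0.
  apply: le_lt_trans (le_lt_trans le (ltry _)).
  by apply: ge0_subset_integral => // x _; rewrite lee_fin cmod_ge0.
rewrite -(fineK fin) lee_fin; apply: amgm_opt; rewrite ?sqnorm_ge0 ?sqrtr_ge0// => a a0.
rewrite (@sqr_sqrtr _ d)// -lee_fin fineK//.
apply: le_trans (_ : (\int[mu]_(x in D) ((a / 2)%:E * (sqmod (f x))%:E + (a^-1 / 2)%:E) <= _)%E).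
  apply: ge0_le_integral => //.
  - by move=> x _; rewrite lee_fin cmod_ge0.
  - apply: emeasurable_funD; last exact: measurable_cst.
    exact: measurable_funeM.
  move=> x _; rewrite -EFinM -EFinD lee_fin -cmod_sqr.
  rewrite -subr_ge0 [leRHS](_ : _ = a / 2 * (cmod (f x) - a^-1) ^+ 2).
    by rewrite mulr_ge0 ?sqr_ge0// divr_ge0// ltW.
  by field; exact: lt0r_neq0.
rewrite ge0_integralD//; last 3 first.
- by move=> x _; rewrite -EFinM lee_fin mulr_ge0 ?sqmod_ge0// divr_ge0// ltW.
- exact: measurable_funeM.
- by move=> x _; rewrite lee_fin divr_ge0// invr_ge0 ltW.
rewrite ge0_integralZl_EFin//; last 2 first.
- by move=> x _; rewrite lee_fin sqmod_ge0.
- by rewrite divr_ge0// ltW.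
rewrite integral_cst//.
rewrite [X in (_ + _ * X)%E](_ : _ = d%:E); last exact: dD.
apply: le_trans (_ : ((a / 2)%:E * (sqnorm f ^+ 2)%:E + (a^-1 / 2)%:E * d%:E <= _)%E).
  rewrite leeD2r// lee_wpmul2l//; first by rewrite lee_fin divr_ge0// ltW.
  rewrite -sqnormE//; apply: ge0_subset_integral => //; first exact: measurable_sqmod.
  by move=> x _; rewrite lee_fin sqmod_ge0.
by rewrite -!EFinM -EFinD lee_fin; lra.
Qed.

Lemma cintegral_bound (f : R -> C) (D : set R) (d : R) : sqint f -> measurable D ->
  D `<=` I01 -> mu D = d%:E -> 0 <= d ->
  cmod (cintegral D f) <= 2 * (sqnorm f * Num.sqrt d).
Proof.
move=> sf mD DI dD d0; have [ir ii] := sqint_integrable sf.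
have [mc le] := integral_cmod_le ltr01 sf.
have mcD : measurable_fun D (fun x => (cmod (f x))%:E) by exact: measurable_funS mc.
have le0 := integral_cmod_set sf mD DI dD d0.
have B (g : R -> R) : mu.-integrable I01 (EFin \o g) -> (forall x, `|g x| <= cmod (f x)) ->
    `|(\int[mu]_(x in D) g x)%R| <= sqnorm f * Num.sqrt d.
  move=> ig gf; have iD : mu.-integrable D (EFin \o g) by exact: integrableS ig.
  rewrite -lee_fin EFin_normr_Rintegral//; apply: le_trans (le_abse_integral _ _ _) _ => //.
    by have /integrableP[] := iD.
  apply: le_trans le0; apply: ge0_le_integral => //.
  - by apply: measurableT_comp => //; have /integrableP[] := iD.
  - by move=> x _; rewrite /= lee_fin gf.
rewrite mulr_natl mulr2n; apply: le_trans (cmod_ReIm _) _; apply: lerD; apply: B => //= x.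
  exact: cmod_Re.
exact: cmod_Im.
Qed.

Lemma cintegralD (D : set R) (f g : R -> C) : measurable D -> D `<=` I01 -> sqint f -> sqint g ->
  cintegral D (fun x => f x + g x) = cintegral D f + cintegral D g.
Proof.
move=> mD DI sf sg; have [fr fi] := sqint_integrable sf; have [gr gi] := sqint_integrable sg.
have sub h : mu.-integrable I01 h -> mu.-integrable D h by move=> ih; exact: integrableS ih.
apply/eqP; rewrite eq_complex /=; apply/andP; split; apply/eqP.
  rewrite -RintegralD//; try exact: sub.
  by apply: eq_Rintegral => x _; case: (f x); case: (g x).
rewrite -RintegralD//; try exact: sub.
by apply: eq_Rintegral => x _; case: (f x); case: (g x).
Qed.

Lemma cintegralZ (D : set R) (c : C) (f : R -> C) : measurable D -> D `<=` I01 -> sqint f ->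
  cintegral D (fun x => c * f x) = c * cintegral D f.
Proof.
move=> mD DI sf; have [fr fi] := sqint_integrable sf.
have sub h : mu.-integrable I01 h -> mu.-integrable D h by move=> ih; exact: integrableS ih.
case: c => a b.
have Z (k : R) (h : R -> R) : mu.-integrable I01 (EFin \o h) -> mu.-integrable D (EFin \o (fun x => k * h x)).
  by move=> ih; exact: (integrableZl _ k (sub _ ih)).
apply/eqP; rewrite eq_complex /=; apply/andP; split; apply/eqP.
  rewrite -!RintegralZl//; try exact: sub.
  rewrite -RintegralB//; try exact: Z.
  by apply: eq_Rintegral => x _; case: (f x).
rewrite -!RintegralZl//; try exact: sub.
rewrite -RintegralD//; try exact: Z.
by apply: eq_Rintegral => x _; case: (f x) => p q /=; rewrite addrC.
Qed.

Lemma cintegral_ae (D : set R) (f g : R -> C) : measurable D -> D `<=` I01 -> sqint f -> sqint g ->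
  sqint_eq f g -> cintegral D f = cintegral D g.
Proof.
move=> mD DI sf sg fg; have [fr fi _] := sf; have [gr gi _] := sg.
rewrite /cintegral /Rintegral; congr ((fine _) +i* (fine _))%C; apply: ae_eq_integral => //.
- by apply/measurable_EFinP; exact: measurable_funS fr.
- by apply/measurable_EFinP; exact: measurable_funS gr.
- by apply: filterS fg => x h xD; rewrite h//; exact: DI.
- by apply/measurable_EFinP; exact: measurable_funS fi.
- by apply/measurable_EFinP; exact: measurable_funS gi.
- by apply: filterS fg => x h xD; rewrite h//; exact: DI.
Qed.

Lemma subset_0x (x : R) : x <= 1 -> `[0, x]%classic `<=` I01.
Proof. by move=> x1; apply: subset_itv; rewrite bnd_simp. Qed.

Lemma measure_0x (x : R) : 0 <= x -> mu `[0, x]%classic = x%:E.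
Proof.
move=> x0; transitivity (lebesgue_measure (`[0, x]%classic : set R)); first by [].
rewrite lebesgue_measure_itv /= lte_fin; case: ltgtP x0 => // [_ _|<- _].
  by rewrite sube0.
by [].
Qed.

End Integrals.

(** * Multiplication by bounded measurable functions *)

Section Multiplication.
Context {R : realType}.
Local Notation C := R[i].
Local Notation mu := (@lebesgue_measure R).
Local Notation L2 := (L2 R).
Local Notation L2norm := (@L2norm R).

Let mI : measurable (I01 (R:=R)). Proof. exact: measurable_itv. Qed.
Hint Resolve mI : core.

Definition cmeas (phi : R -> C) := measurable_fun I01 (fun x => complex.Re (phi x)) /\
  measurable_fun I01 (fun x => complex.Im (phi x)).

Lemma cmeasM (f g : R -> C) : cmeas f -> cmeas g -> cmeas (fun x => f x * g x).
Proof.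
move=> [fr fi] [gr gi]; split.
  rewrite (_ : (fun _ => _) = (fun x => complex.Re (f x) * complex.Re (g x) - complex.Im (f x) * complex.Im (g x))).
    by apply: measurable_funB; apply: measurable_funM.
  by apply/funext => x; case: (f x); case: (g x).
rewrite (_ : (fun _ => _) = (fun x => complex.Re (f x) * complex.Im (g x) + complex.Im (f x) * complex.Re (g x))).
  by apply: measurable_funD; apply: measurable_funM.
by apply/funext => x; case: (f x); case: (g x).
Qed.

Lemma sqint_cmeas f : sqint f -> @cmeas f. Proof. by case. Qed.

Lemma sqint_dom (f g : R -> C) (M : R) : 0 <= M -> cmeas g -> sqint f ->
  (forall x, I01 x -> cmod (g x) <= M * cmod (f x)) ->
  sqint g /\ sqnorm g <= M * sqnorm f.
Proof.
move=> M0 [gr gi] sf h.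
have ms : measurable_fun I01 (fun x => (sqmod (g x))%:E).
  by apply/measurable_EFinP/measurable_funD; exact: measurable_funX.
have le : (\int[mu]_(x in I01) (sqmod (g x))%:E <= ((M * sqnorm f) ^+ 2)%:E)%E.
  rewrite exprMn EFinM -sqnormE// -ge0_integralZl_EFin ?sqr_ge0//; last 2 first.
  - by move=> x _; rewrite lee_fin sqmod_ge0.
  - exact: measurable_sqmod.
  apply: ge0_le_integral => //.
  - by move=> x _; rewrite lee_fin sqmod_ge0.
  - by apply: measurable_funeM; exact: measurable_sqmod.
  - move=> x xI; rewrite -EFinM lee_fin -!cmod_sqr -exprMn lerXn2r ?nnegrE ?mulr_ge0 ?cmod_ge0//.
    exact: h.
split; first by split => //; exact: le_lt_trans le (ltry _).
by apply: sqnorm_le => //; rewrite mulr_ge0// sqnorm_ge0.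
Qed.

Definition bmeas (phi : R -> C) (M : R) := [/\ 0 <= M, cmeas phi & forall x, I01 x -> cmod (phi x) <= M].

Lemma sqint_mul (phi : R -> C) M f : bmeas phi M -> sqint f ->
  sqint (fun x => phi x * f x) /\ sqnorm (fun x => phi x * f x) <= M * sqnorm f.
Proof.
move=> [M0 mphi phiM] sf; apply: sqint_dom => //.
  by apply: cmeasM => //; exact: sqint_cmeas.
by move=> x xI; rewrite cmodM ler_wpM2r ?cmod_ge0// phiM.
Qed.

Lemma mulopE phi M (u : L2) : bmeas phi M -> sqint_eq (mulop phi u) (fun x => phi x * u x).
Proof. by move=> b; apply: toL2K; have [] := sqint_mul b (L2_sqint u). Qed.

Lemma mulop_norm phi M (u : L2) : bmeas phi M -> L2norm (mulop phi u) <= M * L2norm u.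
Proof.
by move=> b; have [s le] := sqint_mul b (L2_sqint u); rewrite L2norm_toL2.
Qed.

Lemma mulop_linear phi M : bmeas phi M -> linear (@mulop R phi).
Proof.
move=> b a u v; rewrite /mulop.
have su := L2_sqint u; have sv := L2_sqint v.
rewrite -toL2Z; last exact: (sqint_mul b su).1.
rewrite -toL2D; last 2 first.
- by apply: sqintZ; exact: (sqint_mul b su).1.
- exact: (sqint_mul b sv).1.
apply: toL2_eq.
- exact: (sqint_mul b (L2_sqint _)).1.
- by apply: sqintD; [apply: sqintZ|]; [exact: (sqint_mul b su).1|exact: (sqint_mul b sv).1].
have := addL2E (a *: u) v; have := scaleL2E a u; apply: filterS2 => x h1 h2 xI.
have -> : L2fun (a *: u + v) x = a * L2fun u x + L2fun v x.
  by apply: etrans (h2 xI) _; congr (_ + _); exact: h1.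
by rewrite mulrDr mulrCA.
Qed.

Lemma sqint_ext (f g : R -> C) : (forall x, I01 x -> f x = g x) -> sqint f -> sqint g.
Proof.
move=> h; have fg : {in I01, f =1 g} by move=> x; rewrite inE => /h.
move=> [fr fi f0]; split.
- by apply: eq_measurable_fun fr => x /fg ->.
- by apply: eq_measurable_fun fi => x /fg ->.
- by rewrite (_ : (\int[mu]_(x in I01) _ = \int[mu]_(x in I01) (sqmod (f x))%:E)%E)//; apply: eq_integral => x /fg ->.
Qed.

Lemma mulop_ext phi psi : (forall x, I01 x -> phi x = psi x) -> @mulop R phi = mulop psi.
Proof.
move=> h; apply/funext => u; rewrite /mulop.
have E x : I01 x -> phi x * u x = psi x * u x by move=> /h ->.
have sq : sqint (fun x => phi x * u x) <-> sqint (fun x => psi x * u x).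
  by split; apply: sqint_ext => x /E.
have [s|ns] := pselect (sqint (fun x => phi x * u x)).
  apply: toL2_eq => //; first exact/sq.
  by apply: nearW => x xI; exact: E.
(* Neither product is square integrable, so both sides are the default class of 0. *)
by rewrite /toL2 /insubd !insubN//; apply/asboolP => // /sq.
Qed.

Lemma bmeas_comp phi psi M N (u : L2) : bmeas phi M -> bmeas psi N ->
  mulop phi (mulop psi u) = mulop (fun x => phi x * psi x) u.
Proof.
move=> b1 b2; apply: toL2_eq.
- exact: (sqint_mul b1 (L2_sqint _)).1.
- under [X in sqint X]eq_fun do rewrite -mulrA.
  exact: (sqint_mul b1 (sqint_mul b2 (L2_sqint u)).1).1.
- by have := mulopE u b2; apply: filterS => x h xI; rewrite h// mulrA.
Qed.

Lemma mulopD phi psi M N (u : L2) : bmeas phi M -> bmeas psi N ->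
  mulop (fun x => phi x + psi x) u = mulop phi u + mulop psi u.
Proof.
move=> b1 b2; have su := L2_sqint u.
rewrite /mulop -(toL2D (sqint_mul b1 su).1 (sqint_mul b2 su).1).
by congr toL2; apply/funext => x; rewrite mulrDl.
Qed.

Lemma mulopZ (c : C) phi M (u : L2) : bmeas phi M -> mulop (fun x => c * phi x) u = c *: mulop phi u.
Proof.
move=> b1; have su := L2_sqint u; rewrite /mulop -(toL2Z c (sqint_mul b1 su).1).
by congr toL2; apply/funext => x; rewrite mulrA.
Qed.

Lemma mulop1 (u : L2) : mulop (fun=> 1) u = u.
Proof. by rewrite /mulop -[RHS]toL2_id; congr toL2; apply/funext => x; rewrite mul1r. Qed.

Lemma within_cmeas (phi : R -> C^o) : {within I01, continuous phi} -> cmeas phi.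
Proof.
move=> /subspace_continuousP pc.
have H (h : C -> R) : (forall z w, `|h z - h w| <= cmod (z - w)) -> measurable_fun I01 (fun x => h (phi x)).
  move=> hl; apply: subspace_continuous_measurable_fun => //.
  apply/subspace_continuousP => x xI; apply/cvgrPdist_lt => e e0.
  have /cvgCP/(_ e e0) := pc x xI; apply: filterS => y; apply: le_lt_trans; exact: hl.
split.
  by apply: H => z w; rewrite -ReB; exact: cmod_Re.
by apply: H => z w; apply: le_trans (cmod_Im _); case: z; case: w.
Qed.

End Multiplication.

(** * Von Neumann's inequality on polynomials *)

Section PolyIntegral.

(** At index 0 the division by [0%:R] yields 0, so this is the antiderivative that vanishes at 0. *)
Definition prim (F : fieldType) (p : {poly F}) : {poly F} :=
  \poly_(i < (size p).+1) (p`_i.-1 / i%:R).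

Lemma coef_prim (F : fieldType) (p : {poly F}) i : (prim p)`_i = p`_i.-1 / i%:R.
Proof.
rewrite coef_poly; case: ltnP => // h.
by case: i h => // i h; rewrite nth_default ?mul0r.
Qed.

Lemma primD (F : fieldType) (p q : {poly F}) : prim (p + q) = prim p + prim q.
Proof. by apply/polyP => i; rewrite coefD !coef_prim coefD mulrDl. Qed.

Lemma primZ (F : fieldType) c (p : {poly F}) : prim (c *: p) = c *: prim p.
Proof. by apply/polyP => i; rewrite coefZ !coef_prim coefZ mulrA. Qed.

Context {R : realType}.
Local Notation C := R[i].
Local Notation mu := (@lebesgue_measure R).

Lemma deriv_prim (p : {poly R}) : (prim p)^`() = p.
Proof.
apply/polyP => i; rewrite coef_deriv coef_prim -[_ *+ _]mulr_natr divfK ?pnatr_eq0//.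
Qed.

Lemma contitv_poly a b (p : {poly R}) : contitv a b (horner p).
Proof. by apply: continuous_subspaceT; exact: continuous_horner. Qed.

Lemma Rint_deriv (f F : R -> R) a b : a < b -> contitv a b f ->
  (forall x, x \in `[a, b] -> is_derive x 1 F (f x)) -> Rint a b f = F b - F a.
Proof.
move=> ab cf dF; rewrite /Rint /Rintegral (continuous_FTC2 (F := F))//.
- have cF x : x \in `[a, b] -> {for x, continuous F}.
    by move=> /dF[d _]; apply: differentiable_continuous; exact/derivable1_diffP.
  split.
  + by move=> x; rewrite in_itv /= => /andP[/ltW h1 /ltW h2]; have [] := dF x; rewrite ?in_itv /= ?h1.
  + by apply: cvg_at_right_filter; apply: cF; rewrite in_itv /= lexx ltW.
  + by apply: cvg_at_left_filter; apply: cF; rewrite in_itv /= lexx ltW.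
- move=> x; rewrite in_itv /= => /andP[/ltW h1 /ltW h2]; rewrite derive1E.
  have xab : x \in `[a, b] by rewrite in_itv /= h1.
  by have [_ ->] := dF x xab.
Qed.

Lemma Rint_poly (p : {poly R}) x : 0 <= x -> Rint 0 x (horner p) = (prim p).[x].
Proof.
rewrite le_eqVlt => /predU1P[<-|x0].
  by rewrite /Rint set_itv1 Rintegral_set1 horner_coef0 coef_prim invr0 mulr0.
have H y : y \in `[0, x] -> is_derive y 1 (horner (prim p)) p.[y].
  by move=> _; have := is_derive_poly (prim p) y; rewrite deriv_prim.
rewrite (Rint_deriv x0 (@contitv_poly 0 x p) H).
by rewrite horner_coef0 coef_prim invr0 mulr0 subr0.
Qed.

Definition pfun (p : {poly C}) (x : R) : C := p.[x%:C%C].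
Definition pL2 (p : {poly C}) : L2 R := toL2 (pfun p).
Definition rep (p : {poly C}) : {poly R} := \poly_(i < size p) complex.Re p`_i.
Definition imp (p : {poly C}) : {poly R} := \poly_(i < size p) complex.Im p`_i.

Lemma coef_rep p i : (rep p)`_i = complex.Re p`_i.
Proof. by rewrite coef_poly; case: ltnP => // h; rewrite nth_default. Qed.
Lemma coef_imp p i : (imp p)`_i = complex.Im p`_i.
Proof. by rewrite coef_poly; case: ltnP => // h; rewrite nth_default. Qed.

Lemma ReMreal (z : C) (x : R) : complex.Re (z * x%:C%C) = complex.Re z * x.
Proof. by case: z => a b /=; rewrite mulr0 subr0. Qed.
Lemma ImMreal (z : C) (x : R) : complex.Im (z * x%:C%C) = complex.Im z * x.
Proof. by case: z => a b /=; rewrite mulr0 add0r. Qed.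
Lemma Im_sum (I : Type) (s : seq I) (P : pred I) (F : I -> C) :
  complex.Im (\sum_(i <- s | P i) F i) = \sum_(i <- s | P i) complex.Im (F i).
Proof. by elim/big_rec2: _ => // i y x _ <-; case: x; case: (F i). Qed.

Lemma Re_pfun p x : complex.Re (pfun p x) = (rep p).[x].
Proof.
rewrite /pfun horner_coef Re_sum (@horner_coef_wide _ (size p)) ?size_poly//.
by apply: eq_bigr => i _; rewrite -rmorphXn ReMreal coef_rep.
Qed.
Lemma Im_pfun p x : complex.Im (pfun p x) = (imp p).[x].
Proof.
rewrite /pfun horner_coef Im_sum (@horner_coef_wide _ (size p)) ?size_poly//.
by apply: eq_bigr => i _; rewrite -rmorphXn ImMreal coef_imp.
Qed.

Lemma Re_div_nat (z : C) n : complex.Re (z / n%:R) = complex.Re z / n%:R.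
Proof. by rewrite -(rmorph_nat (real_complex R)) -fmorphV ReMreal. Qed.
Lemma Im_div_nat (z : C) n : complex.Im (z / n%:R) = complex.Im z / n%:R.
Proof. by rewrite -(rmorph_nat (real_complex R)) -fmorphV ImMreal. Qed.

Lemma rep_prim p : rep (prim p) = prim (rep p).
Proof. by apply/polyP => i; rewrite coef_rep !coef_prim coef_rep Re_div_nat. Qed.
Lemma imp_prim p : imp (prim p) = prim (imp p).
Proof. by apply/polyP => i; rewrite coef_imp !coef_prim coef_imp Im_div_nat. Qed.

Lemma cintegral_poly p x : 0 <= x -> cintegral `[0, x] (pfun p) = pfun (prim p) x.
Proof.
move=> x0; apply/eqP; rewrite eq_complex; apply/andP; split; apply/eqP => /=.
  rewrite Re_pfun rep_prim -Rint_poly// /Rint; apply: eq_Rintegral => y _.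
  exact: Re_pfun.
rewrite Im_pfun imp_prim -Rint_poly// /Rint; apply: eq_Rintegral => y _.
exact: Im_pfun.
Qed.

Lemma poly_bounded p : exists2 B : R, 0 <= B & forall x, I01 x -> cmod (pfun p x) <= B.
Proof.
exists (\sum_(i < size p) cmod p`_i).
  by apply: sumr_ge0 => i _; exact: cmod_ge0.
move=> x; rewrite /I01 /= in_itv /= => /andP[x0 x1].
rewrite /pfun horner_coef (le_trans (cmod_sum _ _ _))//; apply: ler_sum => i _.
by rewrite cmodM cmodX cmod_real ger0_norm// ler_piMr ?cmod_ge0// exprn_ile1.
Qed.

Lemma cmeas_poly p : cmeas (pfun p).
Proof.
split.
  rewrite (_ : (fun _ => _) = horner (rep p)); last by apply/funext => x; exact: Re_pfun.
  by apply: measurable_funTS; apply: continuous_measurable_fun; exact: continuous_horner.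
rewrite (_ : (fun _ => _) = horner (imp p)); last by apply/funext => x; exact: Im_pfun.
by apply: measurable_funTS; apply: continuous_measurable_fun; exact: continuous_horner.
Qed.

Lemma bmeas_poly p : exists M, bmeas (pfun p) M.
Proof. by have [B B0 hB] := poly_bounded p; exists B; split => //; exact: cmeas_poly. Qed.

Lemma sqint_const1 : @sqint R (fun=> 1).
Proof.
split; [exact: measurable_cst|exact: measurable_cst|].
rewrite integral_cst//=; last exact: measurable_itv.
rewrite [X in (_ * X)%E](_ : _ = 1%:E); last exact: measure_0x.
by rewrite -EFinM ltry.
Qed.

Lemma sqint_poly p : sqint (pfun p).
Proof.
have [M b] := bmeas_poly p; have := (sqint_mul b sqint_const1).1.
by under [X in sqint X -> _]eq_fun do rewrite mulr1.
Qed.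

Lemma pL2D p q : pL2 (p + q) = pL2 p + pL2 q.
Proof.
rewrite /pL2 -(toL2D (sqint_poly p) (sqint_poly q)); congr toL2; apply/funext => x.
by rewrite /pfun hornerD.
Qed.

Lemma pL2Z c p : pL2 (c *: p) = c *: pL2 p.
Proof.
rewrite /pL2 -(toL2Z c (sqint_poly p)); congr toL2; apply/funext => x.
by rewrite /pfun hornerZ.
Qed.

Lemma pL2B p q : pL2 (p - q) = pL2 p - pL2 q.
Proof. by rewrite pL2D -scaleN1r pL2Z scaleN1r. Qed.

(* The Gram form of the monomials in L^2[0, 1] is the Hilbert matrix. *)
Definition ip (p q : {poly C}) : C :=
  \sum_(i < size p) \sum_(j < size q) p`_i * (q`_j)^*%C / (i + j).+1%:R.

Lemma ip_wide N M (p q : {poly C}) : (size p <= N)%N -> (size q <= M)%N ->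
  ip p q = \sum_(i < N) \sum_(j < M) p`_i * (q`_j)^*%C / (i + j).+1%:R.
Proof.
move=> pN qM; rewrite /ip (big_ord_widen _ (fun i => \sum_(j < size q) p`_i * (q`_j)^*%C / (i + j).+1%:R) pN).
rewrite big_mkcond; apply: eq_bigr => i _; case: ltnP => ip; last first.
  by rewrite big1// => j _; rewrite nth_default// mul0r mul0r.
rewrite (big_ord_widen _ (fun j => p`_i * (q`_j)^*%C / (i + j).+1%:R) qM) big_mkcond.
apply: eq_bigr => j _; case: ltnP => jq //.
by rewrite [q`_j]nth_default// conjc0 mulr0 mul0r.
Qed.

(** [r] is the real polynomial that equals [|p|^2] on the real line; integrating its monomials
    produces the entries [1 / (i + j + 1)]. *)
Lemma L2norm_poly p : L2norm (pL2 p) ^+ 2 = complex.Re (ip p p).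
Proof.
rewrite L2norm_toL2; last exact: sqint_poly.
pose r : {poly R} := \sum_(i < size p) \sum_(j < size p) complex.Re (p`_i * (p`_j)^*%C) *: 'X^(i + j).
have E x : sqmod (pfun p x) = r.[x].
  rewrite -cmod_sqr -[LHS]/(complex.Re ((cmod (pfun p x) ^+ 2)%:C%C)) -mulcJE {2}/pfun horner_coef.
  rewrite /pfun horner_coef conj_sum mulr_suml Re_sum horner_sum; apply: eq_bigr => i _.
  rewrite mulr_sumr Re_sum horner_sum; apply: eq_bigr => j _.
  rewrite hornerZ hornerXn -ReMreal rmorphXn exprD conjM conjX conjc_real; congr complex.Re; ring.
have pr c k : (prim (c *: 'X^k)).[1] = c / k.+1%:R :> R.
  rewrite primZ hornerZ; congr (_ * _).
  rewrite (_ : prim _ = (k.+1%:R^-1) *: 'X^(k.+1)); first by rewrite hornerZ hornerXn expr1n mulr1.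
  apply/polyP => i; rewrite coefZ coef_prim !coefXn; case: i => [|i] /=.
    by rewrite invr0 !mulr0.
  by rewrite eqSS; case: eqP => [->|_]; rewrite ?mul1r ?mulr1 ?mul0r ?mulr0.
have ps (I : Type) (s : seq I) (F : I -> {poly R}) : (prim (\sum_(i <- s) F i)).[1] = \sum_(i <- s) (prim (F i)).[1].
  elim: s => [|i s IH]; last by rewrite !big_cons primD hornerD IH.
  by rewrite !big_nil (_ : prim 0 = 0) ?horner0//; apply/polyP => i; rewrite coef_prim !coef0 mul0r.
have -> : complex.Re (ip p p) = (prim r).[1].
  rewrite /ip Re_sum ps; apply: eq_bigr => i _; rewrite Re_sum ps; apply: eq_bigr => j _.
  by rewrite pr Re_div_nat.
rewrite -Rint_poly// -[LHS]/(fine (sqnorm (pfun p) ^+ 2)%:E) -sqnormE; last exact: sqint_poly.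
by congr fine; apply: eq_integral => x _; rewrite E.
Qed.

Definition mean (p : {poly C}) : C := \sum_(i < size p) p`_i / i.+1%:R.

Lemma mean_wide N (p : {poly C}) : (size p <= N)%N -> mean p = \sum_(i < N) p`_i / i.+1%:R.
Proof.
move=> pN; rewrite /mean (big_ord_widen _ (fun i => p`_i / i.+1%:R) pN) big_mkcond.
by apply: eq_bigr => i _; case: ltnP => // h; rewrite nth_default ?mul0r.
Qed.

(** The Hardy operator on polynomials, as [hardy_pL2] shows. It acts on coefficients, so its norm
    bound precedes Hardy's inequality on L^2, which is deduced from it. *)
Definition hpoly (p : {poly C}) : {poly C} := \poly_(i < size p) (p`_i / i.+1%:R).
Definition cpoly (p : {poly C}) : {poly C} := p - hpoly p.

Lemma coef_hpoly p i : (hpoly p)`_i = p`_i / i.+1%:R.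
Proof. by rewrite coef_poly; case: ltnP => // h; rewrite nth_default ?mul0r. Qed.

Lemma prim_hpoly p : prim p = hpoly p * 'X.
Proof.
apply/polyP => i; rewrite coef_prim coefMX; case: i => [|i] /=; first by rewrite invr0 mulr0.
by rewrite coef_hpoly.
Qed.

Lemma size_cpoly p : (size (cpoly p) <= size p)%N.
Proof. by rewrite (leq_trans (size_polyD _ _))// geq_max leqnn size_polyN size_poly. Qed.

(* Polarized form of [|(1 - H) p|^2 = |p|^2 - |mean p|^2]. *)
Lemma ip_cpoly p q : ip (cpoly p) (cpoly q) = ip p q - mean p * (mean q)^*%C.
Proof.
rewrite (ip_wide (size_cpoly p) (size_cpoly q)) /ip /mean conj_sum mulr_suml -sumrB.
apply: eq_bigr => i _; rewrite mulr_sumr -sumrB; apply: eq_bigr => j _.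
rewrite /cpoly !coefB !coef_hpoly.
have cD (z : C) n : (z / n%:R)^*%C = z^*%C / n%:R by rewrite conjM conjc_inv conjc_nat.
have cB (z w : C) : (z - w)^*%C = z^*%C - w^*%C by exact: rmorphB.
rewrite cB !cD.
have n0 k : k.+1%:R != 0 :> C by rewrite pnatr_eq0.
(* With [a = i + 1] and [b = j + 1] the third denominator is [a + b - 1], and the entrywise identity
   is [(a - 1) (b - 1) = a b - (a + b - 1)]. *)
have -> : (i + j).+1%:R = i.+1%:R + j.+1%:R - 1 :> C by rewrite -natrD addnS addSn -[in RHS]natr1 addrK.
have := n0 (i + j)%N; have := n0 i; have := n0 j.
rewrite -[(i + j).+1%:R]/(_) (_ : (i + j).+1%:R = i.+1%:R + j.+1%:R - 1 :> C); last first.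
  by rewrite -natrD addnS addSn -[in RHS]natr1 addrK.
move: (i.+1%:R : C) (j.+1%:R : C) => a b b0 a0 ab0; field.
by rewrite ab0 a0 b0.
Qed.

Lemma ipDl p p' q : ip (p + p') q = ip p q + ip p' q.
Proof.
pose N := maxn (size (p + p')) (maxn (size p) (size p')).
rewrite !(@ip_wide N (size q)) ?leq_max ?leqnn ?orbT// -big_split; apply: eq_bigr => i _ /=.
by rewrite -big_split; apply: eq_bigr => j _ /=; rewrite coefD !mulrDl.
Qed.

Lemma ipZl (c : C) p q : ip (c *: p) q = c * ip p q.
Proof.
rewrite (@ip_wide (size p) (size q)) ?size_scale_leq// /ip mulr_sumr.
apply: eq_bigr => i _; rewrite mulr_sumr; apply: eq_bigr => j _.
by rewrite coefZ !mulrA.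
Qed.

Lemma ipC p q : ip q p = (ip p q)^*%C.
Proof.
rewrite /ip conj_sum exchange_big; apply: eq_bigr => i _ /=; rewrite conj_sum.
apply: eq_bigr => j _; rewrite !conjM conjc_inv conjc_nat conjcK addnC.
by rewrite [q`_j * _]mulrC.
Qed.

Lemma ip_suml (n : nat) (a : nat -> C) (x : nat -> {poly C}) q :
  ip (\sum_(j < n) a j *: x j) q = \sum_(j < n) a j * ip (x j) q.
Proof.
elim: n => [|n IH]; last by rewrite !big_ord_recr /= ipDl ipZl IH.
by rewrite !big_ord0 /ip size_poly0 big_ord0.
Qed.

Lemma ip_sum (n : nat) (a : nat -> C) (x : nat -> {poly C}) :
  ip (\sum_(j < n) a j *: x j) (\sum_(j < n) a j *: x j) =
  \sum_(j < n) \sum_(k < n) a j * (a k)^*%C * ip (x j) (x k).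
Proof.
rewrite ip_suml; apply: eq_bigr => j _; rewrite ipC ip_suml conj_sum mulr_sumr.
by apply: eq_bigr => k _; rewrite conjM -ipC mulrA.
Qed.

Lemma ip_ge0 p : 0 <= complex.Re (ip p p).
Proof. by rewrite -L2norm_poly sqr_ge0. Qed.

Lemma norm_sq_le (m u v a b : R) : u ^+ 2 = a -> v ^+ 2 = b -> 0 <= u -> 0 <= v -> 0 <= m ->
  a <= m ^+ 2 * b -> u <= m * v.
Proof.
by move=> <- <- u0 v0 m0; rewrite -exprMn ler_pXn2r// nnegrE mulr_ge0.
Qed.

(* [e i j] records the coordinates that the isometric dilation of [1 - H]
   adds to the [j]-th iterate of [f]. *)
Lemma von_neumann_poly (a f : {poly C}) (m : R) :
  (forall z, cmod z = 1 -> cmod a.[z] <= m) ->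
  L2norm (pL2 (\sum_(j < size a) a`_j *: iter j cpoly f)) <= m * L2norm (pL2 f).
Proof.
move=> am; have m0 : 0 <= m by apply: le_trans (am 1 cmod1); exact: cmod_ge0.
pose x j := iter j cpoly f.
pose e i j := if (i < j)%N then mean (x (j.-1 - i)%N) else 0.
(* Gram matrix of the iterates of [f] under the isometry sending [(f, a_0, a_1, ...)] to
   [((1 - H) f, mean f, a_0, a_1, ...)]; the [j]-th iterate has no coordinate of index [j] or
   more. *)
pose c j k := ip (x j) (x k) + \sum_(i < j) e i j * (e i k)^*%C.
have cN N j k : (j <= N)%N -> c j k = ip (x j) (x k) + \sum_(i < N) e i j * (e i k)^*%C.
  move=> jN; congr (_ + _).
  rewrite (big_ord_widen _ (fun i => e i j * (e i k)^*%C) jN) big_mkcond.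
  by apply: eq_bigr => i _; rewrite /e; case: ltnP => // _; rewrite mul0r.
(* The new coordinate adds the product of the means that [ip_cpoly] subtracts. *)
have cS j k : c j.+1 k.+1 = c j k.
  rewrite /c /= ip_cpoly big_ord_recl /e /= !subn0 subrKA; congr (_ + _).
  apply: eq_bigr => i _; rewrite /bump /= add1n !ltnS.
  by congr (_ * conjc _); case: ltnP => // h; rewrite subnS -predn_sub.
have cge N (b : nat -> C) : 0 <= complex.Re (\sum_(j < N) \sum_(k < N) b j * (b k)^*%C * c j k).
  have -> : \sum_(j < N) \sum_(k < N) b j * (b k)^*%C * c j k =
     ip (\sum_(j < N) b j *: x j) (\sum_(j < N) b j *: x j) +
     \sum_(i < N) (\sum_(j < N) b j * e i j) * (\sum_(j < N) b j * e i j)^*%C.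
    rewrite ip_sum.
    under [X in _ + X]eq_bigr do rewrite mulr_suml.
    rewrite [X in _ + X]exchange_big -big_split; apply: eq_bigr => j _ /=.
    under [X in _ + X]eq_bigr do rewrite conj_sum mulr_sumr.
    rewrite [X in _ + X]exchange_big -big_split; apply: eq_bigr => k _ /=.
    rewrite (cN N) ?(ltnW (ltn_ord _))// mulrDr; congr (_ + _); rewrite mulr_sumr.
    by apply: eq_bigr => i _; rewrite conjM; ring.
  rewrite ReD addr_ge0 ?ip_ge0// Re_sum sumr_ge0// => i _.
  by rewrite mulcJE /= sqr_ge0.
have := toeplitz_bound cS cge am; rewrite {2}/c big_ord0 addr0 => tb.
apply: norm_sq_le (L2norm_poly _) (L2norm_poly f) _ _ m0 _; try exact: L2norm_ge0.
apply: le_trans tb.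
(* Forgetting the added coordinates can only decrease the norm. *)
rewrite (ip_sum (size a) (fun j => a`_j) x) !Re_sum; apply: le_trans (_ : 
  complex.Re (\sum_(j < size a) \sum_(k < size a) a`_j * (a`_k)^*%C * ip (x j) (x k)) +
  complex.Re (\sum_(i < size a) (\sum_(j < size a) a`_j * e i j) * (\sum_(j < size a) a`_j * e i j)^*%C) <= _).
  rewrite -!Re_sum lerDl Re_sum sumr_ge0// => i _.
  by rewrite mulcJE /= sqr_ge0.
rewrite -ReD le_eqVlt; apply/orP; left; apply/eqP; rewrite -Re_sum; congr complex.Re.
under [X in _ + X = _]eq_bigr do rewrite mulr_suml.
rewrite [X in _ + X = _]exchange_big -big_split; apply: eq_bigr => j _ /=.
under [X in _ + X = _]eq_bigr do rewrite conj_sum mulr_sumr.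
rewrite [X in _ + X = _]exchange_big -big_split; apply: eq_bigr => k _ /=.
rewrite (cN (size a)) ?(ltnW (ltn_ord _))// mulrDr; congr (_ + _); rewrite mulr_sumr.
by apply: eq_bigr => i _; rewrite conjM; ring.
Qed.

Lemma cpoly_contraction f : L2norm (pL2 (cpoly f)) <= L2norm (pL2 f).
Proof.
have := norm_sq_le (L2norm_poly (cpoly f)) (L2norm_poly f) (L2norm_ge0 _) (L2norm_ge0 _) ler01.
rewrite mul1r; apply; rewrite expr1n mul1r ip_cpoly ReB.
by rewrite gerBl mulcJE /= sqr_ge0.
Qed.

(** Hardy's inequality on polynomials: [H = 1 - C] with [C] a contraction. *)
Lemma hpoly_bound f : L2norm (pL2 (hpoly f)) <= 2 * L2norm (pL2 f).
Proof.
have -> : hpoly f = f - cpoly f by rewrite /cpoly opprB addrC subrK.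
rewrite (pL2B f (cpoly f)); apply: le_trans (L2normB _ _) _.
have := cpoly_contraction f.
by move: (L2norm (pL2 (cpoly f))) (L2norm (pL2 f)) => a b; lra.
Qed.

End PolyIntegral.

(** * Density of polynomials in L^2 *)

Section Bernstein.
Context {R : realType}.

(** De Casteljau's recursion: monotonicity, linearity and the variance all follow by induction,
    without binomial sums. *)
Fixpoint bernstein n (h : nat -> R) : {poly R} :=
  if n is m.+1 then (1 - 'X) * bernstein m h + 'X * bernstein m (fun k => h k.+1)
  else (h 0%N)%:P.

Lemma bernsteinS n h x : (bernstein n.+1 h).[x] =
  (1 - x) * (bernstein n h).[x] + x * (bernstein n (fun k => h k.+1)).[x].
Proof. by rewrite /= hornerD !hornerM hornerD hornerN hornerX hornerC. Qed.

Lemma bernstein_le n h h' x : 0 <= x <= 1 -> (forall k, (k <= n)%N -> h k <= h' k) ->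
  (bernstein n h).[x] <= (bernstein n h').[x].
Proof.
move=> /andP[x0 x1]; elim: n h h' => [|n IH] h h' hh; first by rewrite !hornerC hh.
rewrite !bernsteinS lerD// ler_wpM2l ?subr_ge0//; apply: IH => k kn; apply: hh => //.
exact: leqW.
Qed.

Lemma bernstein_lin n h h' a b c x :
  (bernstein n (fun k => a * h k + b * h' k + c)).[x] =
  a * (bernstein n h).[x] + b * (bernstein n h').[x] + c.
Proof.
elim: n h h' => [|n IH] h h'; first by rewrite !hornerC.
by rewrite !bernsteinS !IH; ring.
Qed.

(** The free center [c] absorbs the shift of the index in the recursion. *)
Lemma bernstein_variance n c x :
  (bernstein n (fun k => (k%:R - c) ^+ 2)).[x] = (n%:R * x - c) ^+ 2 + n%:R * (x * (1 - x)).
Proof.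
elim: n c => [|n IH] c; first by rewrite hornerC !mul0r addr0.
have E : (fun k => (k.+1%:R - c) ^+ 2) = (fun k => (k%:R - (c - 1)) ^+ 2).
  by apply/funext => k; rewrite -natr1; ring.
by rewrite bernsteinS IH E IH -natr1; ring.
Qed.

Lemma uniform_continuity_real (g : R -> R) : continuous g ->
  forall e : R, 0 < e -> exists2 d : R, 0 < d &
  forall x y, 0 <= x <= 1 -> 0 <= y <= 1 -> `|x - y| < d -> `|g x - g y| < e.
Proof.
move=> gc e e0; have e2 : 0 < e / 2 by lra.
have cov : near_covering (`[0, 1]%classic : set R).
  by apply/compact_near_coveringP; exact: segment_compact.
have : \forall d \near (0 : R)^'+, `[0, 1]%classic `<=` (fun x => forall y, `|x - y| < d -> `|g x - g y| < e).
  apply: cov => x xI; have /cvgrPdist_lt/(_ _ e2) := gc x.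
  rewrite -nbhs_nearE => /nbhs_ballP[d /= d0 hd].
  exists (ball x (d / 2), [set t | t < d / 2]) => /=.
    split; first by apply: nbhsx_ballx; lra.
    by apply: nbhs_right_lt; lra.
  move=> [y t] /= [yx td] w yw.
  have h1 : `|x - w| < d.
    have := ler_normD (x - y) (y - w); rewrite subrKA; rewrite /ball /= in yx; lra.
  have h2 : `|x - y| < d by rewrite /ball /= in yx; lra.
  have := hd _ h1; have := hd _ h2 => /= H1 H2.
  have := ler_normD (g y - g x) (g x - g w); rewrite subrKA [`|g y - g x|]distrC => H3.
  by move: H1 H2 H3; move: `|_ - _| `|_ - _| `|_ - _| => a b c; lra.
move=> [d /= d0 hd]; exists (d / 2); first by lra.
move=> x y xI _ xy; apply: (hd (d / 2)) xy => /=.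
- by rewrite sub0r normrN gtr0_norm; lra.
- by lra.
- by rewrite in_itv.
Qed.

(** Monotonicity carries the bound [e / 2 + c (x - y)^2] on the increments of [g] through the
    Bernstein operator, whose variance is [x (1 - x) / n]. *)
Lemma weierstrass (g : R -> R) (N : R) : continuous g -> (forall x, `|g x| <= N) ->
  forall e : R, 0 < e -> exists p : {poly R}, forall x, 0 <= x <= 1 -> `|p.[x] - g x| <= e.
Proof.
move=> gc gN e e0; have e2 : 0 < e / 2 by lra.
have [d d0 hd] := uniform_continuity_real gc e2.
have N0 : 0 <= N by apply: le_trans (gN 0).
pose c := 2 * N / d ^+ 2.
have c0 : 0 <= c by apply: divr_ge0; [apply: mulr_ge0|exact: sqr_ge0].
have key x y : 0 <= x <= 1 -> 0 <= y <= 1 -> `|g x - g y| <= e / 2 + c * (x - y) ^+ 2.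
  move=> xI yI; have [xy|xy] := ltP `|x - y| d.
    by apply: le_trans (ltW (hd _ _ xI yI xy)) _; rewrite lerDl mulr_ge0 ?sqr_ge0.
  apply: le_trans (_ : 2 * N <= _).
    by have := ler_normB (g x) (g y); have := gN x; have := gN y; lra.
  have : d ^+ 2 <= (x - y) ^+ 2 by rewrite -[leRHS]real_normK ?num_real// lerXn2r ?nnegrE// ltW.
  move=> h; apply: ler_wpDl; first exact: ltW.
  rewrite /c mulrAC ler_pdivlMr ?exprn_gt0// ler_wpM2l// mulr_ge0//.
pose n := (Num.truncn (c / (e / 2))).+1.
have n0 : 0 < n%:R :> R by rewrite ltr0n.
have cn : c / n%:R <= e / 2.
  by rewrite ler_pdivrMr// -ler_pdivrMl// mulrC; apply: ltW; rewrite truncnS_gt.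
clearbody n c.
exists (bernstein n (fun k => g (k%:R / n%:R))) => x xI.
have kI k : (k <= n)%N -> 0 <= (k%:R / n%:R : R) <= 1.
  by move=> kn; rewrite divr_ge0//= ler_pdivrMr// mul1r ler_nat.
have var : (bernstein n (fun k => (k%:R / n%:R - x) ^+ 2)).[x] = x * (1 - x) / n%:R.
  (* The null summands only match the shape of [bernstein_lin]. *)
  have -> : (fun k => (k%:R / n%:R - x) ^+ 2) = (fun k => n%:R ^- 2 * (k%:R - n%:R * x) ^+ 2 + 0 * 0 + 0).
    by apply/funext => k; field; rewrite lt0r_neq0.
  rewrite (bernstein_lin n (fun k => (k%:R - n%:R * x) ^+ 2) (fun=> 0)) bernstein_variance.
  by field; rewrite lt0r_neq0.
have x1 : x * (1 - x) <= 1 by case/andP: xI => ? ?; nra.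
have sm : c * (x * (1 - x) / n%:R) <= e / 2.
  apply: le_trans cn; rewrite mulrA ler_pdivrMr// divfK ?lt0r_neq0//.
  by rewrite ler_piMr.
rewrite ler_norml; apply/andP; split.
  have := @bernstein_le n (fun k => - c * (k%:R / n%:R - x) ^+ 2 + 0 * 0 + (g x - e / 2)) (fun k => g (k%:R / n%:R)) x xI.
  rewrite (bernstein_lin n (fun k => (k%:R / n%:R - x) ^+ 2) (fun=> 0)) var => H.
  suff : forall k, (k <= n)%N -> - c * (k%:R / n%:R - x) ^+ 2 + 0 * 0 + (g x - e / 2) <= g (k%:R / n%:R).
    by move=> /H; lra.
  by move=> k kn; have := key _ _ (kI k kn) xI; rewrite ler_norml => /andP[+ _]; lra.
have := @bernstein_le n (fun k => g (k%:R / n%:R)) (fun k => c * (k%:R / n%:R - x) ^+ 2 + 0 * 0 + (g x + e / 2)) x xI.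
rewrite (bernstein_lin n (fun k => (k%:R / n%:R - x) ^+ 2) (fun=> 0)) var => H.
suff : forall k, (k <= n)%N -> g (k%:R / n%:R) <= c * (k%:R / n%:R - x) ^+ 2 + 0 * 0 + (g x + e / 2).
  by move=> /H; lra.
by move=> k kn; have := key _ _ (kI k kn) xI; rewrite ler_norml => /andP[_ +]; lra.
Qed.

End Bernstein.

(** Projection of [y] onto [[-N, N]] for [N >= 0], written with absolute values so that it is
    visibly continuous. *)
Definition clip (R : realType) (N y : R) : R := (`|y + N| - `|y - N|) / 2.

Lemma clip_le (R : realType) (N y : R) : 0 <= N -> `|clip N y| <= N.
Proof.
rewrite /clip ler_norml => N0.
by have [] := ger0P (y + N); have [] := ger0P (y - N) => ? ?; apply/andP; split; lra.
Qed.

Lemma clip_dist (R : realType) (N a y : R) : `|a| <= N -> `|a - clip N y| <= `|a - y|.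
Proof.
rewrite ler_norml => /andP[a1 a2]; rewrite ler_norml /clip.
by have [] := ger0P (y + N); have [] := ger0P (y - N); have [] := ger0P (a - y) => ? ? ?;
  apply/andP; split; lra.
Qed.

Section Density.
Context {R : realType}.
Local Notation C := R[i].
Local Notation mu := (@lebesgue_measure R).
Local Notation L2norm := (@L2norm R).

Let mI : measurable (I01 (R:=R)). Proof. exact: measurable_itv. Qed.
Hint Resolve mI : core.

Lemma measure_I01 : mu (I01 (R:=R)) = 1%:E.
Proof. exact: measure_0x. Qed.

(** Since [|c - a| <= 2 * N], its square is at most [2 * N * b]: boundedness turns an L^1 estimate
    into an L^2 estimate. *)
Lemma clip_estimate (N e a b c y : R) : `|c - a| <= b -> `|a| <= N -> `|c| <= N ->
  `|y - a| <= 1 -> `|y - a| <= e / 4 -> (c - y) ^+ 2 <= 4 * N * b + e / 2.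
Proof.
rewrite !ler_norml => /andP[? ?] /andP[? ?] /andP[? ?] /andP[? ?] /andP[? ?].
have H1 : (c - y) ^+ 2 <= 2 * (c - a) ^+ 2 + 2 * (y - a) ^+ 2.
  by have := sqr_ge0 (c - a + (y - a)); nra.
have H2 : (y - a) ^+ 2 <= e / 4.
  apply: (@le_trans _ _ `|y - a|); last by rewrite ler_norml; apply/andP.
  by rewrite -real_normK ?num_real// expr2 ler_piMl// ler_norml; apply/andP.
have H3 : (c - a) ^+ 2 <= 2 * N * b.
  rewrite -real_normK ?num_real// expr2 ler_pM// ler_norml; apply/andP; split; lra.
lra.
Qed.

(** Continuous functions approximate [f] in L^1; clipping them at [N] makes the approximation
    quadratic, and Weierstrass's theorem replaces them by polynomials. *)
Lemma poly_density_real (f : R -> R) (N : R) : measurable_fun I01 f -> 1 <= N ->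
  (forall x, I01 x -> `|f x| <= N) -> forall e : R, 0 < e ->
  exists p : {poly R}, (\int[mu]_(x in I01) ((f x - p.[x]) ^+ 2)%:E <= e%:E)%E.
Proof.
move=> mf N1 fN e e0.
have intf : mu.-integrable I01 (EFin \o f).
  apply: (@le_integrable _ _ _ mu I01 mI _ (EFin \o (fun=> N))).
  - exact/measurable_EFinP.
  - by move=> x xI; rewrite /= lee_fin (le_trans (fN x xI))// ler_norm.
  - by apply: contitv_integrable; exact: contitv_cst.
have fin : (mu (I01 (R:=R)) < +oo)%E by rewrite measure_I01 ltry.
have [g [gc gi g0]] := approximation_continuous_integrable mI fin intf.
pose d := e / (8 * N).
have d0 : 0 < d by rewrite divr_gt0//; lra.
have nb : nbhs (0 : \bar R)%E [set x | (x < d%:E)%E].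
  by apply: open_nbhs_nbhs; split; [exact: open_ereal_lt_ereal|rewrite /= lte_fin].
have [n _ /(_ n (leqnn n)) /= hn] := g0 _ nb.
have N0 : 0 <= N := le_trans ler01 N1.
have cc : continuous (clip N \o g n).
  move=> x; apply: (@cvgM R _ _ _ _ (fun=> 2^-1)); last exact: cvg_cst.
  apply: cvgB; apply: cvg_norm.
    by apply: cvgD; [exact: gc|exact: cvg_cst].
  by apply: cvgB; [exact: gc|exact: cvg_cst].
have h0 : 0 < Num.min 1 (e / 4) by rewrite lt_min; apply/andP; split; lra.
have [p hp] := weierstrass cc (fun x => clip_le (g n x) N0) h0.
exists p.
have mfp : measurable_fun I01 (fun x => ((f x - p.[x]) ^+ 2)%:E).
  apply/measurable_EFinP/measurable_funX/measurable_funB => //.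
  by apply: measurable_funTS; apply: continuous_measurable_fun; exact: continuous_horner.
have mfg : measurable_fun I01 (fun x => `|(f x - g n x)%:E|%E).
  apply: measurableT_comp => //; apply/measurable_EFinP/measurable_funB => //.
  by apply: measurable_funTS; apply: continuous_measurable_fun; exact: gc.
apply: le_trans (_ : (\int[mu]_(x in I01) ((4 * N)%:E * `|(f x - g n x)%:E| + (e / 2)%:E) <= _)%E).
  apply: ge0_le_integral => //.
  - by move=> x _; rewrite lee_fin sqr_ge0.
  - apply: emeasurable_funD; last exact: measurable_cst.
    exact: measurable_funeM.
  move=> x xI; rewrite -EFinM -EFinD lee_fin.
  have xI' : 0 <= x <= 1 by move: xI; rewrite /I01 /= in_itv.
  have := hp x xI'; rewrite le_min => /andP[/= h1 h2].
  have h3 := clip_dist (g n x) (fN x xI); have h4 := clip_le (g n x) N0; have h5 := fN x xI.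
  exact: clip_estimate h3 h4 h5 h1 h2.
rewrite ge0_integralD//; last 3 first.
- by move=> x _; rewrite mule_ge0// lee_fin; lra.
- exact: measurable_funeM.
- by move=> x _; rewrite lee_fin; lra.
rewrite ge0_integralZl_EFin//; last by lra.
rewrite integral_cst// [X in (_ + _ * X <= _)%E]measure_I01 mule1.
apply: le_trans (_ : ((4 * N)%:E * d%:E + (e / 2)%:E <= _)%E).
  by rewrite leeD2r// lee_wpmul2l//; [rewrite lee_fin; lra|exact: ltW].
rewrite -EFinM -EFinD lee_fin /d.
rewrite le_eqVlt; apply/orP; left; apply/eqP; field; lra.
Qed.

Lemma bmeas_indic (A : set R) : measurable A -> bmeas (fun x => (\1_A x : R)%:C%C) 1.
Proof.
move=> mA; split => //.
  by split => /=; [exact: measurable_indic|exact: measurable_cst].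
by move=> x _; rewrite cmod_real indicE; case: (_ \in _); rewrite ?normr1 ?normr0.
Qed.

(** Dominated convergence along the sets where [|f|^2 <= n]. *)
Lemma truncation (f : R -> C) (e : R) : sqint f -> 0 < e ->
  exists (A : set R) (N : R), [/\ measurable A, A `<=` I01, forall x, A x -> sqmod (f x) <= N &
  sqnorm (fun x => f x - (\1_A x : R)%:C%C * f x) <= e].
Proof.
move=> sf e0.
pose A n := I01 `&` [set x | ((sqmod (f x))%:E <= n%:R%:E)%E].
have mA n : measurable (A n) by apply: emeasurable_fun_infty_c => //; exact: measurable_sqmod.
pose F n x := (sqmod (f x - (\1_(A n) x : R)%:C%C * f x))%:E.
have sF n : sqint (fun x => f x - (\1_(A n) x : R)%:C%C * f x).
  by apply: sqintB => //; exact: (sqint_mul (bmeas_indic (mA n)) sf).1.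
have FA n x : A n x -> F n x = 0%E.
  by move=> Ax; rewrite /F indicE mem_set// mul1r subrr /sqmod /= expr0n addr0.
have FnA n x : ~ A n x -> F n x = (sqmod (f x))%:E.
  by move=> Ax; rewrite /F indicE memNset// mul0r subr0.
have : (\int[mu]_(x in I01) F n x)%E @[n --> \oo] --> (\int[mu]_(x in I01) 0)%E.
  apply: (@dominated_cvg _ _ R (@lebesgue_measure R) _ mI F (fun=> 0%E) (fun x => (sqmod (f x))%:E)).
  - by move=> n; exact: measurable_sqmod.
  - move=> x xI; apply: cvg_near_cst; exists (Num.truncn (sqmod (f x))).+1 => // n /= hn; apply: FA; split => //=.
    rewrite lee_fin; apply: le_trans (ltW (truncnS_gt _)) _; by rewrite ler_nat.
  - by [].
  - apply/integrableP; split; first exact: measurable_sqmod.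
    under eq_integral do rewrite gee0_abs ?lee_fin ?sqmod_ge0//.
    by case: sf.
  - move=> n x xI; have [Ax|Ax] := pselect (A n x).
      by rewrite FA// abse0 lee_fin sqmod_ge0.
    by rewrite FnA// gee0_abs// lee_fin sqmod_ge0.
rewrite integral0 => /(_ [set x | (x < (e ^+ 2)%:E)%E]) [].
  by apply: open_nbhs_nbhs; split; [exact: open_ereal_lt_ereal|rewrite /= lte_fin exprn_gt0].
move=> n _ /(_ n (leqnn n)) /= hn; exists (A n), n%:R; split => //.
- by move=> x [].
- by move=> x [_] /=; rewrite lee_fin.
- by apply: sqnorm_le; exact: ltW.
Qed.

Lemma horner_real_complex (p : {poly R}) (x : R) :
  (map_poly (real_complex R) p).[x%:C%C] = (p.[x])%:C%C.
Proof. exact: (horner_map (real_complex R)). Qed.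

Lemma poly_density (u : L2 R) (e : R) : 0 < e -> exists p, L2norm (u - pL2 p) <= e.
Proof.
move=> e0; have e2 : 0 < e / 2 by lra.
have [A [N [mA AI AN le1]]] := truncation (L2_sqint u) e2.
pose f x : C := (\1_A x : R)%:C%C * u x.
have sf : sqint f by exact: (sqint_mul (bmeas_indic mA) (L2_sqint u)).1.
pose M := `|N| + 1.
have M1 : 1 <= M by rewrite lerDr.
have fM x : cmod (f x) <= M.
  rewrite /f indicE; case: (pselect (A x)) => [Ax|nAx]; last first.
    by rewrite memNset// mul0r cmod0; lra.
  rewrite mem_set// mul1r.
  have := AN x Ax; rewrite -cmod_sqr; have := cmod_ge0 (u x); have := ler_norm N.
  by rewrite /M; move: `|N| (cmod _) => a b; nra.
have [mr mi _] := sf.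
have d0 : 0 < (e / 2) ^+ 2 / 2 by rewrite divr_gt0// exprn_gt0.
have [p hp] := poly_density_real mr M1 (fun x _ => le_trans (cmod_Re _) (fM x)) d0.
have [q hq] := poly_density_real mi M1 (fun x _ => le_trans (cmod_Im _) (fM x)) d0.
pose P := map_poly (real_complex R) p + (0 +i* 1)%C *: map_poly (real_complex R) q.
have PE x : pfun P x = (p.[x] +i* q.[x])%C.
  rewrite /pfun hornerD hornerZ !horner_real_complex /=.
  by apply/eqP; rewrite eq_complex /= !mul0r !mul1r !(subr0, addr0, add0r) !eqxx.
exists P.
have sd : sqint (fun x => f x - pfun P x) by apply: sqintB => //; exact: sqint_poly.
have le2 : sqnorm (fun x => f x - pfun P x) <= e / 2.
  apply: sqnorm_le; first exact: ltW.
  rewrite (_ : (\int[mu]_(x in I01) _)%E = (\int[mu]_(x in I01) (((complex.Re (f x) - p.[x]) ^+ 2)%:E + ((complex.Im (f x) - q.[x]) ^+ 2)%:E))%E).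
    rewrite ge0_integralD//.
    - by rewrite [X in (_ <= X%:E)%E]splitr EFinD leeD.
    - by move=> x _; rewrite lee_fin sqr_ge0.
    - apply/measurable_EFinP/measurable_funX/measurable_funB => //.
      by apply: measurable_funTS; apply: continuous_measurable_fun; exact: continuous_horner.
    - by move=> x _; rewrite lee_fin sqr_ge0.
    - apply/measurable_EFinP/measurable_funX/measurable_funB => //.
      by apply: measurable_funTS; apply: continuous_measurable_fun; exact: continuous_horner.
  by apply: eq_integral => x _; rewrite -EFinD PE; case: (f x).
apply: le_trans (L2norm_dist (toL2 f) _ _) _; rewrite [e]splitr; apply: lerD.
  by rewrite -{1}(toL2_id u) -(toL2B (L2_sqint u) sf) L2norm_toL2//; apply: sqintB => //; exact: L2_sqint.
by rewrite -(toL2B sf (sqint_poly P)) L2norm_toL2.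
Qed.

End Density.

(** * The Hardy operator *)

Section PolyOp.
Variables (K : comNzRingType).

Section Linear.
Variables (V W : lmodType K) (T : V -> W).
Hypothesis lT : linear T.

Lemma linear_map0 : T 0 = 0.
Proof. by have := lT (-1) 0 0; rewrite scaler0 addr0 scaleN1r addNr. Qed.

Lemma linear_mapD u v : T (u + v) = T u + T v.
Proof. by rewrite -[u in LHS]scale1r lT scale1r. Qed.

Lemma linear_mapZ c u : T (c *: u) = c *: T u.
Proof. by rewrite -[c *: u]addr0 lT linear_map0 addr0. Qed.

Lemma linear_mapB u v : T (u - v) = T u - T v.
Proof. by rewrite addrC -scaleN1r lT scaleN1r addrC. Qed.

Lemma linear_map_sum (I : Type) (s : seq I) (P : pred I) (F : I -> V) :
  T (\sum_(i <- s | P i) F i) = \sum_(i <- s | P i) T (F i).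
Proof.
by elim/big_rec2: _ => [|i x y _ <-]; [exact: linear_map0|exact: linear_mapD].
Qed.
End Linear.

(** The body of [poly_op] over any module, so that it applies both to [hardy] and to [hpoly]. *)
Definition pop (V : lmodType K) (p : {poly K}) (S : V -> V) (u : V) : V :=
  \sum_(i < size p) p`_i *: iter i S u.

Section Pop.
Variables (V : lmodType K) (S : V -> V).

Lemma pop_wide n (p : {poly K}) u : (size p <= n)%N ->
  pop p S u = \sum_(i < n) p`_i *: iter i S u.
Proof.
move=> pn; rewrite /pop (big_ord_widen _ (fun i => p`_i *: iter i S u) pn) big_mkcond.
by apply: eq_bigr => i _; case: ltnP => // h; rewrite nth_default ?scale0r.
Qed.

Lemma pop0 u : pop 0 S u = 0.
Proof. by rewrite /pop size_poly0 big_ord0. Qed.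

Lemma popD p q u : pop (p + q) S u = pop p S u + pop q S u.
Proof.
pose N := maxn (size (p + q)) (maxn (size p) (size q)).
rewrite !(@pop_wide N) ?leq_max ?leqnn ?orbT// -big_split.
by apply: eq_bigr => i _; rewrite coefD scalerDl.
Qed.

Lemma popZ c p u : pop (c *: p) S u = c *: pop p S u.
Proof.
rewrite (@pop_wide (size p)) ?size_scale_leq// /pop scaler_sumr.
by apply: eq_bigr => i _; rewrite coefZ scalerA.
Qed.

Lemma popB p q u : pop (p - q) S u = pop p S u - pop q S u.
Proof. by rewrite popD -(scaleN1r q) popZ scaleN1r. Qed.

Lemma popC c u : pop c%:P S u = c *: u.
Proof. by rewrite (@pop_wide 1) ?size_polyC_leq1// big_ord1 coefC. Qed.

Lemma popMX p u : pop (p * 'X) S u = pop p S (S u).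
Proof.
rewrite (@pop_wide (size p).+1); last by rewrite (leq_trans (size_polyMleq _ _))// size_polyX addn2.
rewrite big_ord_recl coefMX scale0r add0r; apply: eq_bigr => i _.
by rewrite coefMX /= -iterS iterSr.
Qed.

Lemma popX u : pop 'X S u = S u.
Proof. by rewrite -['X]mul1r popMX popC scale1r. Qed.

Hypothesis lS : linear S.

Lemma iter_linear n : linear (iter n S).
Proof. by elim: n => // n IH a u v; rewrite /= IH lS. Qed.

Lemma pop_linear p : linear (pop p S).
Proof.
move=> a u v; rewrite /pop scaler_sumr -big_split; apply: eq_bigr => i _ /=.
by rewrite iter_linear scalerDr !scalerA mulrC.
Qed.

Lemma pop_S p u : pop p S (S u) = S (pop p S u).
Proof.
rewrite (linear_map_sum lS); apply: eq_bigr => i _.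
by rewrite (linear_mapZ lS) -iterSr.
Qed.

Lemma popM p q u : pop (p * q) S u = pop p S (pop q S u).
Proof.
elim/poly_ind: p u => [|p c IH] u.
  by rewrite mul0r !pop0.
rewrite mulrDl mulrAC mul_polyC popD popMX IH popZ popD popMX popC.
by rewrite pop_S.
Qed.

End Pop.

Lemma pop_one_sub (V : lmodType K) (S : V -> V) q u : linear S ->
  pop (q \Po (1 - 'X)) (fun v => v - S v) u = pop q S u.
Proof.
move=> lS; elim/poly_ind: q u => [|q c IH] u; first by rewrite comp_poly0 !pop0.
rewrite comp_polyD comp_polyM comp_polyX comp_polyC mulrBr mulr1.
rewrite popD popB popD !popMX !popC !IH.
by rewrite (linear_mapB (pop_linear lS q)) subKr.
Qed.

(** Used with [pL2], to pass between [hpoly] and [hardy], and with dilations. *)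
Lemma pop_intertwine (V W : lmodType K) (L : V -> W) (S : V -> V) (S' : W -> W) q u :
  linear L -> (forall v, L (S v) = S' (L v)) -> L (pop q S u) = pop q S' (L u).
Proof.
move=> lL LS; rewrite (linear_map_sum lL); apply: eq_bigr => i _.
rewrite (linear_mapZ lL); congr (_ *: _).
by elim: (nat_of_ord i) => //= n <-.
Qed.

End PolyOp.

(** * Hardy's inequality on L^2 *)

Section Hardy.
Context {R : realType}.
Local Notation C := R[i].
Local Notation mu := (@lebesgue_measure R).
Local Notation L2 := (L2 R).
Local Notation L2norm := (@L2norm R).

Let mI : measurable (I01 (R:=R)). Proof. exact: measurable_itv. Qed.
Hint Resolve mI : core.

Definition hfun (f : R -> C) (x : R) : C := (x^-1)%:C%C * cintegral `[0, x] f.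

Lemma I01P (x : R) : I01 x -> 0 <= x <= 1.
Proof. by rewrite /I01 /= in_itv. Qed.

Lemma mem_I01 (x : R) : 0 <= x <= 1 -> I01 x.
Proof. by rewrite /I01 /= in_itv. Qed.

Lemma hfun_ae (f g : R -> C) x : sqint f -> sqint g -> sqint_eq f g -> I01 x -> hfun f x = hfun g x.
Proof.
move=> sf sg fg /I01P/andP[x0 x1]; rewrite /hfun (@cintegral_ae _ _ f g)//.
exact: subset_0x.
Qed.

Lemma hfun_lin a (f g : R -> C) x : sqint f -> sqint g -> I01 x ->
  hfun (fun x => a * f x + g x) x = a * hfun f x + hfun g x.
Proof.
move=> sf sg /I01P/andP[x0 x1]; rewrite /hfun cintegralD//; last 2 first.
- exact: subset_0x.
- exact: sqintZ.
rewrite cintegralZ//; last exact: subset_0x.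
by ring.
Qed.

Lemma hfun0 (f : R -> C) : hfun f 0 = 0.
Proof. by rewrite /hfun invr0 mul0r. Qed.

Lemma hfun_poly p x : 0 < x -> hfun (pfun p) x = pfun (hpoly p) x.
Proof.
move=> x0; rewrite /hfun cintegral_poly ?ltW// prim_hpoly /pfun hornerM hornerX mulrCA -rmorphM /=.
by rewrite mulVf ?mulr1// gt_eqF.
Qed.

Lemma sqint_eq_off (a : R) (f g : R -> C) : (forall x, I01 x -> x != a -> f x = g x) -> sqint_eq f g.
Proof.
move=> h; have : negligible mu [set a] by apply/negligibleP => //; exact: lebesgue_measure_set1.
apply: (@negligibleS _ _ _ mu) => x /= nx; apply/eqP; apply/negP => /negP xn.
by apply: nx => xI; exact: h.
Qed.

Lemma sqint_eq_off0 (f g : R -> C) : (forall x, 0 < x -> x <= 1 -> f x = g x) -> sqint_eq f g.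
Proof.
move=> h; apply: (sqint_eq_off (a := 0)) => x /I01P/andP[x0 x1] xn.
by apply: h => //; rewrite lt_def xn.
Qed.

Lemma hfun_poly_sqint p : sqint (hfun (pfun p)) /\ sqint_eq (hfun (pfun p)) (pfun (hpoly p)).
Proof.
have e : sqint_eq (hfun (pfun p)) (pfun (hpoly p)) by apply: sqint_eq_off0 => x x0 _; exact: hfun_poly.
(* [hfun] is 0 at the point 0 because [0^-1 = 0], whereas [hpoly p] need not vanish there; the
   indicator of the complement of 0 reconciles them. *)
split => //; have mA : measurable (~` [set (0 : R)]) by apply: measurableC.
apply: sqint_ext (sqint_mul (bmeas_indic mA) (sqint_poly (hpoly p))).1 => x /I01P/andP[x0 x1].
have [->|xn] := eqVneq x 0; first by rewrite hfun0 indicE memNset ?mul0r//=; apply.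
rewrite indicE mem_set ?mul1r ?hfun_poly//; last by apply/eqP.
by rewrite lt_def xn.
Qed.

Lemma L2combE a (u v : L2) : sqint_eq (L2fun (a *: u + v)) (fun x => a * u x + v x).
Proof.
have := addL2E (a *: u) v; have := scaleL2E a u; apply: filterS2 => x h1 h2 xI.
by apply: etrans (h2 xI) _; congr (_ + _); exact: h1.
Qed.

Lemma hfun_linL2 a (u v : L2) x : I01 x ->
  hfun (L2fun (a *: u + v)) x = a * hfun u x + hfun v x.
Proof.
move=> xI; rewrite -(hfun_lin a (L2_sqint u) (L2_sqint v) xI).
apply: hfun_ae => //; last exact: L2combE.
  exact: L2_sqint.
by apply: sqintD; [apply: sqintZ|]; exact: L2_sqint.
Qed.

(** Polynomials [p n] tend to [u] in norm, and their means over [[0, x]] tend to that of [u] for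
    every [x > 0] by Cauchy-Schwarz; [sqint_fatou] then transfers the bound for polynomials. *)
Lemma hardy_sqint_norm (u : L2) : sqint (hfun u) /\ sqnorm (hfun u) <= 2 * L2norm u.
Proof.
suff key e : 0 < e -> sqint (hfun u) /\ sqnorm (hfun u) <= 2 * L2norm u + e.
  split; first exact: (key 1 ltr01).1.
  by apply/ler_addgt0Pr => e /key[].
move=> e0.
(* The entry [e / 2] keeps the norms of the images below [2 |u| + e]; the entry [(1 / 2) ^+ n] gives
   convergence. *)
have half n : 0 < Num.min (e / 2) ((1 / 2) ^+ n) by rewrite lt_min exprn_gt0// andbT; lra.
have [p pP'] := choice (fun n => poly_density u (half n)).
have pP n : L2norm (pL2 (p n) - u) <= Num.min (e / 2) ((1 / 2) ^+ n).
  by rewrite (L2norm_distC (pL2 (p n)) u).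
apply: (@sqint_fatou R (fun n => hfun (pfun (p n)))).
- by have := L2norm_ge0 u; move: (L2norm u) => a; lra.
- by move=> n; have [] := hfun_poly_sqint (p n).
- move=> n; have [s1 e1] := hfun_poly_sqint (p n).
  rewrite (sqnorm_eq s1 (sqint_poly _) e1) -(L2norm_toL2 (sqint_poly _)).
  apply: le_trans (hpoly_bound _) _.
  have := L2norm_lower (pL2 (p n)) u; have := pP n; rewrite le_min => /andP[+ _].
  by move: (L2norm (pL2 (p n))) (L2norm u) (L2norm _) => a b c; lra.
move=> x xI d d0; have /andP[x0 x1] := I01P xI.
have [->|xn] := eqVneq x 0.
  by exists 0%N => n _; rewrite !hfun0 subrr cmod0 ltW.
have xp : 0 < x by rewrite lt_def xn.
have d1 : 0 < d * x / (2 * Num.sqrt x) by rewrite !(divr_gt0, mulr_gt0)// sqrtr_gt0.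
have [N hN] := half_pow_small d1; exists N => n Nn.
rewrite -(hfun_ae (L2_sqint (pL2 (p n))) (sqint_poly (p n)))//; last exact: toL2K (sqint_poly _).
have -> : hfun (pL2 (p n)) x - hfun u x = hfun (L2fun (pL2 (p n) - u)) x.
  have := hfun_linL2 1 (pL2 (p n) - u) u xI.
  by rewrite scale1r subrK mul1r => ->; rewrite addrK.
rewrite /hfun cmodM cmod_real ger0_norm ?invr_ge0// mulrC ler_pdivrMr//.
apply: le_trans (cintegral_bound (L2_sqint _) _ (subset_0x x1) (measure_0x x0) x0) _ => //.
have := pP n; rewrite le_min => /andP[_ le].
have {}le : L2norm (pL2 (p n) - u) <= (1 / 2) ^+ N.
  apply: le_trans le _; rewrite ler_wiXn2l//; lra.
have := le_trans le hN; rewrite ler_pdivlMr ?mulr_gt0 ?sqrtr_gt0//.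
rewrite -[sqnorm _]/(L2norm (pL2 (p n) - u)).
by move: (L2norm _) (Num.sqrt x) => a b; rewrite mulrCA mulrC -mulrA [b * 2]mulrC.
Qed.

Lemma hardyE (u : L2) : sqint_eq (hardy u) (hfun u).
Proof. by apply: toL2K; have [] := hardy_sqint_norm u. Qed.

Lemma hardy_norm (u : L2) : L2norm (hardy u) <= 2 * L2norm u.
Proof. by have [s le] := hardy_sqint_norm u; rewrite L2norm_toL2. Qed.

Lemma hardy_comb (a : C) (u v : L2) : hardy (a *: u + v) = a *: hardy u + hardy v.
Proof.
have [su _] := hardy_sqint_norm u; have [sv _] := hardy_sqint_norm v.
rewrite -[hardy u]/(toL2 (hfun u)) -[hardy v]/(toL2 (hfun v)) -(toL2Z a su) -(toL2D (sqintZ a su) sv).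
apply: toL2_eq; first exact: (hardy_sqint_norm _).1.
  by apply: sqintD => //; exact: sqintZ.
by apply: nearW => x xI; exact: hfun_linL2.
Qed.

Lemma hardy_linear : linear (@hardy R).
Proof. exact: hardy_comb. Qed.

Lemma hardy_pL2 (p : {poly C}) : hardy (pL2 p) = pL2 (hpoly p).
Proof.
have [s e] := hfun_poly_sqint p.
apply: toL2_eq; [exact: (hardy_sqint_norm _).1|exact: sqint_poly|].
apply: sqint_eq_trans e; apply: nearW => x xI.
by apply: hfun_ae xI; [exact: L2_sqint|exact: sqint_poly|exact: toL2K (sqint_poly p)].
Qed.

End Hardy.

(** * Von Neumann's inequality on L^2 *)

Section VonNeumann.
Context {R : realType}.
Local Notation C := R[i].
Local Notation L2 := (L2 R).
Local Notation L2norm := (@L2norm R).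

Lemma pL2_linear : linear (@pL2 R).
Proof. by move=> a p q; rewrite pL2D pL2Z. Qed.

(** A real bound, not necessarily the least, spares arithmetic with the extended real [opnorm]. *)
Definition bdd (T : L2 -> L2) (B : R) := 0 <= B /\ forall u, L2norm (T u) <= B * L2norm u.

Lemma bdd_pop (T : L2 -> L2) B q : bdd T B -> exists M, bdd (pop q T) M.
Proof.
move=> [B0 hB].
have it n u : L2norm (iter n T u) <= B ^+ n * L2norm u.
  elim: n => [|n IH]; first by rewrite expr0 mul1r.
  rewrite iterS exprS -mulrA; apply: le_trans (hB _) _; exact: ler_wpM2l.
exists (\sum_(i < size q) cmod q`_i * B ^+ i); split.
  by apply: sumr_ge0 => i _; rewrite mulr_ge0 ?cmod_ge0 ?exprn_ge0.
move=> u; rewrite /pop; apply: le_trans (L2norm_sum _ _ _) _.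
rewrite mulr_suml; apply: ler_sum => i _.
rewrite L2normZ -mulrA; apply: ler_wpM2l; first exact: cmod_ge0.
exact: it.
Qed.

Lemma bdd_hardy : bdd (@hardy R) 2.
Proof. by split => // u; exact: hardy_norm. Qed.

Lemma hpoly_linear : linear (@hpoly R).
Proof.
move=> a p q; apply/polyP => i.
by rewrite coefD coefZ !coef_hpoly coefD coefZ mulrDl mulrA.
Qed.

Lemma density_estimate (M m e a b c d x y : R) : 0 <= M -> 0 <= m -> 0 <= d -> b <= M * d ->
  c <= m * y -> y - x <= d -> a <= b + c -> d <= e / (M + m + 1) -> a <= m * x + e.
Proof.
by move=> M0 m0 d0 h1 h2 h3 h4; rewrite ler_pdivlMr; [nra|lra].
Qed.

(** Composing [q] with [1 - X] turns the calculus of [H] into that of the contraction [1 - H] and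
    sends the unit circle to the boundary of the disk. Density extends the bound from polynomials to
    L^2, the crude bound [M] serving only for continuity. *)
Lemma von_neumann (q : {poly C}) (m : R) : (forall z, cdisk11 z -> cmod q.[z] <= m) ->
  bdd (pop q (@hardy R)) m.
Proof.
move=> qm; have m0 : 0 <= m.
  by apply: le_trans (qm 1 _); [exact: cmod_ge0|apply/cdisk11P; rewrite subrr cmod0].
split => // u; have [M [M0 hM]] := bdd_pop q bdd_hardy.
have poly f : L2norm (pop q (@hardy R) (pL2 f)) <= m * L2norm (pL2 f).
  rewrite -(@pop_intertwine _ _ _ _ (@hpoly R) _ q f pL2_linear); last first.
    by move=> v; rewrite hardy_pL2.
  rewrite -(pop_one_sub q f hpoly_linear).
  apply: (von_neumann_poly (a := q \Po (1 - 'X))) => z z1.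
  rewrite horner_comp hornerD hornerN hornerX hornerC; apply: qm; apply/cdisk11P.
  by rewrite addrAC subrr add0r cmodN z1.
apply/ler_addgt0Pr => e e0.
have d0 : 0 < e / (M + m + 1) by rewrite divr_gt0//; lra.
have [f hf] := poly_density u d0.
have H1 := hM (u - pL2 f); have H2 := poly f.
have H0 := L2norm_ge0 (u - pL2 f).
have H3 := L2norm_lower (pL2 f) u; rewrite (L2norm_distC (pL2 f) u) in H3.
have H4 := L2normD (pop q (@hardy R) (u - pL2 f)) (pop q (@hardy R) (pL2 f)).
rewrite (linear_mapB (pop_linear hardy_linear q)) subrK in H4.
rewrite -(linear_mapB (pop_linear hardy_linear q)) in H4.
exact: density_estimate M0 m0 H0 H1 H2 H3 H4 hf.
Qed.

End VonNeumann.

(** * Bounded and compact operators *)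

Section L2topology.
Context {R : realType}.
Local Notation C := R[i].
Local Notation L2 := (L2 R).
Local Notation L2norm := (@L2norm R).

Lemma nbhsL2P (A : set L2) (u : L2) :
  nbhs u A <-> exists2 d : R, 0 < d & forall v : L2, L2norm (v - u) < d -> A v.
Proof.
split=> [/nbhs_normP[[a b] /= ]|[d d0 h]].
  rewrite ltcE /= => /andP[/eqP-> a0] h; exists a => // w wz; apply: h => /=.
  by rewrite L2normE (L2norm_distC u w) ltcR.
apply/nbhs_normP; exists d%:C%C; rewrite /= ?ltcR// => w /=.
by rewrite L2normE (L2norm_distC u w) ltcR => /h.
Qed.

Lemma L2dist_le (w u v : L2) (a b : R) : L2norm (u - w) <= a -> L2norm (w - v) <= b ->
  L2norm (u - v) <= a + b.
Proof. by move=> h1 h2; apply: le_trans (L2norm_dist w _ _) _; exact: lerD. Qed.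

Lemma L2dist_sym (u v : L2) (a : R) : L2norm (u - v) <= a -> L2norm (v - u) <= a.
Proof. by move=> h; exact: (eq_ind _ (fun x => x <= a) h _ (L2norm_distC u v)). Qed.

Lemma half_pow_le m n (d : R) : (m <= n)%N -> (1 / 2) ^+ m <= d -> (1 / 2) ^+ n <= d.
Proof. by move=> mn; apply: le_trans; apply: ler_wiXn2l => //; lra. Qed.

Lemma third_lt (d : R) : 0 < d -> d / 3 + d / 3 < d. Proof. by lra. Qed.

Lemma half_gt0 (d : R) : 0 < d -> 0 < d / 2. Proof. by lra. Qed.

Lemma third_gt0 (d : R) : 0 < d -> 0 < d / 3. Proof. by lra. Qed.

Lemma L2dist_le' (w u v : L2) (a b : R) : L2norm (w - u) <= a -> L2norm (w - v) <= b ->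
  L2norm (u - v) <= a + b.
Proof. by move=> /L2dist_sym h1 h2; exact: L2dist_le h1 h2. Qed.

Definition totbdd (A : set L2) := forall e : R, 0 < e -> exists s : seq L2,
  forall u, A u -> exists2 v, v \in s & L2norm (u - v) <= e.

Lemma totbdd_subset A B : A `<=` B -> totbdd B -> totbdd A.
Proof. by move=> AB tB e /tB[s hs]; exists s => u /AB /hs. Qed.

Lemma totbdd_closure A : totbdd A -> totbdd (closure A).
Proof.
move=> tA e e0; have e2 := half_gt0 e0.
have [s hs] := tA _ e2; exists s => u clu.
have [|v [Av /= vu]] := clu [set v | L2norm (v - u) < e / 2].
  by apply/nbhsL2P; exists (e / 2).
have [w ws vw] := hs v Av; exists w => //.
rewrite [e in _ <= e]splitr; exact: L2dist_le' (ltW vu) vw.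
Qed.

Lemma ultra_seq (F : set_system L2) (T : eqType) (s : seq T) (B : T -> set L2) : UltraFilter F ->
  F (fun u => exists2 v, v \in s & B v u) -> exists2 v, v \in s & F (B v).
Proof.
move=> FU; elim: s => [|x s IH] h.
  by exfalso; apply: (@filter_not_empty _ F); apply: filterS h => u [].
have [Bx|nBx] := in_ultra_setVsetC (B x) FU; first by exists x; rewrite ?mem_head.
have [|v vs Bv] := IH; last by exists v => //; rewrite inE vs orbT.
apply: filterS2 h nBx => u [v]; rewrite inE => /predU1P[->|vs] Bu nB //.
by exists v.
Qed.

(** An ultrafilter containing [A] contains a ball of radius [2^-n] for each [n]; the centers form a
    Cauchy sequence, whose limit is the limit of the ultrafilter. *)
Lemma totbdd_compact A : totbdd A -> closed A -> compact A.
Proof.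
move=> tA cA; rewrite compact_ultra => F FU FA.
have half n : 0 < (1 / 2) ^+ n :> R by rewrite exprn_gt0.
have ex n : exists v, F (fun u => L2norm (u - v) <= (1 / 2) ^+ n).
  have [s hs] := tA _ (half n).
  have [|v _ Fv] := @ultra_seq F _ s (fun v u => L2norm (u - v) <= (1 / 2) ^+ n) FU.
    by apply: filterS FA => u /hs.
  by exists v.
have [v Fv] := choice ex.
have vv m n : L2norm (v m - v n) <= (1 / 2) ^+ m + (1 / 2) ^+ n.
  have [u [h1 h2]] : exists u, L2norm (u - v m) <= (1 / 2) ^+ m /\ L2norm (u - v n) <= (1 / 2) ^+ n.
    by have [u h] := filter_ex (filterI (Fv m) (Fv n)); exists u.
  exact: L2dist_le' h1 h2.
have [|l hl] := L2_complete (u := v).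
  move=> e e0; have e2 := half_gt0 e0.
  have [N hN] := half_pow_small e2; exists N => m n Nm Nn.
  apply: le_trans (vv m n) _; rewrite [e]splitr; apply: lerD.
    exact: half_pow_le Nm hN.
  exact: half_pow_le Nn hN.
have Fl : F --> l.
  move=> B /nbhsL2P[d d0 hd]; have d3 := third_gt0 d0.
  have [N1 hN1] := half_pow_small d3; have [N2 hN2] := hl _ d3.
  have h1 := hN2 (maxn N1 N2) (leq_maxr _ _).
  apply: filterS (Fv (maxn N1 N2)) => u h2; apply: hd.
  have h4 : (1 / 2) ^+ maxn N1 N2 <= d / 3.
    exact: half_pow_le (leq_maxl _ _) hN1.
  apply: le_lt_trans (L2dist_le (le_trans h2 h4) h1) (third_lt d0).
exists l; split => //; apply: cA => B Bl.
have [w [Aw Bw]] := filter_ex (filterI FA (Fl _ Bl)).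
by exists w.
Qed.

Lemma compact_totbdd A : compact A -> totbdd A.
Proof.
rewrite compact_cover => cA e e0.
have [||D' _ cov] := cA L2 setT (fun v => [set u | L2norm (u - v) < e]).
- move=> v _; rewrite openE => u /= uv; apply/nbhsL2P; exists (e - L2norm (u - v)).
    by rewrite subr_gt0.
  move=> w wu; rewrite /= .
  apply: le_lt_trans (L2norm_dist u _ _) _.
  by rewrite -ltrBrDr.
- by move=> u _; exists u => //=; rewrite subrr L2norm0.
exists (finmap.enum_fset D') => u /cov[v /= vD uv].
by exists v => //; exact: ltW.
Qed.

End L2topology.

Section BoundedOperators.
Context {R : realType}.
Local Notation C := R[i].
Local Notation L2 := (L2 R).
Local Notation L2norm := (@L2norm R).
Local Notation bdd := (@bdd R).
Implicit Types (S T : L2 -> L2) (u v : L2) (B e : R).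

Lemma L2dist_add (u v a b : L2) (x y : R) : L2norm (u - a) <= x -> L2norm (v - b) <= y ->
  L2norm (u + v - (a + b)) <= x + y.
Proof.
move=> h1 h2; rewrite opprD addrACA; apply: le_trans (L2normD _ _) _; exact: lerD h1 h2.
Qed.

Lemma bdd_opnorm T B : bdd T B -> (opnorm T <= B%:E)%E.
Proof.
move=> [B0 hB]; apply: ge_ereal_sup => _ [u /= u1 <-]; rewrite lee_fin.
by apply: le_trans (hB u) _; rewrite ler_piMr.
Qed.

Lemma opnorm_bdd T B : linear T -> (opnorm T <= B%:E)%E -> bdd T B.
Proof.
move=> lT h; have H u : L2norm u <= 1 -> L2norm (T u) <= B.
  by move=> u1; rewrite -lee_fin; apply: le_trans h; apply: ereal_sup_ubound; exists u.
have B0 : 0 <= B.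
  have := H 0; rewrite L2norm0 => /(_ ler01); exact: le_trans (L2norm_ge0 _).
split => // u; have [u0|un] := eqVneq (L2norm u) 0.
  by rewrite u0 mulr0 (L2norm_eq0 u0) (linear_map0 lT) L2norm0.
have up : 0 < L2norm u by rewrite lt_def un L2norm_ge0.
have := H ((L2norm u)^-1%:C%C *: u).
rewrite (linear_mapZ lT) !L2normZ cmod_real ger0_norm ?invr_ge0 ?L2norm_ge0//.
by rewrite mulVf// => /(_ (lexx _)); rewrite mulrC ler_pdivrMr// mulrC.
Qed.

Lemma bounded_opP T : bounded_op T <-> linear T /\ exists B, bdd T B.
Proof.
split=> [[lT h]|[lT [B hB]]]; split => //; last exact: le_lt_trans (bdd_opnorm hB) (ltry _).
exists (fine (opnorm T)); apply: opnorm_bdd => //.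
rewrite fineK// ge0_fin_numE//; apply: le_trans (_ : ((L2norm (T 0))%:E <= _)%E).
  by rewrite lee_fin L2norm_ge0.
by apply: ereal_sup_ubound; exists 0 => //=; rewrite L2norm0.
Qed.

Lemma linear_add S T : linear S -> linear T -> linear (S \+ T).
Proof. by move=> lS lT a u v /=; rewrite lS lT scalerDr addrACA. Qed.

Lemma linear_scale (c : C) T : linear T -> linear (c \*: T).
Proof. by move=> lT a u v /=; rewrite lT scalerDr !scalerA mulrC. Qed.

Lemma linear_sub S T : linear S -> linear T -> linear (S \- T).
Proof. by move=> lS lT a u v /=; rewrite lS lT scalerBr opprD addrACA. Qed.

Lemma linear_comp S T : linear S -> linear T -> linear (S \o T).
Proof. by move=> lS lT a u v /=; rewrite lT lS. Qed.

Lemma bdd_id : bdd idfun 1.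
Proof. by split => // u; rewrite mul1r. Qed.

Lemma bdd_add S T B D : bdd S B -> bdd T D -> bdd (S \+ T) (B + D).
Proof.
move=> [B0 hS] [D0 hT]; split; first exact: addr_ge0.
by move=> u /=; rewrite mulrDl; apply: le_trans (L2normD _ _) _; exact: lerD.
Qed.

Lemma bdd_scale (c : C) T B : bdd T B -> bdd (c \*: T) (cmod c * B).
Proof.
move=> [B0 hT]; split; first by rewrite mulr_ge0 ?cmod_ge0.
by move=> u /=; rewrite L2normZ -mulrA; apply: ler_wpM2l (hT u); exact: cmod_ge0.
Qed.

Lemma bdd_sub S T B D : bdd S B -> bdd T D -> bdd (S \- T) (B + D).
Proof.
move=> [B0 hS] [D0 hT]; split; first exact: addr_ge0.
by move=> u /=; rewrite mulrDl; apply: le_trans (L2normB _ _) _; exact: lerD.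
Qed.

Lemma bdd_comp S T B D : bdd S B -> bdd T D -> bdd (S \o T) (B * D).
Proof.
move=> [B0 hS] [D0 hT]; split; first exact: mulr_ge0.
move=> u /=; apply: le_trans (hS _) _; rewrite -mulrA; exact: ler_wpM2l (hT u).
Qed.

Lemma bdd_le T B D : B <= D -> bdd T B -> bdd T D.
Proof.
move=> BD [B0 hT]; split; first exact: le_trans BD.
by move=> u; apply: le_trans (hT u) _; apply: ler_wpM2r BD; exact: L2norm_ge0.
Qed.

Lemma bdd_distC S T B : bdd (S \- T) B -> bdd (T \- S) B.
Proof.
move=> [B0 h]; split; first exact: B0.
move=> u; exact: L2dist_sym (h u).
Qed.

Lemma bdd_dist (U S T : L2 -> L2) B D : bdd (S \- U) B -> bdd (U \- T) D -> bdd (S \- T) (B + D).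
Proof.
move=> [B0 h] [D0 k]; split; first exact: addr_ge0.
by move=> u; rewrite mulrDl; apply: (@L2dist_le _ (U u)); [exact: h|exact: k].
Qed.

Lemma bounded_opD S T : bounded_op S -> bounded_op T -> bounded_op (S \+ T).
Proof.
move=> /bounded_opP[lS [B hS]] /bounded_opP[lT [D hT]]; apply/bounded_opP.
by split; [exact: linear_add|exists (B + D); exact: bdd_add].
Qed.

Lemma bounded_opZ c T : bounded_op T -> bounded_op (c \*: T).
Proof.
move=> /bounded_opP[lT [D hT]]; apply/bounded_opP.
by split; [exact: linear_scale|exists (cmod c * D); exact: bdd_scale].
Qed.

Lemma bounded_op_comp S T : bounded_op S -> bounded_op T -> bounded_op (S \o T).
Proof.
move=> /bounded_opP[lS [B hS]] /bounded_opP[lT [D hT]]; apply/bounded_opP.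
by split; [exact: linear_comp|exists (B * D); exact: bdd_comp].
Qed.

Lemma bounded_op_id : bounded_op (@idfun L2).
Proof. by apply/bounded_opP; split => //; exists 1; exact: bdd_id. Qed.

Lemma bounded_hardy : bounded_op (@hardy R).
Proof. by apply/bounded_opP; split; [exact: hardy_linear|exists 2; exact: bdd_hardy]. Qed.

Lemma bounded_mulop phi M : bmeas phi M -> bounded_op (@mulop R phi).
Proof.
move=> b; apply/bounded_opP; split; first exact: mulop_linear b.
by exists M; split; [case: b|move=> u; exact: mulop_norm].
Qed.

Definition tbop T := totbdd (T @` [set u | L2norm u <= 1]).

Lemma tbopP T : tbop T <-> forall e, 0 < e -> exists s : seq L2,
  forall u, L2norm u <= 1 -> exists2 v, v \in s & L2norm (T u - v) <= e.
Proof.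
split=> h e e0; have [s hs] := h e e0; exists s.
  by move=> u u1; apply: hs; exists u.
by move=> _ [u u1 <-]; exact: hs.
Qed.

Lemma compact_opP T : compact_op T <-> bounded_op T /\ tbop T.
Proof.
split=> -[bT h]; split => //.
  by apply: totbdd_subset (compact_totbdd h); exact: subset_closure.
by apply: totbdd_compact; [exact: totbdd_closure|exact: closed_closure].
Qed.

Lemma tbopD S T : tbop S -> tbop T -> tbop (S \+ T).
Proof.
move=> /tbopP tS /tbopP tT; apply/tbopP => e e0; have e2 := half_gt0 e0.
have [s hs] := tS _ e2; have [t ht] := tT _ e2.
exists [seq a + b | a <- s, b <- t] => u u1.
have [a sa ua] := hs u u1; have [b tb ub] := ht u u1.
exists (a + b); first by apply/allpairsP; exists (a, b).
rewrite [e]splitr; exact: L2dist_add ua ub.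
Qed.

Lemma tbop_left S T : bounded_op S -> tbop T -> tbop (S \o T).
Proof.
move=> /bounded_opP[lS [B [B0 hS]]] /tbopP tT; apply/tbopP => e e0.
have B1 : 0 < B + 1 by apply: ltr_wpDl.
have [s hs] := tT _ (divr_gt0 e0 B1).
exists (map S s) => u u1; have [v vs uv] := hs u u1.
exists (S v); first exact: map_f.
rewrite /= -(linear_mapB lS); apply: le_trans (hS _) _.
apply: le_trans (_ : B * (e / (B + 1)) <= _); first exact: ler_wpM2l.
by rewrite mulrCA ger_pMr// ler_pdivrMr// mul1r lerDl.
Qed.

Lemma tbop_right S T : linear T -> bounded_op S -> tbop T -> tbop (T \o S).
Proof.
move=> lT /bounded_opP[lS [B [B0 hS]]] /tbopP tT; apply/tbopP => e e0.
have B1 : 0 < B + 1 by apply: ltr_wpDl.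
(* Division by [B + 1], nonzero even when [B = 0], brings [S u] into the unit ball, where the net
   for [T] applies. *)
pose c : C := (B + 1)%:C%C; have c0 : c != 0.
  by apply/eqP => /(congr1 (@cmod R)); rewrite cmod_real cmod0 gtr0_norm // => h; rewrite h ltxx in B1.
have cc : cmod c = B + 1 by rewrite cmod_real gtr0_norm.
have [s hs] := tT _ (divr_gt0 e0 B1).
exists (map ( *:%R c) s) => u u1; have [|v vs uv] := hs (c^-1 *: S u).
  rewrite L2normZ cmodV cc mulrC ler_pdivrMr// mul1r; apply: le_trans (hS u) _.
  by apply: le_trans (ler_piMr B0 u1) _; rewrite lerDl.
exists (c *: v); first exact: map_f.
have -> : (T \o S) u - c *: v = c *: (T (c^-1 *: S u) - v).
  by rewrite scalerBr (linear_mapZ lT) scalerA divff// scale1r.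
rewrite L2normZ cc -[e in _ <= e](divfK (lt0r_neq0 B1)) mulrC.
by rewrite ler_pM2r.
Qed.

Lemma tbop_lim T : (forall e, 0 < e -> exists2 S, tbop S & bdd (T \- S) e) -> tbop T.
Proof.
move=> h; apply/tbopP => e e0; have e2 := half_gt0 e0.
have [S /tbopP tS [_ TS]] := h _ e2.
have [s hs] := tS _ e2; exists s => u u1; have [v vs uv] := hs u u1.
exists v; first exact: vs.
rewrite [e]splitr; apply: L2dist_le uv.
by apply: le_trans (TS u) _; apply: ler_piMr u1; exact: ltW.
Qed.

Lemma compact_opD S T : compact_op S -> compact_op T -> compact_op (S \+ T).
Proof.
move=> /compact_opP[bS tS] /compact_opP[bT tT]; apply/compact_opP.
by split; [exact: bounded_opD|exact: tbopD].
Qed.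

Lemma compact_op_left S T : bounded_op S -> compact_op T -> compact_op (S \o T).
Proof.
move=> bS /compact_opP[bT tT]; apply/compact_opP.
by split; [exact: bounded_op_comp|exact: tbop_left].
Qed.

Lemma compact_op_right S T : bounded_op S -> compact_op T -> compact_op (T \o S).
Proof.
move=> bS /compact_opP[bT tT]; apply/compact_opP.
by split; [exact: bounded_op_comp|apply: tbop_right => //; have /bounded_opP[] := bT].
Qed.

End BoundedOperators.

(** * The algebra generated by the Hardy operator and M_x *)

Section HardyAlgebra.
Context {R : realType}.
Local Notation C := R[i].
Local Notation L2 := (L2 R).
Local Notation L2norm := (@L2norm R).
Local Notation bdd := (@bdd R).
Local Notation hardy := (@hardy R).
Implicit Types (S T : L2 -> L2) (u v : L2) (B e : R).

Definition mulx : L2 -> L2 := mulop (fun x => x%:C%C).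
Definition polyalg : set (L2 -> L2) := smallest (@unital_algebra R) [set hardy; mulx].

Lemma polyalg_unital : unital_algebra polyalg.
Proof.
split.
- by move=> A [[]].
- by move=> S T pS pT A [uA sA]; have [_ h _ _] := uA; apply: h; [apply: pS|apply: pT].
- by move=> c T pT A [uA sA]; have [_ _ h _] := uA; apply: h; apply: pT.
- by move=> S T pS pT A [uA sA]; have [_ _ _ h] := uA; apply: h; [apply: pS|apply: pT].
Qed.

Lemma polyalg_hardy : polyalg hardy.
Proof. by move=> A [_]; apply; left. Qed.

Lemma polyalg_mulx : polyalg mulx.
Proof. by move=> A [_]; apply; right. Qed.

Lemma unital_algebra_bounded : unital_algebra (@bounded_op R).
Proof.
split; [exact: bounded_op_id|exact: bounded_opD|exact: bounded_opZ|exact: bounded_op_comp].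
Qed.

Lemma bmeas_x : bmeas (fun x : R => x%:C%C) 1.
Proof.
split => //; first by split => /=; [exact: measurable_id|exact: measurable_cst].
by move=> x /I01P/andP[x0 x1]; rewrite cmod_real ger0_norm.
Qed.

Lemma polyalg_bounded T : polyalg T -> bounded_op T.
Proof.
apply; split; first exact: unital_algebra_bounded.
by move=> _ [->|->]; [exact: bounded_hardy|exact: bounded_mulop bmeas_x].
Qed.

Lemma hardy_algebraP T : hardy_algebra T <->
  bounded_op T /\ forall e, 0 < e -> exists2 S, polyalg S & bdd (T \- S) e.
Proof.
split=> -[bT h]; split => // e e0.
  have [S pS le] := h e e0; exists S => //; apply: opnorm_bdd (ltW le).
  by apply: linear_sub; [case: bT|case: (polyalg_bounded pS)].
have [S pS le] := h _ (half_gt0 e0); exists S => //.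
by apply: le_lt_trans (bdd_opnorm le) _; rewrite lte_fin ltr_pdivrMr// ltr_pMr// ltr1n.
Qed.

Lemma hardy_algebra_bounded T : hardy_algebra T -> bounded_op T.
Proof. by case. Qed.

Lemma polyalg_hardy_algebra T : polyalg T -> hardy_algebra T.
Proof.
move=> pT; apply/hardy_algebraP; split; first exact: polyalg_bounded.
move=> e e0; exists T => //; split; first exact: ltW.
by move=> u /=; rewrite subrr L2norm0; apply: mulr_ge0 (L2norm_ge0 _); exact: ltW.
Qed.

Lemma hardy_algebra_lim T : bounded_op T ->
  (forall e, 0 < e -> exists2 S, hardy_algebra S & bdd (T \- S) e) -> hardy_algebra T.
Proof.
move=> bT h; apply/hardy_algebraP; split => // e e0; have e2 := half_gt0 e0.
have [S /hardy_algebraP[_ hS] TS] := h _ e2; have [U pU SU] := hS _ e2.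
exists U; first exact: pU.
rewrite [e]splitr; exact: bdd_dist TS SU.
Qed.

Lemma hardy_algebraD S T : hardy_algebra S -> hardy_algebra T -> hardy_algebra (S \+ T).
Proof.
move=> /hardy_algebraP[bS hS] /hardy_algebraP[bT hT]; apply/hardy_algebraP.
split; first exact: bounded_opD.
move=> e e0; have e2 := half_gt0 e0; have [S' pS' h1] := hS _ e2; have [T' pT' h2] := hT _ e2.
exists (S' \+ T'); first by have [_ + _ _] := polyalg_unital; apply.
have -> : (S \+ T) \- (S' \+ T') = (S \- S') \+ (T \- T').
  by apply/funext => u /=; rewrite opprD addrACA.
rewrite [e]splitr; exact: (bdd_add h1 h2).
Qed.

Lemma hardy_algebraZ (c : C) T : hardy_algebra T -> hardy_algebra (c \*: T).
Proof.
move=> /hardy_algebraP[bT hT]; apply/hardy_algebraP.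
split; first exact: bounded_opZ.
move=> e e0; have c1 : 0 < cmod c + 1 by apply: ltr_wpDl => //; exact: cmod_ge0.
have [T' pT' h2] := hT _ (divr_gt0 e0 c1).
exists (c \*: T'); first by have [_ _ + _] := polyalg_unital; apply.
have -> : (c \*: T) \- (c \*: T') = c \*: (T \- T') by apply/funext => u /=; rewrite scalerBr.
apply: bdd_le (bdd_scale c h2).
by rewrite mulrCA ger_pMr// ler_pdivrMr// mul1r lerDl.
Qed.

Lemma hardy_algebra_comp S T : hardy_algebra S -> hardy_algebra T -> hardy_algebra (S \o T).
Proof.
move=> /hardy_algebraP[bS hS] /hardy_algebraP[bT hT]; apply/hardy_algebraP.
split; first exact: bounded_op_comp.
move=> e e0; have [lS [B hB]] := (bounded_opP _).1 bS; have [lT [D hD]] := (bounded_opP _).1 bT.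
have B0 : 0 <= B by case: hB.
have D0 : 0 <= D by case: hD.
have k0 : 0 < B + D + 1 by apply: ltr_wpDl => //; exact: addr_ge0.
(* [d <= 1] bounds [T'] by [D + 1], so the two error terms add up to at most [d * (B + D + 1)]. *)
pose d := Num.min 1 (e / (B + D + 1)).
have d0 : 0 < d by rewrite lt_min ltr01 divr_gt0.
have [S' pS' h1] := hS _ d0; have [T' pT' h2] := hT _ d0.
exists (S' \o T'); first by have [_ _ _ +] := polyalg_unital; apply.
have lS' : linear S' by case: (polyalg_bounded pS').
have -> : (S \o T) \- (S' \o T') = (S \o (T \- T')) \+ ((S \- S') \o T').
  apply/funext => u /=; rewrite (linear_mapB lS).
  by rewrite addrA subrK.
have hT' : bdd T' (D + 1).
  have -> : T' = T \+ (T' \- T) by apply/funext => u /=; rewrite addrC subrK.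
  apply: bdd_add hD _; apply: bdd_le (bdd_distC h2); by rewrite /d ge_min lexx.
apply: bdd_le (bdd_add (bdd_comp hB h2) (bdd_comp h1 hT')).
rewrite mulrC -mulrDr addrA; apply: le_trans (_ : e / (B + D + 1) * (B + D + 1) <= _).
  apply: ler_wpM2r; [exact: ltW|by rewrite /d ge_min lexx orbT].
by rewrite divfK// lt0r_neq0.
Qed.

Lemma hardy_algebra_unital : unital_algebra (@hardy_algebra R).
Proof.
split; [|exact: hardy_algebraD|exact: hardy_algebraZ|exact: hardy_algebra_comp].
by apply: polyalg_hardy_algebra; have [] := polyalg_unital.
Qed.

Lemma unital_algebra_pop (A : set (L2 -> L2)) T q : unital_algebra A -> A T -> A (pop q T).
Proof.
move=> [A1 AD AZ AM] AT.
have A0 : A (pop 0 T).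
  have -> : pop 0 T = 0 \*: idfun by apply/funext => u; rewrite pop0 /= scale0r.
  exact: AZ.
elim/poly_ind: q => [|q c IH]; first exact: A0.
have -> : pop (q * 'X + c%:P) T = (pop q T \o T) \+ (c \*: idfun).
  by apply/funext => u; rewrite popD popMX popC.
by apply: AD; [exact: AM|exact: AZ].
Qed.

Lemma bmeasM phi psi M N : @bmeas R phi M -> bmeas psi N -> bmeas (fun x => phi x * psi x) (M * N).
Proof.
move=> [M0 mphi hphi] [N0 mpsi hpsi]; split; [exact: mulr_ge0|exact: cmeasM|].
by move=> x xI; rewrite cmodM; apply: ler_pM; rewrite ?cmod_ge0//; [exact: hphi|exact: hpsi].
Qed.

Lemma bmeas_cst (c : C) : bmeas (fun _ : R => c) (cmod c).
Proof. by split; [exact: cmod_ge0|split; exact: measurable_cst|]. Qed.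

Lemma mulop_poly (p : {poly C}) : mulop (pfun p) = pop p mulx.
Proof.
elim/poly_ind: p => [|p c IH]; apply/funext => u.
  rewrite pop0 /mulop; apply: L2P; apply: sqint_eq_trans (toL2K _) _.
    apply: (@sqint_ext _ (fun=> 0)); last exact: sqint0.
    by move=> x _; rewrite /pfun horner0 mul0r.
  apply: sqint_eq_sym; apply: sqint_eq_trans (toL2_0E R) _.
  by apply: nearW => x _; rewrite /pfun horner0 mul0r.
rewrite popD popMX popC -IH.
have [M bp] := bmeas_poly p.
rewrite /mulx (bmeas_comp u bp bmeas_x).
have cE : c *: u = mulop (fun=> c * 1) u by rewrite (mulopZ c u (bmeas_cst 1)) mulop1.
rewrite [in RHS]cE -(mulopD u (bmeasM bp bmeas_x) (bmeas_cst _)); congr mulop.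
by apply/funext => x; rewrite /pfun hornerD hornerM hornerX hornerC mulr1.
Qed.


Lemma pop_hardy_algebra (q : {poly C}) : polyalg (pop q hardy).
Proof. exact: unital_algebra_pop polyalg_unital polyalg_hardy. Qed.

Lemma mulop_pL2 (p q : {poly C}) : mulop (pfun p) (pL2 q) = pL2 (p * q).
Proof.
have [M bp] := bmeas_poly p.
apply: toL2_eq; [exact: (sqint_mul bp (L2_sqint _)).1|exact: sqint_poly|].
have := toL2K (sqint_poly q); apply: filterS => x h xI.
by rewrite [L2fun _ _](h xI) /pfun hornerM.
Qed.

Lemma bounded_ext S T : bounded_op S -> bounded_op T -> (forall p, S (pL2 p) = T (pL2 p)) -> S = T.
Proof.
move=> /bounded_opP[lS [B hB]] /bounded_opP[lT [D hD]] h; apply/funext => u.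
apply/eqP; rewrite -subr_eq0; apply/eqP; apply: L2norm_eq0.
have [K0 hK] := bdd_sub hB hD.
apply/eqP; rewrite eq_le L2norm_ge0 andbT; apply/ler_addgt0Pr => e e0; rewrite add0r.
have K1 : 0 < B + D + 1 by apply: ltr_wpDl.
have [p hp] := poly_density u (divr_gt0 e0 K1).
have := hK (u - pL2 p); rewrite /= (linear_mapB lS) (linear_mapB lT) h.
rewrite opprD opprK addrACA addNr addr0 => /le_trans; apply.
apply: le_trans (_ : (B + D) * (e / (B + D + 1)) <= _); first exact: ler_wpM2l K0 _ _ hp.
by rewrite mulrCA ger_pMr// ler_pdivrMr// mul1r lerDl.
Qed.

Definition volterra : L2 -> L2 := mulx \o hardy.

Lemma bounded_mulx : bounded_op mulx.
Proof. exact: bounded_mulop bmeas_x. Qed.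

Lemma bounded_volterra : bounded_op volterra.
Proof. exact: bounded_op_comp bounded_mulx (@bounded_hardy R). Qed.

Lemma mulx_pL2 p : mulx (pL2 p) = pL2 ('X * p).
Proof.
by rewrite -mulop_pL2; congr mulop; apply/funext => x; rewrite /pfun hornerX.
Qed.

(** On [x^i] this is [1 / (i + 2) = 1 / (i + 1) - 1 / ((i + 1) (i + 2))]; bounded operators that
    agree on polynomials are equal. *)
Lemma hardy_mulx : hardy \o mulx = volterra \- (hardy \o volterra).
Proof.
apply: bounded_ext.
- exact: bounded_op_comp (@bounded_hardy R) bounded_mulx.
- apply/bounded_opP; have /bounded_opP[lV [B hB]] := bounded_volterra; split.
    exact: (linear_sub lV (linear_comp hardy_linear lV)).
  exists (B + 2 * B); exact: (bdd_sub hB (bdd_comp bdd_hardy hB)).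
move=> p; rewrite /volterra /= mulx_pL2 !hardy_pL2 mulx_pL2 hardy_pL2 -pL2B; congr pL2.
apply/polyP => -[|i]; rewrite coefB !coef_hpoly !coefXM /=; first by rewrite mul0r subrr.
rewrite coef_hpoly; have i1 : i.+1%:R != 0 :> C by rewrite pnatr_eq0.
have i2 : i.+2%:R != 0 :> C by rewrite pnatr_eq0.
have i3 : i.+2%:R = i.+1%:R + 1 :> C by rewrite -natr1.
by rewrite i3 in i2 *; move: i1 i2; move: (i.+1%:R : C) (p`_i) => a b a0 a1; field; rewrite a0 a1.
Qed.

End HardyAlgebra.

(** * Compactness of the Volterra operator *)

Section Volterra.
Context {R : realType}.
Local Notation C := R[i].
Local Notation mu := (@lebesgue_measure R).
Local Notation L2 := (L2 R).
Local Notation L2norm := (@L2norm R).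
Local Notation bdd := (@bdd R).

Let mI : measurable (I01 (R:=R)). Proof. exact: measurable_itv. Qed.
Hint Resolve mI : core.

Lemma real_net (M e : R) : 0 < e -> exists s : seq R, forall x, `|x| <= M -> exists2 y, y \in s & `|x - y| <= e.
Proof.
move=> e0; pose n := (Num.truncn (2 * M / e)).+1.
exists [seq - M + i%:R * e | i <- iota 0 n] => x xM.
have /andP[xM1 xM2] : - M <= x <= M by rewrite -ler_norml.
have x0 : 0 <= (x + M) / e by apply: divr_ge0; [lra|exact: ltW].
have /andP[h1 h2] := truncn_itv x0.
exists (- M + (Num.truncn ((x + M) / e))%:R * e).
  apply/mapP; exists (Num.truncn ((x + M) / e)) => //; rewrite mem_iota add0n /=.
  rewrite -(ltr_nat R); apply: le_lt_trans (truncnS_gt (2 * M / e)).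
  by apply: le_trans h1 _; apply: ler_wpM2r; [rewrite invr_ge0 ltW|lra].
rewrite ler_pdivlMr// in h1; rewrite ltr_pdivrMr// -natr1 in h2.
by rewrite ler_norml; apply/andP; split; nra.
Qed.

Lemma complex_net (M e : R) : 0 < e -> exists s : seq C, forall z, cmod z <= M -> exists2 w, w \in s & cmod (z - w) <= e.
Proof.
move=> e0; have [s hs] := real_net M (half_gt0 e0).
exists [seq (x +i* y)%C | x <- s, y <- s] => z zM.
have [a sa ha] := hs _ (le_trans (cmod_Re z) zM).
have [b sb hb] := hs _ (le_trans (cmod_Im z) zM).
exists (a +i* b)%C; first by apply/allpairsP; exists (a, b).
apply: le_trans (cmod_ReIm _) _; rewrite [e]splitr; apply: lerD; case: z ha hb {zM} => p q //=.
Qed.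

Lemma tbop_rank1 (c : L2 -> C) (w : L2) (M : R) : (forall u, L2norm u <= 1 -> cmod (c u) <= M) ->
  tbop (fun u => c u *: w).
Proof.
move=> cM; apply/tbopP => e e0.
have w1 : 0 < L2norm w + 1 by apply: ltr_wpDl => //; exact: L2norm_ge0.
have [s hs] := complex_net M (divr_gt0 e0 w1).
exists [seq z *: w | z <- s] => u /cM /hs[z zs cz].
exists (z *: w); first exact: map_f.
rewrite -scalerBl L2normZ; move: cz; rewrite ler_pdivlMr// => cz.
apply: le_trans cz; apply: ler_wpM2l; first exact: cmod_ge0.
by rewrite lerDl.
Qed.

Lemma tbop_sum n (T : nat -> L2 -> L2) : (forall k, (k < n)%N -> tbop (T k)) ->
  tbop (fun u => \sum_(k < n) T k u).
Proof.
elim: n => [|n IH] h.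
  apply/tbopP => e e0; exists [:: 0] => u _; exists 0; first by rewrite mem_head.
  by rewrite big_ord0 subrr L2norm0 ltW.
have -> : (fun u => \sum_(k < n.+1) T k u) = (fun u => \sum_(k < n) T k u) \+ T n.
  by apply/funext => u; rewrite big_ord_recr.
by apply: tbopD; [apply: IH => k kn; apply: h; exact: leqW|exact: h].
Qed.

Lemma toL2_sum n (g : nat -> R -> C) (c : nat -> C) : (forall k, sqint (g k)) ->
  sqint (fun x => \sum_(k < n) c k * g k x) /\
  \sum_(k < n) c k *: toL2 (g k) = toL2 (fun x => \sum_(k < n) c k * g k x).
Proof.
move=> sg; elim: n => [|n [s IH]].
  rewrite big_ord0; under eq_fun do rewrite big_ord0.
  by split; [exact: sqint0|].
have e : (fun x => \sum_(k < n.+1) c k * g k x) = (fun x => (fun x => \sum_(k < n) c k * g k x) x + (fun x => c n * g n x) x).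
  by apply/funext => x; rewrite big_ord_recr.
rewrite e; split; first by apply: sqintD => //; exact: sqintZ.
by rewrite big_ord_recr /= IH (toL2D s (sqintZ (c n) (sg n))) (toL2Z (c n) (sg n)).
Qed.

Lemma volterraE (u : L2) : sqint_eq (volterra u) (fun x => cintegral `[0, x] u).
Proof.
apply: sqint_eq_trans (mulopE (hardy u) bmeas_x) _.
have h0 : sqint_eq (fun x => x%:C%C * hfun u x) (fun x => cintegral `[0, x] u).
  apply: sqint_eq_off0 => x x0 x1; rewrite /hfun mulrA -rmorphM /= mulfV ?gt_eqF//.
  by rewrite mul1r.
apply: sqint_eq_trans h0; have := hardyE u; apply: filterS => x h xI.
by rewrite [L2fun _ _](h xI).
Qed.

Lemma cintegral_increment (f : R -> C) x y : sqint f -> 0 <= x -> x <= y -> y <= 1 ->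
  cmod (cintegral `[0, y] f - cintegral `[0, x] f) <= 2 * (sqnorm f * Num.sqrt (y - x)).
Proof.
move=> sf x0 xy y1.
have sub : `]x, y]%classic `<=` I01 by apply: subset_itv; rewrite bnd_simp.
have xyd : mu `]x, y]%classic = (y - x)%:E.
  transitivity (lebesgue_measure (`]x, y]%classic : set R)); first by [].
  rewrite lebesgue_measure_itv /= lte_fin; move: xy; rewrite le_eqVlt => /predU1P[->|xy].
    by rewrite ltxx subrr.
  by rewrite xy EFinB.
have [ir ii] := sqint_integrable sf.
have -> : cintegral `[0, y] f = cintegral `[0, x] f + cintegral `]x, y] f.
  have E (g : R -> R) : mu.-integrable I01 (EFin \o g) ->
      (\int[mu]_(t in `[0, y]) g t)%R = (\int[mu]_(t in `[0, x]) g t)%R + (\int[mu]_(t in `]x, y]) g t)%R.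
    move=> ig; have xyU : `[0, x]%classic `|` `]x, y]%classic = `[0, y]%classic :> set R.
      by rewrite -itv_bndbnd_setU// bnd_simp.
    rewrite -Rintegral_setU// ?xyU//.
      by apply: integrableS ig => //; exact: subset_0x.
    apply/disj_setPLR => t /= /[!in_itv] /= /andP[_ tx] /andP[xt _].
    by rewrite ltNge tx in xt.
  by apply/eqP; rewrite eq_complex /= !E// !eqxx.
rewrite addrAC subrr add0r.
apply: (cintegral_bound sf _ sub xyd) => //.
by rewrite subr_ge0.
Qed.

Lemma sqnorm_ae_le (f g : R -> C) (M a : R) : 0 <= M -> sqint f -> sqint_eq f g ->
  (forall x, I01 x -> x != a -> cmod (g x) <= M) -> sqnorm f <= M.
Proof.
move=> M0 sf fg h; apply: sqnorm_le => //.
pose k x := if x == a then 0 else g x.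
have fk : sqint_eq f k.
  by apply: sqint_eq_trans fg _; apply: (sqint_eq_off (a := a)) => x _ /negbTE xa; rewrite /k xa.
apply: le_trans (_ : (\int[mu]_(x in I01) (cst (M ^+ 2)%:E x) <= _)%E).
  apply: ae_ge0_le_integral => //.
  - by move=> x _; rewrite lee_fin sqmod_ge0.
  - exact: measurable_sqmod.
  - by move=> x _; rewrite lee_fin sqr_ge0.
  - apply: filterS fk => x hx xI; rewrite hx// lee_fin -cmod_sqr.
    rewrite lerXn2r ?nnegrE ?cmod_ge0// /k; case: eqP => [_|/eqP xa]; first by rewrite cmod0.
    exact: h.
by rewrite integral_cst// [X in (_ * X <= _)%E]measure_I01 mule1.
Qed.

(** Finite-rank approximation of [volterra]: the primitive of [u] is frozen at the left end of each
    of [N] intervals. These are half open, so the point 1 is missed. *)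
Definition step_op (N : nat) (u : L2) : L2 :=
  \sum_(k < N) cintegral `[0, k%:R / N%:R] u *:
     toL2 (fun x => (\1_(`[k%:R / N%:R, k.+1%:R / N%:R[%classic) x : R)%:C%C).

Lemma bin_uniq (N j k : nat) (x : R) : j%:R / N%:R <= x -> x < j.+1%:R / N%:R ->
  k%:R / N%:R <= x -> x < k.+1%:R / N%:R -> j = k.
Proof.
have lt (a b : nat) : a%:R / N%:R <= x -> x < b.+1%:R / N%:R -> (a <= b)%N.
  case: N => [|n]; first by rewrite !invr0 !mulr0 => /le_lt_trans h /h; rewrite ltxx.
  by move=> ha hb; have := le_lt_trans ha hb; rewrite ltr_pM2r ?invr_gt0// ltr_nat ltnS.
by move=> j1 j2 k1 k2; apply/eqP; rewrite eqn_leq !lt.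
Qed.

(** Primitives of L^2 functions are Holder continuous of exponent [1 / 2], so they vary little on an
    interval of length [1 / N]. *)
Lemma volterra_step N : (0 < N)%N -> bdd (volterra \- step_op N) (2 * Num.sqrt (N%:R^-1)).
Proof.
move=> N0; have NR : 0 < N%:R :> R by rewrite ltr0n.
split; first by rewrite mulr_ge0// sqrtr_ge0.
move=> u.
pose E k : set R := `[k%:R / N%:R, k.+1%:R / N%:R[%classic.
have mE k : measurable (E k) by exact: measurable_itv.
pose g k x : C := (\1_(E k) x : R)%:C%C.
have sg k : sqint (g k).
  have := (sqint_mul (bmeas_indic (mE k)) (@sqint_const1 R)).1.
  by under [X in sqint X -> _]eq_fun do rewrite mulr1.
have [ss es] := toL2_sum N (fun k => cintegral `[0, k%:R / N%:R] u) sg.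
pose w x := \sum_(k < N) cintegral `[0, k%:R / N%:R] u * g k x.
have su := L2_sqint (volterra u).
rewrite /= /step_op [X in volterra u - X]es -[volterra u in X in X <= _]toL2_id -(toL2B su ss).
rewrite (L2norm_toL2 (sqintB su ss)).
have M0 : 0 <= 2 * Num.sqrt N%:R^-1 * L2norm u.
  by apply: mulr_ge0 (L2norm_ge0 _); rewrite mulr_ge0// sqrtr_ge0.
(* The exceptional point is 1, which lies in no interval of [step_op]. *)
apply: (@sqnorm_ae_le _ (fun x => cintegral `[0, x] u - w x) _ 1) => //.
- exact: sqintB.
- by have := volterraE u; apply: filterS => x h xI; rewrite h.
move=> x xI x1.
have /andP[x0 xle] := I01P xI.
have xlt : x < 1 by rewrite lt_def eq_sym x1.
have Nx0 : 0 <= N%:R * x by rewrite mulr_ge0.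
have /andP[h1 h2] := truncn_itv Nx0.
set k := Num.truncn (N%:R * x) in h1 h2.
have kN : (k < N)%N.
  by rewrite -(ltr_nat R); apply: le_lt_trans h1 _; rewrite gtr_pMr.
have k1 : k%:R / N%:R <= x by rewrite ler_pdivrMr// mulrC.
have k2 : x < k.+1%:R / N%:R by rewrite ltr_pdivlMr// mulrC.
have -> : w x = cintegral `[0, k%:R / N%:R] u.
  rewrite /w (bigD1 (Ordinal kN)) //= big1 ?addr0.
    by rewrite /g indicE mem_set ?mulr1// /E /= in_itv /= k1.
  move=> j /negP jk; rewrite /g indicE memNset ?mulr0// /E /= in_itv /= => /andP[j1 j2].
  by apply: jk; apply/eqP/val_inj; exact: bin_uniq j1 j2 k1 k2.
apply: le_trans (cintegral_increment (L2_sqint u) _ k1 xle) _; first by rewrite divr_ge0.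
rewrite -mulrA ler_wpM2l// mulrC ler_wpM2r ?L2norm_ge0//; apply: ler_wsqrtr.
rewrite lerBlDr; apply: ltW; apply: lt_le_trans k2 _.
by rewrite -natr1 mulrDl mul1r addrC.
Qed.

Lemma tbop_volterra : tbop (@volterra R).
Proof.
apply: tbop_lim => e e0.
have e2 : 0 < (e / 2) ^+ 2 by rewrite exprn_gt0// half_gt0.
pose N := (Num.truncn ((e / 2) ^- 2)).+1.
have NR : 0 < N%:R :> R by rewrite ltr0n.
exists (step_op N); last first.
  apply: bdd_le (volterra_step _) => //.
  rewrite -ler_pdivlMl// mulrC -[leRHS]ger0_norm ?(ltW (half_gt0 e0))// -sqrtr_sqr.
  apply: ler_wsqrtr; rewrite -[leRHS]invrK lef_pV2 ?posrE ?invr_gt0//.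
  by apply: ltW; exact: truncnS_gt.
apply: (tbop_sum (T := fun k u => cintegral `[0, k%:R / N%:R] u *: toL2 (fun x => (\1_(`[k%:R / N%:R, k.+1%:R / N%:R[%classic) x : R)%:C%C))).
move=> k kN; apply: (@tbop_rank1 _ _ (2 * 1)) => u u1.
have k0 : 0 <= k%:R / N%:R :> R by rewrite divr_ge0.
have k1 : k%:R / N%:R <= 1 :> R by rewrite ler_pdivrMr// mul1r ler_nat ltnW.
apply: le_trans (cintegral_bound (L2_sqint u) _ (subset_0x k1) (measure_0x k0) k0) _ => //.
rewrite ler_wpM2l// -[leRHS]mulr1 ler_pM ?L2norm_ge0 ?sqrtr_ge0//.
by rewrite -[leRHS]sqrtr1 ler_wsqrtr.
Qed.

Lemma compact_volterra : compact_op (@volterra R).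
Proof. by apply/compact_opP; split; [exact: bounded_volterra|exact: tbop_volterra]. Qed.

End Volterra.

Section TwoOperators.
Variables (F : comNzRingType) (V : lmodType F) (M H : V -> V).
Hypotheses (lM : linear M) (lH : linear H).

Definition poly_part (p q : {poly F}) : V -> V := fun u => pop p M u + pop q H u.

Lemma poly_partD p q p' q' (K K' : V -> V) u :
  (poly_part p q u + K u) + (poly_part p' q' u + K' u) =
  poly_part (p + p') (q + q') u + (K u + K' u).
Proof. by rewrite /poly_part !popD addrACA; congr (_ + _); rewrite addrACA. Qed.

Lemma poly_partZ c p q (K : V -> V) u :
  c *: (poly_part p q u + K u) = poly_part (c *: p) (c *: q) u + c *: K u.
Proof. by rewrite /poly_part !popZ !scalerDr. Qed.

(** Splitting off the constant terms isolates the mixed product of [M] and [H]; the remaining terms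
    involve one operator at a time. *)
Lemma pop_comp_left p q c d u :
  pop (p * 'X + c%:P) M (pop (q * 'X + d%:P) H u) =
  pop p M (M (H (pop q H u))) + poly_part (d *: (p * 'X)) (c *: (q * 'X + d%:P)) u.
Proof.
rewrite /poly_part popD popMX popC !popZ popMX addrA; congr (_ + _).
rewrite popD popMX popC (linear_mapD lM) (linear_mapZ lM).
rewrite (linear_mapD (pop_linear lM p)) (linear_mapZ (pop_linear lM p)).
by rewrite (pop_S lH).
Qed.

Lemma pop_comp_right p q c d u :
  pop (q * 'X + d%:P) H (pop (p * 'X + c%:P) M u) =
  pop q H (H (M (pop p M u))) + poly_part (d *: (p * 'X + c%:P)) (c *: (q * 'X)) u.
Proof.
rewrite /poly_part popD popMX popC !popZ popMX [X in _ = _ + X]addrC addrA.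
congr (_ + _); rewrite popD popMX popC (linear_mapD lH) (linear_mapZ lH).
rewrite (linear_mapD (pop_linear lH q)) (linear_mapZ (pop_linear lH q)).
by rewrite (pop_S lM).
Qed.

Lemma poly_part_comp p q p' q' (K K' : V -> V) u :
  poly_part p q (poly_part p' q' u + K' u) + K (poly_part p' q' u + K' u) =
  (pop p M (pop p' M u) + pop p M (pop q' H u) + (pop q H (pop p' M u) + pop q H (pop q' H u))) +
  (poly_part p q (K' u) + K (poly_part p' q' u + K' u)).
Proof.
rewrite /poly_part !(linear_mapD (pop_linear lM _)) !(linear_mapD (pop_linear lH _)).
by rewrite [X in X + _ = _]addrACA -!addrA.
Qed.

End TwoOperators.

(** * Normal form in the polynomial algebra modulo compact operators *)

Section PolynomialElements.
Context {R : realType}.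
Local Notation C := R[i].
Local Notation L2 := (L2 R).
Local Notation hardy := (@hardy R).
Local Notation mulx := (@mulx R).
Local Notation volterra := (@volterra R).
Implicit Types (S T K : L2 -> L2) (p q : {poly C}).

Lemma hardy_compactsD S T : hardy_compacts S -> hardy_compacts T -> hardy_compacts (S \+ T).
Proof.
by move=> [aS cS] [aT cT]; split; [exact: hardy_algebraD|exact: compact_opD].
Qed.

Lemma hardy_compacts_left S K : hardy_algebra S -> hardy_compacts K -> hardy_compacts (S \o K).
Proof.
move=> aS [aK cK]; split; first exact: hardy_algebra_comp.
exact: compact_op_left (hardy_algebra_bounded aS) cK.
Qed.

Lemma hardy_compacts_right S K : hardy_algebra S -> hardy_compacts K -> hardy_compacts (K \o S).
Proof.
move=> aS [aK cK]; split; first exact: hardy_algebra_comp.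
exact: compact_op_right (hardy_algebra_bounded aS) cK.
Qed.

Lemma hardy_compactsZ (c : C) K : hardy_compacts K -> hardy_compacts (c \*: K).
Proof.
move=> hK; have -> : c \*: K = (c \*: idfun) \o K by [].
apply: hardy_compacts_left hK; apply: hardy_algebraZ.
by have [] := @hardy_algebra_unital R.
Qed.

Lemma hardy_compacts_volterra : hardy_compacts volterra.
Proof.
split; last exact: compact_volterra.
apply: polyalg_hardy_algebra; have [_ _ _ h] := @polyalg_unital R.
by apply: h; [exact: polyalg_mulx|exact: polyalg_hardy].
Qed.

Lemma hardy_compacts_hardy_mulx : hardy_compacts (hardy \o mulx).
Proof.
have [aI _ _ _] := @hardy_algebra_unital R.
have -> : hardy \o mulx = (idfun \+ ((-1) \*: hardy)) \o volterra.
  by rewrite hardy_mulx; apply/funext => u /=; rewrite scaleN1r.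
apply: hardy_compacts_left hardy_compacts_volterra; apply: hardy_algebraD aI _.
by apply: hardy_algebraZ; apply: polyalg_hardy_algebra; exact: polyalg_hardy.
Qed.

Local Notation poly_part := (poly_part mulx hardy).

Definition poly_decomp : set (L2 -> L2) := [set T | exists p q K,
  hardy_compacts K /\ T = poly_part p q \+ K].

Lemma hardy_compacts0 : hardy_compacts (fun=> 0 : L2).
Proof.
have -> : (fun=> 0) = 0 \*: volterra by apply/funext => u; rewrite /= scale0r.
exact: hardy_compactsZ hardy_compacts_volterra.
Qed.

Lemma poly_decompD S T : poly_decomp S -> poly_decomp T -> poly_decomp (S \+ T).
Proof.
move=> [p [q [K [hK ->]]]] [p' [q' [K' [hK' ->]]]].
exists (p + p'), (q + q'), (K \+ K'); split; first exact: hardy_compactsD.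
by apply/funext => u; exact: poly_partD.
Qed.

Lemma poly_decompZ (c : C) T : poly_decomp T -> poly_decomp (c \*: T).
Proof.
move=> [p [q [K [hK ->]]]]; exists (c *: p), (c *: q), (c \*: K).
split; first exact: hardy_compactsZ.
by apply/funext => u; exact: poly_partZ.
Qed.

Lemma poly_decomp_compact K : hardy_compacts K -> poly_decomp K.
Proof.
by move=> hK; exists 0, 0, K; split => //; apply/funext => u; rewrite /poly_part /= !pop0 !add0r.
Qed.

Lemma poly_decomp_part p q : poly_decomp (poly_part p q).
Proof.
by exists p, q, (fun=> 0); split; [exact: hardy_compacts0|apply/funext => u; rewrite /= addr0].
Qed.

Lemma poly_decomp_mulx p : poly_decomp (pop p mulx).
Proof.
rewrite (_ : pop p mulx = poly_part p 0); first exact: poly_decomp_part.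
by apply/funext => u; rewrite /poly_part pop0 addr0.
Qed.

Lemma poly_decomp_hardy q : poly_decomp (pop q hardy).
Proof.
rewrite (_ : pop q hardy = poly_part 0 q); first exact: poly_decomp_part.
by apply/funext => u; rewrite /poly_part pop0 add0r.
Qed.

Lemma mulx_linear : linear mulx.
Proof. by have /bounded_opP[] := @bounded_mulx R. Qed.

Lemma poly_split p : exists p1 c, p = p1 * 'X + c%:P.
Proof.
elim/poly_ind: p => [|p c _]; last by exists p, c.
by exists 0, 0; rewrite mul0r addr0.
Qed.

Lemma hardy_algebra_pop_mulx p : hardy_algebra (pop p mulx).
Proof.
apply: polyalg_hardy_algebra.
exact: (unital_algebra_pop p (@polyalg_unital R) (@polyalg_mulx R)).
Qed.

Lemma hardy_algebra_pop q : hardy_algebra (pop q hardy).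
Proof. by apply: polyalg_hardy_algebra; exact: pop_hardy_algebra. Qed.

Lemma poly_decomp_mulx_hardy p q : poly_decomp (pop p mulx \o pop q hardy).
Proof.
have [p1 [c ->]] := poly_split p; have [q1 [d ->]] := poly_split q.
set q0 := q1 * 'X + d%:P.
have -> : pop (p1 * 'X + c%:P) mulx \o pop q0 hardy =
  (pop p1 mulx \o (volterra \o pop q1 hardy)) \+ poly_part (d *: (p1 * 'X)) (c *: q0).
  by apply/funext => u; exact: (pop_comp_left mulx_linear (@hardy_linear R)).
apply: poly_decompD (poly_decomp_part _ _); apply: poly_decomp_compact.
apply: hardy_compacts_left (hardy_algebra_pop_mulx _) _.
exact: hardy_compacts_right (hardy_algebra_pop _) hardy_compacts_volterra.
Qed.

Lemma poly_decomp_hardy_mulx p q : poly_decomp (pop q hardy \o pop p mulx).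
Proof.
have [p1 [c ->]] := poly_split p; have [q1 [d ->]] := poly_split q.
set p0 := p1 * 'X + c%:P.
have -> : pop (q1 * 'X + d%:P) hardy \o pop p0 mulx =
  (pop q1 hardy \o ((hardy \o mulx) \o pop p1 mulx)) \+ poly_part (d *: p0) (c *: (q1 * 'X)).
  by apply/funext => u; exact: (pop_comp_right mulx_linear (@hardy_linear R)).
apply: poly_decompD (poly_decomp_part _ _); apply: poly_decomp_compact.
apply: hardy_compacts_left (hardy_algebra_pop _) _.
exact: hardy_compacts_right (hardy_algebra_pop_mulx _) hardy_compacts_hardy_mulx.
Qed.

Lemma hardy_algebra_part p q : hardy_algebra (poly_part p q).
Proof. exact: hardy_algebraD (hardy_algebra_pop_mulx p) (hardy_algebra_pop q). Qed.

Lemma poly_decomp_comp S T : poly_decomp S -> poly_decomp T -> poly_decomp (S \o T).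
Proof.
move=> [p [q [K [hK ->]]]] [p' [q' [K' [hK' ->]]]].
pose A := pop p mulx; pose B := pop q hardy.
pose A' := pop p' mulx; pose B' := pop q' hardy.
have -> : (poly_part p q \+ K) \o (poly_part p' q' \+ K') =
  (((A \o A') \+ (A \o B')) \+ ((B \o A') \+ (B \o B'))) \+
  ((poly_part p q \o K') \+ (K \o (poly_part p' q' \+ K'))).
  by apply/funext => u; exact: (poly_part_comp mulx_linear (@hardy_linear R)).
apply: poly_decompD; first apply: poly_decompD; first apply: poly_decompD.
- rewrite (_ : A \o A' = pop (p * p') mulx); first exact: poly_decomp_mulx.
  by apply/funext => u; rewrite (popM mulx_linear).
- exact: poly_decomp_mulx_hardy.
- apply: poly_decompD; first exact: poly_decomp_hardy_mulx.
  rewrite (_ : B \o B' = pop (q * q') hardy); first exact: poly_decomp_hardy.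
  by apply/funext => u; rewrite (popM (@hardy_linear R)).
apply: poly_decomp_compact; apply: hardy_compactsD.
  exact: hardy_compacts_left (hardy_algebra_part _ _) hK'.
apply: hardy_compacts_right hK; exact: hardy_algebraD (hardy_algebra_part _ _) hK'.1.
Qed.

Lemma poly_decomp_unital : unital_algebra poly_decomp.
Proof.
split; [|exact: poly_decompD|exact: poly_decompZ|exact: poly_decomp_comp].
rewrite (_ : idfun = pop 1%:P hardy); first exact: poly_decomp_hardy.
by apply/funext => u; rewrite popC scale1r.
Qed.

Lemma polyalg_decomp T : polyalg T -> poly_decomp T.
Proof.
apply; split; first exact: poly_decomp_unital.
move=> _ [->|->].
  by rewrite (_ : hardy = pop 'X hardy); [exact: poly_decomp_hardy|apply/funext => u; rewrite popX].
by rewrite (_ : mulx = pop 'X mulx); [exact: poly_decomp_mulx|apply/funext => u; rewrite popX].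
Qed.

End PolynomialElements.

(** * Lower bounds for the norm *)

Section ApproximateEigenvectors.
Context {R : realType}.
Local Notation C := R[i].
Local Notation mu := (@lebesgue_measure R).
Implicit Types (f g p q : {poly C}).

Definition pnorm (f : {poly C}) : R := L2norm (pL2 f).

Lemma pnorm_ge0 f : 0 <= pnorm f. Proof. exact: L2norm_ge0. Qed.

Lemma pnormD f g : pnorm (f + g) <= pnorm f + pnorm g.
Proof. by rewrite /pnorm pL2D; exact: L2normD. Qed.

Lemma pnormZ (c : C) f : pnorm (c *: f) = cmod c * pnorm f.
Proof. by rewrite /pnorm pL2Z; exact: L2normZ. Qed.

Lemma pnormN f : pnorm (- f) = pnorm f.
Proof. by rewrite -scaleN1r pnormZ cmodN cmod1 mul1r. Qed.

Lemma pnormB f g : pnorm (f - g) <= pnorm f + pnorm g.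
Proof. by rewrite -(pnormN g); exact: pnormD. Qed.

Lemma pnorm0 : pnorm 0 = 0.
Proof. by rewrite -(scale0r 0) pnormZ cmod0 mul0r. Qed.

Lemma pnorm_sum (n : nat) (F : nat -> {poly C}) :
  pnorm (\sum_(k < n) F k) <= \sum_(k < n) pnorm (F k).
Proof.
elim: n => [|n IH]; first by rewrite !big_ord0 pnorm0.
by rewrite !big_ord_recr /=; apply: le_trans (pnormD _ _) _; rewrite lerD2r.
Qed.

Lemma pnorm_sqr f : pnorm f ^+ 2 = complex.Re (ip f f).
Proof. exact: L2norm_poly. Qed.

Opaque pnorm.

Lemma mean_ip f : mean f = ip f 1.
Proof.
rewrite /mean /ip; apply: eq_bigr => i _; rewrite size_poly1 big_ord1 addn0.
have -> : (1 : {poly C})`_0 = 1 by rewrite coef1.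
have -> : (1 : C)^*%C = 1 by apply/eqP; rewrite eq_complex /= oppr0 !eqxx.
by rewrite mulr1.
Qed.

Lemma sqr_inj (a b : R) : 0 <= a -> 0 <= b -> a ^+ 2 = b ^+ 2 -> a = b.
Proof. by move=> a0 b0 /eqP; rewrite eqrXn2// => /eqP. Qed.

Lemma pnorm_cpoly f : pnorm (cpoly f) ^+ 2 = pnorm f ^+ 2 - cmod (mean f) ^+ 2.
Proof.
apply: etrans (pnorm_sqr _) _; rewrite ip_cpoly ReB mulcJE; congr (_ - _).
exact: esym (pnorm_sqr f).
Qed.

Lemma pnorm_mean f : cmod (mean f) <= pnorm f.
Proof.
have := sqr_ge0 (pnorm (cpoly f)); rewrite pnorm_cpoly subr_ge0.
by rewrite ler_pXn2r// ?nnegrE ?cmod_ge0 ?pnorm_ge0.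
Qed.

Lemma prim_deriv (P : {poly R}) : prim P^`() = P - (P`_0)%:P.
Proof.
apply/polyP => -[|i]; rewrite coef_prim coefB coefC /=; first by rewrite invr0 mulr0 subrr.
by rewrite coef_deriv subr0 -[_ *+ _]mulr_natr mulfK// pnatr_eq0.
Qed.

(** [(1 - X)^N] has squared norm [1 / (2 N + 1)]. Evaluation at 0 is not continuous for the L^2
    norm, so a constant term can be removed at small cost. *)
Lemma small_monomial (e : R) : 0 < e -> exists2 s : {poly C}, s`_0 = 1 & pnorm s <= e.
Proof.
move=> e0; pose N := (Num.truncn (e ^- 2)).+1.
pose r : {poly R} := (1 - 'X) ^+ N.
exists ((1 - 'X) ^+ N).
  by rewrite -horner_coef0 horner_exp hornerD hornerN hornerX hornerC subr0 expr1n.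
rewrite -(@ler_pXn2r _ 2)// ?nnegrE ?pnorm_ge0 ?(ltW e0)//.
have : (pnorm ((1 - 'X) ^+ N) ^+ 2)%:E = (\int[mu]_(x in I01) ((r ^+ 2).[x])%:E)%E.
  rewrite [pnorm _](L2norm_toL2 (sqint_poly _)) -(sqnormE (sqint_poly _)).
  apply: eq_integral => x _; congr EFin.
  rewrite /pfun -cmod_sqr /r !horner_exp !hornerD !hornerN !hornerX !hornerC.
  have -> : 1 - x%:C%C = (1 - x)%:C%C by rewrite rmorphB rmorph1.
  by rewrite cmodX cmod_real -!exprM mulnC exprM real_normK ?num_real// -exprM mulnC.
move=> /(congr1 (@fine R)) /= ->.
rewrite -[fine _]/(Rint 0 1 (horner (r ^+ 2))) Rint_poly//.
have -> : r ^+ 2 = - (N * 2).+1%:R^-1 *: ((1 - 'X) ^+ (N * 2).+1)^`().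
  rewrite deriv_exp derivB derivX derivC sub0r /= mulN1r mulNrn scalerN scaleNr opprK.
  by rewrite -scalerMnr scalerMnl -[_ *+ _]mulr_natr mulVf ?pnatr_eq0// scale1r /r -exprM.
rewrite primZ prim_deriv hornerZ hornerD hornerN hornerC horner_exp !hornerD hornerN hornerX.
rewrite hornerC subrr expr0n /= -horner_coef0 horner_exp hornerD hornerN hornerX hornerC subr0 expr1n sub0r.
rewrite mulrN1 opprK.
apply: le_trans (_ : N%:R^-1 <= _).
  by rewrite lef_pV2 ?posrE ?ltr0n// ler_nat -addn1 -ltnS; lia.
rewrite -[leRHS]invrK lef_pV2 ?posrE ?invr_gt0 ?exprn_gt0 ?ltr0n//.
by apply: ltW; exact: truncnS_gt.
Qed.

Lemma cpoly_linear : linear (@cpoly R).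
Proof.
by move=> a p q; rewrite /cpoly hpoly_linear scalerBr opprD addrACA.
Qed.

Lemma cpolyC (c : C) : cpoly c%:P = 0.
Proof.
apply/polyP => i; rewrite coefB coef_hpoly coefC coef0.
by case: i => [|i] /=; rewrite ?divr1 ?mul0r subrr.
Qed.

Lemma meanC (c : C) : mean c%:P = c.
Proof.
by rewrite (@mean_wide _ 1) ?size_polyC_leq1// big_ord1 coefC divr1.
Qed.

Lemma pnorm1 : pnorm 1 = 1.
Proof.
apply: sqr_inj (pnorm_ge0 _) ler01 _; apply: etrans (pnorm_sqr _) _; rewrite -mean_ip.
by rewrite -[1]/(1%:P) meanC expr1n.
Qed.

(** [1 - H] multiplies [x^i] by [i / (i + 1)]: it kills constants and reaches exactly the
    polynomials without constant term. The constant term of [p] is removed by [small_monomial]; then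
    the mean of the preimage is removed, since on mean 0 polynomials [cpoly] is isometric, which
    bounds the norm of [r]. *)
Lemma cpoly_right_inverse p (e : R) : 0 < e ->
  exists r, [/\ mean r = 0, pnorm (cpoly r - p) <= e & pnorm r <= pnorm p + e].
Proof.
move=> e0; have c1 : 0 < cmod p`_0 + 1 by apply: ltr_wpDl => //; exact: cmod_ge0.
have [s s0 sle] := small_monomial (divr_gt0 e0 c1).
pose p' := p - p`_0 *: s.
have p'0 : p'`_0 = 0 by rewrite coefB coefZ s0 mulr1 subrr.
have small : pnorm (p`_0 *: s) <= e.
  rewrite pnormZ; apply: le_trans (_ : cmod p`_0 * (e / (cmod p`_0 + 1)) <= _).
    by apply: ler_wpM2l; rewrite ?cmod_ge0.
  by rewrite mulrCA ger_pMr// ler_pdivrMr// mul1r lerDl.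
(* Coefficients are multiplied by [(i + 1) / i]; at index 0 the division by 0 gives 0. *)
pose r0 := \poly_(i < size p') (p'`_i * i.+1%:R / i%:R).
have cr0 : cpoly r0 = p'.
  apply/polyP => i; rewrite coefB coef_hpoly coef_poly; case: ltnP => [_|h]; last first.
    by rewrite mul0r subr0 nth_default.
  case: i => [|i]; first by rewrite p'0 !mul0r subr0.
  have i1 : i.+1%:R != 0 :> C by rewrite pnatr_eq0.
  have i2 : i.+2%:R != 0 :> C by rewrite pnatr_eq0.
  have i3 : i.+2%:R = i.+1%:R + 1 :> C by rewrite -natr1.
  by rewrite i3 in i2 *; move: i1 i2; move: (i.+1%:R : C) (p'`_i.+1) => a b a0 a1; field; rewrite a0 a1.
pose r := r0 - (mean r0)%:P.
have mr : mean r = 0.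
  rewrite mean_ip /r -scaleN1r -(addrC (-1 *: _)) ipDl ipZl -!mean_ip meanC.
  by rewrite mulN1r addNr.
have cr : cpoly r = p' by rewrite (linear_mapB cpoly_linear) cpolyC subr0.
have nr : pnorm r = pnorm p'.
  apply: sqr_inj (pnorm_ge0 _) (pnorm_ge0 _) _.
  have := pnorm_cpoly r; rewrite mr cmod0 expr0n subr0 cr; exact: esym.
exists r; split.
- exact: mr.
- by rewrite cr /p' addrAC subrr add0r pnormN.
- by rewrite nr; apply: le_trans (pnormB _ _) _; rewrite lerD2l.
Qed.

Lemma geometric_small (w : R) (e : R) : 0 <= w -> w < 1 -> 0 < e -> exists N, w ^+ N <= e.
Proof.
move=> w0 w1 e0.
have : (fun n => w ^+ n) @ \oo --> (0 : R) by apply: cvg_expr; rewrite ger0_norm.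
move=> /cvgrPdist_le/(_ e e0)[N _ /(_ N (leqnn N))] /=.
by rewrite sub0r normrN ger0_norm ?exprn_ge0// => h; exists N.
Qed.

Lemma sub_shift (V : zmodType) (a b c : V) : b - c = - (a - b - (a - c)).
Proof. by rewrite !opprB addrA addrAC [a - c - a]addrAC subrr add0r addrC. Qed.

(* [f] is a truncation of [\sum_k w^k e_k], with [w = 1 - z] and [e_k] an approximate orthonormal
   sequence such that [1 - H] maps [e_k.+1] to [e_k] and [e_0 = 1] to [0]. *)
Lemma approximate_eigenvector (z : C) (h : R) : cmod (1 - z) < 1 -> 0 < h ->
  exists2 f, pnorm (hpoly f - z *: f) <= h & 1 <= pnorm f.
Proof.
set w := 1 - z => w1 h0.
have [N hN] := geometric_small (cmod_ge0 w) w1 (third_gt0 h0).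
(* [N * d <= h / 3] bounds the accumulated defects, and [N * d <= 1] keeps the norm of [e N] below
   2. *)
pose d := Num.min h 1 / (3 * N.+1%:R).
have hm : 0 < Num.min h 1 by rewrite lt_min h0 ltr01.
have d0 : 0 < d by rewrite divr_gt0.
have Nd3 : N%:R * d <= Num.min h 1 / 3.
  rewrite /d mulrCA ler_pM2l// invfM mulrCA ler_piMr ?invr_ge0// ler_pdivrMr//.
  by rewrite mul1r ler_nat.
have Nd : N%:R * d <= h / 3 by apply: le_trans Nd3 _; rewrite ler_pM2r// ge_min lexx.
have Nd1 : N%:R * d <= 1.
  by apply: le_trans Nd3 _; have : Num.min h 1 <= 1; [by rewrite ge_min lexx orbT|lra].
have [D DP] := choice (fun p => cpoly_right_inverse p d0).
pose e k := iter k D 1.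
have ne k : pnorm (e k) <= 1 + k%:R * d.
  elim: k => [|k IH]; first by rewrite mul0r addr0 pnorm1.
  have [_ _ le] := DP (e k); apply: le_trans le _.
  by rewrite -natr1 mulrDl mul1r addrA lerD2r.
pose f := \sum_(k < N.+1) w ^+ k *: e k.
(* Because [cpoly (e 0)] is 0, shifting the index leaves only the defects of the right inverse and
   one boundary term, small by the choice of [N]. *)
have cf : cpoly f - w *: f = \sum_(k < N) w ^+ k.+1 *: (cpoly (e k.+1) - e k) - w ^+ N.+1 *: e N.
  rewrite /f (linear_map_sum cpoly_linear) scaler_sumr big_ord_recl big_ord_recr /=.
  rewrite (linear_mapZ cpoly_linear) [cpoly (e 0%N)]cpolyC scaler0 add0r.
  rewrite opprD addrA scalerA -exprS; congr (_ - _); rewrite -sumrB.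
  apply: eq_bigr => k _; rewrite /bump leq0n add1n add0n (linear_mapZ cpoly_linear) scalerBr scalerA -exprS.
  by rewrite -!scalerBr.
have wle k : cmod (w ^+ k) <= 1 by rewrite cmodX exprn_ile1 ?cmod_ge0// ltW.
exists f; last first.
  (* [e k] has mean 0 for [k > 0], so [f] has mean 1, which bounds its norm from below. *)
  apply: le_trans (pnorm_mean _); rewrite mean_ip /f ip_suml big_ord_recl big1 ?addr0.
    by rewrite expr0 mul1r -mean_ip meanC cmod1.
  by move=> k _; rewrite -mean_ip /=; have [-> _ _] := DP (e k); rewrite mulr0.
have -> : hpoly f - z *: f = - (cpoly f - w *: f).
  by rewrite /w scalerBl scale1r; exact: sub_shift.
rewrite pnormN cf; apply: le_trans (pnormB _ _) _.
apply: le_trans (_ : \sum_(k < N) d + h / 3 * (1 + N%:R * d) <= _).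
  apply: lerD.
    apply: le_trans (pnorm_sum N (fun k => w ^+ k.+1 *: (cpoly (e k.+1) - e k))) _; apply: ler_sum => k _.
    rewrite pnormZ; have [_ le _] := DP (e k).
    by apply: le_trans le; apply: ler_piMl => //; exact: pnorm_ge0.
  rewrite pnormZ; apply: ler_pM; rewrite ?cmod_ge0 ?pnorm_ge0//.
  rewrite cmodX exprS; apply: le_trans hN; apply: ler_piMl; [exact: exprn_ge0 (cmod_ge0 _)|exact: ltW].
rewrite sumr_const card_ord -[d *+ N]mulr_natl.
by nra.
Qed.

End ApproximateEigenvectors.

(** * Compression to sets of small measure *)

Section Compression.
Context {R : realType}.
Local Notation C := R[i].
Local Notation mu := (@lebesgue_measure R).
Local Notation L2 := (L2 R).
Local Notation L2norm := (@L2norm R).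
Local Notation bdd := (@bdd R).
Implicit Types (E : set R) (S T K : L2 -> L2).

Let mI : measurable (I01 (R:=R)). Proof. exact: measurable_itv. Qed.
Hint Resolve mI : core.

Definition indc E (x : R) : C := (\1_E x : R)%:C%C.

Lemma indcT E x : E x -> indc E x = 1.
Proof. by move=> Ex; rewrite /indc indicE mem_set. Qed.

Lemma indcF E x : ~ E x -> indc E x = 0.
Proof. by move=> Ex; rewrite /indc indicE memNset. Qed.

Definition chi E : L2 -> L2 := mulop (indc E).

Lemma bmeas_indc E : measurable E -> bmeas (indc E) 1.
Proof. exact: bmeas_indic. Qed.

Lemma chi_linear E : measurable E -> linear (chi E).
Proof. by move=> mE; exact: mulop_linear (bmeas_indc mE). Qed.

Lemma chi_norm E u : measurable E -> L2norm (chi E u) <= L2norm u.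
Proof. by move=> mE; have := mulop_norm u (bmeas_indc mE); rewrite mul1r. Qed.

Lemma chi_chi E u : measurable E -> chi E (chi E u) = chi E u.
Proof.
move=> mE; rewrite /chi (bmeas_comp u (bmeas_indc mE) (bmeas_indc mE)); congr mulop.
apply/funext => x; have [Ex|nEx] := pselect (E x); first by rewrite indcT// mulr1.
by rewrite indcF// mulr0.
Qed.

Lemma sqint_indc E : measurable E -> sqint (indc E).
Proof.
move=> mE; have := (sqint_mul (bmeas_indc mE) (@sqint_const1 R)).1.
by under [X in sqint X -> _]eq_fun do rewrite mulr1.
Qed.

Lemma sqnorm_indc E (r : R) : measurable E -> E `<=` I01 -> mu E = r%:E ->
  sqnorm (indc E) = Num.sqrt r.
Proof.
move=> mE EI Er; rewrite /sqnorm; congr Num.sqrt.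
have -> : (\int[mu]_(x in I01) (sqmod (indc E x))%:E = \int[mu]_(x in I01) (\1_E x)%:E)%E.
  apply: eq_integral => x _; rewrite -cmod_sqr /indc cmod_real real_normK ?num_real//.
  by rewrite indicE; case: (_ \in _); rewrite ?expr1n ?expr0n.
rewrite integral_indic// setIidl//.
by rewrite [X in fine X](_ : _ = r%:E).
Qed.

(** Absolute continuity of the norm: [v] is close to a polynomial, which is bounded, so its norm
    over [E] is at most a constant times the square root of the measure. *)
Lemma chi_small (v : L2) (e : R) : 0 < e -> exists2 d : R, 0 < d &
  forall E r, measurable E -> E `<=` I01 -> mu E = r%:E -> r <= d -> L2norm (chi E v) <= e.
Proof.
move=> e0; have e2 := half_gt0 e0.
have [p hp] := poly_density v e2; have [B B0 hB] := poly_bounded p.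
have B1 : 0 < B + 1 by apply: ltr_wpDl.
have q0 : 0 < e / 2 / (B + 1) by rewrite divr_gt0.
exists ((e / 2 / (B + 1)) ^+ 2); first by rewrite exprn_gt0.
move=> E r mE EI Er rd.
have le1 : L2norm (chi E (v - pL2 p)) <= e / 2 by apply: le_trans (chi_norm _ mE) hp.
have le2 : L2norm (chi E (pL2 p)) <= e / 2.
  have s1 := (sqint_mul (bmeas_indc mE) (sqint_poly p)).1.
  have -> : chi E (pL2 p) = toL2 (fun x => indc E x * pfun p x).
    apply: toL2_eq => //; first exact: (sqint_mul (bmeas_indc mE) (L2_sqint _)).1.
    have := toL2K (sqint_poly p); apply: filterS => x h xI; by rewrite [L2fun _ _](h xI).
  rewrite (L2norm_toL2 s1).
  have [|_ le] := @sqint_dom R (indc E) (fun x => indc E x * pfun p x) B B0 (sqint_cmeas s1) (sqint_indc mE).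
    by move=> x xI; rewrite cmodM mulrC; apply: ler_wpM2r; rewrite ?cmod_ge0// hB.
  apply: le_trans le _; rewrite (sqnorm_indc mE EI Er).
  apply: le_trans (_ : B * (e / 2 / (B + 1)) <= _).
    apply: ler_wpM2l => //; rewrite -[leRHS]ger0_norm ?(ltW q0)// -sqrtr_sqr.
    exact: ler_wsqrtr.
  by rewrite mulrCA ger_pMr// ler_pdivrMr// mul1r lerDl.
have -> : chi E v = chi E (v - pL2 p) + chi E (pL2 p).
  by rewrite -(linear_mapD (chi_linear mE)) subrK.
by apply: le_trans (L2normD _ _) _; rewrite [e]splitr; exact: lerD le1 le2.
Qed.

Lemma chi_small_seq (s : seq L2) (e : R) : 0 < e -> exists2 d : R, 0 < d &
  forall E r v, v \in s -> measurable E -> E `<=` I01 -> mu E = r%:E -> r <= d ->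
    L2norm (chi E v) <= e.
Proof.
move=> e0; elim: s => [|u s [d d0 hd]]; first by exists 1.
have [d' d0' hd'] := chi_small u e0.
exists (Num.min d d'); first by rewrite lt_min d0.
move=> E r v; rewrite inE => /predU1P[->|vs] mE EI Er; rewrite le_min => /andP[rd rd'].
  exact: hd' Er rd'.
exact: hd vs mE EI Er rd.
Qed.

Lemma L2norm_swap (a b : L2) : L2norm b <= L2norm (a - b) + L2norm a.
Proof. by rewrite -lerBlDr -(L2norm_distC b a) L2norm_lower. Qed.

Lemma lower_estimate (a b c x y m e : R) : a <= b + x -> x <= y + c -> b <= e -> y <= m -> c <= e + e ->
  a <= m + 3 * e.
Proof. lra. Qed.

(** [K] maps the unit ball into finitely many small balls, and their centers are small on [E] once
    [E] has small measure; the compression to [E] thus hides [K]. On the normalized [w] it leaves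
    [lam] up to three errors: one for [S], two for [K]. *)
Lemma lower_bound S K (lam : C) (m : R) : linear S -> linear K -> tbop K -> bdd (S \+ K) m ->
  (forall e d : R, 0 < e -> 0 < d -> exists E r w,
     [/\ measurable E, E `<=` I01, mu E = r%:E, r <= d &
         0 < L2norm w /\ L2norm (chi E (S w) - lam *: w) <= e * L2norm w]) ->
  cmod lam <= m.
Proof.
move=> lS lK /tbopP tK [m0 hm] h; apply/ler_addgt0Pr => e' e0'.
pose e := e' / 3; have e0 : 0 < e := third_gt0 e0'.
have -> : e' = 3 * e by rewrite /e mulrC divfK.
have [s hs] := tK e e0; have [d d0 hd] := chi_small_seq s e0.
have [E [r [w [mE EI Er rd [w0 le]]]]] := h e d e0 d0.
pose c : C := (L2norm w)^-1%:C%C.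
have cc : cmod c = (L2norm w)^-1 by rewrite cmod_real ger0_norm// invr_ge0; exact: L2norm_ge0.
pose v := c *: w.
have v1 : L2norm v = 1 by rewrite L2normZ cc mulVf// lt0r_neq0.
have lev : L2norm (chi E (S v) - lam *: v) <= e.
  have -> : chi E (S v) - lam *: v = c *: (chi E (S w) - lam *: w).
    by rewrite /v (linear_mapZ lS) (linear_mapZ (chi_linear mE)) scalerBr !scalerA [c * _]mulrC.
  by rewrite L2normZ cc mulrC ler_pdivrMr.
have [z zs zle] := hs v (eq_ind_r (fun x => x <= 1) (lexx 1) v1).
have Kz : L2norm (chi E (K v)) <= e + e.
  have -> : chi E (K v) = chi E (K v - z) + chi E z.
    by rewrite -(linear_mapD (chi_linear mE)) subrK.
  apply: le_trans (L2normD _ _) _; apply: lerD; last exact: hd zs mE EI Er rd.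
  exact: le_trans (chi_norm _ mE) zle.
have Tv : L2norm (chi E ((S \+ K) v)) <= m.
  by apply: le_trans (chi_norm _ mE) (le_trans (hm v) _); rewrite v1 mulr1.
have Sv : L2norm (chi E (S v)) <= L2norm (chi E ((S \+ K) v)) + L2norm (chi E (K v)).
  have -> : chi E (S v) = chi E ((S \+ K) v) - chi E (K v).
    by rewrite -(linear_mapB (chi_linear mE)) /= addrK.
  exact: L2normB.
have lv : L2norm (lam *: v) <= L2norm (chi E (S v) - lam *: v) + L2norm (chi E (S v)).
  exact: L2norm_swap.
rewrite L2normZ v1 mulr1 in lv.
exact: lower_estimate lv Sv lev Tv Kz.
Qed.

Lemma chi_local E (psi : R -> C) (lam : C) (M e : R) (u : L2) : measurable E -> bmeas psi M -> 0 <= e ->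
  (forall x, I01 x -> E x -> cmod (psi x - lam) <= e) ->
  L2norm (chi E (mulop psi (chi E u)) - lam *: chi E u) <= e * L2norm (chi E u).
Proof.
move=> mE bp e0 h; have bE := bmeas_indc mE.
have b1 := bmeasM bE bp.
have b2 : bmeas (fun x => - lam * indc E x) (cmod (- lam) * 1) by exact: bmeasM (bmeas_cst _) bE.
have b3 : bmeas (fun x => indc E x * psi x + - lam * indc E x) e.
  split => //.
    case: b1 b2 => _ [r1 i1] _ [_ [r2 i2] _]; split.
      by under eq_fun do rewrite ReD; exact: measurable_funD.
    under eq_fun do rewrite (raddfD (@complex.Im R)) /=.
    exact: measurable_funD.
  move=> x xI; have [Ex|nEx] := pselect (E x); last by rewrite indcF// mul0r mulr0 addr0 cmod0.
  by rewrite indcT// mul1r mulr1; exact: h.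
have -> : chi E (mulop psi (chi E u)) - lam *: chi E u =
    mulop (fun x => indc E x * psi x + - lam * indc E x) (chi E u).
  rewrite (mulopD (chi E u) b1 b2) (mulopZ (- lam) (chi E u) bE) -/(chi E _) (chi_chi u mE).
  by rewrite scaleNr /chi (bmeas_comp _ bE bp).
exact: mulop_norm.
Qed.

End Compression.

Lemma pop_split (F : comNzRingType) (V : lmodType F) (S : V -> V) p c u :
  pop (p * 'X + c%:P) S u = pop p S (S u) + c *: u.
Proof. by rewrite popD popMX popC. Qed.

Lemma pop_compress (F : comNzRingType) (V : lmodType F) (P H : V -> V) q u : linear P ->
  (forall v, P (P v) = P v) -> (forall v, P (H (P v)) = P (H v)) ->
  P (pop q H (P u)) = P (pop q H u).
Proof.
move=> lP PP PH; have it n : P (iter n H (P u)) = P (iter n H u).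
  by elim: n => [|n IH] /=; [exact: PP|rewrite -PH IH PH].
rewrite /pop !(linear_map_sum lP); apply: eq_bigr => i _.
by rewrite !(linear_mapZ lP) it.
Qed.

Lemma linear_comp3 (F : comNzRingType) (U V W X : lmodType F) (P : W -> X) (L : V -> W) (D : U -> V) :
  linear P -> linear L -> linear D -> linear (fun u => P (L (D u))).
Proof. by move=> lP lL lD a u v; rewrite lD lL lP. Qed.

Lemma linear_mapBZ (F : comNzRingType) (V W : lmodType F) (L : V -> W) c u v : linear L ->
  L u - c *: L v = L (u - c *: v).
Proof. by move=> lL; rewrite (linear_mapB lL) (linear_mapZ lL). Qed.

Lemma linear_split (F : comNzRingType) (V W : lmodType F) (P : V -> W) c d x y w : linear P ->
  P (x + y) - (c + d) *: w = (P x - c *: w) + (P y - d *: w).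
Proof. by move=> lP; rewrite (linear_mapD lP) scalerDl opprD addrACA. Qed.

(** * Lower bound at points away from 0 *)

Section PointBound.
Context {R : realType}.
Local Notation C := R[i].
Local Notation mu := (@lebesgue_measure R).
Local Notation L2 := (L2 R).
Local Notation L2norm := (@L2norm R).
Local Notation bdd := (@bdd R).
Local Notation hardy := (@hardy R).
Implicit Types (E : set R) (S T K : L2 -> L2).

Let mI : measurable (I01 (R:=R)). Proof. exact: measurable_itv. Qed.
Hint Resolve mI : core.

Lemma within_bmeas (phi : R -> C^o) : {within I01, continuous phi} -> exists M, bmeas phi M.
Proof.
move=> pc; have mphi := within_cmeas pc.
have cc : {within `[0, 1], continuous (fun x => cmod (phi x))}.
  apply/subspace_continuousP => x xI; apply/cvgrPdist_lt => e e0.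
  move/subspace_continuousP : pc => /(_ x xI) /cvgCP/(_ e e0); apply: filterS => y.
  apply: le_lt_trans; rewrite /from_subspace ler_norml; apply/andP; split; last exact: cmod_lower.
  by rewrite lerNl opprB (cmodC (phi x)); exact: cmod_lower.
have [c cI hc] := EVT_max ler01 cc.
exists (cmod (phi c)); split; [exact: cmod_ge0|exact: mphi|].
by move=> x xI; apply: hc.
Qed.

Lemma within_local (phi : R -> C^o) x e : {within I01, continuous phi} -> I01 x -> 0 < e ->
  exists2 d : R, 0 < d & forall y, I01 y -> `|y - x| < d -> cmod (phi y - phi x) <= e.
Proof.
move=> /subspace_continuousP pc xI e0; have /cvgCP/(_ e e0) := pc x xI.
move=> /nbhs_ballP[d /= d0 hd]; exists d => // y yI yx.
have B : ball x d y by rewrite /ball /= distrC.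
by rewrite cmodC; exact: ltW (hd y B yI).
Qed.

Lemma measure_itv_sub (a b : R) : 0 <= a -> a <= b -> b <= 1 ->
  [/\ measurable (`[a, b]%classic : set R), (`[a, b]%classic : set R) `<=` I01
    & mu `[a, b]%classic = (b - a)%:E].
Proof.
move=> a0 ab b1; split.
- exact: measurable_itv.
- by apply: subset_itv; rewrite bnd_simp.
transitivity (lebesgue_measure (`[a, b]%classic : set R)); first by [].
move: ab; rewrite lebesgue_measure_itv /= lte_fin le_eqVlt => /predU1P[->|->].
  by rewrite ltxx subrr.
by rewrite EFinB.
Qed.

Lemma chi_pos E (r : R) : measurable E -> E `<=` I01 -> mu E = r%:E -> 0 < r ->
  0 < L2norm (chi E (toL2 (fun=> 1))).
Proof.
move=> mE EI Er r0.
have -> : chi E (toL2 (fun=> 1)) = toL2 (indc E).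
  apply: toL2_eq; [exact: (sqint_mul (bmeas_indc mE) (L2_sqint _)).1|exact: sqint_indc|].
  have := toL2K (@sqint_const1 R); apply: filterS => x h xI.
  by rewrite [L2fun _ _](h xI) mulr1.
by rewrite (L2norm_toL2 (sqint_indc mE)) (sqnorm_indc mE EI Er) sqrtr_gt0.
Qed.

Lemma bmeasD (f g : R -> C) M N : bmeas f M -> bmeas g N -> bmeas (fun x => f x + g x) (M + N).
Proof.
move=> [M0 [fr fi] fM] [N0 [gr gi] gN]; split; first exact: addr_ge0.
  split; first by under eq_fun do rewrite ReD; exact: measurable_funD.
  under eq_fun do rewrite (raddfD (@complex.Im R)) /=.
  exact: measurable_funD.
by move=> x xI; apply: le_trans (cmodD _ _) _; apply: lerD; [exact: fM|exact: gN].
Qed.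

Lemma regroup (V : zmodType) (a c x k : V) : (a + c) + (x + k) = a + (x + c) + k.
Proof. by rewrite addrA -(addrA a) [c + x]addrC. Qed.

(* Multiplying on the right by the indicator [g] of an interval away from [0] turns [H] into the
   compact operator [H M_x M_(g / x)]. *)
Lemma point_bound (phi : R -> C^o) (q : {poly C}) K (m x0 : R) : {within I01, continuous phi} ->
  compact_op K -> bdd (fun u => mulop phi u + pop q hardy u + K u) m ->
  0 < x0 -> x0 <= 1 -> cmod (phi x0 + q.[0]) <= m.
Proof.
move=> pc cK hm x0p x01; have [M bphi] := within_bmeas pc.
have [q1 [c qE]] := poly_split q.
have q0 : q.[0] = c by rewrite qE hornerD hornerM hornerX mulr0 add0r hornerC.
(* Half of [x0] stays away from 0 and leaves an interval ending at [x0] inside [[b, 1]]. *)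
pose b := x0 / 2; have b0 : 0 < b := half_gt0 x0p.
have bx : b < x0 by rewrite /b; lra.
pose G : set R := `[b, 1]%classic.
have mG : measurable G by exact: measurable_itv.
pose g := indc G; have bg : bmeas g 1 := bmeas_indc mG.
pose gx x : C := g x * (x^-1)%:C%C.
have minv : measurable_fun I01 (fun x : R => \1_G x * x^-1).
  (* [k x] is the maximum of [x] and [b]: it agrees with [x] on [G] and is positive everywhere, so
     its inverse is continuous. *)
  pose k (x : R) := (`|x - b| + (x + b)) / 2.
  have kx x : b <= x -> k x = x by move=> bx'; rewrite /k ger0_norm ?subr_ge0//; lra.
  have k0 x : 0 < k x by rewrite /k; have := ler_norm (b - x); rewrite distrC; lra.
  have kc : continuous (fun x => (k x)^-1).
    move=> x; apply: cvgV; first by rewrite gt_eqF.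
    apply: (@cvgM R _ _ _ _ (fun=> 2^-1)); last exact: cvg_cst.
    apply: cvgD; first by apply: cvg_norm; apply: cvgB; [exact: cvg_id|exact: cvg_cst].
    by apply: cvgD; [exact: cvg_id|exact: cvg_cst].
  rewrite (_ : (fun _ => _) = (fun x => \1_G x * (k x)^-1)).
    apply: measurable_funM; first exact: measurable_indic.
    by apply: measurable_funTS; exact: continuous_measurable_fun.
  apply/funext => x; rewrite indicE; have [Gx|nGx] := pselect (G x); last by rewrite memNset// !mul0r.
  by rewrite mem_set// kx//; move: Gx; rewrite /G /= in_itv /= => /andP[].
have bgx : bmeas gx b^-1.
  split; first by rewrite invr_ge0 ltW.
    split; first by apply: eq_measurable_fun minv => x _; rewrite /gx /g /indc /= mul0r subr0.
    by apply: eq_measurable_fun (measurable_cst (0 : R)) => x _; rewrite /gx /g /indc /= mul0r mulr0 addr0.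
  move=> x xI; have [Gx|nGx] := pselect (G x); last by rewrite /gx /g indcF// mul0r cmod0 invr_ge0 ltW.
  rewrite /gx /g indcT// mul1r cmod_real; move: Gx; rewrite /G /= in_itv /= => /andP[bx' _].
  have xp : 0 < x := lt_le_trans b0 bx'.
  by rewrite ger0_norm ?invr_ge0 ?(ltW xp)// lef_pV2.
have gE u : mulop g u = mulx (mulop gx u).
  rewrite /mulx (bmeas_comp u (@bmeas_x R) bgx); congr mulop; apply/funext => x.
  have [Gx|nGx] := pselect (G x); last by rewrite /gx /g indcF// mul0r mulr0.
  rewrite /gx mulrCA -rmorphM /= mulfV ?mulr1//.
  by move: Gx; rewrite /G /= in_itv /= => /andP[bx' _]; rewrite gt_eqF// (lt_le_trans b0 bx').
(* Modulo compact operators [q(H)] restricted by [g] is the scalar [c], because the other terms of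
   [q] end with the factor [H]. *)
pose psi x : C := phi x + c.
have bpsi : bmeas psi (M + cmod c) := bmeasD bphi (bmeas_cst c).
pose S := mulop (fun x => psi x * g x).
pose K' : L2 -> L2 := (pop q1 hardy \o ((hardy \o @mulx R) \o mulop gx)) \+ (K \o mulop g).
have cK' : compact_op K'.
  apply: compact_opD; last exact: compact_op_right (bounded_mulop bg) cK.
  apply: compact_op_left; first exact: hardy_algebra_bounded (hardy_algebra_pop q1).
  by apply: compact_op_right (bounded_mulop bgx) _; have [] := @hardy_compacts_hardy_mulx R.
have bSK : bdd (S \+ K') m.
  have [m0 hm'] := hm; split; first exact: m0.
  move=> u.
  have -> : (S \+ K') u = mulop phi (mulop g u) + pop q hardy (mulop g u) + K (mulop g u).
    have E1 : S u = mulop phi (mulop g u) + c *: mulop g u.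
      rewrite /S -(bmeas_comp u bpsi bg) /psi (mulopD _ bphi (bmeas_cst c)); congr (_ + _).
    have E2 : pop q hardy (mulop g u) = pop q1 hardy (hardy (mulx (mulop gx u))) + c *: mulop g u.
      rewrite qE; apply: etrans (pop_split _ _ _ _) _.
      by rewrite -(gE u).
    apply: etrans (f_equal2 +%R E1 (erefl _)) _; apply: etrans (regroup _ _ _ _) _.
    by rewrite E2.
  apply: le_trans (hm' _) _; apply: ler_wpM2l m0 _ _ _.
  by have := mulop_norm u bg; rewrite mul1r.
have [/bounded_opP[lK' _] tK'] := (compact_opP _).1 cK'.
have bpg := bmeasM bpsi bg.
apply: (lower_bound (mulop_linear bpg) lK' tK' bSK) => e d e0 d0.
have x0I : I01 x0 by apply: mem_I01; rewrite (ltW x0p).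
have [d' d0' hd'] := within_local pc x0I e0.
(* The interval [[x0 - r, x0]] ends at [x0], so [x0 = 1] is allowed; [r <= x0 - b] keeps it where
   [g] is 1, and [d' / 2] provides a strict inequality. *)
pose r := Num.min (Num.min d (d' / 2)) (x0 - b).
have r0 : 0 < r by rewrite !lt_min d0 half_gt0// subr_gt0.
have rd : r <= d by rewrite /r !ge_min lexx.
have rd' : r <= d' / 2 by rewrite /r !ge_min lexx !orbT.
have rb : b <= x0 - r by rewrite lerBrDl -lerBrDr /r ge_min lexx orbT.
have xr : x0 - r <= x0 by rewrite gerBl ltW.
have [mE EI Er] := measure_itv_sub (le_trans (ltW b0) rb) xr x01.
rewrite subKr in Er.
exists `[x0 - r, x0]%classic, r, (chi `[x0 - r, x0]%classic (toL2 (fun=> 1))).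
split => //; split; first exact: chi_pos mE EI _ r0.
apply: (chi_local _ mE bpg (ltW e0)) => x xI; rewrite /= in_itv /= => /andP[x1 x2].
have -> : psi x * g x - (phi x0 + q.[0]) = phi x - phi x0.
  rewrite /g indcT; last first.
    by rewrite /G /= in_itv /= (le_trans rb x1)/= (le_trans x2).
  by rewrite mulr1 /psi q0 opprD addrACA subrr addr0.
apply: hd' => //; rewrite ler0_norm; lra.
Qed.

End PointBound.

(** * Dilations and the lower bound on the disk *)

Section Dilation.
Variable F : fieldType.

Definition dil (a : F) (f : {poly F}) : {poly F} := \poly_(i < size f) (f`_i * a^-1 ^+ i).

Lemma coef_dil a f i : (dil a f)`_i = f`_i * a^-1 ^+ i.
Proof. by rewrite coef_poly; case: ltnP => // h; rewrite nth_default ?mul0r. Qed.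

Lemma horner_dil a f x : (dil a f).[x] = f.[x / a].
Proof.
rewrite horner_poly horner_coef; apply: eq_bigr => i _.
by rewrite exprMn mulrA mulrAC.
Qed.

Lemma dil_linear a : linear (dil a).
Proof.
by move=> c p q; apply/polyP => i; rewrite coefD coefZ !coef_dil coefD coefZ mulrDl mulrA.
Qed.

(** The change of variable [x = a y] in the integral from 0 to [a]. *)
Lemma prim_dil a f : a != 0 -> (prim (dil a f)).[a] = a * (prim f).[1].
Proof.
move=> a0; rewrite !(@horner_coef_wide _ (size f).+1); last 2 first.
- by rewrite size_poly.
- by rewrite (leq_trans (size_poly _ _))// ltnS size_poly.
rewrite mulr_sumr; apply: eq_bigr => -[[|i] hi] _ /=.
  by rewrite !coef_prim invr0 !mulr0 !mul0r mulr0.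
rewrite !coef_prim /= coef_dil expr1n mulr1 exprS.
have : a^-1 ^+ i * a ^+ i = 1 by rewrite -exprMn mulVf// expr1n.
by move: (a^-1 ^+ i) (a ^+ i) (i.+1%:R^-1) => b c d E; rewrite -[RHS]mulr1 -E; ring.
Qed.

End Dilation.

Section DiskBound.
Context {R : realType}.
Local Notation C := R[i].
Local Notation mu := (@lebesgue_measure R).
Local Notation L2 := (L2 R).
Local Notation L2norm := (@L2norm R).
Local Notation bdd := (@bdd R).
Local Notation hardy := (@hardy R).
Implicit Types (E : set R) (S T K : L2 -> L2).

Let mI : measurable (I01 (R:=R)). Proof. exact: measurable_itv. Qed.
Hint Resolve mI : core.

Lemma hpoly_dil (a : C) f : hpoly (dil a f) = dil a (hpoly f).
Proof. by apply/polyP => i; rewrite coef_hpoly !coef_dil coef_hpoly mulrAC. Qed.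

Lemma chi_pL2 E (f : {poly C}) : measurable E -> chi E (pL2 f) = toL2 (fun x => indc E x * pfun f x).
Proof.
move=> mE; have s1 := (sqint_mul (bmeas_indc mE) (sqint_poly f)).1.
apply: toL2_eq => //; first exact: (sqint_mul (bmeas_indc mE) (L2_sqint _)).1.
by have := toL2K (sqint_poly f); apply: filterS => x h xI; rewrite [L2fun _ _](h xI).
Qed.

Lemma sqmod_poly (f : {poly C}) : exists r : {poly R}, forall x, sqmod (pfun f x) = r.[x].
Proof.
by exists (rep f ^+ 2 + imp f ^+ 2) => x; rewrite hornerD !horner_exp -Re_pfun -Im_pfun.
Qed.

Lemma L2norm_chi_dil (a : R) (f : {poly C}) : 0 < a -> a <= 1 ->
  L2norm (chi `[0, a]%classic (pL2 (dil a%:C%C f))) = Num.sqrt a * pnorm f.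
Proof.
move=> a0 a1; have mE : measurable (`[0, a]%classic : set R) by exact: measurable_itv.
have [r hr] := sqmod_poly f.
have s1 := (sqint_mul (bmeas_indc mE) (sqint_poly (dil a%:C%C f))).1.
apply: sqr_inj; [exact: L2norm_ge0|by rewrite mulr_ge0 ?sqrtr_ge0 ?pnorm_ge0|].
rewrite (chi_pL2 _ mE) (L2norm_toL2 s1) exprMn [Num.sqrt a ^+ 2]sqr_sqrtr ?(ltW a0)//.
have -> : pnorm f ^+ 2 = (prim r).[1].
  rewrite [pnorm f](L2norm_toL2 (sqint_poly f)) -[LHS]/(fine (sqnorm (pfun f) ^+ 2)%:E).
  rewrite -(sqnormE (sqint_poly f)) -Rint_poly//.
  by congr fine; apply: eq_integral => x _; rewrite hr.
rewrite -prim_dil ?gt_eqF// -Rint_poly ?(ltW a0)//.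
rewrite -[LHS]/(fine (sqnorm _ ^+ 2)%:E) -(sqnormE s1); congr fine.
have sub : `[0, a]%classic `<=` I01 by exact: subset_0x.
rewrite -[in RHS](setIidr sub) integral_mkcondr.
apply: eq_integral => x _; rewrite /patch /=.
have [Ex|nEx] := pselect (`[0, a]%classic x).
  rewrite mem_set// indcT// mul1r; congr EFin; rewrite horner_dil -hr /pfun horner_dil.
  by rewrite -fmorphV -rmorphM.
by rewrite memNset// indcF// mul0r /sqmod /= expr0n addr0.
Qed.

(** For [x <= a] the mean over [[0, x]] sees only the values on [[0, a]]. *)
Lemma chi_hardy_chi (a : R) (u : L2) : a <= 1 ->
  chi `[0, a]%classic (hardy (chi `[0, a]%classic u)) = chi `[0, a]%classic (hardy u).
Proof.
move=> a1; set E := `[0, a]%classic.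
have mE : measurable (E : set R) by exact: measurable_itv.
have bE := bmeas_indc mE.
apply: toL2_eq; [exact: (sqint_mul bE (L2_sqint _)).1|exact: (sqint_mul bE (L2_sqint _)).1|].
have h1 := hardyE (chi E u); have h2 := hardyE u.
apply: filterS2 h1 h2 => x h1 h2 xI.
apply: etrans (congr1 (fun t => indc E x * t) (h1 xI)) _.
apply: etrans (congr1 (fun t => indc E x * t) (esym (h2 xI))).
have [Ex|nEx] := pselect (E x); last by rewrite indcF// !mul0r.
congr (_ * _).
have s1 := (sqint_mul bE (L2_sqint u)).1.
rewrite (hfun_ae (L2_sqint (chi E u)) s1 (mulopE u bE) xI) /hfun; congr (_ * _).
have xa : x <= a by move: Ex; rewrite /E /= in_itv /= => /andP[].
have eqE : {in (`[0, x]%classic : set R), (fun t => indc E t * u t) =1 u}.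
  move=> t; rewrite inE /= in_itv /= => /andP[t0 tx]; rewrite indcT ?mul1r//.
  by rewrite /E /= in_itv /= t0 (le_trans tx).
by rewrite /cintegral; congr (_ +i* _)%C; apply: eq_Rintegral => t /eqE /= ->.
Qed.

Lemma chi_pop_chi (a : R) (q : {poly C}) (u : L2) : a <= 1 ->
  chi `[0, a]%classic (pop q hardy (chi `[0, a]%classic u)) = chi `[0, a]%classic (pop q hardy u).
Proof.
move=> a1; set E := `[0, a]%classic; have mE : measurable (E : set R) by exact: measurable_itv.
exact: (pop_compress q u (chi_linear mE) (fun v => chi_chi v mE) (fun v => chi_hardy_chi v a1)).
Qed.

Lemma pop_pL2 (q f : {poly C}) : pop q hardy (pL2 f) = pL2 (pop q (@hpoly R) f).
Proof.
exact: esym (@pop_intertwine _ _ _ (@pL2 R) (@hpoly R) hardy q f (@pL2_linear R) (fun v => esym (hardy_pL2 v))).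
Qed.

(** [q - q(z)] is divisible by [X - z], so approximate eigenvectors of [H] are also approximate
    eigenvectors of [q(H)]. *)
Lemma poly_eigen_quotient (q : {poly C}) (z : C) : exists q2, forall f,
  pop q (@hpoly R) f - q.[z] *: f = pop q2 (@hpoly R) (hpoly f - z *: f).
Proof.
have : root (q - q.[z]%:P) z by rewrite rootE hornerD hornerN hornerC subrr.
move=> /factor_theorem[q2 E]; exists q2 => f.
have lH := @hpoly_linear R.
rewrite -(popC (@hpoly R) q.[z]) -popB E (popM lH) popB popX popC.
by [].
Qed.

Lemma pnorm_pop (q : {poly C}) : exists2 M : R, 0 <= M & forall f, pnorm (pop q (@hpoly R) f) <= M * pnorm f.
Proof.
have [M [M0 hM]] := bdd_pop q (@bdd_hardy R); exists M => // f.
by have := hM (pL2 f); rewrite pop_pL2.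
Qed.

Lemma half_lt (d : R) : 0 < d -> d / 2 < d. Proof. by lra. Qed.

Lemma disk_estimate (x y n A b s e : R) : b = s * x -> n = s * A -> x <= e / 2 -> 0 <= s ->
  1 <= A -> y <= e / 2 * n -> 0 < e -> y + b <= e * n.
Proof.
move=> -> -> h1 s0 A1 h3 e0.
have : s * x <= s * (e / 2) by apply: ler_wpM2l.
have : s * (e / 2) <= s * (e / 2) * A by apply: ler_peMr => //; rewrite mulr_ge0//; lra.
nra.
Qed.

(** The approximate eigenvector is dilated into [[0, a]], where [phi] is close to [phi 0]; the
    dilation commutes with [H] and multiplies both the norm and the eigenvalue defect by the square
    root of [a]. *)
Lemma disk_bound (phi : R -> C^o) (q : {poly C}) K (m : R) (z : C) : {within I01, continuous phi} ->
  compact_op K -> bdd (fun u => mulop phi u + pop q hardy u + K u) m ->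
  cmod (1 - z) < 1 -> cmod (phi 0 + q.[z]) <= m.
Proof.
move=> pc cK hm z1; have [M bphi] := within_bmeas pc.
have [/bounded_opP[lK _] tK] := (compact_opP _).1 cK.
have lq := pop_linear (@hardy_linear R) q.
have lS : linear (mulop phi \+ pop q hardy) := linear_add (mulop_linear bphi) lq.
apply: (lower_bound lS lK tK hm) => e d e0 d0.
have x0I : I01 (0 : R) by apply: mem_I01; rewrite lexx ler01.
have [d' d0' hd'] := within_local pc x0I (half_gt0 e0).
have [q2 hq2] := poly_eigen_quotient q z; have [N N0 hN] := pnorm_pop q2.
have N1 : 0 < N + 1 by apply: ltr_wpDl.
(* Division by [N + 1], since [q2(H)] may multiply the defect by [N]. *)
have [f fle f1] := approximate_eigenvector z1 (divr_gt0 (half_gt0 e0) N1).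
have qf : pnorm (pop q (@hpoly R) f - q.[z] *: f) <= e / 2.
  rewrite hq2; apply: le_trans (hN _) _; apply: le_trans (ler_wpM2l N0 fle) _.
  by rewrite mulrCA ger_pMr ?half_gt0// ler_pdivrMr// mul1r lerDl.
pose a := Num.min (Num.min d (d' / 2)) 1.
have a0 : 0 < a by rewrite !lt_min d0 half_gt0//= ltr01.
have ad : a <= d by rewrite /a !ge_min lexx.
have ad' : a <= d' / 2 by rewrite /a !ge_min lexx !orbT.
have a1 : a <= 1 by rewrite /a ge_min lexx orbT.
have [mE EI Er] := measure_itv_sub (lexx 0) (ltW a0) a1; rewrite subr0 in Er.
set E := `[0, a]%classic in mE EI Er.
pose w := chi E (pL2 (dil a%:C%C f)).
have wn : L2norm w = Num.sqrt a * pnorm f by exact: L2norm_chi_dil.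
exists E, a, w; split; [exact: mE|exact: EI|exact: Er|exact: ad|split].
  by rewrite wn; apply: mulr_gt0; [rewrite sqrtr_gt0|exact: lt_le_trans f1].
have le1 : L2norm (chi E (mulop phi w) - phi 0 *: w) <= e / 2 * L2norm w.
  apply: (chi_local _ mE bphi (ltW (half_gt0 e0))) => x xI; rewrite /E /= in_itv /= => /andP[x0 xa].
  apply: hd' xI _; rewrite subr0 (ger0_norm x0).
  exact: le_lt_trans xa (le_lt_trans ad' (half_lt d0')).
have le2 : L2norm (chi E (pop q hardy w) - q.[z] *: w) = Num.sqrt a * pnorm (pop q (@hpoly R) f - q.[z] *: f).
  pose D : {poly C} -> {poly C} := dil a%:C%C.
  have E2 : pop q (@hpoly R) (D f) = D (pop q (@hpoly R) f).
    exact: esym (@pop_intertwine _ _ _ D (@hpoly R) (@hpoly R) q f (dil_linear _) (fun v => esym (hpoly_dil _ v))).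
  have E1 : chi E (pop q hardy w) = chi E (pL2 (D (pop q (@hpoly R) f))).
    apply: etrans (chi_pop_chi q (pL2 (D f)) a1) _.
    by apply: etrans (congr1 (chi E) (pop_pL2 q (D f))) _; rewrite E2.
  have lD : linear D by exact: dil_linear.
  have lL := linear_comp3 (chi_linear mE) (@pL2_linear R) lD.
  rewrite -(L2norm_chi_dil _ a0 a1) E1; congr L2norm.
  exact: (@linear_mapBZ _ _ _ (fun u => chi E (pL2 (D u))) q.[z] (pop q (@hpoly R) f) f lL).
have -> : chi E ((mulop phi \+ pop q hardy) w) - (phi 0 + q.[z]) *: w =
    (chi E (mulop phi w) - phi 0 *: w) + (chi E (pop q hardy w) - q.[z] *: w).
  exact: (linear_split _ _ _ _ _ (chi_linear mE)).
apply: le_trans (L2normD _ _) _.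
exact: disk_estimate le2 wn qf (sqrtr_ge0 _) f1 le1 e0.
Qed.

End DiskBound.

Lemma limit_split (F : comNzRingType) (V W : lmodType F) (T G : V -> W) a u v : linear T ->
  G (a *: u + v) - (a *: G u + G v) =
  (G (a *: u + v) - T (a *: u + v)) + (a *: (T u - G u) + (T v - G v)).
Proof.
by move=> lT; rewrite lT scalerBr [a *: T u - _ + _]addrACA -opprD addrA subrK.
Qed.

(** * The functional calculus and the decomposition *)

Section HardyCalculus.
Context {R : realType}.
Local Notation C := R[i].
Local Notation L2 := (L2 R).
Local Notation L2norm := (@L2norm R).
Local Notation bdd := (@bdd R).
Local Notation hardy := (@hardy R).
Implicit Types (S T K G : L2 -> L2) (u v : L2) (p q : {poly C}).

Lemma uniform_cdisk11P (p : nat -> {poly C}) (g : C^o -> C^o) :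
  {uniform (@cdisk11 R), (fun n (z : C^o) => (p n).[z] : C^o) @ \oo --> g} <->
  forall e : R, 0 < e -> exists N, forall n, (N <= n)%N -> forall z, cdisk11 z -> cmod ((p n).[z] - g z) <= e.
Proof.
split=> [h e e0|h].
  have : nbhs (g : {uniform` (@cdisk11 R) -> C^o}) [set f | forall z, cdisk11 z -> cmod (f z - g z) <= e].
    apply/uniform_nbhs; exists [set xy : C^o * C^o | ball xy.1 e%:C%C xy.2]; split.
      by rewrite -entourage_ballE; exists e%:C%C => //=; rewrite ltcR.
    move=> f /= hf z zD; have := hf z zD; rewrite /ball /= normE ltcR cmodC; exact: ltW.
  by move=> /h[N _ hN]; exists N => n Nn; exact: hN n Nn.
move=> P /uniform_nbhs[E [entE EP]].
move: entE; rewrite -entourage_ballE => -[[a b] /=]; rewrite ltcE /= => /andP[/eqP-> a0] aE.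
have [N hN] := h _ (half_gt0 a0); exists N => // n Nn; apply: EP => z zD; apply: aE => /=.
rewrite /ball /= normE ltcR cmodC; apply: le_lt_trans (hN n Nn z zD) _; exact: half_lt.
Qed.

Lemma opnorm_ge0 T : (0 <= opnorm T)%E.
Proof.
apply: le_trans (_ : ((L2norm (T 0))%:E <= _)%E); first by rewrite lee_fin L2norm_ge0.
by apply: ereal_sup_ubound; exists 0 => //=; rewrite L2norm0.
Qed.

Lemma opnorm_cvg0P (T : nat -> L2 -> L2) : (forall n, linear (T n)) ->
  (opnorm (T n) @[n --> \oo] --> 0%E) <->
  forall e : R, 0 < e -> exists N, forall n, (N <= n)%N -> bdd (T n) e.
Proof.
move=> lT; split=> [h e e0|h].
  have : nbhs (0 : \bar R)%E [set x | (x < e%:E)%E].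
    by apply: open_nbhs_nbhs; split; [exact: open_ereal_lt_ereal|rewrite /= lte_fin].
  move=> /h[N _ hN]; exists N => n Nn; apply: opnorm_bdd (lT n) _; exact: ltW (hN n Nn).
have [N1 hN1] := h 1 ltr01.
have fin n : (N1 <= n)%N -> opnorm (T n) \is a fin_num.
  move=> /hN1 b; rewrite ge0_fin_numE ?opnorm_ge0//.
  exact: le_lt_trans (bdd_opnorm b) (ltry _).
apply/fine_cvgP; split; first by exists N1 => // n /= /fin.
apply/cvgrPdist_le => e e0; have [N hN] := h e e0; exists (maxn N N1) => // n /=.
rewrite geq_max => /andP[/hN b /fin f]; rewrite sub0r normrN ger0_norm ?fine_ge0 ?opnorm_ge0//.
by rewrite -lee_fin fineK//; exact: bdd_opnorm.
Qed.

Lemma poly_op_linear p : linear (pop p hardy).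
Proof. exact: pop_linear (@hardy_linear R) p. Qed.

Lemma bdd_ext S T B : (forall u, S u = T u) -> bdd S B -> bdd T B.
Proof. by move=> h; have -> : T = S by apply/funext => u; rewrite h. Qed.

Lemma bdd_lim T B : (forall e : R, 0 < e -> bdd T (B + e)) -> bdd T B.
Proof.
move=> h; have B0 : 0 <= B.
  by apply/ler_addgt0Pr => e /h[].
split => // u; apply/ler_addgt0Pr => e e0.
have u1 : 0 < L2norm u + 1 by apply: ltr_wpDl => //; exact: L2norm_ge0.
have [_ /(_ u) le] := h _ (divr_gt0 e0 u1).
apply: le_trans le _; rewrite mulrDl lerD2l mulrAC ler_pdivrMr// ler_wpM2l ?(ltW e0)//.
by rewrite lerDl.
Qed.

Lemma von_neumann_dist p q (e : R) : (forall z, cdisk11 z -> cmod (p.[z] - q.[z]) <= e) ->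
  bdd (pop p hardy \- pop q hardy) e.
Proof.
move=> h; apply: (@bdd_ext (pop (p - q) hardy)); first by move=> u; exact: popB.
by apply: von_neumann => z /h; rewrite hornerD hornerN.
Qed.

Lemma limit_estimate (x y z e : R) : 0 < e -> 0 < x + (y + z) + 1 ->
  e / (x + (y + z) + 1) * x + (e / (x + (y + z) + 1) * y + e / (x + (y + z) + 1) * z) <= e.
Proof.
move=> e0 k0; rewrite -!mulrDr mulrAC ler_pdivrMr// ler_wpM2l ?(ltW e0)//.
by rewrite lerDl.
Qed.

Section Limit.
Variables (T : nat -> L2 -> L2).
Hypothesis lT : forall n, linear (T n).
Hypothesis bT : forall n, exists B, bdd (T n) B.
Hypothesis cT : forall e : R, 0 < e -> exists N, forall m n, (N <= m)%N -> (N <= n)%N -> bdd (T m \- T n) e.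

(** The pointwise limit exists by completeness of L^2; the uniform Cauchy estimate passes to it and
    gives its linearity and boundedness. *)
Lemma operator_limit : exists G, bounded_op G /\
  forall e : R, 0 < e -> exists N, forall n, (N <= n)%N -> bdd (T n \- G) e.
Proof.
have lim u : exists l, forall e : R, 0 < e -> exists N, forall n, (N <= n)%N -> L2norm (T n u - l) <= e.
  apply: (@L2_complete R (fun n => T n u)) => e e0.
  have u1 : 0 < L2norm u + 1 by apply: ltr_wpDl => //; exact: L2norm_ge0.
  have [N hN] := cT (divr_gt0 e0 u1); exists N => m n Nm Nn.
  have [_ /(_ u) le] := hN m n Nm Nn; apply: le_trans le _.
  by rewrite mulrAC ler_pdivrMr// ler_wpM2l ?(ltW e0)// lerDl.
have [G hG] := choice lim.
have conv (e : R) : 0 < e -> exists N, forall n, (N <= n)%N -> bdd (T n \- G) e.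
  move=> e0; have [N hN] := cT e0; exists N => n Nn; split; first exact: ltW.
  move=> u; apply/ler_addgt0Pr => d d0; have [M hM] := hG u d d0.
  have [_ /(_ u) le] := hN n (maxn N M) Nn (leq_maxl _ _).
  exact: L2dist_le le (hM _ (leq_maxr _ _)).
have lG : linear G.
  move=> a u v; apply/eqP; rewrite -subr_eq0; apply/eqP/L2norm_eq0.
  apply/eqP; rewrite eq_le L2norm_ge0 andbT; apply/ler_addgt0Pr => e e0; rewrite add0r.
  pose k := L2norm (a *: u + v) + (cmod a * L2norm u + L2norm v) + 1.
  have k0 : 0 < k.
    apply: ltr_wpDl => //; apply: addr_ge0; first exact: L2norm_ge0.
    by apply: addr_ge0; [apply: mulr_ge0 (cmod_ge0 _) (L2norm_ge0 _)|exact: L2norm_ge0].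
  have [N hN] := conv _ (divr_gt0 e0 k0); have [_ h] := hN N (leqnn N).
  have h1 := L2dist_sym (h (a *: u + v)).
  have h2 : L2norm (a *: (T N u - G u)) <= e / k * (cmod a * L2norm u).
    by rewrite L2normZ mulrCA; apply: ler_wpM2l (h u); exact: cmod_ge0.
  have h3 := h v.
  have E : G (a *: u + v) - (a *: G u + G v) =
      (G (a *: u + v) - T N (a *: u + v)) + (a *: (T N u - G u) + (T N v - G v)).
    exact: limit_split (lT N).
  have h4 : L2norm (G (a *: u + v) - (a *: G u + G v)) <=
      e / k * L2norm (a *: u + v) + (e / k * (cmod a * L2norm u) + e / k * L2norm v).
    rewrite E; apply: le_trans (L2normD _ _) _; apply: lerD; first exact: h1.
    by apply: le_trans (L2normD _ _) _; apply: lerD; [exact: h2|exact: h3].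
  exact: le_trans h4 (limit_estimate e0 k0).
exists G; split => //; apply/bounded_opP; split => //.
have [N hN] := conv 1 ltr01; have [B hB] := bT N.
exists (B + 1); apply: (@bdd_ext (T N \- (T N \- G))); first by move=> u /=; rewrite subKr.
exact: bdd_sub hB (hN N (leqnn N)).
Qed.

End Limit.

Lemma bdd_hardy_pop p : exists B, bdd (pop p hardy) B.
Proof. exact: bdd_pop p (@bdd_hardy R). Qed.

(** [hardy_calc g] is an arbitrary element chosen by [get], so it is accessible only once its
    defining set is inhabited, by polynomial approximation and von Neumann's inequality. These two
    conclusions are all that is used of it afterwards. *)
Lemma hardy_calcP (g : C^o -> C^o) : disk_algebra g -> bounded_op (hardy_calc g) /\
  forall q (e : R), (forall z, cdisk11 z -> cmod (q.[z] - g z) <= e) ->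
    bdd (pop q hardy \- hardy_calc g) e.
Proof.
move=> dg; have half n : 0 < (1 / 2) ^+ n :> R by rewrite exprn_gt0.
have [p hp] := choice (fun n => disk_algebra_approx dg (half n)).
have pcv (e : R) : 0 < e -> exists N, forall n, (N <= n)%N -> forall z, cdisk11 z -> cmod ((p n).[z] - g z) <= e.
  move=> e0; have [N hN] := half_pow_small e0; exists N => n Nn z zD.
  exact: le_trans (hp n z zD) (half_pow_le Nn hN).
have [G [bG cG]] : exists G, bounded_op G /\
    forall e : R, 0 < e -> exists N, forall n, (N <= n)%N -> bdd (pop (p n) hardy \- G) e.
  apply: operator_limit => [n|n|e e0]; [exact: poly_op_linear|exact: bdd_hardy_pop|].
  have [N hN] := pcv _ (half_gt0 e0); exists N => m n Nm Nn; apply: von_neumann_dist => z zD.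
  rewrite [e]splitr; apply: le_trans (cmod_dist _ (g z) _) _; apply: lerD; first exact: hN.
  by rewrite cmodC; exact: hN.
have ex : exists G, [set G | bounded_op G /\ exists p : nat -> {poly C},
    {uniform (@cdisk11 R), (fun n (z : C^o) => (p n).[z] : C^o) @ \oo --> g} /\
    opnorm (poly_op (p n) hardy \- G) @[n --> \oo] --> 0%E] G.
  exists G; split => //; exists p; split; first exact/uniform_cdisk11P.
  have lG : linear G by have /bounded_opP[] := bG.
  exact: (opnorm_cvg0P (fun n => linear_sub (poly_op_linear (p n)) lG)).2 cG.
have [bH [r [/uniform_cdisk11P rg rH]]] := getPex ex.
rewrite -/(hardy_calc g) in bH rH; split => // q e hq.
have lH : linear (hardy_calc g) by have /bounded_opP[] := bH.
have {}rH := (opnorm_cvg0P (fun n => linear_sub (poly_op_linear (r n)) lH)).1 rH.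
apply: bdd_lim => d d0; have d2 := half_gt0 d0.
have [N1 h1] := rg _ d2; have [N2 h2] := rH _ d2; pose n := maxn N1 N2.
(* [q] is compared with the unknown sequence [r] attached to the chosen operator, both being close
   to [g]. *)
have b1 : bdd (pop q hardy \- pop (r n) hardy) (e + d / 2).
  apply: von_neumann_dist => z zD; apply: le_trans (cmod_dist _ (g z) _) _; apply: lerD; first exact: hq.
  by rewrite cmodC; apply: h1 zD; exact: leq_maxl.
have b2 := h2 n (leq_maxr _ _).
by rewrite [X in e + X]splitr addrA; exact: bdd_dist b1 b2.
Qed.

End HardyCalculus.

Lemma sum3_sub (V : zmodType) (a b c a' b' c' : V) :
  (a - a') + (b - b') + (c - c') = (a + b + c) - (a' + b' + c').
Proof. by rewrite [in RHS]opprD [RHS]addrACA [in RHS]opprD [a + b + _]addrACA. Qed.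

Lemma sum3_rest (V : zmodType) (t a b : V) : t = a + b + (t - a - b).
Proof. by rewrite [RHS]addrC -[t - a - b]addrA -opprD subrK. Qed.

Lemma sum3_dist (V : zmodType) (t s a b a' b' k : V) : s = a' + b' + k ->
  (t - s) - ((a - a') + (b - b')) = (t - a - b) - k.
Proof.
move=> ->; rewrite [(a - a') + _]addrACA -opprD opprB [- (a' + b' + k)]opprD -addrA.
by rewrite [_ + _ + (a' + b' - _)]addrACA addNr add0r opprD [- k + _]addrC !addrA.
Qed.

Lemma sum3_swap (V : zmodType) (a b c a' b' c' x x' : V) : a' + b' + c' = a + b + c ->
  x' - b' - (x - b) = a' + x' + c' - (a + x + c).
Proof.
have A (p q r s : V) : p + q + r = (p + s + r) + (q - s).
  by rewrite [p + s + r]addrAC -[RHS]addrA [s + _]addrC subrK addrAC.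
by move=> E; rewrite (A a' x' c' b') E (A a x c b) [- (_ + _ + _ + _)]opprD [RHS]addrACA subrr add0r.
Qed.

Lemma poly_part_shift (F : comNzRingType) (V : lmodType F) (M H : V -> V) p q c u :
  pop (p + c%:P) M u + pop (q - c%:P) H u = pop p M u + pop q H u.
Proof. by rewrite popD popB !popC addrACA addrN addr0. Qed.

(** * Control of polynomial symbols by the operator norm *)

Section Symbols.
Context {R : realType}.
Local Notation C := R[i].
Local Notation L2 := (L2 R).
Local Notation L2norm := (@L2norm R).
Local Notation bdd := (@bdd R).
Local Notation hardy := (@hardy R).
Implicit Types (S T K G : L2 -> L2) (u v : L2) (p q : {poly C}).

Lemma poly_closed_disk q (c : C) (m : R) : (forall z : C, cmod (1 - z) < 1 -> cmod (c + q.[z]) <= m) ->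
  forall z : C, cdisk11 (R:=R) z -> cmod (c + q.[z]) <= m.
Proof.
move=> h z /cdisk11P zD; apply/ler_addgt0Pr => d d0.
have : \forall x \near (z : C^o), cmod (q.[z] - q.[x]) < d.
  by have /(@cvgCP R C^o (nbhs (z : C^o)) (nbhs_filter _)) := @poly_continuous R q z; apply.
move=> /nbhsCP[r r0 hr].
pose t := Num.min 1 r / 2.
have r1 : Num.min 1 r <= 1 by rewrite ge_min lexx.
have rr : Num.min 1 r <= r by rewrite ge_min lexx orbT.
have rp : 0 < Num.min 1 r by rewrite lt_min ltr01.
have t0 : 0 < t by rewrite /t; lra.
have t1 : t < 1 by rewrite /t; lra.
have tr : t < r by rewrite /t; lra.
(* Moving [z] towards the center 1 puts it in the open disk, at distance less than [r] from [z]. *)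
pose w : C := z + t%:C%C * (1 - z).
have wz : cmod (w - z) < r.
  rewrite /w addrAC subrr add0r cmodM cmod_real gtr0_norm// [cmod (1 - z)]cmodC.
  by apply: le_lt_trans tr; apply: ler_piMr => //; exact: ltW.
have w1 : cmod (1 - w) < 1.
  have -> : 1 - w = (1 - t)%:C%C * (1 - z) by rewrite /w rmorphB rmorph1; ring.
  have s0 : 0 < 1 - t by lra.
  rewrite cmodM cmod_real gtr0_norm// [cmod (1 - z)]cmodC.
  by apply: le_lt_trans (_ : 1 - t < 1); [apply: ler_piMr => //; exact: ltW|lra].
have -> : c + q.[z] = (c + q.[w]) + (q.[z] - q.[w]) by ring.
by apply: le_trans (cmodD _ _) _; apply: lerD; [exact: h|exact: ltW (hr w wz)].
Qed.

Lemma symbol_bounds (phi : R -> C^o) q K (m : R) : {within I01, continuous phi} ->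
  compact_op K -> bdd (fun u => mulop phi u + pop q hardy u + K u) m ->
  (forall x, 0 < x -> x <= 1 -> cmod (phi x + q.[0]) <= m) /\
  (forall z, cdisk11 (R:=R) z -> cmod (phi 0 + q.[z]) <= m).
Proof.
move=> pc cK hm; split; first by move=> x; exact: point_bound pc cK hm.
by apply: poly_closed_disk => z; exact: disk_bound pc cK hm.
Qed.

Lemma cdisk11_0 : cdisk11 (R:=R) 0.
Proof. by apply/cdisk11P; rewrite sub0r cmodN cmod1. Qed.

Lemma pfun_near p (x e : R) : 0 < e -> exists2 d : R, 0 < d & forall y, `|y - x| < d -> cmod (pfun p y - pfun p x) < e.
Proof.
move=> e0; have : \forall z \near (x%:C%C : C^o), cmod (p.[x%:C%C] - p.[z]) < e.
  by have /(@cvgCP R C^o (nbhs (x%:C%C : C^o)) (nbhs_filter _)) := @poly_continuous R p (x%:C%C : C^o); apply.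
move=> /nbhsCP[d d0 hd]; exists d => // y yx; rewrite cmodC; apply: hd.
by rewrite -rmorphB cmod_real.
Qed.

Lemma within_I01P (phi : R -> C^o) : (forall x, I01 x -> forall e : R, 0 < e -> exists2 d : R, 0 < d &
    forall y, I01 y -> `|y - x| < d -> cmod (phi y - phi x) < e) -> {within I01, continuous phi}.
Proof.
move=> h; apply/subspace_continuousP => x xI; apply/cvgCP => e e0.
have [d d0 hd] := h x xI e e0; rewrite near_withinE; apply/nbhs_ballP; exists d => // y.
by rewrite /ball /= distrC => yx yI; rewrite cmodC; exact: hd.
Qed.

Lemma pfun_within p : {within I01, continuous (pfun p : R -> C^o)}.
Proof.
apply: within_I01P => x _ e e0; have [d d0 hd] := pfun_near p x e0.
by exists d => // y _; exact: hd.
Qed.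

Definition symbol_op (phi : R -> C) (q : {poly C}) K u := mulop phi u + pop q hardy u + K u.

(** Scalar operators can be moved from one polynomial to the other; [c] is half the gap between
    their values at 0. *)
Lemma polyalg_normal_form S : polyalg S -> exists p q K,
  [/\ hardy_compacts K, p.[0] = q.[0] & forall u, S u = symbol_op (pfun p) q K u].
Proof.
move=> /polyalg_decomp[p [q [K [hK SE]]]].
pose c := (q.[0] - p.[0]) / 2%:R.
exists (p + c%:P), (q - c%:P), K; split => //.
  by rewrite !hornerD hornerN !hornerC /c; field.
move=> u; rewrite SE; apply: esym; rewrite /symbol_op mulop_poly.
have E : pop (p + c%:P) (@mulx R) u + pop (q - c%:P) hardy u = pop p (@mulx R) u + pop q hardy u.
  exact: poly_part_shift.
by rewrite E.
Qed.

Lemma hardy_compactsB K K' : hardy_compacts K -> hardy_compacts K' -> hardy_compacts (K \- K').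
Proof.
move=> hK hK'; have -> : K \- K' = K \+ ((-1) \*: K') by apply/funext => u /=; rewrite scaleN1r.
exact: hardy_compactsD hK (hardy_compactsZ _ hK').
Qed.

Lemma mulopB phi psi M N u : bmeas phi M -> bmeas psi N ->
  mulop (fun x => phi x - psi x) u = mulop phi u - mulop psi u.
Proof.
move=> b1 b2; have b3 := bmeasM (bmeas_cst (-1)) b2.
have -> : (fun x => phi x - psi x) = (fun x => phi x + -1 * psi x) by apply/funext => x; rewrite mulN1r.
by rewrite (mulopD u b1 b3) (mulopZ _ u b2) scaleN1r.
Qed.

Lemma symbol_opB phi psi q r K K' M N u : bmeas phi M -> bmeas psi N ->
  symbol_op (fun x => phi x - psi x) (q - r) (K \- K') u = symbol_op phi q K u - symbol_op psi r K' u.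
Proof.
move=> b1 b2; rewrite /symbol_op (mulopB u b1 b2); apply: etrans (sum3_sub _ _ _ _ _ _).
by rewrite (popB hardy q r u).
Qed.

(** By the normalization, the bound on the disk at [z = 0] reads [2 |q(0) - q'(0)| <= e], so the
    constant mixed into the other bounds costs at most [e / 2]. *)
Lemma symbols_dist p q K p' q' K' (e : R) : hardy_compacts K -> hardy_compacts K' ->
  p.[0] = q.[0] -> p'.[0] = q'.[0] ->
  bdd (fun u => symbol_op (pfun p) q K u - symbol_op (pfun p') q' K' u) e ->
  (forall x, I01 x -> cmod (pfun p x - pfun p' x) <= 2 * e) /\
  (forall z, cdisk11 (R:=R) z -> cmod (q.[z] - q'.[z]) <= 2 * e).
Proof.
move=> hK hK' pq pq' h.
have [M b] := bmeas_poly p; have [N b'] := bmeas_poly p'.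
have {}h : bdd (fun u => mulop (pfun (p - p')) u + pop (q - q') hardy u + (K \- K') u) e.
  have -> : pfun (p - p') = (fun x => pfun p x - pfun p' x).
    by apply/funext => x; rewrite /pfun hornerD hornerN.
  by apply: bdd_ext h => u; exact: esym (symbol_opB q q' K K' u b b').
have [h1 h2] := symbol_bounds (@pfun_within (p - p')) (hardy_compactsB hK hK').2 h.
have E x : pfun (p - p') x = pfun p x - pfun p' x by rewrite /pfun hornerD hornerN.
have E0 : pfun (p - p') 0 = q.[0] - q'.[0] by rewrite E /pfun /= pq pq'.
have F z : (q - q').[z] = q.[z] - q'.[z] by rewrite hornerD hornerN.
have c0 : 2 * cmod (q.[0] - q'.[0]) <= e.
  have := h2 0 cdisk11_0; rewrite E0 F.
  by rewrite -mulr2n -[_ *+ 2]mulr_natl cmodM cmod_nat.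
have e0 : 0 <= e by apply: le_trans c0; rewrite mulr_ge0 ?cmod_ge0.
have est (z : C) : cmod (z + (q.[0] - q'.[0])) <= e -> cmod z <= 2 * e.
  move=> hz; have := cmodB (z + (q.[0] - q'.[0])) (q.[0] - q'.[0]).
  rewrite addrK; have := cmod_ge0 (q.[0] - q'.[0]); lra.
split.
  move=> x /I01P/andP[x0 x1]; rewrite -E; have [->|xn] := eqVneq x 0.
    by rewrite E0; have := cmod_ge0 (q.[0] - q'.[0]); lra.
  by apply: est; rewrite -F; apply: h1 => //; rewrite lt_def xn.
by move=> z /h2; rewrite E0 F addrC; exact: est.
Qed.

End Symbols.

Lemma small_estimate (R : realFieldType) (M e x : R) : 0 < e -> 0 <= x -> M * (e / (`|M| * x + 1)) * x <= e.
Proof.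
move=> e0 x0; have k0 : 0 < `|M| * x + 1 by apply: ltr_wpDl => //; exact: mulr_ge0.
have -> : M * (e / (`|M| * x + 1)) * x = e * (M * x) / (`|M| * x + 1) by ring.
rewrite ler_pdivrMr// ler_pM2l//.
have : M * x <= `|M| * x by apply: ler_wpM2r => //; exact: ler_norm.
by move=> /le_trans; apply; rewrite lerDl.
Qed.

(** * Existence and uniqueness of the decomposition *)

Section Main.
Context {R : realType}.
Local Notation C := R[i].
Local Notation L2 := (L2 R).
Local Notation L2norm := (@L2norm R).
Local Notation bdd := (@bdd R).
Local Notation hardy := (@hardy R).
Implicit Types (S T K G : L2 -> L2) (u v : L2) (p q : {poly C}).

Lemma cmod_small_eq0 (z : C) (M : R) : (forall e : R, 0 < e -> cmod z <= M * e) -> z = 0.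
Proof.
move=> h; apply: cmod_eq0; apply/eqP; rewrite eq_le cmod_ge0 andbT.
apply/ler_addgt0Pr => e e0; rewrite add0r.
have M1 : 0 < `|M| + 1 by apply: ltr_wpDl.
apply: le_trans (h _ (divr_gt0 e0 M1)) _.
rewrite mulrCA ger_pMr// ler_pdivrMr// mul1r; apply: le_trans (ler_norm M) _.
by rewrite lerDl.
Qed.

Lemma bdd_small_eq S T (M : R) : (forall e : R, 0 < e -> bdd (S \- T) (M * e)) -> S = T.
Proof.
move=> h; apply/funext => u; apply/eqP; rewrite -subr_eq0; apply/eqP/L2norm_eq0.
apply/eqP; rewrite eq_le L2norm_ge0 andbT; apply/ler_addgt0Pr => e e0; rewrite add0r.
have M1 : 0 < `|M| * L2norm u + 1 by apply: ltr_wpDl => //; apply: mulr_ge0 (L2norm_ge0 _).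
have [_ /(_ u) le] := h _ (divr_gt0 e0 M1); apply: le_trans le _.
exact: small_estimate e0 (L2norm_ge0 u).
Qed.

Lemma hardy_calc_ext (g g' : C^o -> C^o) : disk_algebra g -> disk_algebra g' ->
  (forall z, cdisk11 z -> g' z = g z) -> hardy_calc g' = hardy_calc g.
Proof.
move=> dg dg' gg; have [_ h] := hardy_calcP dg; have [_ h'] := hardy_calcP dg'.
apply: (@bdd_small_eq _ _ 2) => e e0; have [p hp] := disk_algebra_approx dg e0.
rewrite mulr_natl mulr2n; apply: (@bdd_dist _ (pop p hardy)); last exact: h.
by apply: bdd_distC; apply: h' => z zD; rewrite gg//; exact: hp.
Qed.

(* The symbols of two decompositions of [T] are compared through polynomials close to [g] and [g'],
   because the lower bounds are only available for polynomials in [H]. *)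
Lemma hardy_decomp_symbols T (phi phi' : R -> C^o) (g g' : C^o -> C^o) K K' :
  hardy_decomp T phi g K -> hardy_decomp T phi' g' K' ->
  (forall x, I01 x -> phi' x = phi x) /\ (forall z, cdisk11 z -> g' z = g z).
Proof.
move=> [pc dg pg hK ->] [pc' dg' pg' hK' TT].
have [M b] := within_bmeas pc; have [M' b'] := within_bmeas pc'.
have [_ hg] := hardy_calcP dg; have [_ hg'] := hardy_calcP dg'.
pose D x : C^o := phi' x - phi x.
have Dc : {within I01, continuous D}.
  apply: within_I01P => x xI e e0.
  have [d d0 hd] := within_local pc xI (third_gt0 e0); have [d' d0' hd'] := within_local pc' xI (third_gt0 e0).
  exists (Num.min d d'); first by rewrite lt_min d0.
  move=> y yI; rewrite lt_min => /andP[y1 y2].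
  have -> : D y - D x = (phi' y - phi' x) - (phi y - phi x) by rewrite /D; ring.
  apply: le_lt_trans (third_lt e0); apply: le_trans (cmodB _ _) _.
  by apply: lerD; [exact: hd'|exact: hd].
(* The operator difference has norm at most [2 * e], and replacing [q] and [q'] by [g] and [g']
   costs another [2 * e]. *)
have bounds (e : R) : 0 < e ->
    (forall x, 0 < x -> x <= 1 -> cmod (D x + (g' 0 - g 0)) <= 4 * e) /\
    (forall z, cdisk11 z -> cmod (D 0 + (g' z - g z)) <= 4 * e).
  move=> e0; have [q hq] := disk_algebra_approx dg e0; have [q' hq'] := disk_algebra_approx dg' e0.
  have bd : bdd (fun u => mulop D u + pop (q' - q) hardy u + (K' \- K) u) (e + e).
    apply: bdd_ext (bdd_sub (hg' q' e hq') (hg q e hq)) => u.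
    apply: etrans (esym (symbol_opB q' q K' K u b' b)).
    have TTu := congr1 (fun T => T u) TT; rewrite /symbol_op.
    exact: sum3_swap (esym TTu).
  have [h1 h2] := symbol_bounds Dc (hardy_compactsB hK' hK).2 bd.
  have est (z w : C) : cdisk11 (R:=R) z -> cmod (w + (q' - q).[z]) <= e + e -> cmod (w + (g' z - g z)) <= 4 * e.
    move=> zD hw; have -> : w + (g' z - g z) = (w + (q' - q).[z]) - (q'.[z] - g' z) + (q.[z] - g z).
      by rewrite hornerD hornerN; ring.
    have := cmodD (w + (q' - q).[z] - (q'.[z] - g' z)) (q.[z] - g z).
    have := cmodB (w + (q' - q).[z]) (q'.[z] - g' z).
    have := hq z zD; have := hq' z zD; lra.
  split; first by move=> x x0 x1; apply: (est 0 _ cdisk11_0); exact: h1.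
  by move=> z zD; apply: est => //; exact: h2.
have Dx x : 0 < x -> x <= 1 -> D x + (g' 0 - g 0) = 0.
  by move=> x0 x1; apply: (@cmod_small_eq0 _ 4) => e /bounds[h _]; exact: h.
have Dz z : cdisk11 z -> D 0 + (g' z - g z) = 0.
  by move=> zD; apply: (@cmod_small_eq0 _ 4) => e /bounds[_ h]; exact: h.
(* The two normalizations turn the equation at [z = 0] into twice [D 0]. *)
have D0 : D 0 = 0.
  have := Dz 0 cdisk11_0; rewrite /D pg pg' => /eqP.
  by rewrite -mulr2n mulrn_eq0 /= => /eqP.
have gz z : cdisk11 z -> g' z = g z.
  by move=> /Dz; rewrite D0 add0r => /eqP; rewrite subr_eq0 => /eqP.
split => // x /I01P/andP[x0 x1]; apply/eqP; rewrite -subr_eq0; apply/eqP.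
have [->|xn] := eqVneq x 0; first exact: D0.
by have := Dx x _ x1; rewrite lt_def xn x0 (gz 0 cdisk11_0) subrr addr0; apply.
Qed.

(** [mulop] and [hardy_calc] depend only on the values on the interval and the disk, so once the
    symbols agree there the compact parts agree by cancellation. *)
Lemma hardy_decomp_uniq T (phi phi' : R -> C^o) (g g' : C^o -> C^o) K K' :
  hardy_decomp T phi g K -> hardy_decomp T phi' g' K' ->
  [/\ forall x, I01 x -> phi' x = phi x, forall z, cdisk11 z -> g' z = g z & K' = K].
Proof.
move=> h h'; have [hp hg] := hardy_decomp_symbols h h'; split => //.
have [_ dg _ _ TE] := h; have [_ dg' _ _ TE'] := h'.
apply/funext => u; have := congr1 (fun T => T u) (etrans (esym TE) TE').
rewrite /= (mulop_ext hp) (hardy_calc_ext dg dg' hg).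
by move=> /addrI.
Qed.

Lemma limit_function (X : Type) (D : set X) (f : nat -> X -> C) :
  (forall e : R, 0 < e -> exists N, forall m n, (N <= m)%N -> (N <= n)%N ->
     forall x, D x -> cmod (f m x - f n x) <= e) ->
  exists g : X -> C, forall e : R, 0 < e -> exists N, forall n, (N <= n)%N ->
     forall x, D x -> cmod (f n x - g x) <= e.
Proof.
move=> cf.
(* Outside [D] any value will do, so that choice yields a total function. *)
have lim x : exists l, D x -> forall e : R, 0 < e -> exists N, forall n, (N <= n)%N -> cmod (f n x - l) <= e.
  have [Dx|nDx] := pselect (D x); last by exists 0.
  have [|l hl] := @cauchy_complex R (fun n => f n x); last by exists l.
  by move=> e /cf[N hN]; exists N => m n Nm Nn; exact: hN.
have [g hg] := choice lim; exists g => e e0.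
have [N hN] := cf e e0; exists N => n Nn x Dx; apply/ler_addgt0Pr => d d0.
have [M hM] := hg x Dx d d0.
apply: le_trans (cmod_dist _ (f (maxn N M) x) _) _; apply: lerD.
  by apply: hN => //; exact: leq_maxl.
by apply: hM; exact: leq_maxr.
Qed.

Lemma uniform_limit_within (p : nat -> {poly C}) (phi : R -> C^o) :
  (forall e : R, 0 < e -> exists N, forall n, (N <= n)%N -> forall x, I01 x -> cmod (pfun (p n) x - phi x) <= e) ->
  {within I01, continuous phi}.
Proof.
move=> h; apply: within_I01P => x xI e e0; have [N hN] := h _ (third_gt0 (third_gt0 e0)).
have [d d0 hd] := pfun_near (p N) x (third_gt0 e0); exists d => // y yI yx.
have h1 := hN N (leqnn N) x xI; have h2 := hN N (leqnn N) y yI; have h3 := hd y yx.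
have -> : phi y - phi x = (pfun (p N) y - pfun (p N) x) - (pfun (p N) y - phi y) + (pfun (p N) x - phi x) by ring.
have := cmodD (pfun (p N) y - pfun (p N) x - (pfun (p N) y - phi y)) (pfun (p N) x - phi x).
by have := cmodB (pfun (p N) y - pfun (p N) x) (pfun (p N) y - phi y); lra.
Qed.

Lemma bdd_mulop_dist phi psi M N (e : R) : bmeas phi M -> bmeas psi N -> 0 <= e ->
  (forall x, I01 x -> cmod (phi x - psi x) <= e) -> bdd (@mulop R phi \- mulop psi) e.
Proof.
move=> b1 b2 e0 h.
have b3 : bmeas (fun x => phi x - psi x) e.
  have [_ m1 _] := bmeasD b1 (bmeasM (bmeas_cst (-1)) b2).
  split => //; move: m1.
  by have -> : (fun x => phi x + -1 * psi x) = (fun x => phi x - psi x) by apply/funext => x; rewrite mulN1r.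
apply: (@bdd_ext _ (mulop (fun x => phi x - psi x))); first by move=> u; exact: mulopB b1 b2.
by split => // u; exact: mulop_norm.
Qed.

Lemma hardy_decomp_exists T : hardy_algebra T -> exists phi g K, hardy_decomp T phi g K.
Proof.
move=> /hardy_algebraP[bT hT].
have half n : 0 < (1 / 2) ^+ n :> R by rewrite exprn_gt0.
have ex n : exists pqK : {poly C} * {poly C} * (L2 -> L2),
    [/\ hardy_compacts pqK.2, pqK.1.1.[0] = pqK.1.2.[0] &
     bdd (T \- symbol_op (pfun pqK.1.1) pqK.1.2 pqK.2) ((1 / 2) ^+ n)].
  have [S /polyalg_normal_form[p [q [K [hK pq SE]]]] TS] := hT _ (half n).
  have SS : S = symbol_op (pfun p) q K by apply/funext.
  rewrite SS in TS; exists (p, q, K); split; [exact: hK|exact: pq|exact: TS].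
have [s hs] := choice ex.
pose p n := (s n).1.1; pose q n := (s n).1.2; pose K n := (s n).2.
have hK n : hardy_compacts (K n) by have [] := hs n.
have pq n : (p n).[0] = (q n).[0] by have [] := hs n.
have TS n : bdd (T \- symbol_op (pfun (p n)) (q n) (K n)) ((1 / 2) ^+ n) by have [] := hs n.
have dist (e : R) : 0 < e -> exists N, forall m n, (N <= m)%N -> (N <= n)%N ->
    (forall x, I01 x -> cmod (pfun (p m) x - pfun (p n) x) <= e) /\
    (forall z, cdisk11 (R:=R) z -> cmod ((q m).[z] - (q n).[z]) <= e).
  (* Two distances of [e / 4] add up to [e / 2], which [symbols_dist] doubles. *)
  move=> e0; have e2 := half_gt0 e0; have [N hN] := half_pow_small (half_gt0 e2).
  exists N => m n Nm Nn.
  have b1 := bdd_le (half_pow_le Nm hN) (bdd_distC (TS m)).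
  have b2 := bdd_le (half_pow_le Nn hN) (TS n).
  have := symbols_dist (hK m) (hK n) (pq m) (pq n) (bdd_dist b1 b2).
  by rewrite -splitr [2 * _]mulrC divfK.
have [|phi hphi] := @limit_function R I01 (fun n => pfun (p n)).
  by move=> e /dist[N hN]; exists N => m n Nm Nn; have [] := hN m n Nm Nn.
have [|g hg] := @limit_function C (@cdisk11 R) (fun n z => (q n).[z]).
  by move=> e /dist[N hN]; exists N => m n Nm Nn; have [] := hN m n Nm Nn.
have phic : {within I01, continuous (phi : R -> C^o)} := uniform_limit_within hphi.
have dg : disk_algebra (g : C^o -> C^o) := uniform_limit_disk_algebra hg.
have [M bphi] := within_bmeas phic; have [bG hG] := hardy_calcP dg.
have phi0 : phi 0 = g 0.
  have x0I : I01 (0 : R) by apply: mem_I01; rewrite lexx ler01.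
  apply/eqP; rewrite -subr_eq0; apply/eqP; apply: (@cmod_small_eq0 _ 2) => e e0.
  have [N1 h1] := hphi e e0; have [N2 h2] := hg e e0; pose n := maxn N1 N2.
  have k1 := h1 n (leq_maxl _ _) 0 x0I; have k2 := h2 n (leq_maxr _ _) 0 (@cdisk11_0 R).
  have pE : pfun (p n) 0 = (q n).[0] by rewrite -pq.
  have -> : phi 0 - g 0 = ((q n).[0] - g 0) - (pfun (p n) 0 - phi 0) by rewrite pE; ring.
  by have := cmodB ((q n).[0] - g 0) (pfun (p n) 0 - phi 0); lra.
(* Taken as a remainder, [K0] makes the decomposition hold by construction; as a norm limit of the
   [K n] it inherits compactness and membership in the algebra. *)
pose K0 : L2 -> L2 := (T \- mulop phi) \- hardy_calc g.
have bK0 : bounded_op K0.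
  have /bounded_opP[lT [B hB]] := bT.
  have /bounded_opP[lP [B' hB']] := bounded_mulop bphi.
  have /bounded_opP[lG [B'' hB'']] := bG.
  apply/bounded_opP; split; first exact: (linear_sub (linear_sub lT lP) lG).
  by exists (B + B' + B''); exact: (bdd_sub (bdd_sub hB hB') hB'').
have KK (e : R) : 0 < e -> exists n, bdd (K0 \- K n) e.
  move=> e0; have e3 := third_gt0 e0.
  have [N1 h1] := half_pow_small e3; have [N2 h2] := hphi _ e3; have [N3 h3] := hg _ e3.
  pose n := maxn N1 (maxn N2 N3); exists n.
  have n2 : (N2 <= n)%N by rewrite /n !leq_max leqnn orbT.
  have n3 : (N3 <= n)%N by rewrite /n !leq_max leqnn !orbT.
  have [B bp] := bmeas_poly (p n).
  have b1 := bdd_le (half_pow_le (leq_maxl _ _) h1) (TS n).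
  have b2 : bdd (mulop phi \- mulop (pfun (p n))) (e / 3).
    by apply: bdd_distC; apply: bdd_mulop_dist bp bphi (ltW e3) _; exact: h2 n n2.
  have b3 := bdd_distC (hG (q n) _ (h3 n n3)).
  have := bdd_sub b1 (bdd_add b2 b3); rewrite (_ : e / 3 + (e / 3 + e / 3) = e); last by field.
  by apply: bdd_ext => u; exact: sum3_dist.
have hK0 : hardy_compacts K0.
  split.
    apply: hardy_algebra_lim bK0 _ => e /KK[n b]; exists (K n); last exact: b.
    by have [] := hK n.
  apply/compact_opP; split; first exact: bK0.
  apply: tbop_lim => e /KK[n b]; exists (K n); last exact: b.
  by have [_ /compact_opP[]] := hK n.
exists phi, g, K0; split => //.
by apply/funext => u; exact: sum3_rest.
Qed.

End Main.

Theorem mainTheorem2 (R : realType) (T : L2 R -> L2 R) (hT : hardy_algebra T) :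
  exists (phi : R -> R[i]^o) (g : R[i]^o -> R[i]^o) (K : L2 R -> L2 R),
    hardy_decomp T phi g K /\
    forall (phi' : R -> R[i]^o) (g' : R[i]^o -> R[i]^o) (K' : L2 R -> L2 R),
      hardy_decomp T phi' g' K' ->
      [/\ forall x : R, I01 x -> phi' x = phi x,
          forall z : R[i]^o, cdisk11 z -> g' z = g z
        & K' = K].
Proof.
have [phi [g [K h]]] := hardy_decomp_exists hT.
by exists phi, g, K; split => // phi' g' K'; exact: hardy_decomp_uniq.
Qed.
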